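(* Let $g>1$. Let $F_1$ be the periodic diffeomorphism of $\Sigma_{2g+1}$ of period $4g$ obtained by gluing $h_{4g,2g}$ and $h_{4g,2g}^{4g-1}$ along their two fixed points, and let $F_2$ be the periodic diffeomorphism of $\Sigma_{2g+2}$ of period $2g+1$ obtained by gluing $h_{2g+1,1}$ and $h_{2g+1,1}^{2g}$ along their three fixed points (constructions as in the context). Then neither $F_1$ nor $F_2$ is conjugate to a power of any irreducible periodic diffeomorphism (of $\Sigma_{2g+1}$, respectively $\Sigma_{2g+2}$).
   Context: $\Sigma_k$ denotes a connected closed oriented surface of genus $k$, and $\operatorname{Diff}_+(\Sigma_k)$ the group of its orientation-preserving diffeomorphisms. All diffeomorphisms are orientation-preserving; periodic means of finite order; conjugate means conjugate in $\operatorname{Diff}_+(\Sigma_k)$. A partition of a surface is a nonempty finite set of mutually disjoint simple closed curves such that no two are freely homotopic and none is homotopic to a point. A periodic diffeomorphism $h$ is reducible if there is a partition mapped to itself (as a set of curves) by the group $\langle h\rangle$; otherwise it is irreducible. Definition of $h_{n,p}$ ($n\ge 3$, $p\in\{1,\dots,n-1\}$): take a regular $2n$-gon in the oriented plane whose edges, in clockwise order, are $\alpha_0,\beta_0,\alpha_1,\beta_1,\dots,\alpha_{n-1},\beta_{n-1}$. Orient each $\alpha_i$ clockwise and each $\beta_i$ counter-clockwise along the boundary. Identify $\alpha_i$ with $\beta_j$, compatibly with these orientations, whenever $j-i\equiv p \pmod n$. The result is a closed oriented surface of genus $\frac{n-\gcd(n,p)-\gcd(n,p+1)+1}{2}$,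 and $h_{n,p}$ is the orientation-preserving periodic diffeomorphism of order $n$ induced by the clockwise $\frac{2\pi}{n}$-rotation of the $2n$-gon. Construction of $F_1$: $h_{4g,2g}$ acts on a surface of genus $g$ with period $4g$ and has exactly two fixed points $x_1,x_2$. Take one copy of this surface with the action of $h_{4g,2g}$ and a second copy with the action of its inverse $h_{4g,2g}^{4g-1}$. Remove small invariant disk neighborhoods of the fixed points in each copy, producing boundary circles $\partial_{1,i}$ (around $x_i$ in the first copy) and $\partial_{2,i}$ (around $x_i$ in the second copy), $i=1,2$. Glue $\partial_{1,i}$ to $\partial_{2,i}$ for $i=1,2$, equivariantly and so that the orientations match. The result is $\Sigma_{2g+1}$ with a periodic diffeomorphism $F_1$ of period $4g$ restricting to the two given maps. Construction of $F_2$: $h_{2g+1,1}$ acts on a surface of genus $g$ with period $2g+1$ and has exactly three fixed points $x_1,x_2,x_3$. Take one copy with the action of $h_{2g+1,1}$ and a second with the action of its inverse $h_{2g+1,1}^{2g}$, remove small invariant disk neighborhoods of the fixed points, and glue the boundary circle around $x_i$ in the first copy to the boundary circle around $x_i$ in the second copy for $i=1,2,3$, equivariantly and so that the orientations match. The result is $\Sigma_{2g+2}$ with a periodic diffeomorphism $F_2$ of period $2g+1$. *)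

(* Defs.v *)
From HB Require Import structures.
From Stdlib Require Import Relation_Operators.
From mathcomp Require Import all_boot all_order all_algebra.
From mathcomp Require Import all_classical all_reals all_analysis.
Set Implicit Arguments.
Unset Strict Implicit.
Unset Printing Implicit Defensive.
Import Order.TTheory GRing.Theory Num.Theory.
Import numFieldNormedType.Exports.
Local Open Scope classical_set_scope.
Local Open Scope ring_scope.

Definition plane (R : realType) : normedModType R := (R * R)%type.

Definition ex {R : realType} : plane R := (1, 0).
Definition ey {R : realType} : plane R := (0, 1).

(* Only used on open [U], so that ['D_ex f] and ['D_ey f] at points of [U] do
   not depend on the values of the total function [f] outside [U]. *)
Fixpoint Ck (R : realType) (k : nat) (U : set (plane R)) (f : plane R -> R)
    : Prop :=
  if k is k'.+1 then
    [/\ forall z, U z -> differentiable f z,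
        Ck k' U ('D_ex f) & Ck k' U ('D_ey f)]
  else forall z, U z -> {for z, continuous f}.

Definition smooth2 (R : realType) (U : set (plane R)) (f : plane R -> plane R)
    : Prop :=
  forall k, Ck k U (fun z => (f z).1) /\ Ck k U (fun z => (f z).2).

Definition jacobian (R : realType) (f : plane R -> plane R) (z : plane R) : R :=
  'D_ex (fun w => (f w).1) z * 'D_ey (fun w => (f w).2) z -
  'D_ey (fun w => (f w).1) z * 'D_ex (fun w => (f w).2) z.

(* A homeomorphism between an open subset of [T] and an open subset of the
   plane; the two maps are total, with irrelevant values outside of these. *)
Record chart (R : realType) (T : topologicalType) := Chart {
  chart_dom : set T;
  chart_map : T -> plane R;
  chart_inv : plane R -> T;
  chart_dom_open : open chart_dom;
  chart_cod_open : open (chart_map @` chart_dom);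
  chart_mapK : forall x, chart_dom x -> chart_inv (chart_map x) = x;
  chart_map_cont : forall x, chart_dom x -> {for x, continuous chart_map};
  chart_inv_cont : forall z, (chart_map @` chart_dom) z ->
    {for z, continuous chart_inv} }.

Section ChartSmoothness.
Variables (R : realType) (S T : topologicalType).
Variables (A : set (chart R S)) (B : set (chart R T)).

Definition in_charts (f : S -> T) (c : chart R S) (d : chart R T) :
    plane R -> plane R :=
  chart_map d \o f \o chart_inv c.

Definition in_charts_dom (U : set S) (f : S -> T) (c : chart R S)
    (d : chart R T) : set (plane R) :=
  chart_map c @` (chart_dom c `&` U `&` f @^-1` chart_dom d).

(* For [U] open. *)
Definition chart_smooth_on (U : set S) (f : S -> T) : Prop :=
  (forall x, U x -> {for x, continuous f}) /\
  forall c d, A c -> B d -> smooth2 (in_charts_dom U f c d) (in_charts f c d).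

Definition chart_oriented_on (U : set S) (f : S -> T) : Prop :=
  forall c d, A c -> B d ->
    forall z, in_charts_dom U f c d z -> 0 < jacobian (in_charts f c d) z.

End ChartSmoothness.

Definition oriented_atlas (R : realType) (T : topologicalType)
    (A : set (chart R T)) : Prop :=
  [/\ forall x, exists2 c, A c & chart_dom c x,
      chart_smooth_on A A setT id & chart_oriented_on A A setT id].

Record surface (R : realType) := Surface {
  surface_space :> topologicalType;
  atlas : set (chart R surface_space);
  atlasP : oriented_atlas atlas }.

Arguments atlas {R} S : rename.

Definition smooth_on (R : realType) (S T : surface R) (U : set S)
    (f : S -> T) : Prop :=
  chart_smooth_on (atlas S) (atlas T) U f.

Definition oriented_on (R : realType) (S T : surface R) (U : set S)
    (f : S -> T) : Prop :=
  chart_oriented_on (atlas S) (atlas T) U f.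

(* By invariance of domain such an [f] is a diffeomorphism from [U] onto an
   open subset of [T]. *)
Definition oriented_embedding (R : realType) (S T : surface R) (U : set S)
    (f : S -> T) : Prop :=
  [/\ open U, smooth_on U f, oriented_on U f &
      forall x y, U x -> U y -> f x = f y -> x = y].

Section PlaneSurface.
Variable R : realType.
Local Notation E := (plane R).

Lemma plane_chart_cod_open : open ((@id E) @` setT).
Proof. by rewrite image_id; exact: openT. Qed.

Definition plane_chart : chart R E :=
  @Chart R E setT id id openT plane_chart_cod_open
    (fun x _ => erefl) (fun x _ => @cvg_id _ _) (fun x _ => @cvg_id _ _).

Lemma Ck_cst k (U : set E) (a : R) : Ck k U (cst a).
Proof.
elim: k a => [|k IHk] a /=; first by move=> z _; exact: cvg_cst.
split; first by move=> z _; exact: differentiable_cst.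
- have -> : 'D_ex (cst a : E -> R) = cst 0.
    by apply/funext => z; rewrite derive_cst.
  exact: IHk.
- have -> : 'D_ey (cst a : E -> R) = cst 0.
    by apply/funext => z; rewrite derive_cst.
  exact: IHk.
Qed.

Lemma differentiable_fst (z : E) : differentiable (fun w : E => w.1) z.
Proof.
apply: (@linear_differentiable R E R (@fst R^o R^o : {linear _ -> _})) => w.
exact: cvg_fst.
Qed.

Lemma derive_fst (v z : E) : 'D_v (fun w : E => w.1) z = v.1.
Proof.
rewrite deriveE; last exact: differentiable_fst.
rewrite (@diff_lin R E R (@fst R^o R^o : {linear _ -> _})) // => w.
exact: cvg_fst.
Qed.

Lemma differentiable_snd (z : E) : differentiable (fun w : E => w.2) z.
Proof.
apply: (@linear_differentiable R E R (@snd R^o R^o : {linear _ -> _})) => w.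
exact: cvg_snd.
Qed.

Lemma derive_snd (v z : E) : 'D_v (fun w : E => w.2) z = v.2.
Proof.
rewrite deriveE; last exact: differentiable_snd.
rewrite (@diff_lin R E R (@snd R^o R^o : {linear _ -> _})) // => w.
exact: cvg_snd.
Qed.

Lemma Ck_fst k (U : set E) : Ck k U (fun w => w.1).
Proof.
case: k => [|k] /=; first by move=> z _; exact: cvg_fst.
split; first by move=> z _; exact: differentiable_fst.
- have -> : 'D_ex (fun w : E => w.1) = cst 1.
    by apply/funext => z; rewrite derive_fst.
  exact: Ck_cst.
- have -> : 'D_ey (fun w : E => w.1) = cst 0.
    by apply/funext => z; rewrite derive_fst.
  exact: Ck_cst.
Qed.

Lemma Ck_snd k (U : set E) : Ck k U (fun w => w.2).
Proof.
case: k => [|k] /=; first by move=> z _; exact: cvg_snd.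
split; first by move=> z _; exact: differentiable_snd.
- have -> : 'D_ex (fun w : E => w.2) = cst 0.
    by apply/funext => z; rewrite derive_snd.
  exact: Ck_cst.
- have -> : 'D_ey (fun w : E => w.2) = cst 1.
    by apply/funext => z; rewrite derive_snd.
  exact: Ck_cst.
Qed.

Lemma plane_atlasP : oriented_atlas [set plane_chart].
Proof.
split.
- by move=> x; exists plane_chart.
- split; first by move=> x _; exact: cvg_id.
  by move=> c d -> -> k; split; [exact: Ck_fst | exact: Ck_snd].
- move=> c d -> -> z _; rewrite /jacobian /in_charts /=.
  by rewrite !derive_fst !derive_snd /= mulr0 mulr1 subr0.
Qed.

Definition plane_surface : surface R := Surface plane_atlasP.

End PlaneSurface.

Record diffeo (R : realType) (S T : surface R) := Diffeo {
  dfun :> S -> T;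
  dinv : T -> S;
  dfunK : cancel dfun dinv;
  dinvK : cancel dinv dfun;
  dfun_smooth : smooth_on setT dfun;
  dinv_smooth : smooth_on setT dinv;
  dfun_oriented : oriented_on setT dfun }.

Definition dpow (R : realType) (S : surface R) (h : diffeo S S) (k : int) :
    S -> S :=
  match k with
  | Posz n => iter n h
  | Negz n => iter n.+1 (dinv h)
  end.

Definition has_period (R : realType) (S : surface R) (h : diffeo S S)
    (n : nat) : Prop :=
  [/\ (0 < n)%N, iter n h =1 id &
      forall k, (0 < k < n)%N -> ~ (iter k h =1 id)].

Definition periodic (R : realType) (S : surface R) (h : diffeo S S) : Prop :=
  exists n, has_period h n.

Definition conjugate (R : realType) (S : surface R) (f f' : S -> S) : Prop :=
  exists c : diffeo S S, forall x, c (f x) = f' (c x).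

Definition circle {R : realType} : set (plane R) :=
  [set z | z.1 ^+ 2 + z.2 ^+ 2 = 1].
Definition open_disk {R : realType} : set (plane R) :=
  [set z | z.1 ^+ 2 + z.2 ^+ 2 < 1].
Definition closed_disk {R : realType} : set (plane R) :=
  [set z | z.1 ^+ 2 + z.2 ^+ 2 <= 1].

Section Curves.
Variables (R : realType) (T : topologicalType).

Definition parametrizes (c : plane R -> T) (C : set T) : Prop :=
  [/\ {within circle, continuous c},
      forall z w, circle z -> circle w -> c z = c w -> z = w &
      c @` circle = C].

Definition simple_closed_curve (C : set T) : Prop :=
  exists c, parametrizes c C.

Definition loops_homotopic (c c' : plane R -> T) : Prop :=
  exists H : R * plane R -> T,
    [/\ {within `[0, 1] `*` circle, continuous H},
        forall z, circle z -> H (0, z) = c z &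
        forall z, circle z -> H (1, z) = c' z].

(* Curves are unoriented: they are homotopic when they are so for some choice
   of parametrizations, possibly reversing the direction of one of them. *)
Definition freely_homotopic (C C' : set T) : Prop :=
  exists c c', [/\ parametrizes c C, parametrizes c' C' & loops_homotopic c c'].

Definition homotopic_to_point (C : set T) : Prop :=
  exists c x, parametrizes c C /\ loops_homotopic c (cst x).

Definition is_partition (P : set (set T)) : Prop :=
  [/\ finite_set P, P !=set0,
      forall C, P C -> simple_closed_curve C /\ ~ homotopic_to_point C &
      forall C C', P C -> P C' -> C <> C' ->
        C `&` C' = set0 /\ ~ freely_homotopic C C'].

Definition nonseparating_family (k : nat) : Prop :=
  exists C : 'I_k -> set T,
    [/\ forall i, simple_closed_curve (C i),
        forall i j, i <> j -> C i `&` C j = set0 &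
        connected (~` \bigcup_i C i)].

(* For a closed oriented surface, the genus is the largest number of disjoint
   simple closed curves whose union does not disconnect it. *)
Definition has_genus (k : nat) : Prop :=
  nonseparating_family k /\ ~ nonseparating_family k.+1.

End Curves.

Definition closed_surface (R : realType) (S : surface R) : Prop :=
  [/\ compact [set: S], hausdorff_space S, connected [set: S] &
      [set: S] !=set0].

Definition closed_surface_of_genus (R : realType) (S : surface R) (k : nat)
    : Prop :=
  closed_surface S /\ has_genus R S k.

Definition reducible (R : realType) (S : surface R) (h : diffeo S S) : Prop :=
  exists P : set (set S), is_partition R P /\
    forall k : int, (fun C => dpow h k @` C) @` P = P.

Definition irreducible_periodic (R : realType) (S : surface R)
    (h : diffeo S S) : Prop :=
  periodic h /\ ~ reducible h.

Definition conjugate_to_power_of_irreducible (R : realType) (S : surface R)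
    (f : diffeo S S) : Prop :=
  exists (h : diffeo S S) (k : int),
    irreducible_periodic h /\ conjugate f (dpow h k).

Section Polygon.
Variables (R : realType) (n : nat).

(* Numbered clockwise, the edges being those from [vertex k] to [vertex k.+1]:
   [alpha_i] for [k = 2i] and [beta_i] for [k = 2i+1]. *)
Definition vertex (k : nat) : plane R :=
  (cos (pi * k%:R / n%:R), - sin (pi * k%:R / n%:R)).

Definition polygon : set (plane R) :=
  [set z | exists w : 'I_(2 * n) -> R,
    [/\ forall i, 0 <= w i, \sum_i w i = 1 & z = \sum_i w i *: vertex i]].

Definition alpha (i : nat) (t : R) : plane R :=
  (1 - t) *: vertex (2 * i) + t *: vertex (2 * i).+1.

Definition beta (i : nat) (t : R) : plane R :=
  (1 - t) *: vertex (2 * i).+2 + t *: vertex (2 * i).+1.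

Definition edge_identified (p : nat) (z w : plane R) : Prop :=
  exists i j t, [/\ (i < n)%N, (j < n)%N, j = i + p %[mod n],
    0 <= t <= 1 & z = alpha i t /\ w = beta j t].

Definition polygon_equiv (p : nat) : plane R -> plane R -> Prop :=
  clos_refl_sym_trans _ (edge_identified p).

Definition clockwise_rotation (z : plane R) : plane R :=
  let theta := 2 * pi / n%:R in
  (cos theta * z.1 + sin theta * z.2, - sin theta * z.1 + cos theta * z.2).

End Polygon.

(* [q] is the quotient map from the polygon. The conditions on [q] determine the
   topology and the orientation of [S], and make [h] unique up to conjugacy; the
   smooth structure at the image of the boundary is only required to be one for
   which [h] is smooth. *)
Definition is_h (R : realType) (n p : nat) (S : surface R) (h : diffeo S S)
    : Prop :=
  closed_surface S /\
  exists q : plane_surface R -> S,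
    [/\ {within polygon n, continuous q},
        q @` polygon n = setT,
        forall z w, polygon n z -> polygon n w ->
          (q z = q w <-> polygon_equiv n p z w),
        @oriented_embedding R (plane_surface R) S (interior (polygon n)) q &
        forall z, polygon n z -> h (q z) = q (clockwise_rotation n z)].

Section Gluing.
Variables (R : realType) (S1 : surface R) (m : nat).
Implicit Types (f : S1 -> S1) (x : 'I_m -> S1).
Implicit Types d : 'I_m -> plane_surface R -> S1.

Definition invariant_disks f x d : Prop :=
  [/\ forall i, exists U : set (plane_surface R),
        (closed_disk : set (plane R)) `<=` U /\ oriented_embedding U (d i),
      forall i, d i 0 = x i,
      forall i, f @` (d i @` closed_disk) = d i @` closed_disk &
      forall i j, i <> j ->
        (d i @` closed_disk) `&` (d j @` closed_disk) = set0].

Definition boundary_circle d (i : 'I_m) : set S1 := d i @` circle.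

Definition disks_removed d : set S1 := ~` \bigcup_i (d i @` open_disk).

(* Smoothness of the inclusion up to the boundary is expressed on an open
   neighbourhood of the surface with boundary [disks_removed d]. *)
Definition glued_piece f d (S : surface R) (F : S -> S) (e : S1 -> S) : Prop :=
  (exists U, disks_removed d `<=` U /\ oriented_embedding U e) /\
  forall y, disks_removed d y -> F (e y) = e (f y).

(* [F] is obtained from the actions of [f1] and [f2] on two copies of [S1] by
   removing invariant disks around the points [x i] in both copies, and gluing
   for each [i] the boundary circles around [x i]. *)
Definition is_gluing f1 f2 x (S : surface R) (F : diffeo S S) : Prop :=
  exists (d1 d2 : 'I_m -> plane_surface R -> S1) (e1 e2 : S1 -> S),
    [/\ invariant_disks f1 x d1 /\ invariant_disks f2 x d2,
        glued_piece f1 d1 F e1 /\ glued_piece f2 d2 F e2,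
        (e1 @` disks_removed d1) `|` (e2 @` disks_removed d2) = setT,
        forall i, e1 @` boundary_circle d1 i = e2 @` boundary_circle d2 i &
        (e1 @` disks_removed d1) `&` (e2 @` disks_removed d2) =
          \bigcup_i (e1 @` boundary_circle d1 i)].

End Gluing.

(* [F] is obtained by gluing [h_{n,p}] and [h_{n,p}^{n-1}] along the fixed
   points of [h_{n,p}], of which there are exactly [m]. *)
Definition is_double (R : realType) (n p m : nat) (S : surface R)
    (F : diffeo S S) : Prop :=
  exists (S1 : surface R) (h : diffeo S1 S1) (x : 'I_m -> S1),
    [/\ is_h n p h, injective x, [set y | h y = y] = range x &
        is_gluing h (iter n.-1 h) x F].

Definition is_F1 (R : realType) (g : nat) (S : surface R) (F : diffeo S S)
    : Prop :=
  is_double (4 * g) (2 * g) 2 F.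

Definition is_F2 (R : realType) (g : nat) (S : surface R) (F : diffeo S S)
    : Prop :=
  is_double (2 * g).+1 1 3 F.

(* Main.v *)
(* A function [phi : S -> R] that is continuous modulo 1 and satisfies [phi (h x) = phi x + j / m] modulo 1, where [m] does
   not divide [j], forces a diffeomorphism [h] of finite order to be reducible: integrating along paths in the
   quotient by [h], one finds a simple closed curve on which [phi] has nonzero increment and whose translates by the
   powers of [h] are equal or disjoint. These translates, one for each free homotopy class, form a partition.

   Such a function exists for [F1] and [F2]. On the first piece it is a pseudo-angle [theta] on the complement of the fixed
   points of [h_{n,p}], equal on the edges of the polygon to a combination of integer parts that is compatible with
   the identifications; on the second piece it is [- theta], which the inverse rotation shifts by the same
   amount. Along each gluing circle the two functions have increments equal up to sign; opposite signs would make
   [2 / m] an integer, so their difference lifts to a real function, which Tietze's theorem extends over the second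
   piece. If [F] is conjugate to a power of [h], a sum of translates of [phi] gives the function for [h]. *)
Require Import Defs.
From mathcomp Require Import all_boot all_order all_algebra.
From mathcomp Require Import all_classical.
From mathcomp Require Import cyclic zify.
Set Implicit Arguments.
Unset Strict Implicit.
Unset Printing Implicit Defensive.
Import Order.TTheory GRing.Theory Num.Theory.
Local Open Scope ring_scope.

(** Disjoint translates of a curve may still be freely homotopic, which a partition forbids; this
    obstacle shapes the construction. Homotopy is only ever tested by the increment of a function
    continuous modulo 1, so each translate gets a function of its own, with nonzero increment on it
    and zero increment on the other translates. That function rises from 0 to 1 across one zone [Y]
    crossed by the curve and vanishes elsewhere. For this, every group element that stabilises [Y]
    must be a multiple of the total displacement [v] of the curve, and so map the curve to itself.
    The first curve found need not have this property, but it crosses as many zones as the group has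
    elements. Crossing a zone by another route changes [v], and if the routes through a zone changed
    [v] only within a subgroup, that subgroup would contain the stabiliser of the zone. Counting
    sumsets then yields a zone each element of whose stabiliser is a total change obtained by
    rerouting in the earlier zones; as the group is cyclic, one such rerouting makes the multiples
    of [v] contain the stabiliser. *)

(** * Cyclic groups and sumsets *)

Lemma coprime_shift (a b n : nat) : (0 < n)%N -> coprime a b -> exists k, coprime (a + k * b) n.
Proof.
(* The multiplier is the product of the primes of [n] that do not divide [a]. Such a prime divides
   [k * b] but not [a]; a prime of [n] that divides [a] divides neither [k] nor [b]. *)
move=> n0 ab; exists (\prod_(q <- primes n | ~~ (q %| a)) q)%N.
set k := (\prod_(q <- _ | _) _)%N.
rewrite /coprime; apply: contraT => g1.
have g2 : (1 < gcdn (a + k * b) n)%N.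
  have : (0 < gcdn (a + k * b) n)%N by rewrite gcdn_gt0 n0 orbT.
  by move: g1; case: gcdn => [|[|]].
have [q pq] := pdivP g2; rewrite dvdn_gcd => /andP[qab qn].
have qk : (q %| k)%N = ~~ (q %| a)%N.
  have qpn : q \in primes n by rewrite mem_primes pq n0.
  apply/idP/idP; last by move=> qa; rewrite /k (big_rem q) //= qa dvdn_mulr.
  apply: contraTN => qa; rewrite /k -big_filter.
  rewrite Euclid_dvd_prod// big_has -all_predC; apply/allP => q' /=.
  rewrite mem_filter mem_primes => /andP[q'a /and3P[pq' _ _]].
  by rewrite dvdn_prime2//; apply: contraNN q'a => /eqP <-.
have [qa|qa] := boolP (q %| a)%N.
  move: qab; rewrite dvdn_addr// Euclid_dvdM// qk qa /= => qb.
  have : (q %| gcdn a b)%N by rewrite dvdn_gcd qa.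
  by rewrite (eqP ab) dvdn1 => /eqP q1; rewrite q1 in pq.
by move: qab; rewrite dvdn_addl ?dvdn_mulr ?qk ?qa// (negbTE qa).
Qed.

(* In a cyclic group, [<v0> + H] is generated by an element of the coset [v0 + H]. *)
Lemma cyclic_coset_gen (n : nat) (H : 'I_n.+1 -> Prop) (v0 : 'I_n.+1) :
  H 0 -> (forall i j, H i -> H j -> H (i - j)) ->
  exists h, H h /\ forall g, H g -> exists k, g = (v0 + h) *+ k.
Proof.
move=> H0 HB.
have HN i : H i -> H (- i) by move=> Hi; rewrite -[- i]sub0r; exact: HB.
have HD i j : H i -> H j -> H (i + j) by move=> Hi Hj; rewrite -[j]opprK; apply: HB => //; exact: HN.
have HM i k : H i -> H (i *+ k) by move=> Hi; elim: k => [|k IH]; rewrite ?mulr0n// mulrS; exact: HD.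
pose z (i : nat) : 'I_n.+1 := inZp i.
have zD i j : z (i + j)%N = z i + z j by apply: val_inj; rewrite /= modnDm.
have zM i k : z (i * k)%N = z i *+ k.
  elim: k => [|k IH]; first by rewrite muln0 mulr0n; apply: val_inj; rewrite /= mod0n.
  by rewrite mulnS zD IH mulrS.
have zK (i : 'I_n.+1) : z i = i by apply: val_inj; rewrite /= modn_small.
have zmod i j : i = j %[mod n.+1] -> z i = z j by move=> e; apply: val_inj.
(* The least positive [r] whose class lies in [H]; by Euclidean division [H] consists of the classes
   of multiples of [r]. *)
have exr : exists r, (0 < r)%N && `[< H (z r) >].
  exists n.+1; apply/andP; split => //; apply/asboolP.
  by rewrite (_ : z n.+1 = 0)//; apply: val_inj; rewrite /= modnn.
have [r0 Hr] : (0 < ex_minn exr)%N /\ H (z (ex_minn exr)).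
  by case: ex_minnP => r /andP[? /asboolP].
have rmin m : (0 < m)%N -> H (z m) -> (ex_minn exr <= m)%N.
  by move=> m0 Hm; case: ex_minnP => r _; apply; rewrite m0; apply/asboolP.
move: (ex_minn exr) r0 Hr rmin => r r0 Hr rmin {exr}.
have rdiv m : H (z m) -> (r %| m)%N.
  move=> Hm; rewrite /dvdn; apply: contraT; rewrite -lt0n => mr.
  have : H (z (m %% r)%N).
    have -> : z (m %% r)%N = z m - z (m %/ r * r)%N by rewrite {2}(divn_eq m r) zD addrAC subrr add0r.
    by apply: HB => //; rewrite mulnC zM; exact: HM.
  by move=> /(rmin _ mr); rewrite leqNgt ltn_pmod.
(* Each [v0 + r * k] is [d] times a term of an arithmetic progression with coprime data, so some [k]
   makes the cofactor [u] invertible modulo [n.+1]. The multiples of [d * u] then include all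
   multiples of [d], in particular those of [r]. *)
pose d := gcdn v0 r; have d0 : (0 < d)%N by rewrite gcdn_gt0 r0 orbT.
have dv : (d %| v0)%N by exact: dvdn_gcdl.
have dr : (d %| r)%N by exact: dvdn_gcdr.
have [k kc] : exists k, coprime (v0 %/ d + k * (r %/ d)) n.+1.
  apply: coprime_shift => //; rewrite /coprime -(eqn_pmul2l d0) muln1.
  by rewrite muln_gcdr !(mulnC d) !divnK.
set u := (v0 %/ d + k * (r %/ d))%N in kc.
exists (z (r * k)%N); split; first by rewrite zM; exact: HM.
move=> g Hg; have /dvdnP[m gm] : (r %| g)%N by apply: rdiv; rewrite zK.
pose u' := (u ^ (totient n.+1).-1)%N.
have uu' : u * u' = 1 %[mod n.+1].
  by rewrite /u' -expnS prednK ?totient_gt0// Euler_exp_totient.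
exists (u' * (r %/ d) * m)%N.
have -> : v0 + z (r * k)%N = z (d * u)%N.
  rewrite -{1}[v0]zK -zD; congr z; rewrite /u mulnDr [(d * (v0 %/ d))%N]mulnC divnK//.
  by congr addn; rewrite mulnCA [(d * (r %/ d))%N]mulnC divnK// mulnC.
rewrite -zM -{1}[g]zK; apply: zmod.
have -> : (d * u * (u' * (r %/ d) * m) = (u * u') * (m * r))%N.
  rewrite -{2}(divnK dr) ; lia.
by rewrite gm -[in RHS]modnMml uu' modnMml mul1n.
Qed.

Section Sumset.
Variable (G : finZmodType).
Implicit Types (J T : {set G}).

(* Sumsets grow until they are stable under the subgroup generated by the next summand. *)
Lemma sumset_stab (O : nat -> G -> Prop) (H : nat -> G -> Prop) :
  (forall j, O j 0) ->
  (forall j (J : G -> Prop), J 0 -> (forall x y, J x -> J y -> J (x - y)) ->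
     (forall x, O j x -> J x) -> forall x, H j x -> J x) ->
  exists2 j, (j < #|G|)%N & forall h, H j h ->
    exists o : nat -> G, (forall i, (i < j)%N -> O i (o i)) /\ \sum_(i < j) o i = h.
Proof.
move=> O0 OH.
pose P j h := exists o : nat -> G, (forall i, (i < j)%N -> O i (o i)) /\ \sum_(i < j) o i = h.
pose T j := [set h | `[< P j h >]].
have TP j h : (h \in T j) = `[< P j h >] by rewrite inE.
have PS j h x : P j h -> O j x -> P j.+1 (h + x).
  move=> [o [Oo <-]] Ox; exists (fun i => if (i < j)%N then o i else x); split.
    move=> i; rewrite ltnS leq_eqVlt => /orP[/eqP ->|ij]; first by rewrite ltnn.
    by rewrite ij; exact: Oo.
  rewrite big_ord_recr /= ltnn; congr (_ + _).
  by apply: eq_bigr => i _; rewrite ltn_ord.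
have sub j : T j \subset T j.+1.
  by apply/fintype.subsetP => h; rewrite !TP => /asboolP Ph; apply/asboolP; rewrite -[h]addr0; exact: PS.
have P0 : P 0%N 0 by exists (fun=> 0); split => //; rewrite big_ord0.
have [[j jG Tj]|noT] := pselect (exists2 j, (j < #|G|)%N & T j.+1 = T j).
  exists j => // h Hh.
  (* Since the sumset is stationary here, it is preserved by translation by the elements of [O j].
     The translations that preserve it form a subgroup, so [OH] extends this to [H j]. *)
  have stab : forall x, H j x -> forall t, (t \in T j) = (t + x \in T j).
    apply: (OH j (fun x => forall t, (t \in T j) = (t + x \in T j))).
    - by move=> t; rewrite addr0.
    - by move=> x y hx hy t; rewrite [RHS]hy addrA subrK hx.
    - move=> x Ox.
      have sx : [set t + x | t in T j] \subset T j.
        apply/fintype.subsetP => _ /imsetP[t + ->]; rewrite TP => /asboolP Pt.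
        by rewrite -Tj TP; apply/asboolP; exact: PS.
      have ex : [set t + x | t in T j] = T j.
        by apply/eqP; rewrite eqEcard sx card_imset ?leqnn//; exact: addIr.
      move=> t; apply/idP/idP => [tT|]; first by rewrite -ex; apply/imsetP; exists t.
      by rewrite -{1}ex => /imsetP[t' t'T /addIr ->].
  have : 0 \in T j.
    elim: (j) => [|i IH]; first by rewrite TP; apply/asboolP.
    by apply: (fintype.subsetP (sub i)).
  by rewrite (stab _ Hh) add0r TP => /asboolP.
(* If no step were stationary, the sumset would gain an element each time and outgrow [G]. *)
have grow j : (j <= #|G|)%N -> (j < #|T j|)%N.
  elim: j => [|j IH] jG.
    by apply/card_gt0P; exists 0; rewrite TP; apply/asboolP.
  apply: leq_ltn_trans (IH (ltnW jG)) _; apply: proper_card.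
  rewrite finset.properEneq sub andbT; apply/eqP => e.
  by apply: noT; exists j => //.
by have := grow #|G| (leqnn _); rewrite ltnNge max_card.
Qed.

End Sumset.

From mathcomp Require Import all_boot all_order all_algebra.
From mathcomp Require Import all_classical all_reals all_analysis.
From mathcomp Require Import ring lra zify.
Import Order.TTheory GRing.Theory Num.Theory.
Import numFieldNormedType.Exports.
Local Open Scope classical_set_scope.
Local Open Scope ring_scope.

(** * Functions continuous modulo 1 and their increments along paths *)

Lemma continuous_pair (T U V : topologicalType) (f : T -> U) (g : T -> V) t :
  {for t, continuous f} -> {for t, continuous g} ->
  {for t, continuous (fun u => (f u, g u))}.
Proof. by move=> cf cg; exact: (cvg_pair cf cg). Qed.

Section ModZ.
Variable R : realType.
Implicit Types (x y e : R).

Definition modZ x y := exists k : int, x = y + k%:~R.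

Lemma modZ_refl x : modZ x x.
Proof. by exists 0; rewrite addr0. Qed.

Lemma modZ_sym x y : modZ x y -> modZ y x.
Proof. by move=> [k ->]; exists (- k); rewrite mulrNz addrK. Qed.

Lemma modZ_trans y x z : modZ x y -> modZ y z -> modZ x z.
Proof. by move=> [k ->] [l ->]; exists (l + k); rewrite intrD addrA. Qed.

Lemma modZD x y x' y' : modZ x y -> modZ x' y' -> modZ (x + x') (y + y').
Proof. by move=> [k ->] [l ->]; exists (k + l); rewrite intrD addrACA. Qed.

Lemma modZN x y : modZ x y -> modZ (- x) (- y).
Proof. by move=> [k ->]; exists (- k); rewrite mulrNz opprD. Qed.

Lemma modZB x y x' y' : modZ x y -> modZ x' y' -> modZ (x - x') (y - y').
Proof. by move=> ? ?; apply: modZD => //; exact: modZN. Qed.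

Lemma modZ_int (k : int) x : modZ (x + k%:~R) x.
Proof. by exists k. Qed.

Lemma modZM (k : nat) x y : modZ x y -> modZ (k%:R * x) (k%:R * y).
Proof.
move=> [l ->]; exists (k%:Z * l); rewrite mulrDr; congr (_ + _).
by rewrite intrM -pmulrn.
Qed.

Definition nearZ e x := exists k : int, `|x - k%:~R| < e.

Lemma nearZ_modZ e x y : modZ x y -> nearZ e x -> nearZ e y.
Proof.
move=> [k ->] [l xl]; exists (l - k); apply: le_lt_trans xl.
by rewrite mulrzBr opprB addrA addrAC.
Qed.

Lemma nearZ_small e x : `|x| < e -> nearZ e x.
Proof. by move=> xe; exists 0; rewrite subr0. Qed.

Lemma nearZD e e' x y : nearZ e x -> nearZ e' y -> nearZ (e + e') (x + y).
Proof.
move=> [k xk] [l yl]; exists (k + l); rewrite intrD opprD addrACA.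
by rewrite (le_lt_trans (ler_normD _ _))// ltrD.
Qed.

Lemma nearZN e x : nearZ e x -> nearZ e (- x).
Proof. by move=> [k xk]; exists (- k); rewrite mulrNz -opprD normrN. Qed.

Lemma nearZ_le e e' x : e <= e' -> nearZ e x -> nearZ e' x.
Proof. by move=> ee' [k xk]; exists k; exact: lt_le_trans xk ee'. Qed.

(* The representative of [x] mod 1 in the interval [[-1/2, 1/2[]. *)
Definition zfrac x := x - (Num.floor (x + 2^-1))%:~R.

Lemma modZ_zfrac x : modZ (zfrac x) x.
Proof. by exists (- Num.floor (x + 2^-1)); rewrite mulrNz. Qed.

Lemma zfrac_itv x : - 2^-1 <= zfrac x < 2^-1.
Proof.
rewrite /zfrac; have := floor_le_tmp (x + 2^-1).
have := floorD1_gt (x + 2^-1).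
rewrite intrD /= => h1 h2; apply/andP; split; lra.
Qed.

Lemma zfrac_uniq x y : modZ x y -> - 2^-1 <= y < 2^-1 -> zfrac x = y.
Proof.
move=> [k ->] yb; rewrite /zfrac.
have -> : Num.floor (y + k%:~R + 2^-1) = k.
  by apply: floor_def; rewrite intrD /=; lra.
by rewrite addrK.
Qed.

Lemma modZ_eq x y : modZ x y -> `|x - y| < 1 -> x = y.
Proof.
move=> [k ->]; rewrite addrAC subrr add0r -intr_norm => k1.
have : `|k| < 1 by rewrite -(ltr_int R).
move=> k0; have -> : k = 0 by lia.
by rewrite addr0.
Qed.

Lemma nearZ_zfrac e x : nearZ e x -> `|zfrac x| < e.
Proof.
move=> [k xk]; have [e2|e2] := leP e 2^-1.
  rewrite (@zfrac_uniq _ (x - k%:~R)) //; first by exists k; rewrite subrK.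
  by move: xk; rewrite ltr_norml; lra.
by have := zfrac_itv x => ?; rewrite ltr_norml; lra.
Qed.

Section Cmod.
Variable T : topologicalType.
Implicit Types (f g : T -> R) (t : T).

(* Continuity at [t] of [f] viewed as a map to [R/Z]. *)
Definition cmod_at f t := forall e, 0 < e -> \forall u \near t, nearZ e (f u - f t).

Lemma continuous_cmod f t : {for t, continuous f} -> cmod_at f t.
Proof.
move=> cf e e0; have /cvgrPdist_lt/(_ _ e0) := cf.
by apply: filterS => u; rewrite distrC; exact: nearZ_small.
Qed.

Lemma cmod_eq f g t : (\forall u \near t, modZ (f u) (g u)) -> cmod_at f t -> cmod_at g t.
Proof.
move=> fg cf e e0; near=> u.
apply: (@nearZ_modZ _ (f u - f t)); last by near: u; exact: cf.
by apply: modZB; [near: u | apply: (nbhs_singleton fg)].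
Unshelve. all: by end_near. Qed.

Lemma cmodD f g t : cmod_at f t -> cmod_at g t -> cmod_at (fun u => f u + g u) t.
Proof.
move=> cf cg e e0; have e2 : 0 < e / 2 by rewrite divr_gt0.
near=> u; rewrite [e]splitr opprD addrACA.
by apply: nearZD; near: u; [exact: cf|exact: cg].
Unshelve. all: by end_near. Qed.

Lemma cmodN f t : cmod_at f t -> cmod_at (fun u => - f u) t.
Proof.
move=> cf e e0; near=> u; rewrite -opprD; apply: nearZN; near: u; exact: cf.
Unshelve. all: by end_near. Qed.

Lemma cmodB f g t : cmod_at f t -> cmod_at g t -> cmod_at (fun u => f u - g u) t.
Proof. by move=> cf cg; apply: cmodD => //; exact: cmodN. Qed.

Lemma cmod_cst (a : R) t : cmod_at (fun=> a) t.
Proof. by apply: continuous_cmod; exact: cvg_cst. Qed.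

Lemma cmod_sum (n : nat) (F : nat -> T -> R) t : (forall i, cmod_at (F i) t) ->
  cmod_at (fun u => \sum_(i < n) F i u) t.
Proof.
move=> cF; elim: n => [|n IH].
  by under eq_fun do rewrite big_ord0; exact: cmod_cst.
by under eq_fun do rewrite big_ord_recr /=; apply: cmodD.
Qed.

Lemma cmodM (n : nat) f t : cmod_at f t -> cmod_at (fun u => n%:R * f u) t.
Proof.
move=> cf; have := @cmod_sum n (fun=> f) t (fun=> cf).
by under eq_fun do rewrite sumr_const card_ord -mulr_natl.
Qed.

Lemma cmod_zfrac f t : cmod_at f t -> nearZ 2^-1 (f t) ->
  {for t, continuous (fun u => zfrac (f u))}.
Proof.
move=> cf /nearZ_zfrac ft; apply/cvgrPdist_lt => e e0.
near=> u; have : nearZ (Num.min e (2^-1 - `|zfrac (f t)|)) (f u - f t).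
  by near: u; apply: cf; rewrite lt_min e0 subr_gt0.
move=> [k]; rewrite lt_min => /andP[h1 h2].
rewrite (@zfrac_uniq (f u) (zfrac (f t) + (f u - f t - k%:~R))).
- by rewrite opprD addrA subrr add0r normrN.
- rewrite /zfrac; exists (k + Num.floor (f t + 2^-1)); rewrite intrD; ring.
- have := ler_normD (zfrac (f t)) (f u - f t - k%:~R) => h3.
  suff : `|zfrac (f t) + (f u - f t - k%:~R)| < 2^-1 by rewrite ltr_norml; lra.
  by apply: le_lt_trans h3 _; lra.
Unshelve. all: by end_near. Qed.

End Cmod.

Lemma cmod_comp (T U : topologicalType) (f : U -> R) (g : T -> U) (t : T) :
  {for t, continuous g} -> cmod_at f (g t) -> cmod_at (fun u => f (g u)) t.
Proof. by move=> cg cf e e0; exact: (cg _ (cf e e0)). Qed.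

(** The increment over the unit interval is read off a continuous lift. It is a relation because a
    lift exists only when [f] is continuous modulo 1. *)
Definition incr (f : R -> R) (w : R) := exists g : R -> R,
  [/\ continuous g, forall t, 0 <= t <= 1 -> modZ (f t) (g t) & g 1 - g 0 = w].

Lemma unif_cmod (T : pseudoMetricType R) (f : T -> R) (K : set T) e : 0 < e ->
  compact K -> (forall t, K t -> cmod_at f t) ->
  \forall d \near 0^'+, forall t u, K t -> ball t d u -> nearZ e (f u - f t).
Proof.
move=> e0 /compact_near_coveringP cK cf.
have hF : \forall d \near 0^'+, K `<=` (fun t => forall u, ball t d u -> nearZ e (f u - f t)).
  apply: cK => t Kt; have e2 : 0 < e / 2 by rewrite divr_gt0.
  have /nbhs_ballP[r /= r0 hr] := cf t Kt _ e2.
  have r2 : 0 < r / 2 by rewrite divr_gt0.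
  near=> t' d => u tu.
  have dr : d <= r / 2 by near: d; exact: nbhs_right_le.
  have t't : ball t (r / 2) t'.
    by near: t'; apply: nbhsx_ballx.
  have -> : f u - f t' = (f u - f t) + - (f t' - f t) by ring.
  rewrite [e]splitr; apply: nearZD; last first.
    by apply: nearZN; apply: hr; apply: le_ball t't; rewrite ler_pdivrMr// ler_peMr// ?ler1n// ltW.
  by apply: hr; rewrite [r]splitr; exact: (ball_triangle t't (le_ball dr tu)).
by apply: filterS hF => d h t u Kt; exact: h.
Unshelve. all: by end_near. Qed.

(** Retraction of the line onto [[a, b]]: composing with it turns a path on an interval into a total
    continuous function. *)
Definition clamp (a b t : R) := Num.max a (Num.min t b).

Lemma clamp_continuous a b : continuous (clamp a b).
Proof.
move=> t; apply: (@continuous_max _ _ (fun=> a) (fun t => Num.min t b)).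
  exact: cvg_cst.
by apply: (@continuous_min _ _ id (fun=> b)); [exact: cvg_id|exact: cvg_cst].
Qed.

Lemma clamp_itv a b t : a <= b -> a <= clamp a b t <= b.
Proof. by move=> ab; rewrite /clamp le_max lexx /= ge_max ab ge_min lexx orbT. Qed.

Lemma clamp_id a b t : a <= t <= b -> clamp a b t = t.
Proof. by move=> /andP[t0 t1]; rewrite /clamp (min_idPl t1) (max_idPr t0). Qed.

(** On a subdivision finer than the modulus of continuity, the differences of [f] stay near 0 modulo
    1, where [zfrac] chooses a real representative continuously. *)
Lemma incr_ex (f : R -> R) : (forall t, cmod_at f t) -> exists w, incr f w.
Proof.
move=> cf.
have e4 : 0 < 4^-1 :> R by rewrite invr_gt0.
have [d d0 hd] : exists2 d : R, 0 < d & forall t u : R, `[0, 1]%classic t -> ball t d u -> nearZ 4^-1 (f u - f t).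
  have := unif_cmod e4 (@segment_compact R 0 1) (fun t _ => cf t).
  move=> [r /= r0 hr]; exists (r / 2); first by rewrite divr_gt0.
  by apply: hr; rewrite /= ?divr_gt0// sub0r normrN gtr0_norm ?divr_gt0// ltr_pdivrMr// ltr_pMr// ltr1n.
have [n n0 nd] : exists2 n : nat, (0 < n)%N & n%:R^-1 < d :> R.
  exists (Num.truncn d^-1).+1 => //.
  rewrite invf_plt ?posrE//; exact: truncnS_gt.
have nR0 : 0 < n%:R :> R by rewrite ltr0n.
pose cl (i : nat) := clamp (i%:R / n%:R) (i.+1%:R / n%:R).
have clc i : continuous (cl i) by exact: clamp_continuous.
have inn (i : nat) : i%:R / n%:R <= i.+1%:R / n%:R :> R.
  by rewrite ler_pM2r ?invr_gt0// ler_nat.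
have clb i t : i%:R / n%:R <= cl i t <= i.+1%:R / n%:R by exact: clamp_itv.
(* Each clamped parameter moves only on its own subinterval, so modulo 1 the sum telescopes to
   [f t]. *)
pose g t := f 0 + \sum_(i < n) zfrac (f (cl i t) - f (i%:R / n%:R)).
exists (g 1 - g 0), g; split => //.
- move=> t; apply: cvgD; first exact: cvg_cst.
  apply: cvg_big => [| i _]; first exact: add_continuous.
  apply: (@cmod_zfrac _ (fun t => f (cl i t) - f (i%:R / n%:R))).
    apply: cmodB; last exact: cmod_cst.
    by apply: cmod_comp; [exact: clc|exact: cf].
  apply: (@nearZ_le 4^-1); first by lra.
  apply: hd.
    rewrite /= in_itv /= divr_ge0//= ler_pdivrMr// mul1r ler_nat.
    exact/ltnW.
  apply: le_lt_trans nd; have := clb i t => /andP[h1 h2].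
  rewrite ler0_norm; last by lra.
  rewrite opprB lerBlDr (le_trans h2)// -natr1 mulrDl mul1r; lra.
- move=> t /andP[t0 t1]; apply: modZ_sym.
  suff H m : modZ (f 0 + \sum_(i < m) zfrac (f (cl i t) - f (i%:R / n%:R)))
      (f (Num.min t (m%:R / n%:R))).
    have := H n; rewrite divff ?gt_eqF//.
    by rewrite (min_idPl t1).
  elim: m => [|m IH].
    by rewrite big_ord0 addr0 mul0r (min_idPr t0); exact: modZ_refl.
  rewrite big_ord_recr /= addrA.
  have -> : f (Num.min t (m.+1%:R / n%:R)) = f (Num.min t (m%:R / n%:R)) +
     (f (cl m t) - f (m%:R / n%:R)).
    rewrite /cl /clamp; have [tm|mt] := leP t (m%:R / n%:R).
      rewrite (min_idPl (le_trans tm (inn m))) (max_idPl tm); ring.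
    rewrite (_ : Num.max _ _ = Num.min t (m.+1%:R / n%:R)); first by ring.
    by apply/max_idPr; rewrite le_min (ltW mt) inn.
  by apply: modZD => //; exact: modZ_zfrac.
Qed.

Lemma int_cst_itv (f : R -> R) : continuous f ->
  (forall t, 0 <= t <= 1 -> exists k : int, f t = k%:~R) ->
  forall t, 0 <= t <= 1 -> f t = f 0.
Proof.
move=> cf fi t t01; apply: contrapT => ft0.
have /andP[t0 t1] := t01.
have cft : {within `[0, t], continuous f} by exact: continuous_subspaceT.
have [k0 f0k] := fi 0 ltac:(by rewrite lexx ler01).
have [k1 f1k] := fi t t01.
have k01 : k0 != k1 by apply/eqP => k01; apply: ft0; rewrite f0k f1k k01.
(* An intermediate value half a unit above the smaller end value, hence not an integer. *)
have [c /[!in_itv]/= /andP[c0 ct] fc] : exists2 c, c \in `[0, t] & f c = Num.min (f 0) (f t) + 2^-1.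
  apply: IVT => //; rewrite f0k f1k.
  have [kk|kk|kk] := ltgtP k0 k1.
  - have : (k0 + 1)%:~R <= k1%:~R :> R by rewrite ler_int; lia.
    rewrite intrD /= => hh; rewrite (@min_idPl _ _ k0%:~R k1%:~R _) ?(@max_idPr _ _ k0%:~R k1%:~R _); lra.
  - have : (k1 + 1)%:~R <= k0%:~R :> R by rewrite ler_int; lia.
    rewrite intrD /= => hh; rewrite (@min_idPr _ _ k0%:~R k1%:~R _) ?(@max_idPl _ _ k0%:~R k1%:~R _); lra.
  - by rewrite kk eqxx in k01.
have [k2 fck] := fi c ltac:(by rewrite c0 (le_trans ct t1)).
have [k3 mk] : exists k : int, Num.min (f 0) (f t) = k%:~R.
  by rewrite minEle; case: ifP => _; [exists k0|exists k1].
have k23 : (k2 - k3)%:~R = 2^-1 :> R by rewrite intrB -fck -mk fc; ring.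
have h1 : (0 < k2 - k3)%R by rewrite -(ltr_int R) /= k23; lra.
have h2 : (k2 - k3 < 1)%R by rewrite -(ltr_int R) /= k23; lra.
by lia.
Qed.

Lemma incr_uniq f w w' : incr f w -> incr f w' -> w = w'.
Proof.
move=> [g [cg fg <-]] [g' [cg' fg' <-]].
suff : (g \- g') 1 = (g \- g') 0 by rewrite /=; lra.
apply: int_cst_itv; rewrite ?ler01 ?lexx//.
  by move=> t; apply: cvgB; [exact: cg|exact: cg'].
move=> t t01; have [k hk] := modZ_trans (modZ_sym (fg t t01)) (fg' t t01).
by exists k; rewrite /= hk addrAC subrr add0r.
Qed.

Lemma incr_eq f f' w : (forall t, 0 <= t <= 1 -> modZ (f t) (f' t)) ->
  incr f w -> incr f' w.
Proof.
move=> ff' [g [cg fg gw]]; exists g; split => // t t01.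
exact: modZ_trans (modZ_sym (ff' t t01)) (fg t t01).
Qed.

Lemma incrD f f' w w' : incr f w -> incr f' w' -> incr (fun t => f t + f' t) (w + w').
Proof.
move=> [g [cg fg gw]] [g' [cg' fg' gw']]; exists (fun t => g t + g' t); split => //.
- by move=> t; apply: cvgD; [exact: cg|exact: cg'].
- by move=> t t01; apply: modZD; [exact: fg|exact: fg'].
- by rewrite -gw -gw'; ring.
Qed.

Lemma incrN f w : incr f w -> incr (fun t => - f t) (- w).
Proof.
move=> [g [cg fg gw]]; exists (fun t => - g t); split => //.
- by move=> t; apply: cvgN; exact: cg.
- by move=> t t01; apply: modZN; exact: fg.
- by rewrite -gw; ring.
Qed.

Lemma incrM (n : nat) f w : incr f w -> incr (fun t => n%:R * f t) (n%:R * w).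
Proof.
move=> [g [cg fg gw]]; exists (fun t => n%:R * g t); split => //.
- by move=> t; apply: cvgM; [exact: cvg_cst|exact: cg].
- by move=> t t01; apply: modZM; exact: fg.
- by rewrite -gw; ring.
Qed.

Lemma incr_cont f : continuous f -> incr f (f 1 - f 0).
Proof. by move=> cf; exists f; split => // t _; exact: modZ_refl. Qed.

Lemma incr_modZ f w : incr f w -> modZ (f 1 - f 0) w.
Proof.
move=> [g [cg fg <-]]; apply: modZB; apply: fg; rewrite ?ler01 ?lexx//.
Qed.

(* Homotopy invariance: for loops the increment is an integer, hence locally constant. *)
Lemma incr_homotopy (H : R * R -> R) w w' : (forall p, cmod_at H p) ->
  (forall s, 0 <= s <= 1 -> modZ (H (s, 0)) (H (s, 1))) ->
  incr (fun t => H (0, t)) w -> incr (fun t => H (1, t)) w' -> w = w'.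
Proof.
move=> cH per h0 h1.
have cs s : forall t, cmod_at (fun t => H (s, t)) t.
  move=> t; apply: (@cmod_comp _ _ H (fun t => (s, t))); last exact: cH.
  by apply: continuous_pair; [exact: cvg_cst|exact: cvg_id].
have /choice [W hW] : forall s, exists w, incr (fun t => H (s, t)) w.
  by move=> s; exact: incr_ex (cs s).
rewrite (incr_uniq h0 (hW 0)) (incr_uniq h1 (hW 1)).
have Wi s : 0 <= s <= 1 -> exists k : int, W s = k%:~R.
  move=> s01; have [k hk] := modZ_trans (modZ_sym (incr_modZ (hW s))) (modZB (modZ_sym (per s s01)) (modZ_refl (H (s, 0)))).
  by exists k; rewrite hk subrr add0r.
have e4 : 0 < 4^-1 :> R by rewrite invr_gt0.
have K : compact (`[0, 1]%classic `*` `[0, 1]%classic : set (R * R)).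
  by apply: compact_setX; exact: segment_compact.
have [d d0 hd] : exists2 d : R, 0 < d & forall t u : R * R, (`[0, 1]%classic `*` `[0, 1]%classic : set (R * R)) t -> ball t d u -> nearZ 4^-1 (H u - H t).
  have := unif_cmod e4 K (fun t _ => cH t).
  move=> [r /= r0 hr]; exists (r / 2); first by rewrite divr_gt0.
  by apply: hr; rewrite /= ?divr_gt0// sub0r normrN gtr0_norm ?divr_gt0// ltr_pdivrMr// ltr_pMr// ltr1n.
(* Nearby loops differ pointwise by less than 1/4 modulo 1. Adding the small representative to a
   lift of one gives a lift of the other, so the two integer increments differ by less than 1. *)
have loc s s' : 0 <= s <= 1 -> 0 <= s' <= 1 -> `|s - s'| < d -> W s = W s'.
  move=> s01 s'01 ss'.
  have [g [cg fg gw]] := hW s.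
  pose cl := clamp 0 1.
  have clc : continuous cl by exact: clamp_continuous.
  have clb t : 0 <= cl t <= 1 by apply: clamp_itv; rewrite ler01.
  have cl1 t : 0 <= t <= 1 -> cl t = t by exact: clamp_id.
  have nz t : nearZ 4^-1 (H (s', cl t) - H (s, cl t)).
    by apply: hd; [rewrite /= !in_itv /=; split => //|split => //=; exact: ballxx].
  pose z t := zfrac (H (s', cl t) - H (s, cl t)).
  have hz : incr (fun t => H (s', t)) (W s + (z 1 - z 0)).
    exists (fun t => g t + z t); split.
    - move=> t; apply: cvgD; first exact: cg.
      apply: (@cmod_zfrac _ (fun t => H (s', cl t) - H (s, cl t))).
        apply: cmodB; (apply: (@cmod_comp _ _ (fun t => H (_, t))); [exact: clc|exact: cs]).
      by apply: nearZ_le (nz t); lra.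
    - move=> t t01; rewrite [H (s', t)](_ : _ = H (s, t) + (H (s', t) - H (s, t))); last by ring.
      apply: modZD; first exact: fg.
      by rewrite /z cl1//; apply: modZ_sym; exact: modZ_zfrac.
    - by rewrite -gw; ring.
  have hs' := incr_uniq (hW s') hz.
  apply: modZ_eq.
    have [k ->] := Wi s s01; have [k' ->] := Wi s' s'01.
    by exists (k - k'); rewrite intrB addrC subrK.
  rewrite hs'.
  have := nearZ_zfrac (nz 0); have := nearZ_zfrac (nz 1).
  rewrite -/(z 0) -/(z 1) !ltr_norml; lra.
have [n n0 nd] : exists2 n : nat, (0 < n)%N & n%:R^-1 < d :> R.
  exists (Num.truncn d^-1).+1 => //.
  rewrite invf_plt ?posrE//; exact: truncnS_gt.
have nR0 : 0 < n%:R :> R by rewrite ltr0n.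
suff Hm (m : nat) : (m <= n)%N -> W 0 = W (m%:R / n%:R).
  by have := Hm n (leqnn n); rewrite divff ?gt_eqF.
elim: m => [|m IH] mn; first by rewrite mul0r.
rewrite IH; last exact: ltnW.
apply: loc.
- by rewrite divr_ge0//= ler_pdivrMr// mul1r ler_nat ltnW.
- by rewrite divr_ge0//= ler_pdivrMr// mul1r ler_nat.
- by rewrite -mulrBl -natr1 opprD addrA subrr sub0r mulN1r normrN gtr0_norm ?invr_gt0.
Qed.

End ModZ.

(** * Pasting of paths and extremal parameters *)

Lemma continuous_compT (T U V : topologicalType) (f : T -> U) (g : U -> V) :
  continuous f -> continuous g -> continuous (fun t => g (f t)).
Proof. by move=> cf cg t; apply: continuous_comp; [exact: cf|exact: cg]. Qed.

Lemma closed_preim (T U : topologicalType) (f : T -> U) (C : set U) :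
  continuous f -> closed C -> closed (f @^-1` C).
Proof. by move/continuous_closedP => h /h. Qed.

Lemma continuous_affine (R : realType) (a b : R) : continuous (fun t : R => a + t * b).
Proof.
move=> t; apply: cvgD; first exact: cvg_cst.
by apply: cvgM; [exact: cvg_id|exact: cvg_cst].
Qed.

Lemma continuous_paste (R : realType) (T : topologicalType) (f g : R -> T) p :
  continuous f -> continuous g -> f p = g p ->
  continuous (fun t => if t <= p then f t else g t).
Proof.
move=> cf cg fg t; have [tp|pt|->] := ltgtP t p.
- apply: (@cvg_trans _ (f @ t)); last by rewrite /= (ltW tp); exact: cf.
  apply: near_eq_cvg; near=> s; rewrite ltW//; near: s; exact: lt_nbhsl.
- apply: (@cvg_trans _ (g @ t)); last by rewrite leNgt pt; exact: cg.
  apply: near_eq_cvg; near=> s; rewrite leNgt ifN// negbK; near: s; exact: lt_nbhsr.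
- move=> U; rewrite /= lexx => Up; have Ug : nbhs (g p) U by rewrite -fg.
  have h1 : nbhs p (f @^-1` U) by exact: cf.
  have h2 : nbhs p (g @^-1` U) by exact: cg.
  suff : \forall s \near p, U (if s <= p then f s else g s) by [].
  by apply: filterS2 h1 h2 => s Us Us'; case: ifP.
Unshelve. all: by end_near. Qed.

Lemma closed_itv_min (R : realType) (A : set R) a b : closed A -> A !=set0 ->
  (forall t, A t -> a <= t <= b) -> exists2 m, A m & forall t, A t -> m <= t.
Proof.
move=> cA A0 Aab; have kA : compact A.
  by apply: (@subclosed_compact _ A `[a, b]%classic) => //; exact: segment_compact.
have [m /[!inE] Am h] := @compact_EVT_min _ R id _ A0 kA ltac:(by apply: continuous_subspaceT; move=> ?; exact: cvg_id).
by exists m => // t At; apply: h; rewrite inE.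
Qed.

Lemma closed_itv_max (R : realType) (A : set R) a b : closed A -> A !=set0 ->
  (forall t, A t -> a <= t <= b) -> exists2 m, A m & forall t, A t -> t <= m.
Proof.
move=> cA A0 Aab; have kA : compact A.
  by apply: (@subclosed_compact _ A `[a, b]%classic) => //; exact: segment_compact.
have [m /[!inE] Am h] := @compact_EVT_max _ R id _ A0 kA ltac:(by apply: continuous_subspaceT; move=> ?; exact: cvg_id).
by exists m => // t At; apply: h; rewrite inE.
Qed.

(** * Arcs that embed in the quotient by a finite group *)

Section Arcs.
Variables (R : realType) (S : topologicalType) (G : finZmodType).
Variables (act : G -> S -> S) (S0 : set S).
Hypothesis hS : hausdorff_space S.
Hypothesis act0 : forall x, act 0 x = x.
Hypothesis actD : forall g g' x, act (g + g') x = act g (act g' x).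
Hypothesis act_cont : forall g, continuous (act g).
Hypothesis act_free : forall x g, S0 x -> act g x = x -> g = 0.
Hypothesis actS0 : forall g x, S0 x -> S0 (act g x).
Implicit Types (x y z u v : S) (g : G) (K L C O Y : set S) (a : R -> S).

Lemma actK g : cancel (act g) (act (- g)).
Proof. by move=> x; rewrite -actD addNr act0. Qed.

Lemma actNK g : cancel (act (- g)) (act g).
Proof. by move=> x; rewrite -actD subrr act0. Qed.

Lemma act_inj g : injective (act g).
Proof. exact: can_inj (actK g). Qed.

Lemma act_eq g g' x : S0 x -> act g x = act g' x -> g = g'.
Proof.
move=> x0 e; apply/eqP; rewrite -subr_eq0; apply/eqP.
by apply: (act_free x0); rewrite addrC actD e actK.
Qed.

Lemma actS0E g x : S0 (act g x) <-> S0 x.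
Proof. by split=> [/(actS0 (- g))|/actS0//]; rewrite actK. Qed.

Lemma act_imageE g K : act g @` K = act (- g) @^-1` K.
Proof.
apply/seteqP; split=> [_ [x Kx <-]|x Kx] /=; first by rewrite actK.
by exists (act (- g) x); rewrite ?actNK.
Qed.

Lemma act_open g K : open K -> open (act g @` K).
Proof. by rewrite act_imageE => oK; apply: (iffLR (continuousP (act (- g))) _ _ oK); exact: act_cont. Qed.

Lemma act_closed g K : closed K -> closed (act g @` K).
Proof. by rewrite act_imageE => cK; apply: (iffLR (continuous_closedP (act (- g))) _ _ cK); exact: act_cont. Qed.

Lemma act_connected g K : connected K -> connected (act g @` K).
Proof.
move=> cK; apply: connected_continuous_connected => //.
by apply: continuous_subspaceT; exact: act_cont.
Qed.

(** The inverse image of the image of [K] in the quotient; it lets the argument speak of the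
    quotient without forming it. *)
Definition orb K : set S := \bigcup_(g in setT) act g @` K.

Lemma orbP K x : orb K x <-> exists g, K (act g x).
Proof.
split=> [[g _ [y Ky <-]]|[g Kg]]; first by exists (- g); rewrite actK.
by exists (- g) => //; exists (act g x); rewrite ?actK.
Qed.

Lemma sub_orb K : K `<=` orb K.
Proof. by move=> x Kx; apply/orbP; exists 0; rewrite act0. Qed.

Lemma orb_act K g x : orb K (act g x) <-> orb K x.
Proof.
split=> /orbP[h Kh]; apply/orbP; first by exists (h + g); rewrite actD.
by exists (h - g); rewrite actD actK.
Qed.

Lemma orb_closed K : closed K -> closed (orb K).
Proof. by move=> cK; apply: closed_bigcup => [|g _]; [exact: finite_finset|exact: act_closed]. Qed.

Lemma orb_open K : open K -> open (orb K).
Proof. by move=> oK; apply: bigcup_open => g _; exact: act_open. Qed.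

Lemma orbS K L : K `<=` L -> orb K `<=` orb L.
Proof. by move=> KL x /orbP[g /KL Lg]; apply/orbP; exists g. Qed.

(** Injectivity is required modulo the group, so the path stays simple in the quotient; that [g = 0]
    when [s = t] then follows from freeness on [S0]. *)
Definition simple_path a := [/\ continuous a,
  forall t : R, 0 <= t <= 1 -> S0 (a t) &
  forall (s t : R) g, 0 <= s <= 1 -> 0 <= t <= 1 -> a s = act g (a t) -> s = t].

Definition img a (s t : R) := a @` `[s, t]%classic.

(* [K] is an arc from [x] to [y] (possibly reduced to a point) that embeds in the quotient by [G]. *)
Definition arc x y K := [/\ S0 x, x = y & K = [set x]] \/
  exists a, [/\ simple_path a, a 0 = x, a 1 = y & K = img a 0 1].

Lemma arc_S0 x y K : arc x y K -> K `<=` S0.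
Proof.
move=> [[x0 _ ->] _ -> //|[a [[_ a0 _] _ _ ->]]] _ [t + <-].
by rewrite /= in_itv; exact: a0.
Qed.

Lemma arc_l x y K : arc x y K -> K x.
Proof.
move=> [[_ _ ->]//|[a [_ <- _ ->]]]; exists 0 => //=.
by rewrite in_itv /= lexx ler01.
Qed.

Lemma arc_r x y K : arc x y K -> K y.
Proof.
move=> [[_ <- ->]//|[a [_ _ <- ->]]]; exists 1 => //=.
by rewrite in_itv /= lexx ler01.
Qed.

Lemma arc_compact x y K : arc x y K -> compact K.
Proof.
move=> [[_ _ ->]|[a [[ca _ _] _ _ ->]]]; first exact: compact_set1.
by apply: continuous_compact; [exact: continuous_subspaceT|exact: segment_compact].
Qed.

Lemma arc_closed x y K : arc x y K -> closed K.
Proof. by move=> /arc_compact; exact: compact_closed. Qed.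

Lemma arc_inj x y K u v g : arc x y K -> K u -> K v -> u = act g v -> u = v /\ g = 0.
Proof.
move=> aK Ku Kv uv; suff e : u = v.
  by split => //; apply: (@act_free v); [exact: arc_S0 aK _ Kv|rewrite -uv].
move: aK => [[_ _ KE]|[a [[_ _ ai] _ _ KE]]]; move: Ku Kv uv; rewrite KE.
  by move=> -> ->.
move=> [s /=]; rewrite in_itv /= => s01 <- [t /=]; rewrite in_itv /= => t01 <- st.
by rewrite (ai s t g).
Qed.

Lemma arc_sym x y K : arc x y K -> arc y x K.
Proof.
move=> [[x0 xy ->]|[a [[ca a0 ai] ax ay ->]]]; first by left; rewrite -xy.
right; exists (fun t => a (1 - t)); split; rewrite ?subr0 ?subrr//.
  split.
  - apply: (@continuous_compT _ _ _ (fun t : R => 1 - t) a) => // t.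
    by apply: cvgB; [exact: cvg_cst|exact: cvg_id].
  - by move=> t t01; apply: a0; lra.
  - move=> s t g s01 t01 st; have := ai (1 - s) (1 - t) g ltac:(lra) ltac:(lra) st; lra.
apply/seteqP; split=> _ [t /= + <-]; rewrite in_itv /= => t01; exists (1 - t);
  rewrite /= ?in_itv /= ?subKr//; lra.
Qed.

Lemma arc_act g x y K : arc x y K -> arc (act g x) (act g y) (act g @` K).
Proof.
move=> [[x0 <- ->]|[a [[ca a0 ai] <- <- ->]]].
  by left; split => //; [exact: actS0|rewrite image_set1].
right; exists (act g \o a); split => //; last by rewrite /img image_comp.
split.
- by move=> t; apply: continuous_comp; [exact: ca|exact: act_cont].
- by move=> t /a0; exact: actS0.
- move=> s t h s01 t01 /= st; apply: (ai s t h) => //; apply: (@act_inj g).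
  by rewrite st -!actD addrC.
Qed.

Lemma arc_sub a (s t : R) : simple_path a -> 0 <= s -> s <= t -> t <= 1 ->
  arc (a s) (a t) (img a s t).
Proof.
move=> [ca a0 ai] s0; rewrite le_eqVlt => /orP[/eqP<- s1|st t1].
  left; split => //; first by apply: a0; rewrite s0.
  by rewrite /img set_itv1 image_set1.
right; exists (fun r => a (s + r * (t - s))); split; rewrite ?mul0r ?addr0//.
- split.
  + by apply: (@continuous_compT _ _ _ (fun r : R => s + r * (t - s)) a) => //; exact: continuous_affine.
  + by move=> r r01; apply: a0; nra.
  + move=> r r' g r01 r'01 /ai -/(_ ltac:(nra) ltac:(nra)) e.
    have : (r - r') * (t - s) = 0 by lra.
    move/eqP; rewrite mulf_eq0 subr_eq0 => /orP[/eqP//|]; rewrite subr_eq0 => /eqP; lra.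
- by rewrite mul1r subrKC.
- apply/seteqP; split=> _ [r /= + <-]; rewrite in_itv /= => rst.
    have ts : 0 < t - s by lra.
    exists ((r - s) / (t - s)).
      rewrite /= in_itv /= ler_pdivrMr// divr_ge0 ?(ltW ts)//= ?mul1r; lra.
    by rewrite divfK ?gt_eqF// subrKC.
  by exists (s + r * (t - s)) => //=; rewrite in_itv /=; nra.
Qed.

Lemma arc_cat x y z K L : arc x y K -> arc y z L ->
  (forall u v g, K u -> L v -> u = act g v -> u = y /\ v = y) -> arc x z (K `|` L).
Proof.
move=> [[x0 <- ->]|[a [sa ax ay KE]]].
  by move=> aL _; rewrite (setUidr _)// sub1set inE; exact: arc_l aL.
move=> [[y0 <- LE] _|[b [sb bx bz LE]] KL].
  rewrite LE (setUidl _); last by rewrite sub1set inE KE -ay; exists 1; rewrite //= in_itv /= ler01 lexx.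
  by right; exists a.
have [ca a0 ai] := sa; have [cb b0 bi] := sb.
pose c (t : R) := if t <= 2^-1 then a (2 * t) else b (2 * t - 1).
have cE1 t : t <= 2^-1 -> c t = a (2 * t) by rewrite /c => ->.
have cE2 t : 2^-1 <= t -> c t = b (2 * t - 1).
  rewrite /c le_eqVlt => /orP[/eqP <-|h]; last by rewrite leNgt h.
  by rewrite lexx divff// subrr ay bx.
have half (t : R) : t <= 2^-1 \/ 2^-1 <= t by case: (leP t 2^-1); [left|right; exact: ltW].
have ainj (s t : R) g : 0 <= s <= 2^-1 -> 2^-1 <= t <= 1 -> a (2 * s) = act g (b (2 * t - 1)) -> s = t.
  move=> s1 t1 e; have [] := KL (a (2 * s)) (b (2 * t - 1)) g _ _ e.
  - by rewrite KE; exists (2 * s) => //=; rewrite in_itv /=; lra.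
  - by rewrite LE; exists (2 * t - 1) => //=; rewrite in_itv /=; lra.
  rewrite -{1}ay -bx => e1 e2.
  have := ai (2 * s) 1 0 ltac:(lra) ltac:(lra); rewrite act0 => /(_ e1).
  have := bi (2 * t - 1) 0 0 ltac:(lra) ltac:(lra); rewrite act0 => /(_ e2); lra.
right; exists c; split.
- split.
  + apply: continuous_paste.
    * apply: (@continuous_compT _ _ _ (fun t : R => 2 * t) a) => // t.
      by apply: cvgM; [exact: cvg_cst|exact: cvg_id].
    * apply: (@continuous_compT _ _ _ (fun t : R => 2 * t - 1) b) => // t.
      by apply: cvgB; [apply: cvgM; [exact: cvg_cst|exact: cvg_id]|exact: cvg_cst].
    * by rewrite divff// subrr ay bx.
  + move=> t t01; case: (half t) => ht; rewrite ?(cE1 _ ht) ?(cE2 _ ht); [apply: a0|apply: b0]; lra.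
  + move=> s t g s01 t01; case: (half s) => hs; case: (half t) => ht.
    * by rewrite !cE1// => /ai -/(_ ltac:(lra) ltac:(lra)); lra.
    * by rewrite cE1// cE2// => /ainj; apply; lra.
    * rewrite cE2// cE1// => e; symmetry; apply: (@ainj _ _ (- g)); [lra|lra|].
      by rewrite e actK.
    * by rewrite !cE2// => /bi -/(_ ltac:(lra) ltac:(lra)); lra.
- by rewrite cE1 ?mulr0// invr_ge0.
- have h1 : 2^-1 <= 1 :> R by lra.
  have h2 : 2 * 1 - 1 = 1 :> R by ring.
  by rewrite (cE2 _ h1) h2.
- rewrite KE LE; apply/seteqP; split=> [_ [[t /= + <-]|[t /= + <-]]|_ [t /= + <-]]; rewrite in_itv /= => t01.
  + exists (t / 2); first by rewrite /= in_itv /=; lra.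
    have h1 : t / 2 <= 2^-1 by lra.
    have h2 : 2 * (t / 2) = t by lra.
    by rewrite (cE1 _ h1) h2.
  + exists ((t + 1) / 2); first by rewrite /= in_itv /=; lra.
    have h1 : 2^-1 <= (t + 1) / 2 by lra.
    have h2 : 2 * ((t + 1) / 2) - 1 = t by lra.
    by rewrite (cE2 _ h1) h2.
  + case: (half t) => ht; rewrite ?(cE1 _ ht) ?(cE2 _ ht); [left; exists (2 * t)|right; exists (2 * t - 1)] => //; rewrite /= in_itv /=; lra.
Qed.

Definition splits x u y K K1 K2 := [/\ arc x u K1, arc u y K2, K = K1 `|` K2 &
  forall p q g, K1 p -> K2 q -> p = act g q -> p = u /\ q = u].

Lemma splits_sym x u y K K1 K2 : splits x u y K K1 K2 -> splits y u x K K2 K1.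
Proof.
move=> [/arc_sym a1 /arc_sym a2 -> d]; split => //; first by rewrite setUC.
move=> p q g Kp Kq pq; have [] := d q p (- g) Kq Kp; last by move=> -> ->.
by rewrite pq actK.
Qed.

Lemma splits_param a (s : R) : simple_path a -> 0 <= s <= 1 ->
  splits (a 0) (a s) (a 1) (img a 0 1) (img a 0 s) (img a s 1).
Proof.
move=> sa s01; split; [by apply: arc_sub => //; lra|by apply: arc_sub => //; lra| |].
  rewrite /img -image_setU; congr (_ @` _); apply/seteqP; split=> t /=; rewrite !in_itv /=; last by case; lra.
  by move=> t01; case: (leP t s); [left|right]; lra.
move=> _ _ g [t /= + <-] [r /= + <-]; rewrite !in_itv /= => t0 r0.
have [_ _ ai] := sa => tr; have e := ai _ _ _ _ _ tr.
have -> : t = s by have := e ltac:(lra) ltac:(lra); lra.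
by have -> : r = s by have := e ltac:(lra) ltac:(lra); lra.
Qed.

Lemma arc_split x y K u : arc x y K -> K u -> exists K1 K2, splits x u y K K1 K2.
Proof.
move=> [[x0 <- ->] ->|[a [sa <- <- ->]] [s /= + <-]].
  by exists [set x], [set x]; split; try by [left]; rewrite ?setUid.
rewrite in_itv /= => s01; exists (img a 0 s), (img a s 1); exact: splits_param.
Qed.

(** The cut is at the least parameter in the closed set. With [C] the orbit of another arc, this
    joins two arcs without creating new intersections in the quotient. *)
Lemma arc_first x y K C : arc x y K -> closed C -> K `&` C !=set0 ->
  exists u K1 K2, [/\ splits x u y K K1 K2, C u & forall p, K1 p -> C p -> p = u].
Proof.
move=> [[x0 <- ->] cC [_ [-> Cx]]|[a [sa <- <- ->]] cC [_ [[s /= + <-] Cs]]].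
  by exists x, [set x], [set x]; split => //; split; try by [left]; rewrite ?setUid.
rewrite in_itv /= => s01; have [ca _ ai] := sa.
have [|||m [m01 Cm] mmin] := @closed_itv_min R (`[0, 1]%classic `&` a @^-1` C) 0 1.
- by apply: closedI; [exact: itv_closed|exact: closed_preim].
- by exists s; split => //=; rewrite in_itv.
- by move=> t [/=]; rewrite in_itv.
move: m01; rewrite /= in_itv /= => m01.
exists (a m), (img a 0 m), (img a m 1); split => //; first exact: splits_param.
move=> _ [t /= + <-] Ct; rewrite in_itv /= => tm.
have t01 : 0 <= t <= 1 by lra.
have mt : m <= t by apply: mmin; split; rewrite //= in_itv.
by rewrite (_ : t = m)//; lra.
Qed.

(** The order of [u] and [v] along the arc is unknown, whence the two cases. *)
Lemma arc_split2 x y K u v : arc x y K -> K u -> K v -> u <> v ->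
  exists K1 K2 K3, [/\ arc u v K2, K = K1 `|` K2 `|` K3 &
   ([/\ arc x u K1, arc v y K3,
      forall p q g, K1 p -> K2 q -> p = act g q -> p = u /\ q = u,
      forall p q g, K2 p -> K3 q -> p = act g q -> p = v /\ q = v &
      forall p q g, K1 p -> K3 q -> p <> act g q] \/
    [/\ arc x v K1, arc u y K3,
      forall p q g, K1 p -> K2 q -> p = act g q -> p = v /\ q = v,
      forall p q g, K2 p -> K3 q -> p = act g q -> p = u /\ q = u &
      forall p q g, K1 p -> K3 q -> p <> act g q])].
Proof.
move=> aK Ku Kv uv.
have [K1 [K23 [a1 a23 KE d]]] := arc_split aK Ku.
have main : forall x y u v K K1 K23, splits x u y K K1 K23 -> K23 v -> u <> v ->
  exists K2 K3, [/\ arc u v K2, K = K1 `|` K2 `|` K3, arc x u K1, arc v y K3 &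
    [/\ forall p q g, K1 p -> K2 q -> p = act g q -> p = u /\ q = u,
      forall p q g, K2 p -> K3 q -> p = act g q -> p = v /\ q = v &
      forall p q g, K1 p -> K3 q -> p <> act g q]].
  move=> {x y K u v aK Ku Kv uv K1 K23 a1 a23 KE d} x y u v K K1 K23 [a1 a23 KE d] Kv uv.
  have [K2 [K3 [a2 a3 K23E d']]] := arc_split a23 Kv.
  exists K2, K3; split => //; first by rewrite KE K23E setUA.
  split => //; first by move=> p q g K1p K2q; apply: d => //; rewrite K23E; left.
  move=> p q g K1p K3q pq; have [pu qu] := d p q g K1p ltac:(by rewrite K23E; right) pq.
  have [] := d' u q 0 (arc_l a2) K3q ltac:(by rewrite act0 qu).
  by [].
have [K1v|K23v] : K1 v \/ K23 v by move: Kv; rewrite KE.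
  2: {
  have [K2 [K3 [? ? ? ? [? ? ?]]]] := main x y u v K K1 K23 (And4 a1 a23 KE d) K23v uv.
  by exists K1, K2, K3; split => //; left; split. }
have sp : splits y u x K K23 K1 by apply: splits_sym.
have [K2 [K3 [b2 KE' b1 b3 [e1 e2 e3]]]] := main y x u v K K23 K1 sp K1v uv.
exists K3, K2, K23; split => //; first by rewrite KE' -setUA setUC (setUC K2).
right; split; [exact: arc_sym|exact: a23| | |].
- move=> p q g K3p K2q pq; have [] := e2 q p (- g) K2q K3p; last by move=> -> ->.
  by rewrite pq actK.
- move=> p q g K2p K23q pq; have [] := e1 q p (- g) K23q K2p; last by move=> -> ->.
  by rewrite pq actK.
- by move=> p q g K3p K23q pq; apply: (e3 q p (- g) K23q K3p); rewrite pq actK.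
Qed.

End Arcs.

(** * Crossings of a zone and the stabiliser of the zone *)

Lemma compact_cball (R : realType) (r : R) : compact [set z : R * R | `|z| <= r].
Proof.
rewrite (_ : [set _ | _] = `[- r, r]%classic `*` `[- r, r]%classic).
  by apply: compact_setX; exact: segment_compact.
by apply/seteqP; split=> -[x y] /=; rewrite prod_normE /= ge_max !in_itv /= !ler_norml => /andP.
Qed.

Lemma step_below (R : realType) (m e : R) : 0 < m -> 0 < e -> exists w, [/\ 0 <= w, w < m & m - w < e].
Proof.
by move=> m0 e0; have [em|me] := leP (e / 2) m; [exists (m - e / 2)|exists 0]; split; lra.
Qed.

Lemma step_above (R : realType) (n e : R) : n < 1 -> 0 < e -> exists w, [/\ w <= 1, n < w & w - n < e].
Proof.
by move=> m0 e0; have [em|me] := leP (e / 2) (1 - n); [exists (n + e / 2)|exists 1]; split; lra.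
Qed.

Section Opt.
Variables (R : realType) (S : topologicalType) (G : finZmodType).
Variables (act : G -> S -> S) (S0 : set S).
Hypothesis hS : hausdorff_space S.
Hypothesis act0 : forall x, act 0 x = x.
Hypothesis actD : forall g g' x, act (g + g') x = act g (act g' x).
Hypothesis act_cont : forall g, continuous (act g).
Hypothesis act_free : forall x g, S0 x -> act g x = x -> g = 0.
Hypothesis actS0 : forall g x, S0 x -> S0 (act g x).
Implicit Types (x y z u v : S) (g : G) (K L C O Y : set S) (a : R -> S).

Local Notation arc := (@arc R S G act S0).
Local Notation orb := (orb act).
Local Notation orbP := (orbP act0 actD).
Local Notation arc_inj := (arc_inj act_free).
Local Notation arc_cat := (arc_cat act0 actD).
Local Notation arc_act := (arc_act act0 actD act_cont actS0).
Local Notation arc_split2 := (arc_split2 act0 actD).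
Local Notation actK := (actK act0 actD).
Local Notation actNK := (actNK act0 actD).

Lemma orbA K g x : orb K x -> orb K (act g x).
Proof. by move=> /(orb_act act0 actD K g x). Qed.

Lemma orbI K g x : orb K (act g x) -> orb K x.
Proof. by move=> /(orb_act act0 actD K g x). Qed.

Lemma arc_xx x K : arc x x K -> K = [set x].
Proof.
move=> [[]//|[a [[_ _ ai] a0 a1 _]]]; exfalso.
have := ai 0 1 0 ltac:(lra) ltac:(lra); rewrite a0 a1 act0 => /(_ erefl); lra.
Qed.

(** A coordinate square around [x], injective modulo the group, which therefore embeds in the
    quotient. *)
Definition disc O x (b : R * R -> S) := [/\ b 0 = x,
  forall z : R * R, `|z| < 1 -> {for z, continuous b} /\ O (b z),
  forall (z w : R * R) g, `|z| < 1 -> `|w| < 1 -> b z = act g (b w) -> z = w &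
  forall r : R, 0 < r <= 1 -> open (b @` [set z | `|z| < r])].

Definition seg (b : R * R -> S) (z w : R * R) := b @` [set z + t *: (w - z) | t in `[0, 1]%classic].

Lemma seg_norm (z w : R * R) (t r : R) : `|z| <= r -> `|w| <= r -> 0 <= t <= 1 -> `|z + t *: (w - z)| <= r.
Proof.
move=> zr wr /andP[t0 t1]; rewrite scalerBr addrCA -{1}[z]scale1r -scalerBl addrC.
rewrite (le_trans (ler_normD _ _))// !normrZ !ger0_norm ?subr_ge0//; nra.
Qed.

Lemma seg_arc O x b (z w : R * R) : O `<=` S0 -> disc O x b -> `|z| < 1 -> `|w| < 1 ->
  arc (b z) (b w) (seg b z w).
Proof.
move=> OS0 [_ bc bi _] z1 w1.
have n1 (t : R) : 0 <= t <= 1 -> `|z + t *: (w - z)| < 1.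
  move=> t01; apply: (@le_lt_trans _ _ (Num.max `|z| `|w|)); last by rewrite gt_max z1.
  by apply: seg_norm => //; rewrite le_max lexx ?orbT.
have [<-|zw] := eqVneq z w.
  left; split => //; first by apply: OS0; have [] := bc z z1.
  rewrite /seg; apply/seteqP; split=> [_ [_ [t _ <-] <-]|_ ->] /=; first by rewrite subrr scaler0 addr0.
  by exists z => //; exists 0; rewrite /= ?in_itv/= ?lexx ?ler01// scale0r addr0.
right; exists (fun t => b (z + clamp 0 1 t *: (w - z))); split.
- split.
  + move=> t; have [] := bc (z + clamp 0 1 t *: (w - z)).
      by apply: n1; apply: clamp_itv; exact: ler01.
    move=> bct _; apply: (@continuous_comp _ _ _ (fun t => z + clamp 0 1 t *: (w - z)) b) => //.
    apply: cvgD; first exact: cvg_cst.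
    by apply: cvgZ; [exact: clamp_continuous|exact: cvg_cst].
  + by move=> t t01; rewrite clamp_id//; apply: OS0; have [] := bc _ (n1 _ t01).
  + move=> s t g s01 t01; rewrite !clamp_id// => /bi -/(_ (n1 _ s01) (n1 _ t01)) /addrI /eqP.
    rewrite -subr_eq0 -scalerBl scaler_eq0 subr_eq0 => /orP[/eqP//|].
    by rewrite subr_eq0 eq_sym (negbTE zw).
- by rewrite clamp_id ?lexx ?ler01// scale0r addr0.
- by rewrite clamp_id ?lexx ?ler01// scale1r subrKC.
- apply/seteqP; split=> [_ [_ [t t01 <-] <-]|_ [t t01 <-]]; move: (t01); rewrite /= in_itv /= => t01'.
    by exists t => //; rewrite clamp_id.
  by exists (z + t *: (w - z)) => //; [exists t|rewrite clamp_id].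
Qed.

(* Two distinct points of the sphere are seen from an inner point in different directions. *)
Lemma seg_meet (p z q : R * R) (r s t : R) : `|p| = r -> `|q| = r -> `|z| < r -> p != q ->
  0 <= s <= 1 -> 0 <= t <= 1 -> p + s *: (z - p) = z + t *: (q - z) ->
  p + s *: (z - p) = z.
Proof.
have main (p' q' : R * R) (l : R) : `|p'| = r -> `|q'| = r -> `|z| < r -> p' != q' -> 0 <= l <= 1 -> q' - z <> l *: (p' - z).
  move=> pr qr zr pq /andP[l0 l1] e.
  have [l1'|l1'] := eqVneq l 1.
    by move: e; rewrite l1' scale1r => /addIr e; rewrite e eqxx in pq.
  have : `|q'| <= l * r + (1 - l) * `|z|.
    rewrite -[q'](subrK z) e scalerBr -pr -addrA -{2}[z]scale1r addrC (addrC _ (1 *: z)) -scalerBl addrC.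
    by rewrite (le_trans (ler_normD _ _))// !normrZ !ger0_norm ?subr_ge0.
  have l1'' : l < 1 by rewrite lt_neqAle l1' l1.
  rewrite qr; nra.
move=> pr qr zr pq s01 t01 e.
have e' : (1 - s) *: (p - z) = t *: (q - z).
  have -> : (1 - s) *: (p - z) = p + s *: (z - p) - z.
    rewrite -(opprB p z) scalerN scalerBl scale1r; rewrite [RHS]addrAC; congr (_ - _).
  by rewrite e addrAC subrr add0r.
have [t0|t0] := eqVneq t 0; first by rewrite e t0 scale0r addr0.
exfalso; have t0' : 0 < t by rewrite lt_neqAle eq_sym t0; lra.
have [ts|st] := leP (1 - s) t.
  apply: (main p q ((1 - s) / t)) => //.
    by rewrite divr_ge0 ?ler_pdivrMr ?mul1r//; lra.
  by rewrite mulrC -scalerA e' scalerA mulVf// scale1r.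
have s0 : 0 < 1 - s by lra.
apply: (main q p (t / (1 - s))) => //.
- by rewrite eq_sym.
- by rewrite divr_ge0 ?ler_pdivrMr ?mul1r//; lra.
- by rewrite mulrC -scalerA -e' scalerA mulVf ?scale1r// gt_eqF.
Qed.

Section Y.
Variables (Y : set S) (b t : S) (v0 : G) (J : set G).
Hypothesis Yo : open Y.
Hypothesis Yc : connected Y.
Hypothesis YS0 : Y `<=` S0.
Hypothesis Yinv : forall g y, Y y -> Y (act g y) -> forall y', Y y' -> Y (act g y').
Hypothesis Yb : ~ orb Y b.
Hypothesis Yt : ~ orb Y t.
Hypothesis bt : forall g, b <> act g t.
Hypothesis discs : forall x, Y x -> exists b, disc Y x b.

(* The arcs that cross [Y] from [b] to a translate of [t]. *)
Definition crossing (v : G) K := arc b (act v t) K /\ K `<=` Y `|` [set b; act v t].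

Hypothesis Yv0 : exists K, crossing v0 K.
Hypothesis J0 : J 0.
Hypothesis JB : forall i j, J i -> J j -> J (i - j).
Hypothesis Jv : forall (v : G) K, crossing v K -> J (v - v0).

Lemma JD i j : J i -> J j -> J (i + j).
Proof. by move=> Ji Jj; rewrite -[j]opprK -[- j]sub0r; apply: JB => //; exact: JB. Qed.

Lemma crossing_orb (v : G) K u : crossing v K -> K u -> orb Y u -> Y u.
Proof.
move=> [_ KY] /KY [//|[->|->]] oY; exfalso; first exact: Yb.
by apply: Yt; move/orbI: oY.
Qed.

(** Rerouting: the part of [K'] between [u1] and [u2] is replaced by [X], which joins their
    translates by [l1] and [l2]. The new crossing follows [X] translated back by [l1], then the rest
    of [K'] translated by [l2 - l1], so its end moves by that amount. The second alternative is for
    [u2] preceding [u1] on [K']. *)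
Lemma bypass (v' : G) K' X p1 p2 u1 u2 (l1 l2 : G) : crossing v' K' -> K' u1 -> K' u2 -> u1 <> u2 ->
  arc p1 p2 X -> p1 = act l1 u1 -> p2 = act l2 u2 ->
  (u1 = b -> l1 = 0) -> (u2 = b -> l2 = 0) ->
  (forall x, X x -> orb Y x -> Y x) -> (forall x, X x -> ~ Y x -> x = p1 \/ x = p2) ->
  (forall x q g, X x -> K' q -> x = act g q ->
     [/\ x = p1, q = u1 & g = l1] \/ [/\ x = p2, q = u2 & g = l2]) ->
  (exists K, crossing (l2 - l1 + v') K) \/ (exists K, crossing (l1 - l2 + v') K).
Proof.
move=> cK' K'u1 K'u2 u12 aX p1E p2E u1b u2b XY Xp XK'.
have [aK' K'Y] := cK'.
have [K1 [K2 [K3 [a2 K'E K123]]]] := arc_split2 aK' K'u1 K'u2 u12.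
have main : forall (p1 p2 u1 u2 : S) (l1 l2 : G), arc u1 u2 K2 -> K' = K1 `|` K2 `|` K3 -> u1 <> u2 ->
  arc p1 p2 X -> p1 = act l1 u1 -> p2 = act l2 u2 ->
  (u1 = b -> l1 = 0) -> (forall x, X x -> ~ Y x -> x = p1 \/ x = p2) ->
  (forall x q g, X x -> K' q -> x = act g q ->
     [/\ x = p1, q = u1 & g = l1] \/ [/\ x = p2, q = u2 & g = l2]) ->
  arc b u1 K1 -> arc u2 (act v' t) K3 ->
  (forall p q g, K1 p -> K2 q -> p = act g q -> p = u1 /\ q = u1) ->
  (forall p q g, K2 p -> K3 q -> p = act g q -> p = u2 /\ q = u2) ->
  (forall p q g, K1 p -> K3 q -> p <> act g q) ->
  exists K, crossing (l2 - l1 + v') K.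
  move: aX p1E p2E u1b u2b Xp XK' K123 K'u1 K'u2 u12 a2 K'E.
  move=> _ _ _ _ _ _ _ _ _ _ _ _ _ {p1 p2 u1 u2 l1 l2} p1 p2 u1 u2 l1 l2.
  move=> a2 K'E u12 aX p1E p2E u1b Xp XK' a1 a3 d12 d23 d13.
  have K1K' : K1 `<=` K' by rewrite K'E => ? ?; left; left.
  have K2K' : K2 `<=` K' by rewrite K'E => ? ?; left; right.
  have K3K' : K3 `<=` K' by rewrite K'E => ? ?; right.
  have K1u2 : ~ K1 u2.
    by move=> h; have [] := d12 u2 u2 0 h (arc_r a2) (esym (act0 _)) => /esym.
  have K3u1 : ~ K3 u1.
    by move=> h; have [] := d23 u1 u1 0 (arc_l a2) h (esym (act0 _)).
  have K3b : ~ K3 b by move=> h; apply: (d13 b b 0 (arc_l a1) h); rewrite act0.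
  have K1t : ~ K1 (act v' t) by move=> h; apply: (d13 _ _ 0 h (arc_r a3)); rewrite act0.
  have aX' : arc u1 (act (l2 - l1) u2) (act (- l1) @` X).
    by have := arc_act (- l1) aX; rewrite p1E p2E actK -actD addrC.
  have a3' : arc (act (l2 - l1) u2) (act (l2 - l1 + v') t) (act (l2 - l1) @` K3).
    by rewrite (actD (l2 - l1) v'); exact: arc_act.
  have c1 : arc b (act (l2 - l1) u2) (K1 `|` act (- l1) @` X).
    apply: (arc_cat a1 aX') => p _ g K1p [x Xx <-]; rewrite -actD => pE.
    have xE : x = act (l1 - g) p by rewrite pE -actD subrKA subrr act0.
    have [[xp pu _]|[_ pu _]] := XK' x p _ Xx (K1K' _ K1p) xE.
      by split => //; rewrite xp p1E actK.
    by rewrite pu in K1p.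
  have c2 := arc_cat c1 a3'.
  exists (K1 `|` act (- l1) @` X `|` act (l2 - l1) @` K3); split.
    apply: c2 => p _ g [K1p [q K3q <-]|[x Xx <-] [q K3q <-]]; rewrite -actD => pE.
      by exfalso; exact: d13 pE.
    have xE : x = act (g + l2) q.
      by rewrite -[x](actNK l1) pE -actD addrC -addrA subrK.
    have [[_ qu _]|[xp qu _]] := XK' x q _ Xx (K3K' _ K3q) xE; first by rewrite qu in K3q.
    by rewrite xp qu p2E -actD [- l1 + _]addrC.
  have tr1 y : Y y -> Y (act (- l1) y).
    move=> Yy; have [Yu1|Yu1] := pselect (Y u1).
      have Yp1 : Y p1 by apply: XY; [exact: arc_l aX|rewrite p1E; apply: orbA; apply: sub_orb].
      by apply: (@Yinv _ p1) => //; rewrite p1E actK.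
    have [//|[u1b'|u1t]] := K'Y _ (K1K' _ (arc_r a1)); first by rewrite u1b// oppr0 act0.
    by exfalso; apply: K1t; rewrite -u1t; exact: arc_r a1.
  have u2Y : Y u2 \/ u2 = act v' t.
    have [//|[u2b|u2t]] := K'Y _ (K3K' _ (arc_l a3)); [by left| |by right].
    by exfalso; apply: K3b; rewrite -u2b; exact: arc_l a3.
  have tr2 y : Y u2 -> Y y -> Y (act (l2 - l1) y).
    move=> Yu2; apply: (@Yinv _ u2) => //; rewrite addrC actD -p2E; apply: tr1.
    by apply: XY; [exact: arc_r aX|rewrite p2E; apply: orbA; apply: sub_orb].
  move=> p [[K1p|[x Xx <-]]|[q K3q <-]].
    have [Yp|[->|pt]] := K'Y _ (K1K' _ K1p).
    - by left.
    - by right; left.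
    - by rewrite pt in K1p.
  - have [Yx|Yx] := pselect (Y x); first by left; exact: tr1.
    have [->|->] := Xp x Xx Yx.
      rewrite p1E actK; have [Yu|[->|u1t]] := K'Y _ (K1K' _ (arc_r a1)); [by left|by right; left|].
      by exfalso; apply: K1t; rewrite -u1t; exact: arc_r a1.
    rewrite p2E -actD [- l1 + _]addrC; have [Yu|->] := u2Y; first by left; exact: tr2.
    by right; right; rewrite actD.
  - have [Yu2|u2t] := u2Y; last first.
      move: a3 K3q; rewrite -u2t => /arc_xx -> ->; right; right.
      by rewrite actD u2t.
    have [Yq|[qb|->]] := K'Y _ (K3K' _ K3q); first by left; exact: tr2.
      by rewrite qb in K3q.
    by right; right; rewrite actD.
case: K123 => [[a1 a3 d12 d23 d13]|[a1 a3 d12 d23 d13]].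
  by left; exact: (main p1 p2 u1 u2 l1 l2).
right; apply: (main p2 p1 u2 u1 l2 l1) => //.
- exact: arc_sym a2.
- by move=> e; apply: u12.
- exact: arc_sym aX.
- by move=> x Xx Yx; have [] := Xp x Xx Yx; [right|left].
- by move=> x q g Xx Kq e; have [] := XK' x q g Xx Kq e; [right|left].
Qed.

Lemma crossing_param (v : G) K : crossing v K -> exists a,
  [/\ simple_path act S0 a, a 0 = b, a 1 = act v t & K = img a 0 1].
Proof. by move=> [[[_ /bt//]|//] _]. Qed.

(** Otherwise [K] would start on [K'] itself, with label 0 in [J], and reach at [u] a translate of
    [K'] with label outside [J]. Between the last meeting of the first kind before [u] and the next
    one of the second kind, [K] meets no translate of [K'], so [bypass] builds a crossing whose
    displacement contradicts [Jv]. *)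
Lemma crossing_label (v : G) K (v' : G) K' u u' (l : G) : crossing v K -> crossing v' K' ->
  K u -> K' u' -> u = act l u' -> J l.
Proof.
move=> cK cK' Ku K'u' ul; apply: contrapT => Jl.
have [a [sa a0 a1 KE]] := crossing_param cK; have [ca aS ai] := sa.
have [aK' K'Y] := cK'.
have [s [s01 asu]] : exists s, 0 <= s <= 1 /\ a s = u.
  by move: Ku; rewrite KE => -[s /=]; rewrite in_itv /=; exists s.
pose E (P : set G) := [set r : R | 0 <= r <= 1 /\ exists2 l, P l & K' (act (- l) (a r))].
have Ecl P : closed (E P).
  rewrite (_ : E P = `[0, 1]%classic `&` \bigcup_(l in P) a @^-1` (act (- l) @^-1` K')).
    apply: closedI; first exact: itv_closed.
    apply: closed_bigcup; first exact: finite_finset.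
    by move=> g _; exact: (closed_preim ca (closed_preim (@act_cont (- g)) (arc_closed hS aK'))).
  by apply/seteqP; split=> r /=; rewrite in_itv.
have Esub P Q : closed (E P `&` Q) -> forall w, 0 <= w <= 1 -> True by [].
have [m [[m01 [l1 Jl1 K'm]] ms] mmax] : exists2 m, (E J `&` `[0, s]%classic) m & forall r, (E J `&` `[0, s]%classic) r -> r <= m.
  apply: (@closed_itv_max _ _ 0 1).
  - by apply: closedI; [exact: Ecl|exact: itv_closed].
  - exists 0; split; last by rewrite /= in_itv /= lexx; lra.
    split; first by rewrite lexx ler01.
    by exists 0; rewrite ?oppr0 ?act0 ?a0//; exact: arc_l aK'.
  - by move=> r [[]].
have [n [[n01 [l2 Jl2 K'n]] ns] nmin] : exists2 n, (E (~` J) `&` `[m, s]%classic) n & forall r, (E (~` J) `&` `[m, s]%classic) r -> n <= r.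
  apply: (@closed_itv_min _ _ 0 1).
  - by apply: closedI; [exact: Ecl|exact: itv_closed].
  - exists s; split; last by move: ms; rewrite /= !in_itv /= lexx; lra.
    by split => //; exists l => //; rewrite asu ul actK.
  - by move=> r [[]].
move: ms ns; rewrite /= !in_itv /= => ms ns.
set u1 := act (- l1) (a m) in K'm; set u2 := act (- l2) (a n) in K'n.
have p1E : a m = act l1 u1 by rewrite actNK.
have p2E : a n = act l2 u2 by rewrite actNK.
have mn : m < n.
  rewrite lt_neqAle; apply/andP; split; last by lra.
  apply/eqP => mn; apply: Jl2.
  have e : u1 = act (l2 - l1) u2 by rewrite /u1 mn p2E -actD addrC.
  have [_ /eqP] := arc_inj aK' K'm K'n e.
  by rewrite subr_eq0 => /eqP ->.
have u12 : u1 <> u2.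
  move=> e; have := ai m n (l1 - l2) m01 n01; rewrite p1E p2E -actD subrK e => /(_ erefl); lra.
have aX : arc (a m) (a n) (img a m n) by apply: arc_sub => //; lra.
have XK : img a m n `<=` K.
  by rewrite KE => _ [r /= + <-]; rewrite in_itv /= => ?; exists r => //=; rewrite in_itv /=; lra.
have bl (u0 : S) (g : G) : K (act g u0) -> u0 = b -> g = 0.
  move=> Kg ub; move: Kg; rewrite ub => Kg.
  by have [_ ->] := arc_inj cK.1 Kg (arc_l cK.1) erefl.
have Km : K (a m) by apply: XK; exact: arc_l aX.
have Kn : K (a n) by apply: XK; exact: arc_r aX.
have [||||||] := bypass cK' K'm K'n u12 aX p1E p2E.
- by apply: bl; rewrite -p1E.
- by apply: bl; rewrite -p2E.
- by move=> x /XK Kx; exact: crossing_orb cK Kx.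
- move=> x [r /= + <-]; rewrite in_itv /= => rmn Yr.
  have [//|[arb|art]] := cK.2 (a r) (XK _ ltac:(by exists r; rewrite //= in_itv)).
    left; congr a; have := ai r 0 0 ltac:(lra) ltac:(lra); rewrite act0 arb a0 => /(_ erefl); lra.
  right; congr a; have := ai r 1 0 ltac:(lra) ltac:(lra); rewrite act0 art a1 => /(_ erefl); lra.
- move=> x q g [r /= + <-]; rewrite in_itv /= => rmn K'q rq.
  have K'r : K' (act (- g) (a r)) by rewrite rq actK.
  have [Jg|Jg] := pselect (J g).
    have rm : r = m.
      have := mmax r (conj (conj _ (ex_intro2 _ _ g Jg K'r)) _); rewrite /= in_itv /=.
      by move=> /(_ ltac:(lra) ltac:(lra)); lra.
    left; rewrite rm; rewrite rm in rq.
    have e : u1 = act (g - l1) q by rewrite /u1 rq -actD addrC.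
    have [<- /eqP] := arc_inj aK' K'm K'q e.
    by rewrite subr_eq0 => /eqP ->.
  have rn : r = n.
    have := nmin r (conj (conj _ (ex_intro2 _ _ g Jg K'r)) _); rewrite /= in_itv /=.
    by move=> /(_ ltac:(lra) ltac:(lra)); lra.
  right; rewrite rn; rewrite rn in rq.
  have e : u2 = act (g - l2) q by rewrite /u2 rq -actD addrC.
  have [<- /eqP] := arc_inj aK' K'n K'q e.
  by rewrite subr_eq0 => /eqP ->.
- move=> [K'' /Jv h]; apply: Jl2.
  have := JD (JB h (Jv cK')) Jl1.
  by rewrite opprB addrA subrK addrK subrK.
- move=> [K'' /Jv h]; apply: Jl2.
  have := JB Jl1 (JB h (Jv cK')).
  by rewrite (opprB v') addrA subrK addrK opprB addrC subrK.
Qed.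

(** An element that moves [y] onto some crossing. By [crossing_label] its class modulo [J] depends
    only on [y]. *)
Definition label y (l : G) := exists (v : G) K, crossing v K /\ K (act l y).

Lemma label_uniq y l l' : label y l -> label y l' -> J (l - l').
Proof.
move=> [v [K [cK Kl]]] [v' [K' [cK' K'l]]].
by apply: (crossing_label cK cK' Kl K'l); rewrite -actD subrK.
Qed.

(** A crossing through the ball is cut at its first and last visits to the translates of the closed
    ball, and between them it is sent through [z] along two straight segments of the chart. The
    translate visited first does not depend on [z], so it labels the whole ball. *)
Lemma label_ball x d (r : R) (z0 : R * R) l0 : disc Y x d -> r < 1 -> `|z0| < r -> label (d z0) l0 ->
  exists l, forall z : R * R, `|z| < r -> label (d z) l.
Proof.
move=> hd r1 z0r [v [K [cK Kl0]]].
have [d0 dc di dop] := hd.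
have r0 : 0 < r by apply: le_lt_trans z0r.
have nr1 (z : R * R) : `|z| <= r -> `|z| < 1 by move=> /le_lt_trans; apply.
have dY (z : R * R) : `|z| <= r -> Y (d z) by move=> /nr1 /dc [].
have [a [sa a0 a1 KE]] := crossing_param cK; have [ca aS ai] := sa.
pose C := orb (d @` [set z | `|z| <= r]).
have CY : C `<=` orb Y by apply: orbS => // _ [z /dY Yz <-].
have Ccl : closed C.
  apply: orb_closed => //; apply: compact_closed => //; apply: continuous_compact.
    by apply: continuous_in_subspaceT => z /[!inE] /nr1 /dc [].
  exact: compact_cball.
have CP y : C y -> exists (l : G) (z : R * R), `|z| <= r /\ y = act l (d z).
  by move=> /orbP[g [z zr e]]; exists (- g), z; rewrite e actK.
have Cd (l : G) (z : R * R) : `|z| <= r -> C (act l (d z)).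
  by move=> zr; apply: orbA; apply: sub_orb => //; exists z.
pose E := `[0, 1]%classic `&` a @^-1` C.
have Ecl : closed E.
  by apply: closedI; [exact: itv_closed|exact: closed_preim].
have [s0 [s001 as0]] : exists s, 0 <= s <= 1 /\ a s = act l0 (d z0).
  by move: Kl0; rewrite KE => -[s /=]; rewrite in_itv /=; exists s.
have E0 : E s0.
  by split; rewrite /= ?in_itv//= as0; apply: Cd; exact: ltW.
have Eb s : E s -> 0 <= s <= 1 by move=> [/=]; rewrite in_itv.
have [m Em mmin] := closed_itv_min Ecl (ex_intro _ _ E0) Eb.
have [n En nmax] := closed_itv_max Ecl (ex_intro _ _ E0) Eb.
have m01 := Eb _ Em; have n01 := Eb _ En.
have [l1 [p [pr mp]]] := CP _ Em.2.
have [l2 [q [qr nq]]] := CP _ En.2.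
have bd (s : R) (l : G) (z : R * R) : 0 <= s <= 1 -> a s = act l (d z) -> `|z| < r ->
   exists e : R, 0 < e /\ forall w, 0 <= w <= 1 -> `|w - s| < e -> E w.
  move=> s01 sz zr.
  have oB : open (act l @` (d @` [set z | `|z| < r])) by apply: act_open => //; apply: dop; lra.
  have : nbhs s (a @^-1` (act l @` (d @` [set z | `|z| < r]))).
    by apply: ca; apply: open_nbhs_nbhs; split => //; rewrite sz; exists (d z) => //; exists z.
  move=> /nbhs_ballP[e /= e0 he]; exists e; split => // w w01 ws.
  split; first by rewrite /= in_itv.
  have := he w; rewrite /ball /= distrC => /(_ ws) [_ [w' w'r <-] <-].
  by apply: Cd; exact: ltW.
have m0 : 0 < m.
  rewrite lt_neqAle; apply/andP; split; last by lra.
  by apply/eqP => m0; apply: Yb; apply: CY; rewrite -a0 m0; exact: Em.2.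
have n1 : n < 1.
  rewrite lt_neqAle; apply/andP; split; last by lra.
  by apply/eqP => n1; apply: Yt; apply: (@orbI _ v); apply: CY; rewrite -a1 -n1; exact: En.2.
(* At an interior point of the ball there would be an earlier or a later visit, so both extremal
   visits lie on its boundary. *)
have pr' : `|p| = r.
  apply/eqP; rewrite eq_le pr leNgt; apply/negP => pr'.
  have [e [e0 he]] := bd m l1 p m01 mp pr'.
  have [w [w0 wm we]] : exists w, [/\ 0 <= w, w < m & m - w < e].
    exact: step_below.
  have w1 : 0 <= w <= 1 by case/andP: m01 => _ m1; rewrite w0 (le_trans (ltW wm) m1).
  have := mmin w (he w w1 ltac:(by rewrite distrC gtr0_norm ?subr_gt0)).
  by rewrite leNgt wm.
have qr' : `|q| = r.
  apply/eqP; rewrite eq_le qr leNgt; apply/negP => qr'.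
  have [e [e0 he]] := bd n l2 q n01 nq qr'.
  have [w [w0 wm we]] : exists w, [/\ w <= 1, n < w & w - n < e].
    exact: step_above.
  have w1 : 0 <= w <= 1 by case/andP: n01 => n0 _; rewrite w0 (le_trans n0 (ltW wm)).
  have := nmax w (he w w1 ltac:(by rewrite gtr0_norm ?subr_gt0)).
  by rewrite leNgt wm.
have ms0 := mmin _ E0; have s0n := nmax _ E0.
have mn : m < n.
  rewrite lt_neqAle (le_trans ms0 s0n) andbT; apply/eqP => mn.
  have ms : m = s0 by apply/eqP; rewrite eq_le ms0 mn s0n.
  have e : d p = act (l0 - l1) (d z0) by rewrite addrC actD -as0 -ms mp actK.
  by have := di _ _ _ (nr1 _ pr) (nr1 _ (ltW z0r)) e => pz; rewrite -pz pr' ltxx in z0r.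
have pq : p != q.
  apply/eqP => pq; have := ai m n (l1 - l2) m01 n01; rewrite mp nq -actD subrK pq => /(_ erefl).
  by move=> mn'; rewrite mn' ltxx in mn.
have inK s : 0 <= s <= 1 -> K (a s) by move=> ?; rewrite KE; exists s; rewrite //= in_itv.
have Yam : Y (a m) by apply: (crossing_orb cK (inK _ m01)); apply: CY; exact: Em.2.
have Yan : Y (a n) by apply: (crossing_orb cK (inK _ n01)); apply: CY; exact: En.2.
have tr1 y : Y y -> Y (act l1 y) by apply: (Yinv (dY _ pr)); rewrite -mp.
have tr2 y : Y y -> Y (act (l1 - l2) y).
  by apply: (Yinv Yan); rewrite nq -actD subrK; apply: tr1; exact: dY.
exists l1 => z zr; have zr' := ltW zr.
have segP (p1 p2 : R * R) u : `|p1| <= r -> `|p2| <= r -> seg d p1 p2 u -> exists t0, [/\ 0 <= t0 <= 1, `|p1 + t0 *: (p2 - p1)| <= r & u = d (p1 + t0 *: (p2 - p1))].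
  move=> xr yr [_ [t0 + <-] <-]; rewrite /= in_itv /= => t01.
  by exists t0; split => //; exact: seg_norm.
have A1 : arc b (act l1 (d p)) (img a 0 m) by rewrite -a0 -mp; apply: arc_sub => //; lra.
have A2 : arc (act l1 (d p)) (act l1 (d z)) (act l1 @` seg d p z).
  by apply: arc_act; apply: seg_arc YS0 hd _ _; exact: nr1.
have A3 : arc (act l1 (d z)) (act l1 (d q)) (act l1 @` seg d z q).
  by apply: arc_act; apply: seg_arc YS0 hd _ _; exact: nr1.
have A4 : arc (act l1 (d q)) (act (l1 - l2 + v) t) (act (l1 - l2) @` img a n 1).
  have : arc (a n) (a 1) (img a n 1) by apply: arc_sub => //; lra.
  by move=> /(arc_act (l1 - l2)); rewrite a1 nq -!actD subrK.
have segC (p1 p2 : R * R) u g : `|p1| <= r -> `|p2| <= r -> seg d p1 p2 u -> C (act g u).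
  by move=> xr yr /(segP _ _ _ xr yr)[t0 [_ tr ->]]; exact: Cd.
have AmC s : 0 <= s <= m -> C (a s) -> s = m.
  by move=> s0m Cs; have := mmin s (conj (ltac:(by rewrite /= in_itv /=; lra) : `[0, 1]%classic s) Cs); lra.
have AnC s : n <= s <= 1 -> C (a s) -> s = n.
  by move=> s0m Cs; have := nmax s (conj (ltac:(by rewrite /= in_itv /=; lra) : `[0, 1]%classic s) Cs); lra.
have A12 : arc b (act l1 (d z)) (img a 0 m `|` act l1 @` seg d p z).
  apply: (arc_cat A1 A2) => _ _ g [s /= + <-] [u su <-]; rewrite in_itv /= => sm e.
  have sE : s = m by apply: AmC => //; rewrite e; apply: orbA; exact: segC su.
  move: e su; rewrite sE mp => e /(segP _ _ _ pr zr') [t0 [t001 t0r uE]].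
  split => //; congr (act l1 _).
  have e2 : d p = act (- l1 + g + l1) u by rewrite !actD -e actK.
  by rewrite uE in e2 *; rewrite -(di _ _ _ (nr1 _ pr) (nr1 _ t0r) e2).
have A123 : arc b (act l1 (d q)) (img a 0 m `|` act l1 @` seg d p z `|` act l1 @` seg d z q).
  apply: (arc_cat A12 A3) => _ _ g [[s /= + <-]|[u su <-]] [u' su' <-] e.
    rewrite in_itv /= => sm.
    have sE : s = m by apply: AmC => //; rewrite e; apply: orbA; exact: segC su'.
    exfalso; move: e su'; rewrite sE mp => e /(segP _ _ _ zr' qr) [t0 [t001 t0r uE]].
    have e2 : d p = act (- l1 + g + l1) u' by rewrite !actD -e actK.
    rewrite uE in e2; have e3 := di _ _ _ (nr1 _ pr) (nr1 _ t0r) e2.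
    have := @seg_meet p z q r 0 t0 pr' qr' zr pq ltac:(lra) t001.
    rewrite scale0r addr0 => /(_ e3) pz; by rewrite -pz pr' ltxx in zr.
  move: su su' => /(segP _ _ _ pr zr') [s1 [s101 s1r uE]] /(segP _ _ _ zr' qr) [t0 [t001 t0r u'E]].
  have e2 : u = act (- l1 + g + l1) u' by rewrite !actD -e actK.
  rewrite uE u'E in e2; have e3 := di _ _ _ (nr1 _ s1r) (nr1 _ t0r) e2.
  have e4 := seg_meet pr' qr' zr pq s101 t001 e3.
  by rewrite uE u'E -e3 e4.
have A : arc b (act (l1 - l2 + v) t) (img a 0 m `|` act l1 @` seg d p z `|` act l1 @` seg d z q `|` act (l1 - l2) @` img a n 1).
  have main (p1 p2 : R * R) u s g : `|p1| <= r -> `|p2| <= r ->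
     seg d p1 p2 u -> n <= s <= 1 -> act l1 u = act g (act (l1 - l2) (a s)) -> act l1 u = act l1 (d q) /\ act (l1 - l2) (a s) = act l1 (d q).
    move=> xr yr su ns e.
    have e1 : a s = act (- (g + (l1 - l2)) + l1) u by rewrite (actD (- (g + (l1 - l2)))) e -(actD g) actK.
    have sE : s = n by apply: AnC => //; rewrite e1; exact: segC su.
    move: (su) => /(segP _ _ _ xr yr)[t0 [t001 t0r uE]].
    have e5 : d q = act (- l2 + (- (g + (l1 - l2)) + l1)) u by rewrite actD -e1 sE nq actK.
    rewrite uE in e5 *; rewrite -(di _ _ _ (nr1 _ qr) (nr1 _ t0r) e5).
    by rewrite sE nq -actD subrK.
  apply: (arc_cat A123 A4) => _ _ g [[[s /= + <-]|[u su <-]]|[u su <-]] [_ [s' /= + <-] <-]; rewrite !in_itv /=.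
  - move=> s'n sm; rewrite -actD => e.
    exfalso; have := ai s s' _ ltac:(lra) ltac:(lra) e; lra.
  - by move=> s'n; apply: (main p z).
  - by move=> s'n; apply: (main z q).
exists (l1 - l2 + v), (img a 0 m `|` act l1 @` seg d p z `|` act l1 @` seg d z q `|` act (l1 - l2) @` img a n 1).
have Yseg (p1 p2 : R * R) u : `|p1| <= r -> `|p2| <= r -> seg d p1 p2 u -> Y (act l1 u).
  by move=> xr yr /(segP _ _ _ xr yr)[t0 [_ t0r ->]]; apply: tr1; exact: dY.
split; last first.
  by left; right; exists (d z) => //; exists z => //; exists 0; rewrite /= ?in_itv /= ?lexx ?ler01// scale0r addr0.
split => // _ [[[[s /= + <-]|[u su <-]]|[u su <-]]|[_ [s /= + <-] <-]]; rewrite ?in_itv /=.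
- move=> sm; have [Ys|[->|as1]] := cK.2 _ (inK s ltac:(lra)); [by left|by right; left|exfalso].
  have := ai s 1 0 ltac:(lra) ltac:(lra); rewrite act0 a1 as1 => /(_ erefl); lra.
- by left; exact: Yseg su.
- by left; exact: Yseg su.
- move=> sm; have [Ys|[as1|->]] := cK.2 _ (inK s ltac:(lra)); [by left; exact: tr2|exfalso|by right; right; rewrite -actD].
  have := ai s 0 0 ltac:(lra) ltac:(lra); rewrite act0 a0 as1 => /(_ erefl); lra.
Qed.

(** The points with a label in [J] form an open and closed part of [Y], because labels propagate
    over discs; an inner point of the given crossing has label 0. *)
Lemma label_all y : Y y -> exists2 l, label y l & J l.
Proof.
pose A := [set y | Y y /\ exists2 l, label y l & J l].
suff -> : Y = A by case.
have locA x d (z0 : R * R) : disc Y x d -> `|z0| < 1 -> A (d z0) -> forall z : R * R, `|z| < 1 -> A (d z).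
  move=> hd z01 [_ [l0 Ll0 Jl0]] z z1.
  have [_ dc _ _] := hd; split; first by have [] := dc z z1.
  pose r := (1 + Num.max `|z| `|z0|) / 2.
  have mm : Num.max `|z| `|z0| < 1 by rewrite gt_max z1.
  have zm : `|z| <= Num.max `|z| `|z0| by rewrite le_max lexx.
  have z0m : `|z0| <= Num.max `|z| `|z0| by rewrite le_max lexx orbT.
  have [zr z0r r1] : [/\ `|z| < r, `|z0| < r & r < 1].
    by rewrite /r; move: (Num.max _ _) mm zm z0m => mx; split; lra.
  have [l hl] := label_ball hd r1 z0r Ll0.
  exists l; first exact: hl.
  by rewrite -(subrK l0 l); apply: JD => //; apply: label_uniq (hl z0 z0r) Ll0.
have oA : open A.
  rewrite openE => x Ax; have [Yx _] := Ax.
  have [d hd] := discs Yx; have [d0 dc _ dop] := hd.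
  have : nbhs x (d @` [set z | `|z| < 1]).
    apply: open_nbhs_nbhs; split; first by apply: dop; rewrite lexx ltr01.
    by exists 0; rewrite //= normr0.
  apply: filterS.
  by move=> _ [z z1 <-]; apply: (locA x d 0) => //; rewrite ?normr0// d0.
have oB : open (Y `\` A).
  rewrite openE => x [Yx Ax].
  have [d hd] := discs Yx; have [d0 dc _ dop] := hd.
  have : nbhs x (d @` [set z | `|z| < 1]).
    apply: open_nbhs_nbhs; split; first by apply: dop; rewrite lexx ltr01.
    by exists 0; rewrite //= normr0.
  apply: filterS.
  move=> _ [z z1 <-]; split; first by have [] := dc z z1.
  by move=> Az; apply: Ax; rewrite -d0; apply: (locA x d z) => //; rewrite normr0.
apply/esym; apply: Yc.
- have [K cK] := Yv0; have [a [[_ _ ai] a0 a1 KE]] := crossing_param cK.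
  have Ka : K (a 2^-1) by rewrite KE; exists 2^-1 => //=; rewrite in_itv /=; lra.
  exists (a 2^-1); split; last by exists 0 => //; exists v0, K; rewrite act0.
  have [//|[ab|ab]] := cK.2 _ Ka; exfalso.
    have := ai 2^-1 0 0 ltac:(lra) ltac:(lra); rewrite act0 a0 ab => /(_ erefl); lra.
  have := ai 2^-1 1 0 ltac:(lra) ltac:(lra); rewrite act0 a1 ab => /(_ erefl); lra.
- by exists A => //; apply/seteqP; split=> [x Ax|x []//]; split => //; case: Ax.
- exists (~` (Y `\` A)); first exact: open_closedC.
  apply/seteqP; split=> [x Ax|x [Yx h]]; first by split; [case: Ax|case].
  by apply: contrapT => nA; apply: h.
Qed.

(** The labels of [y] and [act g y] both lie in [J], and they differ by [g] modulo [J]. *)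
Lemma crossing_stab g y : Y y -> Y (act g y) -> J g.
Proof.
move=> Yy Ygy; have [l [v [K [cK Kl]]] Jl] := label_all Yy.
have [l' [v' [K' [cK' K'l]]] Jl'] := label_all Ygy.
have e : act l y = act (l - l' - g) (act l' (act g y)).
  by rewrite -!actD (addrAC _ (- g) l') subrK subrK.
have := JB (JB Jl Jl') (crossing_label cK cK' Kl K'l e).
by rewrite opprB addrC subrK.
Qed.

End Y.
End Opt.

(** * Arcwise connection and components of invariant open sets *)

Section Chains.
Variables (R : realType) (S : topologicalType) (G : finZmodType).
Variables (act : G -> S -> S) (S0 : set S).
Hypothesis hS : hausdorff_space S.
Hypothesis act0 : forall x, act 0 x = x.
Hypothesis actD : forall g g' x, act (g + g') x = act g (act g' x).
Hypothesis act_cont : forall g, continuous (act g).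
Hypothesis act_free : forall x g, S0 x -> act g x = x -> g = 0.
Hypothesis actS0 : forall g x, S0 x -> S0 (act g x).
Hypothesis S0o : open S0.
Hypothesis S0c : connected S0.
Hypothesis discs : forall O x, open O -> O `<=` S0 -> O x ->
  exists b : R * R -> S, disc act O x b.
Implicit Types (x y z u v : S) (g : G) (K L C O Y : set S) (a : R -> S).

Local Notation arc := (@arc R S G act S0).
Local Notation orb := (orb act).
Local Notation orbP := (orbP act0 actD).
Local Notation arc_cat := (arc_cat act0 actD).
Local Notation arc_act := (arc_act act0 actD act_cont actS0).
Local Notation actK := (actK act0 actD).
Local Notation actNK := (actNK act0 actD).
Local Notation orbA := (orbA act0 actD).
Local Notation orbI := (orbI act0 actD).

Lemma disc_nbhs O x d (r : R) : 0 < r <= 1 -> disc act O x d -> nbhs x (d @` [set z | `|z| < r]).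
Proof.
move=> r01 [d0 _ _ dop]; apply: open_nbhs_nbhs; split; first exact: dop.
by exists 0; rewrite //= normr0; case/andP: r01.
Qed.

Lemma open_clopen Y (A : set S) : connected Y -> open Y -> A `<=` Y -> A !=set0 ->
  (forall x, Y x -> exists N, [/\ nbhs x N, N `<=` Y & A `&` N !=set0 -> N `<=` A]) -> A = Y.
Proof.
move=> Yc Yo AY A0 AN; apply: Yc => //.
  exists A; last by apply/seteqP; split=> [x Ax|x []//]; split => //; exact: AY.
  rewrite openE => x Ax; have [N [xN _ h]] := AN x (AY _ Ax).
  by apply: filterS (xN); apply: h; exists x; split => //; exact: (nbhs_singleton xN).
exists (~` (Y `\` A)); last first.
  apply/seteqP; split=> [x Ax|x [Yx h]]; first by split; [exact: AY|case].
  by apply: contrapT => nA; apply: h.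
apply: open_closedC; rewrite openE => x [Yx Ax]; have [N [xN NY h]] := AN x Yx.
apply: filterS (xN) => y Ny; split; first exact: NY.
by move=> Ay; apply: Ax; apply: h (nbhs_singleton xN); exists y.
Qed.

(** The end is only prescribed up to translation. Before a segment is appended, the arc is cut where
    it first meets the orbit of the segment, and it continues along a translate of what remains of
    the segment. *)
Lemma arc_to Y x y : open Y -> connected Y -> Y `<=` S0 ->
  (forall g y, Y y -> Y (act g y) -> forall y', Y y' -> Y (act g y')) ->
  Y x -> Y y -> exists g K, arc x (act g y) K /\ K `<=` Y.
Proof.
move=> Yo Yc YS0 Yinv Yx Yy.
pose A := [set y | Y y /\ exists g K, arc x (act g y) K /\ K `<=` Y].
suff AY : A = Y by have [_] : A y by rewrite AY.
apply: open_clopen => //; first by move=> z [].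
  exists x; split => //; exists 0, [set x]; rewrite act0; split; last by move=> _ ->.
  by left; split => //; exact: YS0.
move=> y0 Yy0; have [d hd] := discs Yo YS0 Yy0; have [d0 dc di dop] := hd.
have dY (z : R * R) : `|z| < 1 -> Y (d z) by move=> /dc [].
exists (d @` [set z | `|z| < 1]); split; first by apply: (disc_nbhs _ hd); rewrite ltr01 lexx.
  by move=> _ [z /dY ? <-].
move=> [q0 [[_ [g [K [aK KY]]]] [z0 z01 zE]]] _ [z1 z11 <-]; rewrite /= in z01 z11.
split; first exact: dY.
have as1 := seg_arc YS0 hd z01 z11.
pose C := orb (seg d z0 z1).
have cC : closed C by apply: orb_closed => //; exact: arc_closed as1.
have Cin : C (act g (d z0)) by apply: orbA; apply: sub_orb => //; exact: arc_l as1.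
have KC : K `&` C !=set0 by exists (act g (d z0)); split => //; rewrite zE; exact: arc_r aK.
have [u [K1 [K2 [[a1 a2 KE dd] Cu K1C]]]] := arc_first aK cC KC.
have K1K : K1 `<=` K by rewrite KE; left.
have [l Kl] := (orbP _ _).1 Cu.
move: (Kl) => [_ [t t01 <-] lE].
have segn (s : R) : `[0, 1]%classic s -> `|z0 + s *: (z1 - z0)| < 1.
  rewrite /= in_itv /= => s01; apply: (@le_lt_trans _ _ (Num.max `|z0| `|z1|)); last by rewrite gt_max z01.
  by apply: seg_norm => //; rewrite le_max lexx ?orbT.
set w := z0 + t *: (z1 - z0) in lE; have w1 : `|w| < 1 by exact: segn.
have uE : u = act (- l) (d w) by rewrite lE actK.
have tr p : Y p -> Y (act (- l) p).
  by apply: (Yinv _ _ (dY _ w1)); rewrite -uE; apply: KY; apply: K1K; exact: arc_r a1.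
have as2 := seg_arc YS0 hd w1 z11.
have sub12 : seg d w z1 `<=` seg d z0 z1.
  move=> _ [_ [s s01 <-] <-]; exists (z0 + (t + s * (1 - t)) *: (z1 - z0)).
    exists (t + s * (1 - t)) => //; move: t01 s01; rewrite /= !in_itv /=; nra.
  congr d; rewrite /w scalerDl addrA; congr (_ + _).
  by rewrite -scalerA scalerBl scale1r opprD addrA.
exists (- l), (K1 `|` act (- l) @` seg d w z1); split; last first.
  move=> p [/K1K /KY//|[q [_ [s s01 <-] <-] <-]]; apply: tr; apply: dY.
  move: s01; rewrite /= in_itv /= => s01.
  apply: (@le_lt_trans _ _ (Num.max `|w| `|z1|)); last by rewrite gt_max w1.
  by apply: seg_norm => //; rewrite le_max lexx ?orbT.
have as3 := arc_act (- l) as2; rewrite -uE in as3.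
apply: (arc_cat a1 as3) => p _ h K1p [q sq <-] pE.
have pu : p = u.
  by apply: K1C => //; rewrite pE; apply: orbA; apply: orbA; apply: sub_orb => //; exact: sub12.
split => //; rewrite pu uE in pE *; congr act.
have e : d w = act (l + h - l) q by rewrite !actD -pE actNK.
by have [-> _] := arc_inj act_free as1 (sub12 _ (arc_l as2)) (sub12 _ sq) e.
Qed.

Section Components.
Variable L : set S.
Hypothesis Lo : open L.
Hypothesis LS0 : L `<=` S0.
Hypothesis Linv : forall g x, L x -> L (act g x).

Lemma component_open x : open (connected_component L x).
Proof.
rewrite openE => y Cy; have Ly := connected_component_sub Cy.
have [d hd] := discs Lo LS0 Ly; have [d0 dc _ _] := hd.
have n1 : 0 < (1 : R) <= 1 by rewrite ltr01 lexx.
apply: filterS (disc_nbhs n1 hd) => q Dp.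
apply: (connected_component_trans Cy).
apply: (@connected_component_max _ L (d @` [set z | `|z| < 1])) Dp.
- by exists 0; rewrite //= normr0.
- by move=> _ [z z1 <-]; have [] := dc z z1.
- apply: connected_continuous_connected.
    rewrite (_ : [set z | _] = \bigcup_(w in [set w : R * R | `|w| < 1]) [set t *: w | t in `[0 : R, 1]%classic]).
      apply: bigcup_connected; first by exists 0 => w w1; exists 0; rewrite /= ?in_itv/= ?lexx ?ler01// scale0r.
      move=> w _; apply: connected_continuous_connected; first exact: segment_connected.
      by apply: continuous_subspaceT => t; apply: cvgZr_tmp; exact: cvg_id.
    apply/seteqP; split=> [w w1|_ [w w1 [t t01 <-]]].
      by exists w => //; exists 1; rewrite /= ?in_itv/= ?lexx ?ler01// scale1r.
    move: t01 w1; rewrite /= in_itv /= normrZ => /andP[t0 t1] w1.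
    by rewrite ger0_norm//; apply: le_lt_trans w1; rewrite ler_piMl.
  by apply: continuous_in_subspaceT => z /[!inE] z1; have [] := dc z z1.
Qed.

Lemma act_component_sub g x : act g @` connected_component L x `<=` connected_component L (act g x).
Proof.
have [Lx|Lx] := pselect (L x); last first.
  by rewrite connected_component_out// image_set0.
apply: connected_component_max.
- by exists x => //; exact: connected_component_refl.
- by move=> _ [y /connected_component_sub Ly <-]; exact: Linv.
- by apply: act_connected => //; exact: component_connected.
Qed.

Lemma act_component g x y : connected_component L x y -> connected_component L (act g x) (act g y).
Proof. by move=> Cy; apply: act_component_sub; exists y. Qed.

Lemma component_inv x g y : connected_component L x y -> connected_component L x (act g y) ->
  forall y', connected_component L x y' -> connected_component L x (act g y').
Proof.
move=> xy xgy y' xy'.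
apply: (connected_component_trans xgy); apply: act_component.
exact: connected_component_trans (connected_component_sym xy) xy'.
Qed.

End Components.
End Chains.

(** * Level sets of a function modulo 1 and minimal closed walks *)

Section LevelChains.
Variables (R : realType) (S : topologicalType) (G : finZmodType).
Variables (act : G -> S -> S) (S0 : set S).
Hypothesis hS : hausdorff_space S.
Hypothesis act0 : forall x, act 0 x = x.
Hypothesis actD : forall g g' x, act (g + g') x = act g (act g' x).
Hypothesis act_cont : forall g, continuous (act g).
Hypothesis act_free : forall x g, S0 x -> act g x = x -> g = 0.
Hypothesis actS0 : forall g x, S0 x -> S0 (act g x).
Hypothesis S0o : open S0.
Hypothesis S0c : connected S0.
Hypothesis discs : forall O x, open O -> O `<=` S0 -> O x ->
  exists b : R * R -> S, disc act O x b.
Variables (kap : S -> R) (Q : nat).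
Hypothesis kapc : forall x, cmod_at kap x.
Hypothesis kap_inv : forall g x, modZ (kap (act g x)) (kap x).
Hypothesis Q3 : (3 <= Q)%N.
Implicit Types (x y z u v : S) (g : G) (k : int).

Local Notation orb := (orb act).
Local Notation orbP := (orbP act0 actD).
Local Notation actK := (actK act0 actD).
Local Notation actNK := (actNK act0 actD).
Local Notation orbA := (orbA act0 actD).
Local Notation orbI := (orbI act0 actD).

(** With radius 2/3, consecutive levels overlap, while levels whose difference is not -1, 0 or 1
    modulo [Q] are disjoint. *)
Definition Lv k : set S := [set x | S0 x /\ exists z : int, `|Q%:R * (kap x + z%:~R) - k%:~R| < 2 / 3].

(** The inverse image of a component of the level set in the quotient. These sets are the vertices
    of a graph lying over the circle of levels. *)
Definition W k x := orb (connected_component (Lv k) x).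

Lemma Q3R : 3 <= Q%:R :> R. Proof. by rewrite ler_nat. Qed.

Lemma Lv_near k x (z : int) (e : R) : 0 < e -> S0 x -> `|Q%:R * (kap x + z%:~R) - k%:~R| < e ->
  \forall y \near x, S0 y /\ exists z : int, `|Q%:R * (kap y + z%:~R) - k%:~R| < e.
Proof.
move=> e0 Sx hz; have q3 := Q3R; set d := e - `|Q%:R * (kap x + z%:~R) - k%:~R|.
have d0 : 0 < d / Q%:R by rewrite divr_gt0// ?subr_gt0//; lra.
near=> y; split; first by near: y; exact: open_nbhs_nbhs.
have [z' hz'] : nearZ (d / Q%:R) (kap y - kap x) by near: y; exact: kapc.
exists (z - z').
have -> : Q%:R * (kap y + (z - z')%:~R) - k%:~R =
  Q%:R * (kap y - kap x - z'%:~R) + (Q%:R * (kap x + z%:~R) - k%:~R) by rewrite rmorphB/=; ring.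
apply: (le_lt_trans (ler_normD _ _)); rewrite -ltrBrDr -/d normrM ger0_norm; last lra.
by rewrite mulrC -ltr_pdivlMr//; lra.
Unshelve. all: by end_near. Qed.

Lemma Lv_open k : open (Lv k).
Proof.
by rewrite openE => x [Sx [z hz]]; apply: Lv_near hz => //; lra.
Qed.

Lemma Lv_sub k : Lv k `<=` S0. Proof. by move=> x []. Qed.

Lemma Lv_inv k g x : Lv k x -> Lv k (act g x).
Proof.
move=> [Sx [z hz]]; split; first exact: actS0.
have [w ->] := kap_inv g x; exists (z - w); congr (`|_| < _): hz.
by rewrite rmorphB/=; ring.
Qed.

Lemma Lv_shift k (z : int) : Lv (k + Q%:Z * z) = Lv k.
Proof.
suff h k' (z' : int) : Lv (k' + Q%:Z * z') `<=` Lv k'.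
  apply/seteqP; split; first exact: h.
  by have := h (k + Q%:Z * z) (- z); rewrite mulrN addrK.
move=> x [Sx [w hw]]; split => //; exists (w - z'); congr (`|_| < _): hw.
by rewrite rmorphB rmorphD rmorphM/=; ring.
Qed.

Lemma Lv_cover x : S0 x -> exists k, Lv k x.
Proof.
move=> Sx; exists (Num.floor (Q%:R * kap x + 1 / 2)); split => //; exists 0; rewrite addr0.
have /andP[h1 h2] := floor_itv (Q%:R * kap x + 1 / 2).
by move: h1 h2; rewrite ltr_norml rmorphD/= => h1 h2; apply/andP; split; lra.
Qed.

Lemma int_small (i : int) : `|i%:~R : R| < 2 -> i = -1 \/ i = 0 \/ i = 1.
Proof.
rewrite -intr_norm -[ltRHS]/(2%:~R) ltr_int; lia.
Qed.

Lemma Lv_lift k k' x (z z' : int) : `|Q%:R * (kap x + z%:~R) - k%:~R| < 2 / 3 ->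
  `|Q%:R * (kap x + z'%:~R) - k'%:~R| < 2 / 3 ->
  let e := k' - k - Q%:Z * (z' - z) in e = -1 \/ e = 0 \/ e = 1.
Proof.
move=> h h' e; apply: int_small.
have -> : e%:~R = (Q%:R * (kap x + z%:~R) - k%:~R) - (Q%:R * (kap x + z'%:~R) - k'%:~R) :> R.
  by rewrite /e !(rmorphB, rmorphM)/=; ring.
by move: h h'; rewrite !ltr_norml => /andP[? ?] /andP[? ?]; apply/andP; split; lra.
Qed.

Lemma Lv_meet k k' x : Lv k x -> Lv k' x -> exists z e : int, k' = k + Q%:Z * z + e /\ (e = -1 \/ e = 0 \/ e = 1).
Proof.
move=> [_ [z hz]] [_ [z' hz']]; exists (z' - z), (k' - k - Q%:Z * (z' - z)); split; last exact: Lv_lift hz hz'.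
ring.
Qed.

Lemma W_open k x : open (W k x).
Proof.
apply: orb_open => //; apply: (component_open discs) => //; first exact: Lv_open.
exact: Lv_sub.
Qed.

Lemma W_sub k x : W k x `<=` Lv k.
Proof.
move=> y /orbP [g /connected_component_sub]; rewrite -{2}(actK g y); exact: Lv_inv.
Qed.

Lemma W_inv k x g y : W k x y -> W k x (act g y). Proof. exact: orbA. Qed.

Lemma W_refl k x : Lv k x -> W k x x.
Proof. by move=> kx; apply: sub_orb => //; exact: connected_component_refl. Qed.

Lemma W_eq k x y : W k x y -> W k y = W k x.
Proof.
have aux x' y' : W k x' y' -> W k y' `<=` W k x'.
  move=> /orbP[g h] z /orbP[g' h']; apply/orbP; exists (g + g'); rewrite actD.
  apply: (connected_component_trans h); apply: (act_component act_cont) => //.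
  by move=> ? ?; exact: Lv_inv.
move=> xy; apply/seteqP; split; first exact: aux.
apply: aux; move/orbP: xy => [g h]; apply/orbP; exists (- g).
rewrite -(actK g y); apply: (act_component act_cont); first by move=> ? ?; exact: Lv_inv.
exact: connected_component_sym.
Qed.

Lemma W_eq2 k x x' y : W k x y -> W k x' y -> W k x = W k x'.
Proof. by move=> /W_eq <- /W_eq <-. Qed.

Lemma W_shift k (z : int) x : W (k + Q%:Z * z) x = W k x.
Proof. by rewrite /W Lv_shift. Qed.

(** A vertex keeps its level as an integer and not modulo [Q], so a walk that comes back to the same
    set has a winding number. *)
Definition vtx := (int * S)%type.
Local Notation Wv a := (W a.1 a.2).
Definition adj (a b : vtx) := [/\ b.1 - a.1 = 1 \/ b.1 - a.1 = -1 & Wv a `&` Wv b !=set0].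

Definition walk n (a b : vtx) := exists c : nat -> vtx, [/\ (c 0%N).1 = a.1 /\ Wv (c 0%N) = Wv a,
  (c n).1 = b.1 /\ Wv (c n) = Wv b & forall i, (i < n)%N -> adj (c i) (c i.+1)].

Lemma adj_sym a b : adj a b -> adj b a.
Proof. by move=> [h1 h2]; split; [lia|rewrite setIC]. Qed.

Lemma adj_eq a a' b b' : a.1 = a'.1 /\ Wv a = Wv a' -> b.1 = b'.1 /\ Wv b = Wv b' -> adj a b -> adj a' b'.
Proof. by move=> [e1 e2] [e3 e4] [h1 h2]; split; [rewrite -e1 -e3|rewrite -e2 -e4]. Qed.

Lemma walk0 (a b : vtx) : a.1 = b.1 -> Wv a = Wv b -> walk 0 a b.
Proof. by move=> h1 h2; exists (fun=> a). Qed.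

Lemma walk1 (a b : vtx) : adj a b -> walk 1 a b.
Proof. by move=> ab; exists (fun i => if i is 0%N then a else b); split => // -[]. Qed.

Lemma walk_sym n a b : walk n a b -> walk n b a.
Proof.
move=> [c [c0 cn cs]]; exists (fun i => c (n - i)%N); rewrite subn0 subnn; split => // i i_n.
by apply: adj_sym; rewrite (_ : (n - i)%N = (n - i.+1).+1); [apply: cs; lia|lia].
Qed.

Lemma walk_cat n m a b d : walk n a b -> walk m b d -> walk (n + m) a d.
Proof.
move=> [c [c0 cn cs]] [c' [c0' cm cs']].
exists (fun i => if (i < n)%N then c i else c' (i - n)%N); split.
- by case: n cn cs => [|n] cn cs //=; rewrite subn0; move: cn c0 c0' => [-> ->] [-> ->] [-> ->].
- by rewrite ltnNge leq_addr/= addKn.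
- move=> i inm; have [i_n|n_i] := ltnP i n.
    have [_|n_i] := ltnP i.+1 n; first exact: cs.
    have e : i.+1 = n by lia.
    rewrite -e subnn; have := cs i i_n; apply: adj_eq => //.
    by rewrite e; move: cn c0' => [-> ->] [-> ->].
  by rewrite ifF; [rewrite subSn//; apply: cs'; lia|lia].
Qed.

Definition closed_walk n (T : int) := exists2 a, walk n a (a.1 + Q%:Z * T, a.2) & True.

Lemma closed_walkN n T : closed_walk n T -> closed_walk n (- T).
Proof.
move=> [a /walk_sym h _]; exists (a.1 + Q%:Z * T, a.2) => //=.
by rewrite mulrN addrK; case: a h.
Qed.

Lemma walk_eq n a b b' : walk n a b -> b.1 = b'.1 -> Wv b = Wv b' -> walk n a b'.
Proof. by move=> [c [c0 [cn cn'] cs]] e1 e2; exists c; split => //; rewrite cn' cn. Qed.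

Lemma adj_pt x k k' : Lv k x -> Lv k' x -> k' - k = 1 \/ k' - k = -1 -> adj (k, x) (k', x).
Proof. by move=> kx kx' h; split => //; exists x; split; exact: W_refl. Qed.

(** If every closed walk had winding 0, the integer levels reached at a point by walks from a base
    vertex would single out one real value of [kap] there, and this value would vary
    continuously. *)
Lemma closed_walk_ex : ~ (exists f : S -> R, forall x, S0 x -> {for x, continuous f} /\ modZ (kap x) (f x)) ->
  exists n T, T != 0 /\ closed_walk n T.
Proof.
move=> nl; apply: contrapT => nw.
have nw' n T : closed_walk n T -> T = 0.
  by move=> nT; apply/eqP/negPn/negP => T0; apply: nw; exists n, T.
have [x0 Sx0] : exists x0, S0 x0.
  by apply: contrapT => h; apply: nl; exists (fun=> 0) => x Sx; case: h; exists x.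
have [k0 kx0] := Lv_cover Sx0.
pose rd x k := Lv k x /\ exists n, walk n (k0, x0) (k, x).
have rd_shift x k k' : rd x k -> Lv k' x -> k' - k = -1 \/ k' - k = 0 \/ k' - k = 1 -> rd x k'.
  move=> [kx [n w]] kx' h; split => //.
  have [e|h'] : k' = k \/ (k' - k = 1 \/ k' - k = -1) by lia.
    by exists n; rewrite e.
  by exists (n + 1)%N; apply: walk_cat w (walk1 _); exact: adj_pt.
have rd_comp x y k : rd y k -> Lv k x -> W k x y -> rd x k.
  move=> [ky [n w]] kx xy; split => //; exists n; apply: (walk_eq w) => //=.
  exact: W_eq.
have rd_uniq x k (z : int) : rd x k -> rd x (k + Q%:Z * z) -> z = 0.
  move=> [_ [n w]] [_ [n' w']]; apply: (nw' (n + n')%N).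
  by exists (k, x) => //; exact: walk_cat (walk_sym w) w'.
have reach x : S0 x -> exists k, rd x k.
  pose A := [set x | S0 x /\ exists k, rd x k].
  suff AS : A = S0 by move=> Sx; have [_] : A x by rewrite AS.
  apply: open_clopen => //; first by move=> y [].
    exists x0; split => //; exists k0; split => //; exists 0%N; exact: walk0.
  move=> {}x Sx; have [k kx] := Lv_cover Sx; exists (W k x); split.
  - by apply: open_nbhs_nbhs; split; [exact: W_open|exact: W_refl].
  - by move=> y /W_sub[].
  - move=> [y [[Sy [k' [ky' w']]] xy]].
    have ky := W_sub xy.
    have [z [e [ke he]]] := Lv_meet ky' ky.
    have ks : k + Q%:Z * (- z) = k' + e by rewrite ke; ring.
    have rdy : rd y (k' + e).
      apply: (rd_shift _ _ _ (conj ky' w')); last by lia.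
      by rewrite -ks Lv_shift.
    move=> p xp; have kp := W_sub xp; split; first exact: Lv_sub kp.
    exists (k' + e); apply: (rd_comp _ _ _ rdy); rewrite -ks ?Lv_shift ?W_shift//.
    by rewrite (W_eq2 (W_refl kp) xp).
pose P x r := exists k, [/\ rd x k, modZ (kap x) r & `|Q%:R * r - k%:~R| < 2 / 3].
have P_uniq x r r' : P x r -> P x r' -> r = r'.
  move=> [k [rk /modZ_sym[z ->] h]] [k' [rk' /modZ_sym[z' ->] h']].
  suff -> : z = z' by [].
  have := Lv_lift h h'; set e := k' - k - _ => he.
  apply/eqP; rewrite eq_sym -subr_eq0; apply/eqP; apply: (rd_uniq _ _ _ rk).
  apply: (rd_shift _ _ _ rk'); last by rewrite /e in he *; lia.
  by rewrite Lv_shift; case: rk.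
have P_ex x : exists r, S0 x -> P x r.
  have [Sx|Sx] := pselect (S0 x); last by exists 0.
  have [k rk] := reach x Sx; have [[_ [z hz]] _] := rk.
  by exists (kap x + z%:~R) => _; exists k; split => //; apply: modZ_sym; exact: modZ_int.
have [f fP] := choice P_ex.
apply: nl; exists f => x Sx; have [k [rk kf h]] := fP x Sx; split => //.
have q3 := Q3R; set d := 2 / 3 - `|Q%:R * f x - k%:~R|.
have d0 : 0 < d / Q%:R by rewrite divr_gt0// ?subr_gt0//; lra.
apply/cvgrPdist_lt => e e0.
near=> y.
have Sy : S0 y by near: y; exact: open_nbhs_nbhs.
have xy : W k x y.
  near: y; apply: open_nbhs_nbhs; split; [exact: W_open|apply: W_refl].
  exact: rk.1.
have [z hz] : nearZ (Num.min e (d / Q%:R)) (kap y - kap x).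
  by near: y; apply: kapc; rewrite lt_min e0.
move: hz; rewrite lt_min => /andP[he hd].
suff -> : f y = f x + (kap y - kap x - z%:~R) by rewrite opprD addNKr normrN.
apply: (P_uniq y); first exact: fP.
exists k; split.
- apply: (rd_comp _ _ _ rk); first exact: W_sub xy.
  by rewrite (W_eq xy); apply: W_refl; exact: rk.1.
- by have [w ->] := kf; exists (w + z); rewrite rmorphD/=; ring.
- have -> : Q%:R * (f x + (kap y - kap x - z%:~R)) - k%:~R =
    Q%:R * (kap y - kap x - z%:~R) + (Q%:R * f x - k%:~R) by ring.
  apply: (le_lt_trans (ler_normD _ _)); rewrite -ltrBrDr -/d normrM ger0_norm; last lra.
  by rewrite mulrC -ltr_pdivlMr//; lra.
Unshelve. all: by end_near. Qed.

Hypothesis nl : ~ (exists f : S -> R, forall x, S0 x -> {for x, continuous f} /\ modZ (kap x) (f x)).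

(** A periodic sequence over all naturals, which avoids indices modulo [n]. Within a period, sets
    meet only when cyclically adjacent, as for a simple closed curve. *)
Definition cyclic_chain n T (c : nat -> vtx) := [/\ 0 < T, forall i, adj (c i) (c i.+1),
  forall i, (c (i + n)%N).1 = (c i).1 + Q%:Z * T /\ Wv (c (i + n)%N) = Wv (c i) &
  forall i j, (i < j)%N -> (j < i + n)%N -> Wv (c i) `&` Wv (c j) !=set0 -> j = i.+1 \/ j.+1 = (i + n)%N].

(** A closed walk of least length among those with nonzero winding. A further intersection would be
    a chord that cuts it into two shorter closed walks whose windings add up to [T], so one of them
    would be nonzero. *)
Lemma cyclic_chain_ex : exists n T c, cyclic_chain n T c.
Proof.
pose B n := exists T, T != 0 /\ closed_walk n T.
have exB : exists n, `[< B n >].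
  by have [n [T h]] := closed_walk_ex nl; exists n; apply/asboolP; exists T.
case: (ex_minnP exB) => n /asboolP [T0 [T00 w0]] nmin.
have min m T : (m < n)%N -> closed_walk m T -> T = 0.
  move=> mn w; apply/eqP/negPn/negP => Tn0.
  by have := nmin m; rewrite leqNgt mn => h; have /h : `[< B m >] by apply/asboolP; exists T.
have [T [T0p [a [c0 [c0a c0n c0s]] _]]] : exists T, 0 < T /\ closed_walk n T.
  have [|T0n] := ltP 0 T0; first by exists T0.
  by exists (- T0); split; [lia|exact: closed_walkN].
rewrite /= W_shift in c0n.
have n0 : (0 < n)%N.
  by case: n c0n {nmin min w0 c0s} => // [[e _]]; move: c0a e => [-> _]; have := Q3; nia.
pose c i : vtx := ((c0 (i %% n)%N).1 + Q%:Z * (T * (i %/ n)%N%:Z), (c0 (i %% n)%N).2).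
have cs i : adj (c i) (c i.+1).
  have sh a' b' (z : int) : adj a' b' -> adj (a'.1 + Q%:Z * z, a'.2) (b'.1 + Q%:Z * z, b'.2).
    by move=> [h1 h2]; split; rewrite /= ?W_shift//; lia.
  have rn : (i %% n < n)%N by rewrite ltn_pmod.
  have := sh _ _ (T * (i %/ n)%N%:Z) (c0s _ rn); apply: adj_eq => //=.
  rewrite /c /= !W_shift.
  have iE : i.+1 = (i %/ n * n + (i %% n).+1)%N by rewrite {1}(divn_eq i n) addnS.
  have [h|h] := ltnP (i %% n).+1 n.
    have -> : (i.+1 %% n = (i %% n).+1)%N by rewrite iE modnMDl modn_small.
    have -> : (i.+1 %/ n = i %/ n)%N by rewrite iE divnMDl// (divn_small h) addn0.
    by [].
  have {}h : (i %% n).+1 = n by lia.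
  have iE' : i.+1 = ((i %/ n).+1 * n)%N by rewrite iE h mulSn addnC.
  rewrite h iE' modnMl mulnK//; move: c0a c0n => [-> ->] [-> ->]; split => //.
  by rewrite -[(i %/ n).+1]addn1 PoszD; ring.
have cp i : (c (i + n)%N).1 = (c i).1 + Q%:Z * T /\ Wv (c (i + n)%N) = Wv (c i).
  rewrite /c /= modnDr divnDr ?dvdnn// divnn n0 /= !W_shift; split => //.
  by rewrite /= PoszD; ring.
have win i m : walk m (c i) (c (i + m)%N).
  by exists (fun l => c (i + l)%N); rewrite addn0; split => // l _; rewrite addnS; exact: cs.
clearbody c; exists n, T, c; split => // i j ij jn [y [Wi Wj]].
have [z [e [ke he]]] := Lv_meet (W_sub Wi) (W_sub Wj).
have [cp1 cp2] := cp i.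
have w1 : walk (j - i) (c i) (c j) by have := win i (j - i)%N; rewrite subnKC// ltnW.
have w2 : walk (i + n - j) (c j) (c (i + n)%N) by have := win j (i + n - j)%N; rewrite subnKC// ltnW.
apply: contrapT => nij.
(* If [e] is 0 the two sets coincide and cut the walk without an extra edge. Otherwise they are
   adjacent, and the chord costs one edge on each side, which is still shorter as the indices are
   not consecutive. *)
have [e0|e1] : e = 0 \/ (e = -1 \/ e = 1) by lia.
  have Wij : W (c j).1 (c i).2 = Wv (c j).
    by rewrite ke e0 addr0 !W_shift; apply: (W_eq2 Wi); rewrite -(W_shift _ z) -[_ + _]addr0 -{1}e0 -ke.
  have z0 : z = 0.
    apply: (min (j - i)%N); first by lia.
    exists (c i) => //; apply: (walk_eq w1) => //=; first by rewrite ke e0 addr0.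
    by rewrite -Wij ke e0 addr0 !W_shift.
  have : T = 0; last by lia.
  apply: (min (i + n - j)%N); first by lia.
  exists (c j) => //; apply: (walk_eq w2) => //=; first by rewrite cp1 ke e0 z0; ring.
  by rewrite !W_shift cp2 -Wij ke e0 z0 mulr0 !addr0.
have z0 : z = 0.
  apply: (min (j - i + 1)%N); first by lia.
  exists (c i) => //; apply: (walk_cat w1); apply: walk1; split => /=; first by rewrite ke; lia.
  by rewrite W_shift; exists y.
have : T - z = 0; last by lia.
apply: (min (i + n - j + 1)%N); first by lia.
exists (c j) => //; apply: (walk_cat w2); apply: walk1; split => /=; first by rewrite ke cp1; lia.
by rewrite W_shift cp2; exists y.
Qed.

(** Over a period the level rises by at least [Q] in steps of one. Relative to the start, the zone
    [z j] is the index just before level [2 * j + 2] is first reached: the level there is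
    [2 * j + 1], and it was [2 * j] one step earlier. Using every other level keeps the zones two
    indices apart. *)
Lemma zones_ex n T c m : cyclic_chain n T c -> (2 * m + 3 <= Q)%N -> exists z : nat -> nat,
  forall j, (j < m)%N -> [/\ (1 <= z j)%N, (z j + 2 <= n)%N, forall i, (i < j)%N -> (z i + 2 <= z j)%N,
   (c (z j).+1).1 = (c (z j)).1 + 1 & (c (z j)).1 = (c (z j).-1).1 + 1].
Proof.
move=> [T0 cs cp _] mQ; pose f i := (c i).1 - (c 0%N).1.
have f0 : f 0%N = 0 by rewrite /f subrr.
have fs i : f i.+1 - f i = 1 \/ f i.+1 - f i = -1.
  by have [h _] := cs i; rewrite /f; lia.
have fn : (Q%:Z <= f n)%R.
  by have [+ _] := cp 0%N; rewrite /f add0n => ->; have := Q3; nia.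
have tex (M : nat) : exists t, (M <= Q)%N -> [/\ (t <= n)%N, M%:Z <= f t & forall i, (i < t)%N -> f i < M%:Z].
  have [MQ|MQ] := leqP M Q; last by exists 0%N.
  have ex : exists i, M%:Z <= f i by exists n; lia.
  case: (ex_minnP ex) => t ht tmin; exists t => _; split => //.
    by apply: tmin; lia.
  by move=> i it; rewrite ltNge; apply/negP => /tmin; rewrite leqNgt it.
have [t tP] := choice tex.
have tS M : (M < Q)%N -> [/\ (t M < t M.+1)%N, f (t M.+1).-1 = M%:Z & f (t M.+1) = M.+1%:Z].
  move=> MQ; have [t1 t2 t3] := tP M.+1 MQ; have [t1' t2' t3'] := tP M (ltnW MQ).
  have tp : (0 < t M.+1)%N by case: (t M.+1) t2 => //; lia.
  have := t3 (t M.+1).-1; have := fs (t M.+1).-1; rewrite !prednK// => h1 h2.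
  have {}h2 := h2 (leqnn _).
  have e : f (t M.+1).-1 = M%:Z by lia.
  split => //; last by lia.
  by rewrite ltnNge; apply/negP => h; have := t3' (t M.+1).-1; lia.
have tmono (M k : nat) : (M + k <= Q)%N -> (t M + k <= t (M + k))%N.
  elim: k => [|k IH] h; first by rewrite !addn0.
  have := IH; rewrite !addnS in h *; have [? _ _] := tS _ h; lia.
exists (fun j => (t (2 * j + 2)%N).-1) => j jm.
have [a1 a2 a3] := tS (2 * j + 1)%N ltac:(lia); rewrite (_ : (2 * j + 1).+1 = 2 * j + 2)%N in a1 a2 a3; last by lia.
have [b1 b2 b3] := tS (2 * j)%N ltac:(lia).
have [d1 d2 d3] := tP (2 * j + 2)%N ltac:(lia).
have u := tmono (2 * j + 2)%N 1%N ltac:(lia).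
have [g1 g2 g3] := tP (2 * j + 2 + 1)%N ltac:(lia).
have z1 : (1 <= (t (2 * j + 2)%N).-1)%N.
  rewrite lt0n; apply/eqP => z0; move: a2; rewrite z0 f0; lia.
split => //=.
- lia.
- move=> i ij; have := tmono (2 * i + 2)%N (2 * (j - i))%N ltac:(lia).
  have -> : (2 * i + 2 + 2 * (j - i) = 2 * j + 2)%N by lia.
  have := tmono 0%N (2 * i + 2)%N ltac:(lia).
  by rewrite add0n; lia.
- rewrite prednK; last by lia. 
  by move: a2 a3; rewrite /f; lia.
- have := fs (t (2 * j + 2)%N).-1.-1; have := d3 (t (2 * j + 2)%N).-1.-1.
  rewrite prednK//; move: a2; rewrite /f; lia.
Qed.

End LevelChains.

(** * Simple closed curves in the quotient *)

Section Cycles.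
Variables (R : realType) (S : topologicalType) (G : finZmodType).
Variables (act : G -> S -> S) (S0 : set S).
Hypothesis hS : hausdorff_space S.
Hypothesis act0 : forall x, act 0 x = x.
Hypothesis actD : forall g g' x, act (g + g') x = act g (act g' x).
Hypothesis act_cont : forall g, continuous (act g).
Hypothesis act_free : forall x g, S0 x -> act g x = x -> g = 0.
Hypothesis actS0 : forall g x, S0 x -> S0 (act g x).
Implicit Types (x y z u v : S) (g : G) (K : set S).

Local Notation arc := (@arc R S G act S0).
Local Notation orb := (orb act).
Local Notation orbP := (orbP act0 actD).
Local Notation actK := (actK act0 actD).
Local Notation actNK := (actNK act0 actD).
Local Notation orbA := (orbA act0 actD).
Local Notation orbI := (orbI act0 actD).
Local Notation orbS := (orbS act0 actD).

Lemma arc_interior x y K : arc x y K -> x <> y ->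
  connected (K `\` [set x; y]) /\ K `\` [set x; y] !=set0.
Proof.
move=> [[_ -> //]|[a [sa <- <- ->]]] _; have [ca _ ai] := sa.
have -> : img a 0 1 `\` [set a 0; a 1] = a @` `]0, 1[%classic.
  apply/seteqP; split=> [_ [[t t01 <-] h]|_ [t t01 <-]].
    exists t => //; move: t01; rewrite /= !in_itv /= !lt_neqAle => /andP[-> ->]; rewrite !andbT.
    by apply/andP; split; apply/eqP => e; apply: h; [left; rewrite -e|right; rewrite e].
  move: t01; rewrite /= in_itv /= => t01; split.
    by exists t => //; rewrite /= in_itv /=; lra.
  move=> [e|e].
    by have e1 := ai t 0 0 ltac:(lra) ltac:(lra) ltac:(by rewrite act0); move: t01; rewrite e1 ltxx.
  by have e1 := ai t 1 0 ltac:(lra) ltac:(lra) ltac:(by rewrite act0); move: t01; rewrite e1 ltxx andbF.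
split; last by exists (a 2^-1), 2^-1 => //; rewrite /= in_itv /=; apply/andP; split; lra.
apply: connected_continuous_connected.
  by apply/connected_intervalP; exact: interval_is_interval.
exact: continuous_subspaceT.
Qed.

(** A simple closed curve in the quotient, given by lifted arcs. The sum of the [s i] is the
    translation between the two ends of its lift. *)
Definition acycle (n : nat) (u : nat -> S) (s : nat -> G) (a : nat -> set S) :=
  [/\ u n = u 0%N, forall i, (i < n)%N -> arc (u i) (act (s i) (u i.+1)) (a i) &
    forall i j q, (i < j)%N -> (j < n)%N -> orb (a i) q -> orb (a j) q ->
      (j = i.+1 /\ orb [set u j] q) \/ [/\ i = 0%N, j.+1 = n & orb [set u 0%N] q]].

(** Each arc is stopped where it first meets the orbit of the next one, which is made to start
    there. The last arc stops at its first meeting with what is left of arc 0, and arc 0 loses its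
    part before that point. *)
Lemma acycle_ex (n : nat) (p : nat -> S) (s : nat -> G) (A : nat -> set S) : (1 < n)%N -> p n = p 0%N ->
  (forall i, (i < n)%N -> arc (p i) (act (s i) (p i.+1)) (A i)) ->
  (forall i j q, (i < j)%N -> (j < n)%N -> orb (A i) q -> orb (A j) q -> j = i.+1 \/ i = 0%N /\ j.+1 = n) ->
  exists (u : nat -> S) (t : nat -> G) (a : nat -> set S), acycle n u t a /\ forall i, (i < n)%N -> a i `<=` A i.
Proof.
move=> n1 pn pA Ad.
have step (x : nat * S) : exists y : S * G * set S, (x.1.+1 < n)%N -> A x.1 x.2 ->
    [/\ arc x.2 (act y.1.2 y.1.1) y.2, y.2 `<=` A x.1, A x.1.+1 y.1.1 &
      forall q, y.2 q -> orb (A x.1.+1) q -> orb [set y.1.1] q].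
  case: x => i w /=; have [h|h] := pselect ((i.+1 < n)%N /\ A i w); last first.
    by exists (w, 0, A i) => *; case: h.
  have [i_n Aw] := h; have aA := pA i (ltnW i_n); have aA' := pA _ i_n.
  have [K1 [K2 [_ a2 AE _]]] := arc_split aA Aw.
  have cC : closed (orb (A i.+1)) by apply: orb_closed => //; exact: arc_closed aA'.
  have ne : K2 `&` orb (A i.+1) !=set0.
    exists (act (s i) (p i.+1)); split; first exact: arc_r a2.
    by apply: orbA; apply: sub_orb => //; exact: arc_l aA'.
  have [q [L1 [L2 [[b1 _ K2E _] Cq Lq]]]] := arc_first a2 cC ne.
  have [g Ag] := (orbP _ _).1 Cq.
  exists (act g q, - g, L1) => _ _ /=; split => //; first by rewrite actK.
    by move=> r Lr; rewrite AE K2E; right; left.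
  by move=> r Lr Ar; rewrite (Lq _ Lr Ar) -{2}(actK g q); apply: orbA; apply: sub_orb.
have [f fP] := choice step.
pose st := fix st i := if i is i'.+1 then (f (i', st i')).1.1 else p 0%N.
have stA i : (i < n)%N -> A i (st i).
  elim: i => [|i IH] i_n; first by have := arc_l (pA 0%N i_n).
  by have [_ _ h _] := fP (i, st i) i_n (IH (ltnW i_n)).
pose b i := (f (i, st i)).2; pose t i := (f (i, st i)).1.2.
have stP i : (i.+1 < n)%N -> [/\ arc (st i) (act (t i) (st i.+1)) (b i), b i `<=` A i &
   forall q, b i q -> orb (A i.+1) q -> orb [set st i.+1] q].
  by move=> i_n; have [? ? ? ?] := fP (i, st i) i_n (stA i (ltnW i_n)).
have nE : n.-1.+1 = n by lia.
have n_1 : (n.-1 < n)%N by lia.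
have [a0 b0A _] := stP 0%N n1.
have [K1 [K2 [_ a2 AE _]]] := arc_split (pA _ n_1) (stA _ n_1); rewrite nE pn in a2.
have cC : closed (orb (b 0%N)) by apply: orb_closed => //; exact: arc_closed a0.
have ne : K2 `&` orb (b 0%N) !=set0.
  exists (act (s n.-1) (p 0%N)); split; first exact: arc_r a2.
  by apply: orbA; apply: sub_orb => //; exact: arc_l a0.
have [q [L1 [L2 [[b1 _ K2E _] Cq Lq]]]] := arc_first a2 cC ne.
have [g Ag] := (orbP _ _).1 Cq.
have [M1 [M2 [_ m2 b0E _]]] := arc_split a0 Ag.
pose u i := if (i == 0%N) || (i == n) then act g q else st i.
pose tt i := if i == n.-1 then - g else t i.
pose a i := if i == 0%N then M2 else if i == n.-1 then L1 else b i.
have aA i : (i < n)%N -> a i `<=` A i.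
  move=> i_n x; rewrite /a; case: eqVneq => [-> M2x|i0]; first by apply: b0A; rewrite b0E; right.
  case: eqVneq => [-> L1x|i1]; first by rewrite AE K2E; right; left.
  by have [|_ + _] := stP i; [lia|apply].
have ab i : (i.+1 < n)%N -> a i `<=` b i.
  move=> i_n x; rewrite /a; case: eqVneq => [-> M2x|i0]; first by rewrite b0E; right.
  by rewrite ifF//; lia.
exists u, tt, a; split => //; split.
- by rewrite /u eqxx orbT.
- move=> i i_n; rewrite /u /tt /a /=; case: (eqVneq i 0%N) => [->|i0] /=.
    by rewrite !ifF//; lia.
  case: (eqVneq i n.-1) => [->|i1].
    by rewrite nE eqxx actK ifF//; lia.
  by rewrite !ifF; [have [|? _ _] := stP i; [lia|]|lia|lia].
- move=> i j r ij jn ir jr.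
  have sA k : (k < n)%N -> orb (a k) r -> orb (A k) r by move=> kn; exact: (orbS (aA k kn)).
  have i_n : (i < n)%N by lia.
  have [jE|[i0 jE]] := Ad i j r ij jn (sA _ i_n ir) (sA _ jn jr).
    left; split => //; have [l al] := (orbP _ _).1 ir; apply: (@orbI _ l).
    have [|_ _ h] := stP i; first by rewrite -jE.
    rewrite /u ifF; last by lia.
    by rewrite jE; apply: h; [apply: ab => //; lia|apply: orbA; rewrite -jE; exact: sA].
  right; split => //; have [l al] := (orbP _ _).1 jr; apply: (@orbI _ l).
  have e : act l r = q.
    apply: Lq; first by move: al; rewrite /a ifF ?ifT //; lia.
    by apply: orbA; move: ir; rewrite i0; exact: (orbS (ab 0%N n1)).
  by rewrite e /u /=; apply: (@orbI _ g); apply: sub_orb.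
Qed.

End Cycles.

(** * A zone and the function that rises across it *)

Section Zone.
Variables (R : realType) (S : topologicalType) (G : finZmodType).
Variables (act : G -> S -> S) (S0 : set S).
Hypothesis hS : hausdorff_space S.
Hypothesis act0 : forall x, act 0 x = x.
Hypothesis actD : forall g g' x, act (g + g') x = act g (act g' x).
Hypothesis act_cont : forall g, continuous (act g).
Hypothesis act_free : forall x g, S0 x -> act g x = x -> g = 0.
Hypothesis actS0 : forall g x, S0 x -> S0 (act g x).
Hypothesis S0o : open S0.
Hypothesis discs : forall O x, open O -> O `<=` S0 -> O x ->
  exists b : R * R -> S, disc act O x b.
Hypothesis Hloc : forall (O : set S) (x : S), open O -> open (connected_component O x).
Hypothesis Hpunct : forall Y : set S, open Y -> connected Y -> connected (Y `&` S0).
Variables (kap : S -> R) (Q : nat).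
Hypothesis kapc : forall x, cmod_at kap x.
Hypothesis kap_inv : forall g x, modZ (kap (act g x)) (kap x).
Hypothesis Q3 : (3 <= Q)%N.
Implicit Types (x y z u v : S) (g : G) (K : set S).

Local Notation arc := (@arc R S G act S0).
Local Notation orb := (orb act).
Local Notation orbP := (orbP act0 actD).
Local Notation actK := (actK act0 actD).
Local Notation actNK := (actNK act0 actD).
Local Notation orbA := (orbA act0 actD).
Local Notation orbI := (orbI act0 actD).
Local Notation orbS := (orbS act0 actD).
Local Notation Lv := (Lv S0 kap Q).
Local Notation W := (W act S0 kap Q).
Local Notation crossing := (@crossing R S G act S0).

Variables (k : int) (x0 : S) (B : set S) (b t : S) (v0 : G) (a : set S).
Hypothesis Bc : closed B.
Hypothesis Binv : forall g x, B x -> B (act g x).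
Hypothesis BS0 : B `<=` S0.
Hypothesis aarc : arc b (act v0 t) a.
Hypothesis aW : a `<=` W k x0.
Hypothesis Bb : B b.
Hypothesis Bt : B t.
Hypothesis aB : forall x, a x -> B x -> orb [set b] x \/ orb [set t] x.
Hypothesis bt : forall g, b <> act g t.
Hypothesis klow : exists z : int, `|Q%:R * (kap b + z%:~R) - k%:~R| < 2 / 3 /\ Q%:R * (kap b + z%:~R) - k%:~R < - (1 / 3).
Hypothesis khigh : exists z : int, `|Q%:R * (kap t + z%:~R) - k%:~R| < 2 / 3 /\ 1 / 3 < Q%:R * (kap t + z%:~R) - k%:~R.
Hypothesis Bmid : forall x (z : int), B x -> `|Q%:R * (kap x + z%:~R) - k%:~R| <= 1 / 3 ->
  exists N, nbhs x N /\ N `&` W k x0 = set0.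

Let q3 : 3 <= Q%:R :> R. Proof. by rewrite ler_nat. Qed.

(** The level set without the restriction to [S0], because the function has to be continuous modulo
    1 at the nonfree points as well. *)
Definition LS : set S := [set x | exists z : int, `|Q%:R * (kap x + z%:~R) - k%:~R| < 2 / 3].

Lemma LS_near x (z : int) (e ep : R) : 0 < ep -> `|Q%:R * (kap x + z%:~R) - k%:~R| < e ->
  \forall y \near x, exists w : int, `|kap y + w%:~R - (kap x + z%:~R)| < ep /\ `|Q%:R * (kap y + w%:~R) - k%:~R| < e.
Proof.
have q3' := q3; move=> ep0 hz; set d := e - `|Q%:R * (kap x + z%:~R) - k%:~R|.
have d0 : 0 < d / Q%:R by rewrite divr_gt0// ?subr_gt0//; lra.
near=> y.
have [z' hz'] : nearZ (Num.min ep (d / Q%:R)) (kap y - kap x) by near: y; apply: kapc; rewrite lt_min ep0.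
move: hz'; rewrite lt_min => /andP[h1 h2].
have e1 : kap y + (z - z')%:~R - (kap x + z%:~R) = kap y - kap x - z'%:~R by rewrite rmorphB/=; ring.
exists (z - z'); split; first by rewrite e1.
have -> : Q%:R * (kap y + (z - z')%:~R) - k%:~R =
  Q%:R * (kap y + (z - z')%:~R - (kap x + z%:~R)) + (Q%:R * (kap x + z%:~R) - k%:~R) by ring.
rewrite e1; apply: (le_lt_trans (ler_normD _ _)); rewrite -ltrBrDr -/d normrM ger0_norm; last lra.
by rewrite mulrC -ltr_pdivlMr//; lra.
Unshelve. all: by end_near. Qed.

Lemma LS_open : open LS.
Proof.
rewrite openE => x [z hz]; have := @LS_near x z (2 / 3) 1 ltr01 hz.
by apply: filterS => y [w [_ h]]; exists w.
Qed.

Lemma LS_uniq x (z z' : int) : `|Q%:R * (kap x + z%:~R) - k%:~R| < 2 / 3 ->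
  `|Q%:R * (kap x + z'%:~R) - k%:~R| < 2 / 3 -> z = z'.
Proof.
have q3' := q3; move=> h h'; apply/eqP; rewrite -subr_eq0 -absz_eq0 -leqn0 -ltnS -(ltr_nat R) natr_absz intr_norm rmorphB/=.
have e : z%:~R - z'%:~R = (Q%:R * (kap x + z%:~R) - k%:~R - (Q%:R * (kap x + z'%:~R) - k%:~R)) / Q%:R.
  by field; lra.
rewrite e normrM normfV (ger0_norm (_ : 0 <= Q%:R)); last lra.
rewrite ltr_pdivrMr; last lra.
apply: (le_lt_trans (ler_normB _ _)); lra.
Qed.

Lemma kap_lift_ex : exists f : S -> R, forall x, LS x -> (exists z : int, f x = kap x + z%:~R) /\ `|Q%:R * f x - k%:~R| < 2 / 3.
Proof.
have ex x : exists r : R, LS x -> (exists z : int, r = kap x + z%:~R) /\ `|Q%:R * r - k%:~R| < 2 / 3.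
  have [[z hz]|h] := pselect (LS x); last by exists 0.
  by exists (kap x + z%:~R) => _; split => //; exists z.
by have [f fP] := choice ex; exists f.
Qed.

(** Constant outside [[-1/3, 1/3]], hence well inside the level set, with end values 0 and 1 that
    agree modulo 1. *)
Definition ramp (s : R) : R := clamp 0 1 ((3 * s + 1) / 2).

Lemma ramp_continuous : continuous ramp.
Proof.
move=> s; apply: (@continuous_comp _ _ _ (fun s : R => (3 * s + 1) / 2) (clamp 0 1)); last exact: clamp_continuous.
have -> : (fun s : R => (3 * s + 1) / 2) = (fun s => 1 / 2 + s * (3 / 2)) by apply/funext => r; lra.
exact: continuous_affine.
Qed.

Lemma ramp0 s : s <= - (1 / 3) -> ramp s = 0.
Proof. by move=> h; rewrite /ramp /clamp min_l ?max_l//; lra. Qed.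

Lemma ramp1 s : 1 / 3 <= s -> ramp s = 1.
Proof. by move=> h; rewrite /ramp /clamp min_r ?max_r//; lra. Qed.

Definition zstab (Y : set S) : set G := [set g | exists y, Y y /\ Y (act g y)].

(** [B] stands for the orbits of the other arcs; [Y] is the component of the level set minus [B]
    that contains the interior of [a]. The function is the ramp of the level there and 0 elsewhere.
    It is continuous modulo 1 because the ramp is 0 or 1 wherever the level leaves the middle third,
    and in the middle third [Bmid] keeps [B] away from the zone. *)
Lemma zone_ex : exists (Y : set S) (phi : S -> R),
 [/\ [/\ Y `<=` W k x0, Y `&` B = set0, a `<=` Y `|` [set b; act v0 t] &
     forall g y y', Y y -> Y (act g y) -> Y y' -> Y (act g y')],
   (forall J : set G, J 0 -> (forall i j, J i -> J j -> J (i - j)) ->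
     (forall (v : G) K, crossing Y b t v K -> J (v - v0)) -> zstab Y `<=` J),
   zstab Y 0 /\ (forall i j, zstab Y i -> zstab Y j -> zstab Y (i - j)),
   forall x, cmod_at phi x &
   [/\ forall x, S0 x -> ~ Y x -> phi x = 0,
    forall (c : R -> S) h, continuous c -> c 0 = b -> c 1 = act v0 t -> (forall r : R, 0 <= r <= 1 -> a (c r)) ->
      zstab Y h -> incr (fun r => phi (act h (c r))) 1 &
    forall h x, ~ zstab Y h -> a x -> phi (act h x) = 0]].
Proof.
have q3' := q3.
have b_ne : b <> act v0 t by exact: bt.
have [Ic [m [am mbt]]] := arc_interior act0 aarc b_ne.
pose L0 := Lv k `\` B.
have L0o : open L0 by rewrite /L0 setDE; apply: openI; [exact: Lv_open|exact: closed_openC].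
have L0S : L0 `<=` S0 by move=> x [[]].
have L0inv g x : L0 x -> L0 (act g x).
  move=> [kx Bx]; split; first exact: Lv_inv.
  by move=> /(Binv (- g)); rewrite actK.
have aI x : a x -> ~ [set b; act v0 t] x -> L0 x.
  move=> ax nx; split; first exact: (W_sub act0 actD actS0 kap_inv (aW ax)).
  move=> Bx; have [] := aB ax Bx => /orbP[g /= h]; apply: nx.
    have e : x = act (- g) b by rewrite -h actK.
    by have [-> _] := arc_inj act_free aarc ax (arc_l aarc) e; left.
  have e : x = act (- g - v0) (act v0 t) by rewrite -actD subrK -h actK.
  by have [-> _] := arc_inj act_free aarc ax (arc_r aarc) e; right.
pose Y := connected_component L0 m.
have Lm : L0 m by exact: aI.
have Yo : open Y by exact: (component_open discs).
have Yc : connected Y by exact: component_connected.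
have YL : Y `<=` L0 by exact: connected_component_sub.
have YS0 : Y `<=` S0 by move=> x /YL/L0S.
have Yinv g y y' : Y y -> Y (act g y) -> Y y' -> Y (act g y').
  by move=> h1 h2; apply: (component_inv act_cont L0inv h1 h2).
have aY : a `<=` Y `|` [set b; act v0 t].
  move=> x ax; have [|nx] := pselect ([set b; act v0 t] x); first by right.
  left; apply: (@connected_component_max _ L0 (a `\` [set b; act v0 t])) => //.
  by move=> y [ay ny]; exact: aI.
have YB : Y `&` B = set0 by apply/seteqP; split=> // x [/YL[]].
have YW : Y `<=` W k x0.
  move=> y Yy; have kx : Lv k m by case: Lm.
  rewrite -(W_eq act0 actD act_cont actS0 kap_inv (aW am)); apply: sub_orb => //.
  apply: (@connected_component_max _ (Lv k) Y) => //; first exact: connected_component_refl.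
  by move=> x /YL[].
pose L1 := LS `\` B.
have L1o : open L1 by rewrite /L1 setDE; apply: openI; [exact: LS_open|exact: closed_openC].
(* [Z] is [Y] with nonfree points filled in; by [Hpunct] taking them out again does not disconnect
   it. *)
pose Z := connected_component L1 m.
have L01 : L0 `<=` L1 by move=> x [[_ ?] ?].
have Zo : open Z by exact: Hloc.
have ZL : Z `<=` L1 by exact: connected_component_sub.
have ZY : Z `&` S0 = Y.
  apply/seteqP; split=> [x Zx|x Yx].
    apply: (@connected_component_max _ L0 (Z `&` S0)) => //.
    - by split; [apply: connected_component_refl; exact: L01|exact: L0S].
    - by move=> y [/ZL[? ?] ?].
    - by apply: Hpunct => //; exact: component_connected.
  split; last exact: YS0.
  apply: (@connected_component_max _ L1 Y) => //; first exact: connected_component_refl.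
  by move=> y /YL/L01.
have [f fP] := kap_lift_ex.
have f_uniq x (z : int) : `|Q%:R * (kap x + z%:~R) - k%:~R| < 2 / 3 -> f x = kap x + z%:~R.
  move=> h; have [[z' e] h'] := fP x ltac:(by exists z).
  by rewrite e; rewrite e in h'; rewrite (LS_uniq h h').
have f_cont x : LS x -> {for x, continuous f}.
  move=> Lx; have [[z e] h] := fP x Lx; rewrite e in h.
  apply/cvgrPdist_lt => ep ep0; apply: filterS (LS_near ep0 h) => y [w [h1 h2]].
  by rewrite (f_uniq _ _ h2) e -normrN opprB.
pose ft x := ramp (Q%:R * f x - k%:~R).
have ft_cont x : LS x -> {for x, continuous ft}.
  move=> Lx; apply: (@continuous_comp _ _ _ (fun x => Q%:R * f x - k%:~R) ramp); last exact: ramp_continuous.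
  by apply: cvgB; [apply: cvgM; [exact: cvg_cst|exact: f_cont]|exact: cvg_cst].
have ft_act g x : LS x -> ft (act g x) = ft x.
  move=> Lx; have [[z e] h] := fP x Lx; have [w kE] := kap_inv g x.
  have e' : f x = kap (act g x) + (z - w)%:~R by rewrite e kE rmorphB/=; ring.
  by rewrite /ft e' (f_uniq (act g x) (z - w)) // -e'.
have LY x : Y x -> LS x by move=> /YL[[]].
have La x : a x -> LS x by move=> /aW/(W_sub act0 actD actS0 kap_inv)[].
pose phi x := if `[< Z x >] then ft x else 0.
have phiY x : Y x -> phi x = ft x by rewrite -ZY => -[Zx _]; rewrite /phi asboolT.
have phi0 x : S0 x -> ~ Y x -> phi x = 0.
  by move=> Sx nY; rewrite /phi asboolF// => Zx; apply: nY; rewrite -ZY.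
have phiB x : B x -> phi x = 0.
  by move=> Bx; apply: phi0; [exact: BS0|move=> Yx; have : (Y `&` B) x by []; rewrite YB].
have ftb : ft b = 0.
  by have [z [z1 z2]] := klow; rewrite /ft (f_uniq _ _ z1) ramp0//; apply: ltW.
have ftt : ft t = 1.
  by have [z [z1 z2]] := khigh; rewrite /ft (f_uniq _ _ z1) ramp1//; apply: ltW.
have Lt : LS t by have [z [z1 z2]] := khigh; exists z.
have Ha h y : zstab Y h -> Y y -> Y (act h y) by move=> [y0 [h1 h2]]; exact: Yinv h1 h2.
exists Y, phi; split.
- by split.
- move=> J J0 JB Jc g [y [y1 y2]].
  apply: (crossing_stab hS act0 actD act_cont act_free actS0 Yc YS0 (fun g y h1 h2 y1 h3 => Yinv g y y1 h1 h2 h3) _ _ bt _ _ J0 JB Jc y1 y2).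
  + move=> /orbP[l h]; have : (Y `&` B) (act l b) by split => //; exact: Binv.
    by rewrite YB.
  + move=> /orbP[l h]; have : (Y `&` B) (act l t) by split => //; exact: Binv.
    by rewrite YB.
  + by move=> x Yx; exact: discs.
  + by exists a.
- split; first by exists m; rewrite act0; split; exact: connected_component_refl.
  move=> i j [y [y1 y2]] hj; exists (act j y); split; first exact: Ha.
  by rewrite -actD subrK.
- move=> x.
  have [Zx|nZ] := pselect (Z x).
    apply: (@cmod_eq _ _ ft).
      have : nbhs x Z by exact: open_nbhs_nbhs.
      by apply: filterS => y Zy; rewrite /phi asboolT//; exact: modZ_refl.
    by apply: continuous_cmod; apply: ft_cont; have [] := ZL x Zx.
  (* Three cases off [Z]: at a middle level on [B], [Bmid] excludes [Z] nearby; at a middle level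
     off [B], the component through [x] is a neighbourhood disjoint from [Z]; at any other level the
     ramp is 0 or 1 around [x]. *)
  have near0 : (\forall y \near x, ~ Z y) -> cmod_at phi x.
    move=> h; apply: (@cmod_eq _ _ (fun=> 0)); last exact: cmod_cst.
    by apply: filterS h => y nZy; rewrite /phi asboolF//; exact: modZ_refl.
  pose mid := exists z : int, `|Q%:R * (kap x + z%:~R) - k%:~R| <= 1 / 3.
  have [[z hz]|nmid] := pselect mid.
    have [Bx|nB] := pselect (B x).
      have [N [xN NW]] := Bmid Bx hz.
      apply: near0; near=> y => Zy.
      have : (N `&` W k x0) y.
        split; first by near: y.
        apply: YW; rewrite -ZY; split => //; near: y.
        by apply: open_nbhs_nbhs; split => //; exact: BS0.
      by rewrite NW.
    have L1x : L1 x by split => //; exists z; lra.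
    apply: near0; near=> y => Zy.
    apply: nZ; have xy : connected_component L1 x y.
      near: y; apply: open_nbhs_nbhs; split; [exact: Hloc|exact: connected_component_refl].
    exact: connected_component_trans Zy (connected_component_sym xy).
  have Q0 : 0 < Q%:R :> R by lra.
  set yx := kap x - k%:~R / Q%:R.
  have ge (z : int) : 1 / 3 < `|Q%:R * (kap x + z%:~R) - k%:~R|.
    by rewrite ltNge; apply/negP => h; apply: nmid; exists z.
  have sc (v : R) : `|Q%:R * v - k%:~R| = Q%:R * `|v - k%:~R / Q%:R|.
    by rewrite -{2}(ger0_norm (ltW Q0)) -normrM; congr `|_|; field; lra.
  pose e := `|zfrac yx| - 1 / 3 / Q%:R.
  have e0 : 0 < e; first rewrite /e.
    have [w we] := modZ_zfrac yx.
    have -> : zfrac yx = kap x + w%:~R - k%:~R / Q%:R by rewrite we /yx; ring.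
    by rewrite subr_gt0 ltr_pdivrMr// [ltRHS]mulrC -sc; exact: ge.
  apply: (@cmod_eq _ _ (fun=> 0)); last exact: cmod_cst.
  near=> y.
  have [w hw] : nearZ e (kap y - kap x) by near: y; exact: kapc.
  have gey (z : int) : 1 / 3 < `|Q%:R * (kap y + z%:~R) - k%:~R|.
    rewrite ltNge; apply/negP; rewrite sc -ler_pdivlMl// => h.
    have : nearZ `|zfrac yx| yx.
      exists (- (w + z)).
      have -> : yx - (- (w + z))%:~R = (kap y + z%:~R - k%:~R / Q%:R) - (kap y - kap x - w%:~R).
        by rewrite /yx rmorphN rmorphD/=; ring.
      apply: (le_lt_trans (ler_normB _ _)).
      have -> : `|zfrac yx| = Q%:R^-1 * (1 / 3) + e by rewrite /e [_ * (1 / 3)]mulrC addrC subrK.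
      exact: ler_ltD.
    by move=> /nearZ_zfrac; rewrite ltxx.
  rewrite /phi; case: ifPn => [/asboolP Zy|_]; last exact: modZ_refl.
  have [Ly _] := ZL y Zy; have [[z fz] h] := fP y Ly.
  have := gey z; rewrite -fz ltr_normr => /orP[h1|h1].
    by rewrite /ft ramp1 ?ltW//; exists (-1); rewrite rmorphN1 subrr.
  by rewrite /ft ramp0; [exact: modZ_refl|rewrite -lerN2 opprK ltW].
- split => //.
  + move=> c h cc c0 c1 ca hh; exists (fun r => ft (c (clamp 0 1 r))); split.
    * move=> r; apply: continuous_comp; last first.
        by apply: ft_cont; apply: La; apply: ca; apply: clamp_itv; exact: ler01.
      by apply: continuous_comp; [exact: clamp_continuous|exact: cc].
    * move=> r r01; rewrite (clamp_id r01).
      have Lc := La _ (ca _ r01).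
      have [Yc'|[->|->]] := aY _ (ca _ r01).
      - by rewrite phiY ?ft_act//; [exact: modZ_refl|exact: Ha].
      - by rewrite phiB ?ftb; [exact: modZ_refl|exact: Binv].
      - rewrite phiB; last by apply: (Binv); exact: Binv.
        by rewrite ft_act// ftt; exists (-1); rewrite rmorphN1 subrr.
    * by rewrite /= !clamp_id ?lexx ?ler01// c0 c1 ft_act// ftt ftb subr0.
  + move=> h x nh ax; apply: phi0.
      by apply: actS0; exact: (arc_S0 aarc).
    move=> Yh; apply: nh; have [Yx|[xb|xt]] := aY _ ax; first by exists x.
      have : (Y `&` B) (act h x) by split => //; rewrite xb; exact: Binv.
      by rewrite YB.
    have : (Y `&` B) (act h x) by split => //; rewrite xt; do 2! apply: Binv.
    by rewrite YB.
Unshelve. all: by end_near. Qed.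

End Zone.

(** * Choice of the cycle by rerouting *)

Section GoodCycle.
Variables (R : realType) (S : topologicalType) (N : nat).
Local Notation G := ('I_N.+1 : finZmodType).
Variables (act : G -> S -> S) (S0 : set S).
Hypothesis hS : hausdorff_space S.
Hypothesis act0 : forall x, act 0 x = x.
Hypothesis actD : forall g g' x, act (g + g') x = act g (act g' x).
Hypothesis act_cont : forall g, continuous (act g).
Hypothesis act_free : forall x g, S0 x -> act g x = x -> g = 0.
Hypothesis actS0 : forall g x, S0 x -> S0 (act g x).
Hypothesis S0o : open S0.
Hypothesis S0c : connected S0.
Hypothesis discs : forall (O : set S) x, open O -> O `<=` S0 -> O x ->
  exists b : R * R -> S, disc act O x b.
Hypothesis Hloc : forall (O : set S) (x : S), open O -> open (connected_component O x).
Hypothesis Hpunct : forall Y : set S, open Y -> connected Y -> connected (Y `&` S0).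
Variables (kap : S -> R).
Hypothesis kapc : forall x, cmod_at kap x.
Hypothesis kap_inv : forall g x, modZ (kap (act g x)) (kap x).
Hypothesis nl : ~ (exists f : S -> R, forall x, S0 x -> {for x, continuous f} /\ modZ (kap x) (f x)).
Implicit Types (x y z u v : S) (g : G) (K : set S).

Local Notation arc := (@arc R S G act S0).
Local Notation orb := (orb act).
Local Notation orbP := (orbP act0 actD).
Local Notation actK := (actK act0 actD).
Local Notation actNK := (actNK act0 actD).
Local Notation orbA := (orbA act0 actD).
Local Notation orbI := (orbI act0 actD).
Local Notation orbS := (orbS act0 actD).
Local Notation crossing := (@crossing R S G act S0).
Local Notation acycle := (@acycle R S G act S0).
Local Notation zstab := (zstab act).

(** Enough levels for [#|G|] zones: [zones_ex] asks for [2 * m + 3] levels to find [m] of them. *)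
Let Q := (2 * #|G| + 4)%N.
Let Q3 : (3 <= Q)%N. Proof. by rewrite /Q; lia. Qed.
Local Notation Lv := (Lv S0 kap Q).
Local Notation W := (W act S0 kap Q).
Local Notation Wv a := (W a.1 a.2).

Lemma level_adj x k k' (z : int) : `|Q%:R * (kap x + z%:~R) - k%:~R| < 2 / 3 -> Lv k' x ->
  k' - k = 1 \/ k' - k = -1 -> `|Q%:R * (kap x + z%:~R) - k'%:~R| < 2 / 3.
Proof.
move=> h [_ [z' h']] kk'; have := Lv_lift Q3 h h'; have Q3' := Q3; move=> e.
suff -> : z = z' by [].
by move: e kk' Q3'; clear; nia.
Qed.

Lemma level_low x k k' : Lv k x -> Lv k' x -> k = k' + 1 ->
  exists z : int, `|Q%:R * (kap x + z%:~R) - k%:~R| < 2 / 3 /\ Q%:R * (kap x + z%:~R) - k%:~R < - (1 / 3).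
Proof.
move=> [_ [z h]] kx' kE; exists z; split => //.
have := level_adj h kx' ltac:(lia); rewrite kE intrD ltr_norml; move=> {h} /andP[_]; lra.
Qed.

Lemma level_high x k k' : Lv k x -> Lv k' x -> k' = k + 1 ->
  exists z : int, `|Q%:R * (kap x + z%:~R) - k%:~R| < 2 / 3 /\ 1 / 3 < Q%:R * (kap x + z%:~R) - k%:~R.
Proof.
move=> [_ [z h]] kx' kE; exists z; split => //.
have := level_adj h kx' ltac:(lia); rewrite kE intrD ltr_norml; move=> {h} /andP[+ _]; lra.
Qed.

Lemma level_mid x k k' (z : int) : `|Q%:R * (kap x + z%:~R) - k%:~R| <= 1 / 3 -> Lv k' x ->
  ~ (k' - k = 1 \/ k' - k = -1).
Proof.
move=> h kx' kk'; have h1 : `|Q%:R * (kap x + z%:~R) - k%:~R| < 2 / 3 by apply: (le_lt_trans h); lra.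
have /ltr_normlP[u1 u2] := level_adj h1 kx' kk'; have /ler_normlP[u3 u4] := h.
have [kE|kE] : k' = k + 1 \/ k' = k - 1 by lia.
  by rewrite kE intrD in u1 u2; move: u1 u2 u3 u4; lra.
by rewrite kE intrB in u1 u2; move: u1 u2 u3 u4; lra.
Qed.

Definition zone_props (n i : nat) (u : nat -> S) (s : nat -> G) (a : nat -> set S) (Wi : set S) (Y : set S) (phi : S -> R) :=
  [/\ [/\ Y `<=` Wi, forall j q, (j < n)%N -> j != i -> Y q -> ~ orb (a j) q & a i `<=` Y `|` [set u i; act (s i) (u i.+1)]],
   (forall J : set G, J 0 -> (forall i j, J i -> J j -> J (i - j)) ->
     (forall (v : G) K, crossing Y (u i) (u i.+1) v K -> J (v - s i)) -> zstab Y `<=` J),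
   zstab Y 0 /\ (forall i j, zstab Y i -> zstab Y j -> zstab Y (i - j)),
   forall x, cmod_at phi x &
   [/\ forall x, S0 x -> ~ Y x -> phi x = 0,
    forall (c : R -> S) h, continuous c -> c 0 = u i -> c 1 = act (s i) (u i.+1) ->
      (forall r : R, 0 <= r <= 1 -> a i (c r)) -> zstab Y h -> incr (fun r => phi (act h (c r))) 1 &
    forall h x, ~ zstab Y h -> a i x -> phi (act h x) = 0]].

Lemma chain_arcs n T c : cyclic_chain act S0 kap Q n T c -> (1 < n)%N ->
  exists (u : nat -> S) (s : nat -> G) (a : nat -> set S), acycle n u s a /\ forall i, (i < n)%N -> a i `<=` Wv (c i).
Proof.
move=> [T0 cs cp cdis] n1.
have [p' p'P] : exists p' : nat -> S, forall i, Wv (c i) (p' i) /\ Wv (c i.+1) (p' i).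
  have ex i : exists y, Wv (c i) y /\ Wv (c i.+1) y.
    by have [_ [y [? ?]]] := cs i; exists y.
  by have [f fP] := choice ex; exists f.
pose p i := if i is i'.+1 then p' i' else p' n.-1.
have pW i : (i < n)%N -> Wv (c i) (p i).
  case: i => [|i] i_n /=; last by have [] := p'P i.
  have [_] := p'P n.-1; rewrite prednK; last by lia.
  by have [_ <-] := cp 0%N; rewrite add0n.
have [x xP] : exists x : nat -> G * set S, forall i, (i < n)%N ->
    arc (p i) (act (x i).1 (p i.+1)) (x i).2 /\ (x i).2 `<=` Wv (c i).
  have ex i : exists x : G * set S, (i < n)%N ->
    arc (p i) (act x.1 (p i.+1)) x.2 /\ x.2 `<=` Wv (c i).
    have [i_n|i_n] := boolP (i < n)%N; last by exists (0, set0).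
    have Wp := pW i i_n; have Wp' : Wv (c i) (p i.+1) by have [] := p'P i.
    have Li : Lv (c i).1 (p i) := W_sub act0 actD actS0 kap_inv Wp.
    have WE := W_eq act0 actD act_cont actS0 kap_inv Wp.
    have Yo : open (connected_component (Lv (c i).1) (p i)).
      by apply: (component_open discs) => //; [exact: Lv_open|exact: Lv_sub].
    have Linv g x : Lv (c i).1 x -> Lv (c i).1 (act g x) by exact: Lv_inv.
    have YS0 : connected_component (Lv (c i).1) (p i) `<=` S0.
      by move=> y /connected_component_sub[].
    have [g Yg] : exists g, connected_component (Lv (c i).1) (p i) (act g (p i.+1)).
      by apply/orbP; rewrite -/(W _ _) WE.
    have [g' [K [aK KY]]] := arc_to hS act0 actD act_cont act_free actS0 discs Yo
      (@component_connected _ _ _) YS0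
      (fun g y h1 h2 y' h3 => component_inv act_cont Linv h1 h2 h3) (connected_component_refl Li) Yg.
    exists (g' + g, K) => _; rewrite actD; split => // y /KY Yy.
    by rewrite -WE; apply: sub_orb.
  by have [x xP] := choice ex; exists x.
have Ad i j q : (i < j)%N -> (j < n)%N -> orb (x i).2 q -> orb (x j).2 q -> j = i.+1 \/ i = 0%N /\ j.+1 = n.
  move=> ij jn iq jq.
  have i_n : (i < n)%N by lia.
  have W1 : Wv (c i) q.
    by have /orbP[g /(proj2 (xP i i_n)) h] := iq; rewrite -(actK g q); exact: W_inv.
  have W2 : Wv (c j) q.
    by have /orbP[g /(proj2 (xP j jn)) h] := jq; rewrite -(actK g q); exact: W_inv.
  by have := cdis i j ij ltac:(lia) ltac:(by exists q); lia.
have pn : p n = p 0%N by rewrite /p; case: n n1 {cp cdis pW xP Ad p}.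
have [u [s [a [ac aA]]]] := acycle_ex hS act0 actD act_cont n1 pn (fun i i_n => proj1 (xP i i_n)) Ad.
by exists u, s, a; split => // i i_n y /(aA i i_n) /(proj2 (xP i i_n)).
Qed.

(** The chain climbs through three consecutive levels at [i], so the arc starts in the overlap with
    the lower level and ends in the overlap with the upper one, and the ramp goes from 0 to 1 along
    it. Any other arc whose set meets this one belongs to one of those two levels, hence avoids the
    middle third. *)
Lemma zone_at n T c (u : nat -> S) (s : nat -> G) (a : nat -> set S) i : cyclic_chain act S0 kap Q n T c -> acycle n u s a ->
  (forall i, (i < n)%N -> a i `<=` Wv (c i)) -> (1 <= i)%N -> (i + 2 <= n)%N ->
  (c i.+1).1 = (c i).1 + 1 -> (c i).1 = (c i.-1).1 + 1 ->
  exists Yp, zone_props n i u s a (Wv (c i)) Yp.1 Yp.2.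
Proof.
move=> [T0 cs cp cdis] [un aarc ameet] aW i1 i2 lu ll.
have i_n : (i < n)%N by lia.
have in1 : (i.+1 < n)%N by lia.
have ip : (i.-1 < n)%N by lia.
have ipE : i.-1.+1 = i by lia.
pose k := (c i).1.
pose B := \bigcup_(j in [set j : 'I_n | nat_of_ord j != i]) orb (a j).
have BP x : B x <-> exists j, [/\ (j < n)%N, j != i & orb (a j) x].
  by split=> [[j ji h]|[j [jn ji h]]]; [exists j|exists (Ordinal jn)].
have WL j x : Wv (c j) x -> Lv (c j).1 x by exact: W_sub.
have oW j x : (j < n)%N -> orb (a j) x -> Wv (c j) x.
  by move=> jn /orbP[g /(aW j jn) h]; rewrite -(actK g x); exact: W_inv.
have uW j : (j < n)%N -> Wv (c j) (u j) by move=> jn; apply: aW => //; exact: arc_l (aarc _ jn).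
have u'W j : (j < n)%N -> Wv (c j) (u j.+1).
  by move=> jn; rewrite -(actK (s j) (u j.+1)); apply: W_inv => //; apply: aW => //; exact: arc_r (aarc _ jn).
have Bc : closed B.
  apply: closed_bigcup; first exact: finite_finset.
  by move=> j _; apply: orb_closed => //; exact: arc_closed (aarc _ (ltn_ord j)).
have Binv g x : B x -> B (act g x).
  by move=> /BP[j [jn ji h]]; apply/BP; exists j; split => //; exact: orbA.
have BS0 : B `<=` S0 by move=> x /BP[j [jn ji /oW]] /(_ jn) /WL[].
have Bb : B (u i).
  apply/BP; exists i.-1; split => //; first by lia.
  rewrite -(actK (s i.-1) (u i)); apply: orbA; apply: sub_orb => //.
  by have := arc_r (aarc _ ip); rewrite ipE.
have Bt : B (u i.+1).
  apply/BP; exists i.+1; split => //; first by lia.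
  by apply: sub_orb => //; exact: arc_l (aarc _ in1).
have aB x : a i x -> B x -> orb [set u i] x \/ orb [set u i.+1] x.
  move=> ax /BP[j [jn ji jx]]; have ix : orb (a i) x by exact: sub_orb.
  have [ij|ij] : (i < j \/ j < i)%N by lia.
    by have [[<- h]|[h _ _]] := ameet i j x ij jn ix jx; [right|lia].
  by have [[_ h]|[_ h _]] := ameet j i x ij i_n jx ix; [left|lia].
have klow : exists z : int, `|Q%:R * (kap (u i) + z%:~R) - k%:~R| < 2 / 3 /\ Q%:R * (kap (u i) + z%:~R) - k%:~R < - (1 / 3).
  apply: (@level_low _ _ (c i.-1).1) => //; first exact/WL/uW.
  by apply: WL; have := u'W _ ip; rewrite ipE.
have khigh : exists z : int, `|Q%:R * (kap (u i.+1) + z%:~R) - k%:~R| < 2 / 3 /\ 1 / 3 < Q%:R * (kap (u i.+1) + z%:~R) - k%:~R.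
  by apply: (@level_high _ _ (c i.+1).1) => //; [exact/WL/u'W|exact/WL/uW].
have bt g : u i <> act g (u i.+1).
  move=> e; have [z1 [h1 h1']] := klow; have [z2 [h2 h2']] := khigh.
  have [w kw] := kap_inv g (u i.+1); rewrite -e in kw.
  have e1 : kap (u i) + z1%:~R = kap (u i.+1) + (w + z1)%:~R by rewrite kw intrD; ring.
  rewrite e1 in h1 h1'; have e2 := LS_uniq Q3 h1 h2; rewrite e2 in h1'.
  by move: h1' h2'; lra.
have Bmid x (z : int) : B x -> `|Q%:R * (kap x + z%:~R) - k%:~R| <= 1 / 3 ->
  exists M, nbhs x M /\ M `&` Wv (c i) = set0.
  move=> /BP[j [jn ji jx]] hz; exists (Wv (c j)); split.
    by apply: open_nbhs_nbhs; split; [exact: W_open|exact: oW].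
  apply/seteqP; split => // y [yj yi].
  have jL := WL _ _ (oW j x jn jx).
  have [ij|ij] : (i < j \/ j < i)%N by lia.
    have [jE|] := cdis i j ij ltac:(lia) ltac:(by exists y); last by lia.
    by apply: (level_mid hz jL); rewrite jE /k; lia.
  have [iE|] := cdis j i ij ltac:(lia) ltac:(by exists y); last by lia.
  have e : i.-1 = j by lia.
  by apply: (level_mid hz jL); rewrite /k ll e; lia.
have [Y [phi [[z1 z2 z3 z3'] z4 z5 z6 [z7 z8 z9]]]] := zone_ex hS act0 actD act_cont act_free actS0 S0o discs Hloc Hpunct
  kapc kap_inv Q3 Bc Binv BS0 (aarc i i_n) (aW i i_n) Bb Bt aB bt klow khigh Bmid.
exists (Y, phi); split => //=.
  split => // j q jn ji Yq jq; have : (Y `&` B) q by split => //; apply/BP; exists j.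
  by rewrite z2.
Qed.

(** [H] is the stabiliser of the zone around arc [i0]. The new total displacement is [V0 + h], where
    [cyclic_coset_gen] chooses [h] in [H] so that every element of [H] is a multiple of [V0 + h]. *)
Lemma good_cycle_ex : exists (n : nat) (u : nat -> S) (s : nat -> G) (a : nat -> set S) (i0 : nat) (phi : S -> R) (H : set G),
  [/\ (1 < n)%N /\ acycle n u s a, (i0.+1 < n)%N, forall x, cmod_at phi x &
   [/\ H 0 /\ forall g, H g -> exists k : nat, g = (\sum_(i < n) s i) *+ k,
    forall i x, (i < n)%N -> i != i0 -> orb (a i) x -> phi x = 0,
    forall (c : R -> S) h, continuous c -> c 0 = u i0 -> c 1 = act (s i0) (u i0.+1) ->
      (forall r : R, 0 <= r <= 1 -> a i0 (c r)) -> H h -> incr (fun r => phi (act h (c r))) 1 &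
    forall h x, ~ H h -> a i0 x -> phi (act h x) = 0]].
Proof.
have [n [T [c cyc]]] := cyclic_chain_ex act0 actD act_cont actS0 S0o S0c discs kapc kap_inv Q3 nl.
pose m := #|('I_N.+1 : finZmodType)|.
have mQ : (2 * m + 3 <= Q)%N by rewrite /Q -/m; lia.
have [z zP] := zones_ex Q3 cyc mQ.
have m0 : (0 < m)%N by rewrite /m card_ord.
have n1 : (1 < n)%N by have [z1 z2 _ _ _] := zP 0%N m0; lia.
have [u [s [a [ac aW]]]] := chain_arcs cyc n1.
have [un aarc ameet] := ac; have [T0 cs cp cdis] := cyc.
have [Yp YpP] : exists Yp : nat -> set S * (S -> R), forall j, (j < m)%N ->
    zone_props n (z j) u s a (Wv (c (z j))) (Yp j).1 (Yp j).2.
  have ex j : exists Yp : set S * (S -> R), (j < m)%N -> zone_props n (z j) u s a (Wv (c (z j))) Yp.1 Yp.2.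
    have [jm|_] := boolP (j < m)%N; last by exists (set0, fun=> 0).
    have [z1 z2 z3 z4 z5] := zP j jm.
    by have [Y hY] := zone_at cyc ac aW z1 z2 z4 z5; exists Y.
  by have [f fP] := choice ex; exists f.
have zinj l l' : (l < m)%N -> (l' < m)%N -> z l = z l' -> l = l'.
  move=> lm lm' e; have [ll'|ll'|//] := ltngtP l l'.
    by have [_ _ /(_ _ ll') + _ _] := zP l' lm'; lia.
  by have [_ _ /(_ _ ll') + _ _] := zP l lm; lia.
have zdis l l' q : (l < m)%N -> (l' < m)%N -> l <> l' -> Wv (c (z l)) q -> Wv (c (z l')) q -> False.
  have aux l1 l2 : (l1 < l2)%N -> (l1 < m)%N -> (l2 < m)%N -> Wv (c (z l1)) q -> Wv (c (z l2)) q -> False.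
    move=> l12 lm lm' h h'; have [a1 a2 _ _ _] := zP l1 lm; have [b1 b2 /(_ _ l12) b3 _ _] := zP l2 lm'.
    by have := cdis (z l1) (z l2) ltac:(lia) ltac:(lia) ltac:(by exists q); lia.
  move=> lm lm' ll' h h'; have [l12|l12] : (l < l' \/ l' < l)%N by lia.
    exact: (aux _ _ l12 lm lm' h h').
  exact: (aux _ _ l12 lm' lm h' h).
pose Ymeets j (v : G) := exists K, crossing (Yp j).1 (u (z j)) (u (z j).+1) (s (z j) + v) K.
(* [O j] collects the changes of displacement available in zone [j], and [H j] its stabiliser; both
   are made trivial beyond the last zone because [sumset_stab] takes families over all naturals. *)
pose O j (v : G) := ((j < m)%N /\ Ymeets j v) \/ ((m <= j)%N /\ v = 0).
pose H j (v : G) := ((j < m)%N /\ zstab (Yp j).1 v) \/ ((m <= j)%N /\ v = 0).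
have O0 j : O j 0.
  have [jm|jm] := ltnP j m; last by right.
  have [[_ _ h] _ _ _ _] := YpP j jm; have [z1 z2 _ _ _] := zP j jm.
  left; split => //; exists (a (z j)); rewrite addr0; split => //.
  by apply: aarc; lia.
have OH j (J : G -> Prop) : J 0 -> (forall i i' : G, J i -> J i' -> J (i - i')) ->
    (forall i, O j i -> J i) -> forall i, H j i -> J i.
  move=> J0 JB JO g [[jm Hg]|[_ ->//]].
  have [_ h _ _ _] := YpP j jm; apply: (h J J0 JB) Hg => v K cK.
  by apply: JO; left; split => //; exists K; rewrite addrC subrK.
(* Zone [j] keeps its arc and carries the function; only zones of smaller index are rerouted. *)
have [j jm jP] := sumset_stab O0 OH.
have [[Y1 Y2 Y3] _ [Y0 YB] phic [phiY phiH phinH]] := YpP j jm.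
set V0 := \sum_(i < n) s i.
have [h [Hh hgen]] := cyclic_coset_gen V0 Y0 YB.
have [os [oO oh]] := jP h ltac:(by left).
have [K KP] : exists K : nat -> set S, forall l, (l < j)%N -> crossing (Yp l).1 (u (z l)) (u (z l).+1) (s (z l) + os l) (K l).
  have ex l : exists K, (l < j)%N -> crossing (Yp l).1 (u (z l)) (u (z l).+1) (s (z l) + os l) K.
    have [lj|_] := boolP (l < j)%N; last by exists set0.
    by have [[_ [K0 hK]]|[ml _]] := oO l lj; [exists K0|lia].
  by have [f fP] := choice ex; exists f.
pose pk i := [pick l : 'I_j | z l == i].
pose a' i := if pk i is Some l then K l else a i.
pose s' i := s i + (if pk i is Some l then os l else 0).
have pkz (l : 'I_j) : pk (z l) = Some l.
  rewrite /pk; case: pickP => [l' /eqP e|/(_ l)]; last by rewrite eqxx.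
  by congr Some; apply: val_inj; apply: zinj => //; apply: ltn_trans (ltn_ord _) _.
have pkP i : (exists l : 'I_j, i = z l /\ pk i = Some l) \/ pk i = None.
  by rewrite /pk; case: pickP => [l /eqP <-|_]; [left; exists l|right].
have zm (l : 'I_j) : (l < m)%N by apply: ltn_trans (ltn_ord l) _.
have zn l : (l < m)%N -> (z l < n)%N by move=> /zP[? ? _ _ _]; lia.
have pkj : pk (z j) = None.
  have [[l [e _]]|//] := pkP (z j).
  by have := zinj j l jm (zm l) e; have := ltn_ord l; lia.
have sE : \sum_(i < n) s' i = V0 + h.
  rewrite big_split /= -/V0; congr (_ + _); rewrite -oh.
  rewrite (eq_bigr (fun i : 'I_n => \sum_(l < j) if z l == i then os l else 0)); last first.
    move=> i _; have [[l [e ->]]|e] := pkP i.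
      rewrite -big_mkcond (big_pred1 l)// => l' /=; rewrite e.
      by apply/eqP/eqP => [e'|->//]; apply: val_inj; exact: zinj (zm l') (zm l) e'.
    rewrite e -big_mkcond big_pred0// => l; apply/negP => /eqP e'.
    by move: e; rewrite -e' pkz.
  rewrite exchange_big /=; apply: eq_bigr => l _.
  rewrite -big_mkcond (big_pred1 (Ordinal (zn l (zm l))))//.
(* A new arc stays in its zone except for its ends, which are translates of the old ends. Since a
   zone meets neither the other arcs nor the other zones, no new intersection arises. *)
have a'P i q : (i < n)%N -> orb (a' i) q -> orb (a i) q \/ exists l : 'I_j, i = z l /\ orb (Yp l).1 q.
  move=> i_n; rewrite /a'; have [[l [e ->]]|->] := pkP i; last by left.
  move=> /orbP[g Kq]; have [_ /(_ _ Kq)] := KP l (ltn_ord l); rewrite -e.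
  have aE := aarc i i_n; move=> [Yq|[gE|gE]].
  - by right; exists l; split => //; apply/orbP; exists g.
  - by left; apply/orbP; exists g; rewrite gE; exact: arc_l aE.
  - left; apply/orbP; exists (s i - (s i + os l) + g); rewrite actD gE -actD subrK.
    exact: arc_r aE.
have YpW (l : 'I_j) q : orb (Yp l).1 q -> Wv (c (z l)) q.
  have [[h1 _ _] _ _ _ _] := YpP l (zm l).
  by move=> /orbP[g /h1 hq]; rewrite -(actK g q); exact: W_inv.
have Ypa (l : 'I_j) q i : (i < n)%N -> i != z l -> orb (Yp l).1 q -> orb (a i) q -> False.
  move=> i_n il; have [[_ h1 _] _ _ _ _] := YpP l (zm l).
  by move=> /orbP[g hq] aq; apply: (h1 i (act g q)) => //; exact: orbA.
have WS0 k x : W k x `<=` S0 by move=> y /(W_sub act0 actD actS0 kap_inv)[].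
exists n, u, s', a', (z j), (Yp j).2, (zstab (Yp j).1); split => //.
- split => //; split => //.
    move=> i i_n; rewrite /s' /a'; have [[l [-> ->]]|->] := pkP i; last by rewrite addr0; exact: aarc.
    by have [] := KP l (ltn_ord l).
  move=> i l q il ln iq lq; have i_n : (i < n)%N by lia.
  have [ai|[l1 [iE Yi]]] := a'P i q i_n iq; have [al|[l2 [lE Yl]]] := a'P l q ln lq.
  + exact: ameet.
  + by exfalso; apply: (Ypa l2 q i) => //; lia.
  + by exfalso; apply: (Ypa l1 q l) => //; lia.
  + exfalso; apply: (zdis l1 l2 q (zm l1) (zm l2) _ (YpW l1 q Yi) (YpW l2 q Yl)).
    by move=> e; move: il; rewrite iE lE e; lia.
- by have [? ? _ _ _] := zP j jm; lia.
- split.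
  + by split => // g Hg; have [k ->] := hgen g Hg; exists k; rewrite sE.
  + move=> i x i_n ij ix.
    have [ai|[l [iE Yi]]] := a'P i x i_n ix.
      apply: phiY; last by move=> Yx; apply: (Y2 i x).
      by move/orbP: ai => [g ag]; apply/(actS0E act0 actD actS0 g); exact: arc_S0 (aarc i i_n) _ ag.
    have Wx := YpW l x Yi; apply: phiY; first exact: WS0 Wx.
    move=> /Y1 Wx'; apply: (zdis l j x (zm l) jm _ Wx Wx').
    by have := ltn_ord l; lia.
  + by rewrite /s' /a' pkj addr0.
  + by rewrite /a' pkj.
Qed.

End GoodCycle.

(** * Parametrized circles and lifts along them *)

Lemma withinP (X Y : topologicalType) (A : set X) (f : X -> Y) : {within A, continuous f} <->
  forall x, A x -> forall V, nbhs (f x) V -> exists U, nbhs x U /\ forall y, U y -> A y -> V (f y).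
Proof.
rewrite continuous_subspace_in; split=> h x Ax.
  move=> V fV; have /(_ V fV) := h x (mem_set Ax).
  rewrite /nbhs /= -nbhs_subspace_in// => hV.
  by exists [set y | A y -> V (f y)]; split => // y /= hy /hy.
move=> V fV; rewrite /nbhs /= -nbhs_subspace_in; last exact: set_mem.
have [U [xU UV]] := h x (set_mem Ax) V fV.
by apply: filterS xU => y Uy Ay; exact: UV.
Qed.

Lemma within_comp (T X Y : topologicalType) (A : set X) (f : X -> Y) (g : T -> X) :
  {within A, continuous f} -> continuous g -> (forall t, A (g t)) -> continuous (f \o g).
Proof.
move=> /withinP fA gc gA t V /(fA _ (gA t)) [U [gU UV]].
have : nbhs t (g @^-1` U) by exact: gc.
by apply: filterS => s Us; exact: UV.
Qed.

(** On the compact interval [p] is a closed map onto its image, hence a quotient map. *)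
Lemma quot_cont (R : realType) (X Y : topologicalType) (p : R -> X) (f : X -> Y) : hausdorff_space X ->
  continuous p -> (exists g : R -> Y, continuous g /\ forall t, 0 <= t <= 1 -> g t = f (p t)) ->
  {within p @` `[0, 1]%classic, continuous f}.
Proof.
move=> hX pc [g [gc gE]]; apply/withinP => _ [t0 + <-] V fV; rewrite /= in_itv /= => t01.
move: fV; rewrite nbhsE => -[V' [V'o V'f] V'V].
pose A := `[0, 1]%classic `\` g @^-1` V'.
have Ac : compact A.
  apply: subclosed_compact (@segment_compact R 0 1) _; last by move=> x [].
  rewrite /A setDE; apply: closedI; first exact: itv_closed.
  by apply: open_closedC; apply: open_comp => // x _; exact: gc.
have pAc : closed (p @` A).
  by apply: compact_closed => //; apply: continuous_compact => //; exact: continuous_subspaceT.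
exists (~` (p @` A)); split.
  apply: open_nbhs_nbhs; split; first exact: closed_openC.
  move=> [t [t01' nV] e]; apply: nV; rewrite /= gE; first by rewrite e.
  by move: t01'; rewrite /= in_itv.
move=> y h [t t01' ty]; rewrite -ty /= in h *; apply: V'V; apply: contrapT => nV; apply: (h); exists t => //.
by split => //; rewrite /= gE//; move: t01'; rewrite /= in_itv.
Qed.

Section Circle.
Variable R : realType.
Local Notation circle := (@circle R).

Definition turnE (t : R) : plane R := (cos (2 * pi * t), sin (2 * pi * t)).

Lemma turnE_continuous : continuous turnE.
Proof.
move=> t; apply: continuous_pair.
  apply: (@continuous_comp _ _ _ (fun t => 2 * pi * t) cos); last exact: continuous_cos.
  by apply: cvgMr; exact: cvg_id.
apply: (@continuous_comp _ _ _ (fun t => 2 * pi * t) sin); last exact: continuous_sin.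
by apply: cvgMr; exact: cvg_id.
Qed.

Lemma turnE_circle t : circle (turnE t). Proof. exact: cos2Dsin2. Qed.

Lemma turnE1 : turnE 1 = turnE 0.
Proof. by rewrite /turnE mulr1 mulr0 cos0 sin0 mulr_natl cos2pi sin2pi. Qed.

Lemma turnE_surj z : circle z -> exists t, 0 <= t <= 1 /\ turnE t = z.
Proof.
case: z => x y; rewrite /circle /= => h; have p0 := pi_gt0 R.
have x1 : -1 <= x <= 1 by have := sqr_ge0 y; nra.
have h1 := acos_ge0 x1; have h2 := acos_lepi x1.
have cE : cos (acos x) = x by apply: acosK; rewrite in_itv.
have sE : sin (acos x) = `|y| by rewrite sin_acos// -sqrtr_sqr; congr Num.sqrt; lra.
have e0 : 2 * pi * (acos x / (2 * pi)) = acos x by field; lra.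
have r0 : 0 <= acos x / (2 * pi) <= 1 / 2.
  by apply/andP; split; [apply: divr_ge0; lra|rewrite ler_pdivrMr; lra].
have [y0|y0] := lerP 0 y.
  exists (acos x / (2 * pi)); split; first by lra.
  by rewrite /turnE e0 cE sE ger0_norm.
exists (1 - acos x / (2 * pi)); split; first by lra.
have -> : turnE (1 - acos x / (2 * pi)) = (cos (- acos x + pi *+ 2), sin (- acos x + pi *+ 2)).
  by rewrite /turnE mulrBr e0 mulr1 addrC mulr_natl.
by rewrite cosD2pi sinD2pi cosN sinN cE sE ltr0_norm// opprK.
Qed.

Lemma cos_eq1 (x : R) : cos x = 1 -> `|x| < 2 * pi -> x = 0.
Proof.
wlog x0 : x / 0 <= x.
  move=> h c1 x2; have [x0|x0] := lerP 0 x; first exact: h.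
  by apply: oppr_inj; rewrite oppr0; apply: h; rewrite ?cosN ?normrN//; lra.
have p0 := pi_gt0 R; rewrite ger0_norm// => c1 x2.
have [xp|xp] := lerP x pi; first by apply: cos_inj; rewrite ?in_itv/= ?cos0 ?c1//; lra.
have : pi *+ 2 - x = 0.
  apply: cos_inj; rewrite ?in_itv/=; [lra|lra|].
  by rewrite addrC cosD2pi cosN cos0.
lra.
Qed.

Lemma turnE_inj s t : `|s - t| < 1 -> turnE s = turnE t -> s = t.
Proof.
move=> st [e1 e2]; have p0 := pi_gt0 R.
suff : 2 * pi * (s - t) = 0.
  by move=> /eqP; rewrite mulf_eq0 gt_eqF ?subr_eq0/=; [move/eqP|lra].
have p2 : 0 < 2 * pi :> R by lra.
apply: cos_eq1; last by rewrite normrM (gtr0_norm p2) -[ltRHS]mulr1 ltr_pM2l.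
by rewrite mulrBr cosB e1 e2 -!expr2 cos2Dsin2.
Qed.

Lemma parametrizes_loop (T : topologicalType) (p : R -> T) : continuous p -> p 0 = p 1 ->
  (forall s t, 0 <= s < 1 -> 0 <= t < 1 -> p s = p t -> s = t) ->
  simple_closed_curve R (p @` `[0, 1]%classic).
Proof.
move=> pc p01 pinj.
have [f fP] : exists f : plane R -> T, forall t, 0 <= t <= 1 -> f (turnE t) = p t.
  have ex z : exists y : T, forall t, 0 <= t <= 1 -> turnE t = z -> y = p t.
    have [[t0 [t01 tz]]|h] := pselect (exists t, 0 <= t <= 1 /\ turnE t = z); last first.
      by exists (p 0) => t t01 tz; case: h; exists t.
    exists (p t0) => t t1; rewrite -tz => e.
    have [d|d] : `|t - t0| < 1 \/ (t = 0 /\ t0 = 1) \/ (t = 1 /\ t0 = 0).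
      have [h|h] := ltP `|t - t0| 1; [by left|right].
      by move: h; rewrite ler_normr => /orP[h|h]; [right|left]; split; lra.
    - by rewrite (turnE_inj d e).
    - by move: d => [[-> ->]|[-> ->]].
  have [f fP] := choice ex; exists f => t t01; exact: fP.
have cE : turnE @` `[0, 1]%classic = circle.
  apply/seteqP; split=> [_ [t _ <-]|z /turnE_surj[t [t01 <-]]]; first exact: turnE_circle.
  by exists t => //; rewrite /= in_itv.
exists f; split.
- rewrite -cE; apply: quot_cont; [exact: norm_hausdorff|exact: turnE_continuous|].
  by exists p; split => // t t01; rewrite fP.
- move=> z w /turnE_surj[s [s01 <-]] /turnE_surj[t [t01 <-]].
  have norm1 r : 0 <= r <= 1 -> exists r', [/\ 0 <= r' < 1, turnE r' = turnE r & p r' = p r].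
    move=> r01; have [r1|r1] := ltP r 1; first by exists r; split => //; lra.
    by exists 0; rewrite (_ : r = 1) ?turnE1 ?p01; [split => //; lra|lra].
  have [s' [s1 <- s2]] := norm1 _ s01; have [t' [t1 <- t2]] := norm1 _ t01.
  by rewrite !fP; [move=> e; rewrite (pinj s' t')|lra|lra].
- apply/seteqP; split=> [_ [z /turnE_surj[t [t01 <-]] <-]|_ [t + <-]].
    by exists t; rewrite ?fP//= in_itv.
  by rewrite /= in_itv /= => t01; exists (turnE t); [exact: turnE_circle|rewrite fP].
Qed.

(** When the increment is 0, the lift along the circle has equal end values and descends to the
    curve. *)
Lemma lift_of_null (T : topologicalType) (c : plane R -> T) (C : set T) (phi : T -> R) : hausdorff_space T ->
  parametrizes c C -> incr (phi \o c \o turnE) 0 ->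
  exists f : T -> R, {within C, continuous f} /\ forall x, C x -> modZ (phi x) (f x).
Proof.
move=> hT [cc cinj cC] [g [gc gE g01]].
pose p := c \o turnE.
have pc : continuous p by apply: (within_comp cc turnE_continuous) => t; exact: turnE_circle.
have g10 : g 1 = g 0 by lra.
have [f fP] : exists f : T -> R, forall t, 0 <= t <= 1 -> f (p t) = g t.
  have ex x : exists y : R, forall t, 0 <= t <= 1 -> p t = x -> y = g t.
    have [[t0 [t01 tz]]|h] := pselect (exists t, 0 <= t <= 1 /\ p t = x); last first.
      by exists 0 => t t01 tz; case: h; exists t.
    exists (g t0) => t t1; rewrite -tz => /(cinj _ _ (turnE_circle t) (turnE_circle t0)) e.
    have [d|d] : `|t - t0| < 1 \/ (t = 0 /\ t0 = 1) \/ (t = 1 /\ t0 = 0).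
      have [h|h] := ltP `|t - t0| 1; [by left|right].
      by move: h; rewrite ler_normr => /orP[h|h]; [right|left]; split; lra.
    - by rewrite (turnE_inj d e).
    - by move: d => [[-> ->]|[-> ->]].
  have [f fP] := choice ex; exists f => t t01; exact: fP.
have CE : C = p @` `[0, 1]%classic.
  rewrite -cC; apply/seteqP; split=> [_ [z /turnE_surj[t [t01 <-]] <-]|_ [t t01 <-]].
    by exists t => //=; rewrite in_itv.
  by exists (turnE t) => //; exact: turnE_circle.
exists f; rewrite CE; split; first by apply: quot_cont => //; exists g; split => // t /fP.
by move=> _ [t + <-]; rewrite /= in_itv /= => t01; rewrite fP//; exact: gE.
Qed.

Lemma loops_homotopic_incr (T : topologicalType) (c c' : plane R -> T) (phi : T -> R) w w' :
  (forall x, cmod_at phi x) -> loops_homotopic c c' ->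
  incr (phi \o c \o turnE) w -> incr (phi \o c' \o turnE) w' -> w = w'.
Proof.
move=> phic [H [Hc H0 H1]] iw iw'.
pose K (q : R * R) := phi (H (clamp 0 1 q.1, turnE q.2)).
have Kc q : cmod_at K q.
  apply: (@cmod_comp _ _ _ phi (fun q : R * R => H (clamp 0 1 q.1, turnE q.2))); last exact: phic.
  apply: (within_comp Hc (g := fun q : R * R => (clamp 0 1 q.1, turnE q.2))).
    move=> r; apply: (@continuous_pair _ R (plane R) (fun q : R * R => clamp 0 1 q.1) (fun q => turnE q.2)).
      by apply: (@continuous_comp _ _ _ fst (clamp 0 1)); [exact: cvg_fst|exact: clamp_continuous].
    by apply: (@continuous_comp _ _ _ snd turnE); [exact: cvg_snd|exact: turnE_continuous].
  by move=> r; split; [rewrite /= in_itv /=; apply: clamp_itv; exact: ler01|exact: turnE_circle].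
apply: (incr_homotopy Kc).
- by move=> s _; rewrite /K /= turnE1; exact: modZ_refl.
- apply: incr_eq iw => t t01; rewrite /K /= clamp_id ?lexx ?ler01// H0; [exact: modZ_refl|exact: turnE_circle].
- apply: incr_eq iw' => t t01; rewrite /K /= clamp_id ?lexx ?ler01// H1; [exact: modZ_refl|exact: turnE_circle].
Qed.

End Circle.

(** * The lifted curve and the partition by its translates *)

Section Closed.
Variables (R : realType) (S : topologicalType) (N : nat).
Local Notation G := ('I_N.+1 : finZmodType).
Variables (act : G -> S -> S) (S0 : set S).
Hypothesis hS : hausdorff_space S.
Hypothesis act0 : forall x, act 0 x = x.
Hypothesis actD : forall g g' x, act (g + g') x = act g (act g' x).
Hypothesis act_cont : forall g, continuous (act g).
Hypothesis act_free : forall x g, S0 x -> act g x = x -> g = 0.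
Hypothesis actS0 : forall g x, S0 x -> S0 (act g x).
Implicit Types (x y z : S) (g v : G) (K : set S).

Local Notation arc := (@arc R S G act S0).
Local Notation orb := (orb act).
Local Notation orbP := (orbP act0 actD).
Local Notation actK := (actK act0 actD).
Local Notation actNK := (actNK act0 actD).
Local Notation orbA := (orbA act0 actD).
Local Notation acycle := (@acycle R S G act S0).

Lemma muln0_ord v : v *+ N.+1 = 0.
Proof. by apply: val_inj; rewrite Zp_mulrn /= modnMl. Qed.

Lemma order_ex v : exists o : nat, [/\ (0 < o)%N, v *+ o = 0 &
  forall i j, (i < o)%N -> (j < o)%N -> v *+ i = v *+ j -> i = j].
Proof.
have ex : exists o : nat, (0 < o)%N && (v *+ o == 0) by exists N.+1; rewrite muln0_ord eqxx.
case: (ex_minnP ex) => od /andP[dp /eqP ov] omin; exists od; split => //.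
have main i j : (i <= j)%N -> (j < od)%N -> v *+ i = v *+ j -> i = j.
  move=> ij jo e; apply/eqP; rewrite eqn_leq ij leqNgt; apply/negP => ij'.
  have := omin (j - i)%N; rewrite subn_gt0 ij' mulrnBr// e subrr eqxx => /(_ isT).
  by lia.
move=> i j io jo e; have [ij|ij] := leqP i j; first exact: main.
by symmetry; apply: main => //; exact: ltnW.
Qed.

(** The path from [x] to [act v x] closes up in the quotient. Upstairs it continues through its
    translates by multiples of [v] and closes after as many turns as the order of [v]. *)
Lemma closed_curve x y v A B : arc x y A -> arc y (act v x) B -> x <> y -> y <> act v x ->
  (forall p q g, A p -> B q -> p = act g q -> q = y \/ q = act v x) ->
  simple_closed_curve R [set z | exists k : nat, (act (v *+ k) @` (A `|` B)) z].
Proof.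
move=> [[_ -> //]|[a [sa ax ay AE]]]; move=> [[_ -> //]|[b [sb bx by_ BE]]] _ _ meet.
have [ca aS ai] := sa; have [cb bS bi] := sb.
pose c (t : R) := if t <= 1 / 2 then a (0 + t * 2) else b (- 1 + t * 2).
have e1 : 0 + 1 / 2 * 2 = 1 :> R by lra.
have e2 : - 1 + 1 / 2 * 2 = 0 :> R by lra.
have e3 : - 1 + 1 * 2 = 1 :> R by lra.
have l1 : 0 <= 1 / 2 :> R by lra.
have l2 : (1 <= 1 / 2 :> R) = false by apply/negbTE; rewrite -ltNge; lra.
have cc : continuous c.
  apply: continuous_paste.
  - by apply: (@continuous_compT _ _ _ (fun t : R => 0 + t * 2) a) => //; exact: continuous_affine.
  - by apply: (@continuous_compT _ _ _ (fun t : R => - 1 + t * 2) b) => //; exact: continuous_affine.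
  - by rewrite e1 e2 ay bx.
have c0 : c 0 = x by rewrite /c l1 mul0r addr0.
have c1 : c 1 = act v x by rewrite /c l2 e3.
have ab s t g : 0 <= s <= 1 -> 0 < t < 1 -> a s = act g (b t) -> False.
  move=> s01 t01 e.
  have t01' : 0 <= t <= 1 by lra.
  have [] := meet (a s) (b t) g _ _ e.
  - by rewrite AE; exists s => //; rewrite /= in_itv.
  - by rewrite BE; exists t => //; rewrite /= in_itv.
  - rewrite -bx => e'; have := bi t 0 0 t01' ltac:(lra); rewrite act0 => /(_ e'); lra.
  - rewrite -by_ => e'; have := bi t 1 0 t01' ltac:(lra); rewrite act0 => /(_ e'); lra.
have cinj s t g : 0 <= s < 1 -> 0 <= t < 1 -> c s = act g (c t) -> s = t.
  move=> s01 t01; rewrite /c; case: lerP => s2; case: lerP => t2 e.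
  - have := ai (0 + s * 2) (0 + t * 2) g ltac:(lra) ltac:(lra) e; lra.
  - by exfalso; apply: (@ab (0 + s * 2) (- 1 + t * 2) g) => //; lra.
  - exfalso; apply: (@ab (0 + t * 2) (- 1 + s * 2) (- g)); [lra|lra|].
    by rewrite e actK.
  - have := bi (- 1 + s * 2) (- 1 + t * 2) g ltac:(lra) ltac:(lra) e; lra.
have cAB : c @` `[0, 1]%classic = A `|` B.
  rewrite AE BE; apply/seteqP; split=> [_ [t + <-]|_ [[t + <-]|[t + <-]]]; rewrite /= in_itv /= => t01.
  - rewrite /c; case: lerP => t2; [left; exists (0 + t * 2)|right; exists (- 1 + t * 2)] => //; rewrite /= in_itv /=; lra.
  - exists (t / 2); first by rewrite /= in_itv /=; lra.
    have h1 : t / 2 <= 1 / 2 by lra.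
    have h2 : 0 + t / 2 * 2 = t by lra.
    by rewrite /c h1 h2.
  - have [t0|t0] := eqVneq t 0.
      exists (1 / 2); first by rewrite /= in_itv /=; lra.
      by rewrite /c lexx e1 ay t0 bx.
    have {}t0 : 0 < t by rewrite lt_def t0; case/andP: t01.
    exists ((t + 1) / 2); first by rewrite /= in_itv /=; lra.
    have h1 : ((t + 1) / 2 <= 1 / 2) = false by apply/negbTE; rewrite -ltNge; lra.
    have h2 : - 1 + (t + 1) / 2 * 2 = t by lra.
    by rewrite /c h1 h2.
have [od [dp ov oinj]] := order_ex v.
(* [F] runs through the successive translates of [c] on successive unit intervals. *)
have [F [Fc FE Fo]] : exists F : R -> S, [/\ continuous F,
    forall i (t : R), (i < od)%N -> 0 <= t <= 1 -> F (i%:R + t) = act (v *+ i) (c t) & F od%:R = act (v *+ od) x].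
  elim: (od) => [|k [F [Fc FE Fk]]].
    exists (fun=> x); split; [exact: cst_continuous|by []|by rewrite mulr0n act0].
  exists (fun t => if t <= k%:R then F t else act (v *+ k) (c (- k%:R + t * 1))); split.
  - apply: continuous_paste => //; last by rewrite Fk mulr1 addNr c0.
    apply: (@continuous_compT _ _ _ _ (act (v *+ k))) => //.
    by apply: (@continuous_compT _ _ _ (fun t : R => - k%:R + t * 1) c) => //; exact: continuous_affine.
  - move=> i t; rewrite ltnS leq_eqVlt => /orP[/eqP ->|ik] t01.
      case: ifPn => [h|_]; last by rewrite mulr1 addKr.
      have -> : t = 0 by lra.
      by rewrite addr0 Fk c0.
    have ik' : i%:R + 1 <= k%:R :> R by rewrite natr1 ler_nat.
    have h1 : i%:R + t <= k%:R by lra.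
    by rewrite h1 FE.
  - rewrite ifF; last by apply/negbTE; rewrite -ltNge ltr_nat.
    have e4 : - k%:R + k.+1%:R * 1 = 1 :> R by rewrite -natr1; ring.
    by rewrite e4 c1 mulrSr actD.
have o1 : 0 < od%:R :> R by rewrite ltr0n.
pose p (t : R) := F (0 + t * od%:R).
have pE t : 0 <= t < 1 -> exists (i : nat) (r : R), [/\ (i < od)%N, 0 <= r < 1, t * od%:R = i%:R + r & p t = act (v *+ i) (c r)].
  move=> t01; have t0 : 0 <= t * od%:R by apply: mulr_ge0; lra.
  have /andP[h1 h2] := truncn_itv t0; set i := Num.truncn _ in h1 h2.
  have io : (i < od)%N.
    by rewrite -(ltr_nat R); apply: (le_lt_trans h1); rewrite -[ltRHS]mul1r ltr_pM2r//; lra.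
  rewrite -natr1 in h2.
  exists i, (t * od%:R - i%:R); split => //; [lra|lra|].
  have r01 : 0 <= t * od%:R - i%:R <= 1 by lra.
  by rewrite /p add0r -FE// addrC subrK.
have pim : p @` `[0, 1]%classic = [set z | exists k : nat, (act (v *+ k) @` (A `|` B)) z].
  rewrite -cAB; apply/seteqP; split=> [_ [t + <-]|z [k [_ [r + <-] <-]]]; rewrite /= in_itv /= => t01.
    have [t1|t1] := ltP t 1.
      have [i [r [_ r01 _ ->]]] := pE t ltac:(lra); exists i, (c r) => //.
      by exists r => //; rewrite /= in_itv /=; lra.
    have -> : t = 1 by lra.
    exists od.-1, (c 1); first by exists 1; rewrite //= in_itv /= ler01 lexx.
    rewrite /p add0r mul1r -(FE od.-1 1) ?ler01 ?lexx//; last by lia.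
    by congr F; rewrite natr1 prednK.
  have -> : v *+ k = v *+ (k %% od) by rewrite {1}(divn_eq k od) mulrnDr mulnC mulrnA ov mul0rn add0r.
  have ko : (k %% od < od)%N by rewrite ltn_pmod.
  exists (((k %% od)%N%:R + r) / od%:R).
    have ko' : (k %% od)%N%:R + 1 <= od%:R :> R by rewrite natr1 ler_nat.
    have k0 : 0 <= (k %% od)%N%:R :> R by [].
    rewrite /= in_itv /= ler_pdivrMr// mul1r; apply/andP; split; last by lra.
    by apply: divr_ge0; lra.
  by rewrite /p add0r divfK ?FE// gt_eqF.
rewrite -pim; apply: parametrizes_loop.
- by apply: (@continuous_compT _ _ _ (fun t : R => 0 + t * od%:R) F) => //; exact: continuous_affine.
- rewrite /p mul0r addr0 add0r mul1r Fo ov act0.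
  by have := FE 0%N 0 dp ltac:(by rewrite lexx ler01); rewrite add0r mulr0n act0 c0.
- move=> s t s01 t01; have [i [r [io r01 sE ->]]] := pE s s01; have [j [r' [jo r01' tE ->]]] := pE t t01.
  move=> e.
  have e' : c r = act (- (v *+ i) + v *+ j) (c r') by rewrite actD -e actK.
  have rr := cinj _ _ _ r01 r01' e'.
  have Sc : S0 (c r).
    by rewrite /c; case: lerP => r2; [apply: aS|apply: bS]; lra.
  have ij : v *+ i = v *+ j.
    by apply: (act_eq act0 actD act_free Sc); rewrite e rr.
  have ij' := oinj i j io jo ij.
  have : s * od%:R = t * od%:R by rewrite sE tE rr ij'.
  by move/mulIf; apply; rewrite gt_eqF.
Qed.

Section Partition.
Variables (n : nat) (u : nat -> S) (s : nat -> G) (a : nat -> set S) (i0 : nat) (phi : S -> R) (H : set G).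
Hypothesis n1 : (1 < n)%N.
Hypothesis ac : acycle n u s a.
Hypothesis i0n : (i0.+1 < n)%N.
Hypothesis phic : forall x, cmod_at phi x.
Hypothesis H0 : H 0.
Hypothesis Hv : forall g, H g -> exists k : nat, g = (\sum_(i < n) s i) *+ k.
Hypothesis phi0 : forall i x, (i < n)%N -> i != i0 -> orb (a i) x -> phi x = 0.
Hypothesis phi1 : forall (c : R -> S) h, continuous c -> c 0 = u i0 -> c 1 = act (s i0) (u i0.+1) ->
  (forall r : R, 0 <= r <= 1 -> a i0 (c r)) -> H h -> incr (fun r => phi (act h (c r))) 1.
Hypothesis phi2 : forall h x, ~ H h -> a i0 x -> phi (act h x) = 0.

(** [sg i] is the displacement accumulated before arc [i], and [v] that of a whole turn. The pieces
    for all turns [k] make up [D], the full lift of the cycle through [u 0]. *)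
Let sg (i : nat) : G := \sum_(l < i) s l.
Let v := sg n.
Let piece (k i : nat) := act (v *+ k + sg i) @` a i.
Let D : set S := [set x | exists k i : nat, (i < n)%N /\ piece k i x].

Lemma piece_arc k i : (i < n)%N -> arc (act (v *+ k + sg i) (u i)) (act (v *+ k + sg i.+1) (u i.+1)) (piece k i).
Proof.
move=> i_n; have [_ aarc _] := ac.
by have := arc_act act0 actD act_cont actS0 (v *+ k + sg i) (aarc i i_n); rewrite -actD -addrA /sg big_ord_recr.
Qed.

Lemma piece_meet k k' i j p q g : (i < j)%N -> (j < n)%N -> piece k i p -> piece k' j q -> p = act g q ->
  (j = i.+1 /\ q = act (v *+ k' + sg j) (u j)) \/ [/\ i = 0%N, j.+1 = n & q = act (v *+ k' + sg j.+1) (u j.+1)].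
Proof.
move=> ij jn ip jq pq; have [un aarc ameet] := ac; have i_n : (i < n)%N by lia.
have oi : orb (a i) p by case: ip => x ax <-; apply: orbA; exact: sub_orb.
have oj : orb (a j) p by rewrite pq; case: jq => x ax <-; do 2!apply: orbA; exact: sub_orb.
have aj := piece_arc k' jn.
have [[ji /orbP[h /= e]]|[i_0 jn1 /orbP[h /= e]]] := ameet i j p ij jn oi oj; [left|right]; split => //.
  have e' : q = act (- g - h - (v *+ k' + sg j)) (act (v *+ k' + sg j) (u j)).
    by rewrite -actD subrK -e actD pq actK actK.
  by have [] := arc_inj act_free aj jq (arc_l aj) e'.
have e' : q = act (- g - h - (v *+ k' + sg j.+1)) (act (v *+ k' + sg j.+1) (u j.+1)).
  by rewrite -actD subrK jn1 un -e actD pq actK actK.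
by have [] := arc_inj act_free aj jq (arc_r aj) e'.
Qed.

Lemma chain_arc j : (0 < j < n)%N -> arc (u 0%N) (act (sg j) (u j)) [set x | exists2 i, (i < j)%N & piece 0 i x].
Proof.
elim: j => [//|[|j] IH] jn.
  have := piece_arc 0 (ltnW n1); rewrite mulr0n !add0r {1}/sg big_ord0 act0.
  congr arc; apply/seteqP; split=> [x px|x [[|i]//]]; by exists 0%N.
have IHj := IH ltac:(lia); have jn' : (j.+1 < n)%N by lia.
have pj := piece_arc 0 jn'; rewrite mulr0n !add0r in pj.
have -> : [set x | exists2 i, (i < j.+2)%N & piece 0 i x] = [set x | exists2 i, (i < j.+1)%N & piece 0 i x] `|` piece 0 j.+1.
  apply/seteqP; split=> [x [i]|x [[i ij px]|px]].
  - by rewrite ltnS leq_eqVlt => /orP[/eqP -> ?|ij px]; [right|left; exists i].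
  - by exists i => //; exact: ltnW.
  - by exists j.+1.
apply: (arc_cat act0 actD IHj pj) => p q g [i ij ip] jq pq.
have [[_ qE]|[_ h _]] := piece_meet ij jn' ip jq pq; last by lia.
rewrite mulr0n add0r in qE; split => //.
have e : p = act g (act (sg j.+1) (u j.+1)) by rewrite pq qE.
by have [] := arc_inj act_free IHj (ex_intro2 _ _ i ij ip : [set x | exists2 i, (i < j.+1)%N & piece 0 i x] p) (arc_r IHj) e.
Qed.

Lemma piece_S0 k i : (i < n)%N -> piece k i `<=` S0.
Proof. by move=> i_n; exact: arc_S0 (piece_arc k i_n). Qed.

(** A constant path has increment 0, against the value 1 in [phi1]. *)
Lemma ai0_nontrivial : u i0 <> act (s i0) (u i0.+1).
Proof.
move=> e; have [_ aarc _] := ac.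
have h := phi1 (@cst_continuous _ _ (u i0)) erefl e (fun r _ => arc_l (aarc i0 (ltnW i0n))) H0.
have h' : incr (fun=> phi (act 0 (u i0))) 0.
  by have := incr_cont (@cst_continuous R _ (phi (act 0 (u i0)))); rewrite subrr.
by have := incr_uniq h h'; lra.
Qed.

Lemma D_curve : simple_closed_curve R D.
Proof.
have nE : n.-1.+1 = n by lia.
have np : (n.-1 < n)%N by lia.
have cA := chain_arc (_ : 0 < n.-1 < n)%N; have {}cA := cA ltac:(lia).
have cB := piece_arc 0 np; rewrite nE mulr0n !add0r in cB; have [un _ _] := ac.
rewrite un in cB.
set A := [set x | _] in cA.
have xy : u 0%N <> act (sg n.-1) (u n.-1).
  move=> e; rewrite -e in cA; have AE := arc_xx act0 cA.
  have h x : piece 0 i0 x -> x = u 0%N.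
    by move=> px; have : A x; [exists i0 => //; lia|rewrite AE].
  have p0 := piece_arc 0 (ltnW i0n).
  apply: ai0_nontrivial; apply: (act_inj act0 actD (g := v *+ 0 + sg i0)).
  rewrite (h _ (arc_l p0)) -(h _ (arc_r p0)) -actD -addrA.
  by rewrite /sg big_ord_recr.
have yv : act (sg n.-1) (u n.-1) <> act v (u 0%N).
  move=> e; rewrite e in cA; have e' : u 0%N = act (- v) (act v (u 0%N)) by rewrite actK.
  have [e1 _] := arc_inj act_free cA (arc_l cA) (arc_r cA) e'.
  by apply: xy; rewrite e.
have := closed_curve cA cB xy yv; rewrite (_ : [set z | _] = D).
  apply => p q g [i i_n ip] qB pq.
  have [[_ qE]|[_ _ qE]] := piece_meet i_n np ip qB pq; rewrite mulr0n add0r in qE; first by left.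
  by right; rewrite qE nE un.
apply/seteqP; split=> [x [k [y [[i i_n [z az <-]]|[z az <-]] <-]]|x [k [i [i_n [z az <-]]]]].
- exists k, i; split; first by lia.
  by exists z => //; rewrite -actD mulr0n add0r.
- exists k, n.-1; split => //.
  by exists z => //; rewrite -actD mulr0n add0r.
exists k, (act (sg i) z); last by rewrite -actD.
have [i1|i1] : (i < n.-1 \/ i = n.-1)%N by lia.
  by left; exists i => //; exists z => //; rewrite mulr0n add0r.
by right; rewrite -i1; exists z => //; rewrite mulr0n add0r.
Qed.

(** A real lift would not decrease along [D]: each arc adds 0 or 1, and arc [i0] adds 1 in the first
    turn. Yet [N.+1] turns lead back to the starting point. *)
Lemma D_lift : ~ exists f : S -> R, {within D, continuous f} /\ forall x, D x -> modZ (phi (act (- sg i0) x)) (f x).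
Proof.
move=> [f [fc fphi]]; have [un aarc _] := ac.
have sgS i : sg i.+1 = sg i + s i by rewrite /sg big_ord_recr.
have sg0 : sg 0 = 0 by rewrite /sg big_ord0.
pose m k i := f (act (v *+ k + sg i) (u i)).
have step k i : (i < n)%N -> m k i.+1 - m k i = if `[< i = i0 /\ H (v *+ k) >] then 1 else 0.
  move=> i_n; have pa := piece_arc k i_n.
  have pD : piece k i `<=` D by move=> x px; exists k, i.
  have {pa}[[_ xy ai]|[c [[cc cS ci] cx cy cE]]] := aarc i i_n.
    rewrite asboolF; last by move=> [ii _]; rewrite ii in xy; exact: ai0_nontrivial.
    by rewrite /m xy -actD sgS addrA subrr.
  have ca r : 0 <= r <= 1 -> a i (c r) by move=> r01; rewrite cE; exists r => //; rewrite /= in_itv.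
  pose F r := f (act (v *+ k + sg i) (c (clamp 0 1 r))).
  have Fc : continuous F.
    apply: (within_comp fc (g := fun r : R => act (v *+ k + sg i) (c (clamp 0 1 r)))).
      apply: (@continuous_compT _ _ _ _ (act (v *+ k + sg i))) => //.
      by apply: (@continuous_compT _ _ _ (clamp 0 1) c) => //; exact: clamp_continuous.
    move=> r; apply: pD; exists (c (clamp 0 1 r)) => //; apply: ca; apply: clamp_itv; exact: ler01.
  have Fi : incr F (m k i.+1 - m k i).
    have := incr_cont Fc; rewrite /F !clamp_id ?lexx ?ler01// cx cy -actD.
    by rewrite /m sgS addrA.
  have Fphi : incr (fun r => phi (act (v *+ k + sg i - sg i0) (c r))) (m k i.+1 - m k i).
    apply: incr_eq Fi => r r01; apply: modZ_sym; rewrite /F clamp_id// [_ - sg i0]addrC actD.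
    by apply: fphi; apply: pD; exists (c r) => //; exact: ca.
  have null : (forall r, 0 <= r <= 1 -> phi (act (v *+ k + sg i - sg i0) (c r)) = 0) -> m k i.+1 - m k i = 0.
    move=> h; apply: (incr_uniq Fphi).
    have h0 : incr (fun=> 0 : R) 0 by have := incr_cont (@cst_continuous R _ (0 : R)); rewrite subrr.
    by apply: incr_eq h0 => r r01; rewrite h//; exact: modZ_refl.
  have [ii|ii] := eqVneq i i0; last first.
    rewrite asboolF; last by move=> [/eqP]; rewrite (negbTE ii).
    by apply: null => r r01; apply: (phi0 i_n ii); apply: orbA; apply: sub_orb => //; exact: ca.
  have e : v *+ k + sg i - sg i0 = v *+ k by rewrite ii addrK.
  have [Hk|nHk] := pselect (H (v *+ k)).
    rewrite asboolT//; apply: (incr_uniq Fphi); rewrite e ii in cx cy ca *.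
    exact: phi1.
  rewrite asboolF; last by case.
  by apply: null => r r01; rewrite e; apply: phi2 => //; rewrite -ii; exact: ca.
have mono k i : (i < n)%N -> m k i <= m k i.+1.
  by move=> i_n; have := step k i i_n; case: ifP => _; lra.
have monoi k i j : (i <= j)%N -> (j <= n)%N -> m k i <= m k j.
  elim: j => [|j IH]; first by rewrite leqn0 => /eqP ->.
  rewrite leq_eqVlt => /orP[/eqP -> //|ij] jn; apply: (le_trans (IH ij (ltnW jn))).
  exact: mono.
have mS k : m k n = m k.+1 0%N.
  by rewrite /m un sg0 addr0 -/v mulrSr.
have monok k : m 1%N 0%N <= m k.+1 0%N.
  elim: k => [//|k IH]; apply: (le_trans IH); rewrite -(mS k.+1); exact: monoi.
have j1 : m 0%N i0.+1 - m 0%N i0 = 1.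
  by rewrite (step 0%N i0 (ltnW i0n)) asboolT //; split => //; rewrite mulr0n.
have h1 := monoi 0%N 0%N i0 (leq0n _) (ltnW (ltnW i0n)).
have h2 := monoi 0%N i0.+1 n (ltnW i0n) (leqnn _).
have h3 := monok N.
have h4 : m N.+1 0%N = m 0%N 0%N by rewrite /m muln0_ord mulr0n.
by move: h1 h2 h3 h4 j1; rewrite (mS 0%N); lra.
Qed.

Lemma D_shift g g' k l : g + v *+ k = g' + v *+ l -> act g @` D `<=` act g' @` D.
Proof.
move=> e _ [_ [k0 [i [i_n [z az <-]]]] <-].
(* Undoing [k] turns is written as adding [k * N] turns, since [N.+1] turns amount to 0. *)
have gE : g = g' + v *+ (l + k * N).
  have kN : v *+ (k * N.+1) = 0 by rewrite mulnC mulrnA muln0_ord mul0rn.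
  apply: (addIr (v *+ k)); rewrite e mulrnDr -!addrA; congr (_ + _).
  by rewrite -[LHS]addr0 -kN mulnS mulrnDr; congr (_ + _); rewrite addrC.
exists (act (v *+ (l + k * N) + v *+ k0 + sg i) z).
  by exists (l + k * N + k0)%N, i; split => //; exists z => //; rewrite mulrnDr.
by rewrite -!actD gE !addrA.
Qed.

Lemma D_eq g g' k l : g + v *+ k = g' + v *+ l -> act g @` D = act g' @` D.
Proof. by move=> e; apply/seteqP; split; [exact: D_shift e|exact: D_shift (esym e)]. Qed.

(** At a common point, freeness compares the displacements of the two pieces through it, and shows
    that [g] and [g'] differ by a multiple of [v]. *)
Lemma D_disjoint g g' x : (act g @` D) x -> (act g' @` D) x -> act g @` D = act g' @` D.
Proof.
move=> [p [k [i [i_n ip]]] <-] [q [k' [j [jn jq]]] e].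
have main g1 g2 k1 k2 i1 i2 p1 p2 : (i1 < i2)%N -> (i2 < n)%N -> piece k1 i1 p1 -> piece k2 i2 p2 ->
    act g1 p1 = act g2 p2 -> act g1 @` D = act g2 @` D.
  move=> i12 i2n P1 P2 e12; have i1n : (i1 < n)%N by lia.
  have pE : p1 = act (- g1 + g2) p2 by rewrite actD -e12 actK.
  have a1 := piece_arc k1 i1n; have S1 := piece_S0 i1n P1.
  have [[iE qE]|[iE nE qE]] := piece_meet i12 i2n P1 P2 pE; have [un _ _] := ac.
    have p1E : p1 = act (- g1 + g2 + (v *+ k2 + sg i2) - (v *+ k1 + sg i1.+1)) (act (v *+ k1 + sg i1.+1) (u i1.+1)).
      by rewrite -actD subrK -iE actD -qE.
    have [_ h] := arc_inj act_free a1 P1 (arc_r a1) p1E.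
    apply: (@D_eq _ _ k1 k2); apply: (addIr (sg i2)); apply: (addrI (- g1)).
    rewrite !addrA addNr add0r; apply/eqP; rewrite -subr_eq0 -oppr_eq0 opprB -!addrA -!iE in h *.
    by rewrite !addrA in h *; rewrite h.
  have p1E : p1 = act (- g1 + g2 + (v *+ k2 + sg i2.+1) - (v *+ k1 + sg i1)) (act (v *+ k1 + sg i1) (u i1)).
    by rewrite -actD subrK iE -un -nE actD -qE.
  have [_ h] := arc_inj act_free a1 P1 (arc_l a1) p1E.
  apply: (@D_eq _ _ k1 k2.+1); apply: (addrI (- g1)).
  rewrite iE {2}/sg big_ord0 addr0 nE -/v in h.
  rewrite !addrA addNr add0r mulrSr !addrA; apply/eqP; rewrite -subr_eq0 -oppr_eq0 opprB.
  by rewrite !addrA in h *; rewrite h.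
have [ij|ij|ij] := ltngtP i j.
- by apply: main ij jn ip jq _; rewrite e.
- by symmetry; apply: main ij i_n jq ip _.
- move: ip; rewrite ij => ip; have aj := piece_arc k jn.
  case: ip jq e => y ay <- [z az <-]; rewrite -!actD => e.
  have [_ aarc _] := ac.
  have yE : y = act (- (g + (v *+ k + sg j)) + (g' + (v *+ k' + sg j))) z by rewrite actD e actK.
  have [_ h] := arc_inj act_free (aarc j jn) ay az yE.
  apply: (@D_eq _ _ k k'); apply: (addIr (sg j)); apply/eqP.
  by rewrite -subr_eq0 -oppr_eq0 opprB addrC -!addrA h.
Qed.

Lemma curve_act g c C : @parametrizes R S c C -> parametrizes (act g \o c) (act g @` C).
Proof.
move=> [cc cinj <-]; split.
- apply/withinP => z cz V gV; move/withinP: cc => /(_ z cz (act g @^-1` V)) []; first exact: act_cont.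
  by move=> U [zU UV]; exists U.
- by move=> z w cz cw /(act_inj act0 actD); exact: cinj.
- by rewrite -image_comp.
Qed.

(** [ph g] is the function adapted to the translate by [g], on which its increment is nonzero by
    [D_lift]; so that translate is not null-homotopic. It can be nonzero on a translate by [g'] only
    through an element of [H], which by [Hv] is a multiple of [v], and then the two translates
    coincide. Its increment thus distinguishes distinct translates up to homotopy. *)
Lemma cycle_partition : exists P : set (set S), is_partition R P /\ forall g C, P C -> P (act g @` C).
Proof.
exists [set C | exists g, C = act g @` D]; split; last first.
  move=> g _ [g' ->]; exists (g + g'); rewrite image_comp.
  by apply/seteqP; split=> x [y Dy <-]; exists y => //; rewrite /= ?actD.
pose ph g x := phi (act (- sg i0) (act (- g) x)).
have phc g x : cmod_at (ph g) x.
  apply: (@cmod_comp _ _ _ phi (fun x => act (- sg i0) (act (- g) x))); last exact: phic.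
  by apply: continuous_comp; exact: act_cont.
have pci g c C : parametrizes c C -> exists w, incr (ph g \o c \o @turnE R) w.
  move=> [cc _ _]; apply: incr_ex => t.
  apply: (@cmod_comp _ _ _ (ph g) (c \o @turnE R)); last exact: phc.
  by apply: (within_comp cc) => [|r]; [exact: turnE_continuous|exact: turnE_circle].
have nonnull g c : parametrizes c (act g @` D) -> ~ incr (ph g \o c \o @turnE R) 0.
  move=> cP /(lift_of_null hS cP) [f [fc fP]]; apply: D_lift.
  exists (f \o act g); split.
    apply/withinP => x Dx V fV; have gDx : (act g @` D) (act g x) by exists x.
    move/withinP: fc => /(_ _ gDx _ fV) [U [gU UV]]; exists (act g @^-1` U); split; first exact: act_cont.
    by move=> y Uy Dy; apply: UV => //; exists y.
  move=> x Dx /=; have := fP (act g x) ltac:(by exists x).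
  by rewrite /ph actK.
have incr00 (r : R) : incr (fun=> r) 0.
  by have := incr_cont (@cst_continuous R _ r); rewrite subrr.
split.
- rewrite (_ : [set C | _] = (fun g => act g @` D) @` setT); first by apply: finite_image; exact: finite_finset.
  by apply/seteqP; split=> [C [g ->]|C [g _ <-]]; exists g.
- by exists (act 0 @` D), 0.
- move=> _ [g ->]; split.
    by have [c cP] := D_curve; exists (act g \o c); exact: curve_act.
  move=> [c [x [cP ch]]]; have [w iw] := pci g c _ cP.
  by have w0 := loops_homotopic_incr (phc g) ch iw (incr00 (ph g x)); apply: (nonnull g c cP); rewrite -w0.
- move=> _ _ [g ->] [g' ->] ne; split.
    by apply/seteqP; split=> // x [x1 x2]; apply: ne; exact: D_disjoint x1 x2.
  move=> [c [c' [cP cP' ch]]]; have [w iw] := pci g c _ cP.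
  have iw' : incr (ph g \o c' \o @turnE R) 0.
    apply: incr_eq (incr00 0) => t t01; rewrite /=.
    have [_ _ cE'] := cP'.
    have : (act g' @` D) (c' (turnE t)) by rewrite -cE'; exists (turnE t) => //; exact: turnE_circle.
    move=> [x [k [i [i_n [z az <-]]]] <-]; rewrite /ph -!actD.
    have [ii|ii] := eqVneq i i0; last first.
      by rewrite (phi0 i_n ii); [exact: modZ_refl|apply: orbA; exact: sub_orb].
    rewrite ii in az *; have gE : - sg i0 + - g + g' + (v *+ k + sg i0) = - g + g' + v *+ k.
      by rewrite -!addrA addrC !addrA addrK.
    rewrite gE phi2//; first exact: modZ_refl.
    move=> /Hv [l hl]; apply: ne; apply: (@D_eq _ _ l k).
    by rewrite -/v in hl; rewrite -hl !addrA addrN add0r.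
  by have w0 := loops_homotopic_incr (phc g) ch iw iw'; apply: (nonnull g c cP); rewrite -w0.
Qed.

End Partition.
End Closed.

(** * The partition obtained from an invariant class without real lift *)

Section InvariantPartition.
Variables (R : realType) (S : topologicalType) (N : nat).
Local Notation G := ('I_N.+1 : finZmodType).
Variables (act : G -> S -> S) (S0 : set S) (kap : S -> R).

Theorem invariant_partition : hausdorff_space S -> (forall x, act 0 x = x) ->
  (forall g g' x, act (g + g') x = act g (act g' x)) -> (forall g, continuous (act g)) ->
  (forall x g, S0 x -> act g x = x -> g = 0) -> (forall g x, S0 x -> S0 (act g x)) ->
  open S0 -> connected S0 ->
  (forall (O : set S) x, open O -> O `<=` S0 -> O x -> exists b : R * R -> S, disc act O x b) ->
  (forall (O : set S) (x : S), open O -> open (connected_component O x)) ->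
  (forall Y : set S, open Y -> connected Y -> connected (Y `&` S0)) ->
  (forall x, cmod_at kap x) -> (forall g x, modZ (kap (act g x)) (kap x)) ->
  ~ (exists f : S -> R, forall x, S0 x -> {for x, continuous f} /\ modZ (kap x) (f x)) ->
  exists P : set (set S), is_partition R P /\ forall g C, P C -> P (act g @` C).
Proof.
move=> hS act0 actD act_cont act_free actS0 S0o S0c discs Hloc Hpunct kapc kap_inv nl.
have [n [u [s [a [i0 [phi [H [[n1 ac] i0n phic [[H0 Hv] p0 p1 p2]]]]]]]]] :=
  good_cycle_ex hS act0 actD act_cont act_free actS0 S0o S0c discs Hloc Hpunct kapc kap_inv nl.
exact: (cycle_partition hS act0 actD act_cont act_free actS0 n1 ac i0n phic H0 Hv p0 p1 p2).
Qed.

End InvariantPartition.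

(** * Strict differentiability in the plane *)

Section StrictDiff.
Variable R : realType.
Local Notation E := (plane R).

Lemma mvt_abs (f df : R -> R) (s t L e : R) :
  (forall r, Num.min s t <= r <= Num.max s t -> is_derive r 1 f (df r)) ->
  (forall r, Num.min s t <= r <= Num.max s t -> `|df r - L| <= e) ->
  `|f s - f t - L * (s - t)| <= e * `|s - t|.
Proof.
wlog st : s t / t <= s.
  move=> h fd fe; have /orP[ts|ts] := le_total t s; first exact: (h s t ts fd fe).
  have -> : f s - f t - L * (s - t) = - (f t - f s - L * (t - s)) by ring.
  rewrite normrN [`|s - t|]distrC; apply: h => // r; rewrite minC maxC; [exact: fd|exact: fe].
rewrite (min_r st) (max_l st) => fd fe.
have fc : {within `[t, s], continuous f}.
  apply: continuous_in_subspaceT => r /set_mem; rewrite /= in_itv /= => /fd hr.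
  by apply: differentiable_continuous; apply/derivable1_diffP; exact: (@ex_derive _ _ _ _ _ _ _ hr).
have fd' r : r \in `]t, s[ -> is_derive r 1 f (df r).
  by rewrite in_itv /= => /andP[h1 h2]; apply: fd; rewrite (ltW h1) (ltW h2).
have [c + ->] := MVT_segment st fd' fc; rewrite in_itv /= => ct.
by rewrite -mulrBl normrM ler_wpM2r// fe.
Qed.

Lemma is_derive_ex (g : E -> R) (b r : R) : differentiable g (r, b) ->
  is_derive r 1 (fun x : R => g (x, b) : R) ('D_ex g (r, b)).
Proof.
move=> gd; have gD : derivable g (r, b) ex by exact: diff_derivable.
have e : (fun h : R => h^-1 *: ((g \o shift (r, b)) (h *: (ex : E)) - g (r, b))) =
         (fun h : R => h^-1 *: (((fun x : R => g (x, b) : R) \o shift r) (h *: (1 : R)) - g (r, b))).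
  apply/funext => h; congr (_ *: (g _ - _)); rewrite /shift /=.
  have -> : h *: (ex : E) + (r, b) = (h *: (1 : R) + r, h *: (0 : R) + b) by [].
  by rewrite scaler0 add0r.
by split; [rewrite /derivable -e|rewrite /derive -e].
Qed.

Lemma is_derive_ey (g : E -> R) (b r : R) : differentiable g (b, r) ->
  is_derive r 1 (fun x : R => g (b, x) : R) ('D_ey g (b, r)).
Proof.
move=> gd; have gD : derivable g (b, r) ey by exact: diff_derivable.
have e : (fun h : R => h^-1 *: ((g \o shift (b, r)) (h *: (ey : E)) - g (b, r))) =
         (fun h : R => h^-1 *: (((fun x : R => g (b, x) : R) \o shift r) (h *: (1 : R)) - g (b, r))).
  apply/funext => h; congr (_ *: (g _ - _)); rewrite /shift /=.
  have -> : h *: (ey : E) + (b, r) = (h *: (0 : R) + b, h *: (1 : R) + r) by [].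
  by rewrite scaler0 add0r.
by split; [rewrite /derivable -e|rewrite /derive -e].
Qed.

Lemma norm_pairE (z : E) : `|z| = Num.max `|z.1| `|z.2|. Proof. by []. Qed.

Lemma norm_pair_le (z : E) (r : R) : (`|z| <= r) = (`|z.1| <= r) && (`|z.2| <= r).
Proof. by rewrite norm_pairE ge_max. Qed.

Lemma norm_pair_lt (z : E) (r : R) : (`|z| < r) = (`|z.1| < r) && (`|z.2| < r).
Proof. by rewrite norm_pairE gt_max. Qed.

(** The mean value theorem along a horizontal and then a vertical segment, both inside the square
    around [z0] where the partial derivatives vary little. *)
Lemma C1_strict (U : set E) (g : E -> R) (z0 : E) : open U -> U z0 -> Ck 1 U g ->
  forall e, 0 < e -> exists2 d, 0 < d & forall z w : E, `|z - z0| < d -> `|w - z0| < d ->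
    `|g z - g w - ('D_ex g z0 * (z - w).1 + 'D_ey g z0 * (z - w).2)| <= e * `|z - w|.
Proof.
move=> Uo Uz [gd c1 c2] e e0.
have e2 : 0 < e / 2 by lra.
have /cvgrPdist_lt/(_ _ e2) h1 := c1 z0 Uz; have /cvgrPdist_lt/(_ _ e2) h2 := c2 z0 Uz.
have h0 : nbhs z0 U by exact: open_nbhs_nbhs.
have [d /= d0 hd] := (nbhs_ballP _ _).1 (filterI h0 (filterI h1 h2)); exists d => // z w zd wd.
have bP (p : E) : `|p - z0| < d -> [/\ U p, `|'D_ex g z0 - 'D_ex g p| < e / 2 & `|'D_ey g z0 - 'D_ey g p| < e / 2].
  by move=> pd; have [|? [? ?]] := hd p; [rewrite -ball_normE /= distrC|split].
move: zd wd; rewrite !norm_pair_lt /= => /andP[zd1 zd2] /andP[wd1 wd2].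
have bet (a b c r : R) : `|a - c| < d -> `|b - c| < d -> Num.min a b <= r <= Num.max a b -> `|r - c| < d.
  rewrite ge_min le_max !ltr_norml => /andP[? ?] /andP[? ?] /andP[/orP[?|?] /orP[?|?]]; apply/andP; split; lra.
have m1 := @mvt_abs (fun x => g (x, z.2)) (fun x => 'D_ex g (x, z.2)) z.1 w.1 ('D_ex g z0) (e / 2).
have m2 := @mvt_abs (fun x => g (w.1, x)) (fun x => 'D_ey g (w.1, x)) z.2 w.2 ('D_ey g z0) (e / 2).
have {m1} m1 := m1 (fun r hr => is_derive_ex (gd _ (let: And3 h _ _ := bP (r, z.2) ltac:(by rewrite norm_pair_lt /= (bet _ _ _ _ zd1 wd1 hr) zd2) in h))).
have {m1} m1 := m1 (fun r hr => ltac:(by rewrite distrC ltW//; have [_ ? _] := bP (r, z.2) ltac:(by rewrite norm_pair_lt /= (bet _ _ _ _ zd1 wd1 hr) zd2))).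
have {m2} m2 := m2 (fun r hr => is_derive_ey (gd _ (let: And3 h _ _ := bP (w.1, r) ltac:(by rewrite norm_pair_lt /= (bet _ _ _ _ zd2 wd2 hr) wd1) in h))).
have {m2} m2 := m2 (fun r hr => ltac:(by rewrite distrC ltW//; have [_ _ ?] := bP (w.1, r) ltac:(by rewrite norm_pair_lt /= (bet _ _ _ _ zd2 wd2 hr) wd1))).
have -> : g z - g w - ('D_ex g z0 * (z - w).1 + 'D_ey g z0 * (z - w).2) =
   (g (z.1, z.2) - g (w.1, z.2) - 'D_ex g z0 * (z.1 - w.1)) + (g (w.1, z.2) - g (w.1, w.2) - 'D_ey g z0 * (z.2 - w.2)).
  by rewrite -!surjective_pairing /=; ring.
apply: (le_trans (ler_normD _ _)).
have n1 : `|z.1 - w.1| <= `|z - w| by rewrite norm_pairE le_max lexx.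
have n2 : `|z.2 - w.2| <= `|z - w| by rewrite norm_pairE le_max lexx orbT.
apply: (le_trans (lerD m1 m2)).
have := ler_wpM2l (ltW e2) n1; have := ler_wpM2l (ltW e2) n2; lra.
Qed.

Definition lmap : Type := ((R * R) * (R * R))%type.
Implicit Types (A B : lmap) (z w v : E).

Lemma pair_ext z w : z.1 = w.1 -> z.2 = w.2 -> z = w.
Proof. by case: z w => [? ?] [? ?] /= -> ->. Qed.

Definition lin A z : E := (A.1.1 * z.1 + A.1.2 * z.2, A.2.1 * z.1 + A.2.2 * z.2).

Definition lmul A B : lmap := ((A.1.1 * B.1.1 + A.1.2 * B.2.1, A.1.1 * B.1.2 + A.1.2 * B.2.2),
  (A.2.1 * B.1.1 + A.2.2 * B.2.1, A.2.1 * B.1.2 + A.2.2 * B.2.2)).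

Definition ldet A := A.1.1 * A.2.2 - A.1.2 * A.2.1.

Lemma lin_mul A B z : lin (lmul A B) z = lin A (lin B z).
Proof. by rewrite /lin /lmul /=; congr pair; ring. Qed.

Lemma ldet_mul A B : ldet (lmul A B) = ldet A * ldet B.
Proof. by rewrite /ldet /lmul /=; ring. Qed.

Lemma linB A z w : lin A (z - w) = lin A z - lin A w.
Proof. by apply: pair_ext; rewrite /=; ring. Qed.

Lemma linD A z w : lin A (z + w) = lin A z + lin A w.
Proof. by apply: pair_ext; rewrite /=; ring. Qed.

Lemma linZ A (r : R) z : lin A (r *: z) = r *: lin A z.
Proof. by apply: pair_ext; rewrite /= /GRing.scale /=; ring. Qed.

Lemma lin_bound A : exists2 K, 0 < K & forall z, `|lin A z| <= K * `|z|.
Proof.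
exists (`|A.1.1| + `|A.1.2| + `|A.2.1| + `|A.2.2| + 1).
  by have := normr_ge0 A.1.1; have := normr_ge0 A.1.2; have := normr_ge0 A.2.1; have := normr_ge0 A.2.2; lra.
move=> z; have n1 : `|z.1| <= `|z| by rewrite norm_pairE le_max lexx.
have n2 : `|z.2| <= `|z| by rewrite norm_pairE le_max lexx orbT.
have b (p q : R) : `|p * z.1 + q * z.2| <= (`|p| + `|q|) * `|z|.
  apply: (le_trans (ler_normD _ _)); rewrite !normrM mulrDl.
  by apply: lerD; apply: ler_wpM2l.
rewrite norm_pair_le /=; apply/andP; split; apply: (le_trans (b _ _)); apply: ler_wpM2r => //.
  by have := normr_ge0 A.2.1; have := normr_ge0 A.2.2; lra.
by have := normr_ge0 A.1.1; have := normr_ge0 A.1.2; lra.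
Qed.

Lemma lin_inv A : ldet A != 0 -> exists B, (forall v, lin B (lin A v) = v) /\ (forall v, lin A (lin B v) = v).
Proof.
move=> d0; exists ((A.2.2 / ldet A, - A.1.2 / ldet A), (- A.2.1 / ldet A, A.1.1 / ldet A)).
split=> -[x y]; rewrite /lin /= /ldet; congr pair; field; exact: d0.
Qed.

(** The last hypothesis says that 1 is an eigenvalue. By Cayley-Hamilton, [A] multiplies
    [u = A v - v] by its determinant. Finite order and positivity force that determinant to be 1;
    the iterates of [v] are then [v + k u], so [u = 0]. *)
Lemma lin_order (M : nat) A : (0 < M)%N -> (forall v, iter M (lin A) v = v) -> 0 < ldet A ->
  (A.1.1 - 1) * (A.2.2 - 1) - A.1.2 * A.2.1 = 0 -> forall v, lin A v = v.
Proof.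
move=> M0 AM d0 h v; pose u := lin A v - v.
have Au : lin A u = ldet A *: u.
  have bc : A.1.2 * A.2.1 = (A.1.1 - 1) * (A.2.2 - 1) by lra.
  have dE : ldet A = A.1.1 + A.2.2 - 1 by rewrite /ldet bc; ring.
  apply: pair_ext; rewrite /u /= /GRing.scale /= dE.
    by transitivity ((A.1.1 * (A.1.1 - 1) + A.1.2 * A.2.1) * v.1 + A.1.2 * (A.1.1 + A.2.2 - 1) * v.2); [ring|rewrite bc; ring].
  by transitivity ((A.2.2 * (A.2.2 - 1) + A.1.2 * A.2.1) * v.2 + A.2.1 * (A.1.1 + A.2.2 - 1) * v.1); [ring|rewrite bc; ring].
have iu k : iter k (lin A) u = ldet A ^+ k *: u.
  by elim: k => [|k IH]; rewrite ?expr0 ?scale1r//= IH linZ Au scalerA exprSr.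
have [u0|u0] := eqVneq u 0; first by apply/eqP; rewrite -subr_eq0 -/u u0.
have dM : ldet A ^+ M = 1.
  have := iu M; rewrite AM => /eqP; rewrite -{1}[u]scale1r -subr_eq0 -scalerBl scaler_eq0 (negbTE u0) orbF subr_eq0.
  by move=> /eqP ->.
have d1 : ldet A = 1.
  by apply/eqP; rewrite -(pexpr_eq1 M0 (ltW d0)) dM.
have iv k : iter k (lin A) v = v + k%:R *: u.
  elim: k => [|k IH]; first by rewrite scale0r addr0.
  rewrite iterS IH linD linZ Au d1 scale1r -natr1 scalerDl scale1r addrA addrAC; congr (_ + _).
  by rewrite /u addrC subrK.
have := iv M; rewrite AM => /eqP; rewrite -subr_eq0 opprD addrA subrr add0r oppr_eq0 scaler_eq0 (negbTE u0) orbF.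
by rewrite pnatr_eq0 -leqn0 leqNgt M0.
Qed.

(** The strict derivative at [z0]: both points vary, which is what the local estimates for
    injectivity and openness require. *)
Definition sdiff (F : E -> E) z0 A := forall e, 0 < e -> exists2 d, 0 < d &
  forall z w, `|z - z0| < d -> `|w - z0| < d -> `|F z - F w - lin A (z - w)| <= e * `|z - w|.

Lemma sdiff_lip F z0 A : sdiff F z0 A -> exists d K, [/\ 0 < d, 0 < K &
  forall z w, `|z - z0| < d -> `|w - z0| < d -> `|F z - F w| <= K * `|z - w|].
Proof.
move=> /(_ 1 ltr01)[d d0 hd]; have [K K0 hK] := lin_bound A; exists d, (K + 1); split => //; first lra.
move=> z w zd wd; rewrite -(subrK (lin A (z - w)) (F z - F w)).
apply: (le_trans (ler_normD _ _)); rewrite mulrDl addrC.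
exact: lerD (hK _) (hd _ _ zd wd).
Qed.

Lemma sdiff_comp F F' z0 A B : sdiff F z0 A -> sdiff F' (F z0) B -> sdiff (F' \o F) z0 (lmul B A).
Proof.
move=> FA FB e e0; have [d1 [K [d10 K0 hK]]] := sdiff_lip FA; have [C C0 hC] := lin_bound B.
have e1 : 0 < e / 2 / C by rewrite !divr_gt0.
have e2 : 0 < e / 2 / K by rewrite !divr_gt0.
have [d2 d20 h2] := FA _ e1; have [d3 d30 h3] := FB _ e2.
exists (Num.min d1 (Num.min d2 (d3 / K))); first by rewrite !lt_min d10 d20 divr_gt0.
move=> z w; rewrite !lt_min => /and3P[z1 z2 z3] /and3P[w1 w2 w3] /=.
have near p : `|p - z0| < d1 -> `|p - z0| < d3 / K -> `|F p - F z0| < d3.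
  move=> p1 p3; have z00 : `|z0 - z0| < d1 by rewrite subrr normr0.
  by apply: (le_lt_trans (hK _ _ p1 z00)); rewrite mulrC -ltr_pdivlMr.
have -> : F' (F z) - F' (F w) - lin (lmul B A) (z - w) =
  (F' (F z) - F' (F w) - lin B (F z - F w)) + lin B (F z - F w - lin A (z - w)).
  by rewrite lin_mul [lin B (_ - _ - _)]linB addrA subrK.
apply: (le_trans (ler_normD _ _)).
have a1 := h3 _ _ (near z z1 z3) (near w w1 w3).
have a2 := le_trans (hC _) (ler_wpM2l (ltW C0) (h2 _ _ z2 w2)).
have a3 := le_trans a1 (ler_wpM2l (ltW e2) (hK _ _ z1 w1)).
apply: (le_trans (lerD a3 a2)); rewrite !mulrA.
have -> : e / 2 / K * K = e / 2 by field; lra.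
have -> : C * e / 2 / C = e / 2 by field; lra.
by rewrite -mulrDl; apply: ler_wpM2r => //; lra.
Qed.

Lemma sdiff_eq F F' z0 A : (\forall z \near z0, F z = F' z) -> sdiff F z0 A -> sdiff F' z0 A.
Proof.
move=> h FA e e0; have [d1 /= d10 h1] := (nbhs_ballP _ _).1 h; have [d d0 hd] := FA e e0.
exists (Num.min d d1); first by rewrite lt_min d0.
move=> z w; rewrite !lt_min => /andP[z1 z2] /andP[w1 w2].
have zE : F z = F' z by apply: h1; rewrite -ball_normE /= distrC.
have wE : F w = F' w by apply: h1; rewrite -ball_normE /= distrC.
by rewrite -zE -wE; exact: hd.
Qed.

Lemma sdiff_uniq F z0 A B : sdiff F z0 A -> sdiff F z0 B -> forall v, lin A v = lin B v.
Proof.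
move=> FA FB v; apply/eqP; rewrite -subr_eq0 -normr_le0; apply/ler_addgt0Pr => e e0; rewrite add0r.
have v1 : 0 < `|v| + 1 by have := normr_ge0 v; lra.
have e2 : 0 < e / 2 / (`|v| + 1) by rewrite !divr_gt0.
have [d d0 hd] := FA _ e2; have [d' d0' hd'] := FB _ e2.
pose t := Num.min d d' / (`|v| + 1) / 2.
have m0 : 0 < Num.min d d' by rewrite lt_min d0.
have t0 : 0 < t by rewrite !divr_gt0.
have tv : `|t *: v| < Num.min d d'.
  rewrite normrZ gtr0_norm// /t.
  have -> : Num.min d d' / (`|v| + 1) / 2 * `|v| = (Num.min d d' / 2) * (`|v| / (`|v| + 1)) by field; lra.
  have : `|v| / (`|v| + 1) <= 1 by rewrite ler_pdivrMr//; lra.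
  have n0 := normr_ge0 v; have q0 : 0 <= `|v| / (`|v| + 1) by rewrite divr_ge0//; lra.
  nra.
move: tv; rewrite lt_min => /andP[t1 t2].
have z00 (r : R) : 0 < r -> `|0 : E| < r by rewrite normr0.
have a1 := hd (z0 + t *: v) z0; rewrite [z0 + _ - z0]addrAC subrr add0r in a1; have {}a1 := a1 t1 (z00 _ d0).
have a2 := hd' (z0 + t *: v) z0; rewrite [z0 + _ - z0]addrAC subrr add0r in a2; have {}a2 := a2 t2 (z00 _ d0').
have a3 : `|lin A (t *: v) - lin B (t *: v)| <= e / (`|v| + 1) * `|t *: v|.
  have -> : lin A (t *: v) - lin B (t *: v) = (F (z0 + t *: v) - F z0 - lin B (t *: v)) - (F (z0 + t *: v) - F z0 - lin A (t *: v)).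
    by rewrite opprB [RHS]addrC addrA subrK.
  apply: (le_trans (ler_normB _ _)); apply: (le_trans (lerD a2 a1)); rewrite -mulrDl.
  apply: ler_wpM2r => //; lra.
have nt w : `|t *: w| = t * `|w| by rewrite normrZ gtr0_norm.
move: a3; rewrite !linZ -scalerBr !nt mulrCA ler_pM2l// => a3.
apply: (le_trans a3); rewrite mulrAC ler_pdivrMr//; apply: ler_wpM2l; [exact: ltW|lra].
Qed.

Lemma sdiff_cont F z0 A : sdiff F z0 A -> exists2 d, 0 < d & forall z, `|z - z0| < d -> {for z, continuous F}.
Proof.
move=> FA; have [d [K [d0 K0 hK]]] := sdiff_lip FA; exists d => // z zd.
apply/cvgrPdist_lt => e e0; near=> w.
have wd : `|w - z0| < d.
  rewrite -(subrK z w) -addrA; apply: (le_lt_trans (ler_normD _ _)); rewrite -ltrBrDr distrC.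
  by near: w; apply: cvgr_dist_lt; [exact: cvg_id|rewrite subr_gt0].
apply: (le_lt_trans (hK _ _ zd wd)); rewrite mulrC -ltr_pdivlMr//.
by near: w; apply: cvgr_dist_lt; [exact: cvg_id|rewrite divr_gt0].
Unshelve. all: by end_near. Qed.

(* Open mapping: a minimum of |F - y| over a small closed ball is a zero, since otherwise a Newton step decreases it. *)
Lemma sdiff_open F z0 A (r : R) : sdiff F z0 A -> ldet A != 0 -> 0 < r ->
  exists2 d, 0 < d & forall y, `|y - F z0| < d -> exists2 z, `|z - z0| < r & F z = y.
Proof.
move=> FA dA r0; have [B [BA AB]] := lin_inv dA; have [K K0 hK] := lin_bound B.
have [d1 d10 cF] := sdiff_cont FA.
(* [K] bounds the inverse of the derivative; an error of at most half of [1 / K] gives the lower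
   bound [low] on distances between images. *)
have e0 : 0 < (2 * K)^-1 by rewrite invr_gt0; lra.
have [d2 d20 hd] := FA _ e0.
pose q := Num.min r (Num.min d1 d2) / 2.
have m0 : 0 < Num.min r (Num.min d1 d2) by rewrite !lt_min r0 d10.
have q0 : 0 < q by rewrite divr_gt0.
have [qr q1 q2] : [/\ q < r, q < d1 & q < d2].
  have : q < Num.min r (Num.min d1 d2) by rewrite /q; lra.
  by rewrite !lt_min => /and3P[].
exists (q / (4 * K)); first by rewrite divr_gt0//; lra.
move=> y yd; pose C := [set z : E | `|z - z0| <= q].
have Cc : compact C.
  have -> : C = (fun z : E => z + z0) @` [set z : R * R | `|z| <= q].
    apply/seteqP; split=> [z zq|_ [z zq <-]]; last by rewrite /C /= addrK.
    by exists (z - z0); rewrite //= subrK.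
  apply: continuous_compact; last exact: compact_cball.
  by apply: continuous_subspaceT => z; apply: cvgD; [exact: cvg_id|exact: cvg_cst].
have Cz0 : C z0 by rewrite /C /= subrr normr0 ltW.
have Fc : {within C, continuous (fun z : E => `|F z - y|)}.
  apply: continuous_in_subspaceT => z /set_mem Cz.
  apply: (@continuous_comp _ _ _ (fun z : E => F z - y) (fun v : E => `|v|)); last exact: norm_continuous.
  by apply: cvgB; [apply: cF; apply: le_lt_trans Cz q1|exact: cvg_cst].
have [z /set_mem Cz zmin] := compact_EVT_min (ex_intro _ z0 Cz0) Cc Fc.
have zd2 : `|z - z0| < d2 by exact: le_lt_trans Cz q2.
have z0d2 : `|z0 - z0| < d2 by rewrite subrr normr0.
have low p w : `|p - z0| < d2 -> `|w - z0| < d2 -> `|p - w| <= 2 * K * `|F p - F w|.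
  move=> pd wd; have h1 := hd _ _ pd wd; have h2 := hK (lin A (p - w)); rewrite BA in h2.
  have h3 : `|lin A (p - w)| <= `|F p - F w| + (2 * K)^-1 * `|p - w|.
    have -> : lin A (p - w) = (F p - F w) - (F p - F w - lin A (p - w)) by rewrite opprB [RHS]addrC subrK.
    by apply: (le_trans (ler_normB _ _)); apply: lerD.
  have h4 := le_trans h2 (ler_wpM2l (ltW K0) h3).
  have h5 : K * ((2 * K)^-1 * `|p - w|) = `|p - w| / 2 by field; lra.
  by move: h4; rewrite mulrDr h5; lra.
have zz0 : `|z - z0| < q.
  apply: (le_lt_trans (low _ _ zd2 z0d2)).
  have h1 : `|F z - F z0| <= `|F z - y| + `|y - F z0|.
    by rewrite -{1}(subrK y (F z)) -addrA ler_normD.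
  have h2 := zmin z0 (mem_set Cz0); rewrite /= [`|F z0 - y|]distrC in h2.
  have h3 : `|F z - F z0| < 2 * (q / (4 * K)) by lra.
  have k2 : 0 < 2 * K by lra.
  rewrite -(ltr_pM2l k2) in h3.
  apply: (lt_le_trans h3); have -> : 2 * K * (2 * (q / (4 * K))) = q by field; lra.
  by [].
exists z; first by apply: lt_trans zz0 qr.
apply/eqP; rewrite -subr_eq0; apply/negPn/negP => Fy.
have n0 : 0 < `|F z - y| by rewrite normr_gt0.
pose v := lin B (F z - y).
have vK : `|v| <= K * `|F z - y| by exact: hK.
(* The Newton step is damped: by at least one half, and enough for [z'] to remain in the ball. *)
pose t := Num.min (2^-1) ((q - `|z - z0|) / (2 * (K * `|F z - y|))).
have K1 : 0 < K * `|F z - y| by rewrite mulr_gt0.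
have t0 : 0 < t by rewrite lt_min; apply/andP; split; [lra|apply: divr_gt0; lra].
have t1 : t <= 2^-1 by rewrite ge_min lexx.
have tv : `|t *: v| <= (q - `|z - z0|) / 2.
  rewrite normrZ gtr0_norm//; apply: (le_trans (ler_wpM2l (ltW t0) vK)).
  have : t <= (q - `|z - z0|) / (2 * (K * `|F z - y|)) by rewrite ge_min lexx orbT.
  move=> h; have := ler_wpM2r (ltW K1) h.
  have -> : (q - `|z - z0|) / (2 * (K * `|F z - y|)) * (K * `|F z - y|) = (q - `|z - z0|) / 2 by field; lra.
  by [].
pose z' := z - t *: v.
have z'q : `|z' - z0| <= q.
  rewrite /z' addrAC; apply: (le_trans (ler_normB _ _)); lra.
have z'd2 : `|z' - z0| < d2 by exact: le_lt_trans z'q q2.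
have h1 := hd _ _ z'd2 zd2.
have zv : z' - z = - (t *: v) by rewrite /z' addrAC subrr add0r.
rewrite zv normrN in h1.
have lv : lin A (- (t *: v)) = - (t *: (F z - y)).
  by rewrite -[- (t *: v)]scaleN1r linZ linZ AB scaleN1r.
rewrite lv in h1.
have : `|F z' - y| < `|F z - y|; last by rewrite ltNge zmin//; exact: mem_set.
have -> : F z' - y = (F z' - F z - - (t *: (F z - y))) + (1 - t) *: (F z - y).
  by rewrite scalerBl scale1r opprK -addrA [t *: _ + _]addrC subrK addrA subrK.
apply: (le_lt_trans (ler_normD _ _)); rewrite [X in _ + X]normrZ ger0_norm; last lra.
have h2 : (2 * K)^-1 * `|t *: v| <= t * `|F z - y| / 2.
  rewrite normrZ gtr0_norm// mulrCA -mulrA; apply: ler_wpM2l; first exact: ltW.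
  have -> : `|F z - y| / 2 = (2 * K)^-1 * (K * `|F z - y|) by field; lra.
  by apply: ler_wpM2l vK; exact: ltW.
have tn : 0 < t * `|F z - y| by rewrite mulr_gt0.
by move: h1 h2 tn; rewrite mulrBl mul1r; lra.
Qed.

End StrictDiff.

(** * Derivatives in charts and fixed points of maps of finite order *)

Section Csd.
Variable R : realType.
Local Notation E := (plane R).

Definition csd (S T : topologicalType) (f : S -> T) (x : S) (c : chart R S) (d : chart R T) (A : lmap R) :=
  [/\ chart_dom c x, chart_dom d (f x), {for x, continuous f} &
    sdiff (chart_map d \o f \o chart_inv c) (chart_map c x) A].

Lemma chart_inv_near (S : topologicalType) (c : chart R S) x (V : set S) : chart_dom c x -> nbhs x V ->
  \forall z \near chart_map c x, V (chart_inv c z) /\ (chart_map c @` chart_dom c) z.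
Proof.
move=> cx xV.
have cod : (chart_map c @` chart_dom c) (chart_map c x) by exists x.
have n1 : nbhs (chart_map c x) (chart_map c @` chart_dom c) by apply: open_nbhs_nbhs; split => //; exact: chart_cod_open.
have n2 : nbhs (chart_map c x) (chart_inv c @^-1` V).
  by have := chart_inv_cont cod; apply; rewrite chart_mapK.
exact: filterI n2 n1.
Qed.

Lemma chart_invK (S : topologicalType) (c : chart R S) z : (chart_map c @` chart_dom c) z ->
  chart_map c (chart_inv c z) = z /\ chart_dom c (chart_inv c z).
Proof. by move=> [y cy <-]; rewrite chart_mapK. Qed.

Lemma csd_comp (S T X : topologicalType) (f : S -> T) (g : T -> X) x c d e A B :
  csd f x c d A -> csd g (f x) d e B -> csd (g \o f) x c e (lmul B A).
Proof.
move=> [cx dfx fc sA] [_ egx gc sB]; split => //; first by apply: continuous_comp.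
have fx : (chart_map d \o f \o chart_inv c) (chart_map c x) = chart_map d (f x) by rewrite /= chart_mapK.
rewrite -fx in sB; apply: sdiff_eq (sdiff_comp sA sB).
have xV : nbhs x (f @^-1` chart_dom d).
  by apply: fc; apply: open_nbhs_nbhs; split => //; exact: chart_dom_open.
by apply: filterS (chart_inv_near cx xV) => z [h _]; rewrite /= chart_mapK.
Qed.

Lemma csd_id (S : topologicalType) (x : S) c : chart_dom c x -> csd id x c c ((1, 0), (0, 1)).
Proof.
move=> cx; split => //.
apply: (@sdiff_eq _ id).
  by apply: filterS (chart_inv_near cx filterT) => z [_ /chart_invK[]].
move=> e e0; exists 1 => // z w _ _.
have -> : lin ((1, 0), (0, 1)) (z - w) = z - w by apply: pair_ext; rewrite /=; ring.
by rewrite subrr normr0 mulr_ge0// ltW.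
Qed.

Lemma csd_open (S T : topologicalType) (f : S -> T) x c d A (V : set S) : csd f x c d A -> ldet A != 0 ->
  nbhs x V -> nbhs (f x) (f @` V).
Proof.
move=> [cx dfx fc sA] dA xV.
have xV' : nbhs x (V `&` f @^-1` chart_dom d).
  by apply: filterI => //; apply: fc; apply: open_nbhs_nbhs; split => //; exact: chart_dom_open.
have [r /= r0 hr] := (nbhs_ballP _ _).1 (chart_inv_near cx xV').
have [e e0 he] := sdiff_open sA dA r0.
have fx : (chart_map d \o f \o chart_inv c) (chart_map c x) = chart_map d (f x) by rewrite /= chart_mapK.
rewrite fx in he.
have n1 : nbhs (f x) (chart_dom d) by apply: open_nbhs_nbhs; split => //; exact: chart_dom_open.
have n2 : nbhs (f x) (chart_map d @^-1` [set z | `|z - chart_map d (f x)| < e]).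
  apply: (chart_map_cont dfx); apply/nbhs_ballP; exists e => // z.
  by rewrite -ball_normE /= distrC.
apply: filterS (filterI n1 n2) => y [dy hy].
have [z zr zE] := he _ hy.
have [[Vz dz] _] := hr z ltac:(by rewrite -ball_normE /= distrC).
exists (chart_inv c z) => //; rewrite -(chart_mapK dz) -[in LHS]/((chart_map d \o f \o chart_inv c) z).
by rewrite [chart_map d _]zE chart_mapK.
Qed.

Lemma embed_csd (S T : surface R) (U : set S) (f : S -> T) x c d : open U -> smooth_on U f -> oriented_on U f -> U x ->
  atlas S c -> atlas T d -> chart_dom c x -> chart_dom d (f x) -> exists A, csd f x c d A /\ 0 < ldet A.
Proof.
move=> Uo [fc fs] fo Ux cA dA cx dfx.
pose F := in_charts f c d; pose W := in_charts_dom U f c d.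
have Wz : W (chart_map c x) by exists x.
have Wo : open W.
  rewrite openE => _ [y [[cy Uy] dy] <-].
  have yV : nbhs y (U `&` f @^-1` chart_dom d).
    apply: filterI; first exact: open_nbhs_nbhs.
    by apply: (fc y Uy); apply: open_nbhs_nbhs; split => //; exact: chart_dom_open.
  apply: filterS (chart_inv_near cy yV) => z [[h1 h2] /chart_invK[h3 h4]].
  by exists (chart_inv c z).
pose A : lmap R := (('D_ex (fun w => (F w).1) (chart_map c x), 'D_ey (fun w => (F w).1) (chart_map c x)),
  ('D_ex (fun w => (F w).2) (chart_map c x), 'D_ey (fun w => (F w).2) (chart_map c x))).
exists A; split; last exact: fo Wz.
split => //; first exact: fc.
move=> e e0; have [s1 s2] := fs c d cA dA 1%N.
have [d1 d10 h1] := C1_strict Wo Wz s1 e0; have [d2 d20 h2] := C1_strict Wo Wz s2 e0.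
exists (Num.min d1 d2); first by rewrite lt_min d10.
move=> z w; rewrite !lt_min => /andP[z1 z2] /andP[w1 w2].
rewrite norm_pair_le; apply/andP; split; [exact: h1|exact: h2].
Qed.

(* At a fixed point the differential A has finite order and positive determinant, so either 1 is not an
   eigenvalue and the fixed point is isolated, or A = 1 and averaging a chart over the iterates linearizes f. *)
Lemma fixed_point_dichotomy (S : topologicalType) (f : S -> S) x c A (M : nat) : csd f x c c A -> 0 < ldet A ->
  f x = x -> (0 < M)%N -> (forall y, iter M f y = y) ->
  (exists V, nbhs x V /\ forall y, V y -> f y = y -> y = x) \/ (exists V, nbhs x V /\ forall y, V y -> f y = y).
Proof.
move=> fA dA fx M0 fM; have [cx _ fc sA] := fA.
pose D := (A.1.1 - 1) * (A.2.2 - 1) - A.1.2 * A.2.1.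
have mapn (e : R) : 0 < e -> nbhs x (chart_dom c `&` chart_map c @^-1` [set z | `|z - chart_map c x| < e]).
  move=> e0; apply: filterI; first by apply: open_nbhs_nbhs; split => //; exact: chart_dom_open.
  apply: (chart_map_cont cx); apply/nbhs_ballP; exists e => // z.
  by rewrite -ball_normE /= distrC.
have Fx : (chart_map c \o f \o chart_inv c) (chart_map c x) = chart_map c x by rewrite /= chart_mapK// fx.
have iterfx k : iter k f x = x by elim: k => //= k ->.
have [D0|D0] := eqVneq D 0.
  right.
  have iA k : exists B, csd (iter k f) x c c B /\ forall v, lin B v = iter k (lin A) v.
    elim: k => [|k [B [fB hB]]].
      by exists ((1, 0), (0, 1)); split; [exact: csd_id|move=> v; apply: pair_ext; rewrite /=; ring].
    exists (lmul A B); split; last by move=> v; rewrite lin_mul hB.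
    have := csd_comp fB (_ : csd f (iter k f x) c c A); rewrite iterfx => /(_ fA).
    by [].
  have Aid v : lin A v = v.
    apply: (@lin_order _ M) => // {}v; have [B [[_ _ _ fB] hB]] := iA M.
    have [_ _ _ fI] := csd_id cx; rewrite -hB.
    have -> : lin B v = lin ((1, 0), (0, 1)) v; last by apply: pair_ext; rewrite /=; ring.
    by apply: (sdiff_uniq fB); apply: sdiff_eq fI; near=> z; rewrite /= fM.
  have iid k : exists2 d, 0 < d & forall z w, `|z - chart_map c x| < d -> `|w - chart_map c x| < d ->
    `|chart_map c (iter k f (chart_inv c z)) - chart_map c (iter k f (chart_inv c w)) - (z - w)| <= 2^-1 * `|z - w|.
    have [B [[_ _ _ fB] hB]] := iA k; have [|d d0 hd] := fB 2^-1; first by rewrite invr_gt0.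
    exists d => // z w zd wd; have := hd z w zd wd; rewrite hB.
    by rewrite (_ : iter k (lin A) (z - w) = z - w)//; elim: (k) => //= k' ->.
  have [dk hk] := choice (fun k => let: ex_intro2 d h1 h2 := iid k in ex_intro (fun d => 0 < d /\ forall z w, `|z - chart_map c x| < d -> `|w - chart_map c x| < d ->
    `|chart_map c (iter k f (chart_inv c z)) - chart_map c (iter k f (chart_inv c w)) - (z - w)| <= 2^-1 * `|z - w|) d (conj h1 h2)).
  (* The sum of the iterates read in the chart. It is unchanged by [f], and its strict derivative at
     the point is [M] times the identity, so it is injective nearby and forces [f y = y]. *)
  pose G (z : E) : E := \sum_(k < M) chart_map c (iter k f (chart_inv c z)).
  have [d d0 hd] : exists2 d, 0 < d & forall z w, `|z - chart_map c x| < d -> `|w - chart_map c x| < d ->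
     `|G z - G w - M%:R *: (z - w)| <= M%:R * (2^-1 * `|z - w|).
    rewrite /G; elim: (M) => [|m [d d0 hd]].
      by exists 1 => // z w _ _; rewrite !big_ord0 scale0r !subr0 normr0 mul0r.
    have [m0 hm] := hk m; exists (Num.min d (dk m)); first by rewrite lt_min d0.
    move=> z w; rewrite !lt_min => /andP[z1 z2] /andP[w1 w2]; rewrite !big_ord_recr /= -natr1 mulrDl mul1r scalerDl scale1r.
    have -> (a b a' b' p q : E) : a + b - (a' + b') - (p + q) = (a - a' - p) + (b - b' - q).
      by rewrite !opprD !addrA; apply: pair_ext; rewrite /=; ring.
    by apply: (le_trans (ler_normD _ _)); apply: lerD; [exact: hd|exact: hm].
  pose V := chart_dom c `&` chart_map c @^-1` [set z | `|z - chart_map c x| < d].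
  have xV : nbhs x V by exact: mapn.
  exists (V `&` f @^-1` V); split; first by apply: filterI => //; apply: fc; rewrite fx.
  move=> y [[cy yd] [cfy fyd]]; have := hd _ _ fyd yd.
  have -> : G (chart_map c (f y)) = G (chart_map c y).
    rewrite /G !chart_mapK//; case: M M0 fM {G hd} => // m _ fM.
    rewrite big_ord_recr /= big_ord_recl /= -iterSr fM addrC; congr (_ + _).
    by apply: eq_bigr => k _; rewrite -iterSr.
  rewrite subrr add0r normrN normrZ ger0_norm//.
  have M1 : 0 < M%:R :> R by rewrite ltr0n.
  rewrite ler_pM2l// => h.
  have : `|chart_map c (f y) - chart_map c y| <= 0 by lra.
  rewrite normr_le0 subr_eq0 => /eqP e.
  by rewrite -(chart_mapK cfy) e chart_mapK.
left.
(* Cramer's rule: [D] times each coordinate of [v] is a combination of the coordinates of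
   [u = v - A v] with coefficients bounded by [K]. For a fixed point, [u] is a mere error term, so
   the norm of [v] is at most half of itself. *)
have K0 : 0 < `|A.1.1 - 1| + `|A.1.2| + `|A.2.1| + `|A.2.2 - 1| + 1.
  by have := normr_ge0 (A.1.1 - 1); have := normr_ge0 A.1.2; have := normr_ge0 A.2.1; have := normr_ge0 (A.2.2 - 1); lra.
set K := _ + 1 in K0.
have Dp : 0 < `|D| by rewrite normr_gt0.
have e0 : 0 < `|D| / (2 * K) by rewrite divr_gt0//; lra.
have [d d0 hd] := sA _ e0.
exists (chart_dom c `&` chart_map c @^-1` [set z | `|z - chart_map c x| < d]); split; first exact: mapn.
move=> y [cy yd] fy; have := hd _ _ yd (_ : `|chart_map c x - chart_map c x| < d).
rewrite subrr normr0 => /(_ d0); rewrite Fx /= chart_mapK// fy.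
set v := chart_map c y - chart_map c x => hv.
suff : `|v| <= 0.
  by rewrite normr_le0 subr_eq0 => /eqP e; rewrite -(chart_mapK cy) e chart_mapK.
move: hv; set u := v - lin A v => hu.
have hu2 : `|u.1| <= `|D| / (2 * K) * `|v| /\ `|u.2| <= `|D| / (2 * K) * `|v|.
  by move: hu; rewrite norm_pair_le => /andP[].
have b (p q r s' : R) : p = q * u.1 + r * u.2 -> `|q| + `|r| <= K -> `|p| <= `|D| / 2 * `|v|.
  move=> -> qr; apply: (le_trans (ler_normD _ _)); rewrite !normrM.
  have h1 := ler_wpM2l (normr_ge0 q) hu2.1; have h2 := ler_wpM2l (normr_ge0 r) hu2.2.
  apply: (le_trans (lerD h1 h2)); rewrite -mulrDl.
  have h3 : 0 <= `|D| / (2 * K) * `|v| by rewrite mulr_ge0// ltW.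
  apply: (le_trans (ler_wpM2r h3 qr)); rewrite mulrA.
  have -> : K * (`|D| / (2 * K)) = `|D| / 2 by field; lra.
  by [].
have n1 : `|D * v.1| <= `|D| / 2 * `|v|.
  apply: (b _ (- (A.2.2 - 1)) A.1.2 0); first by rewrite /u /D /=; ring.
  rewrite normrN /K; have := normr_ge0 (A.1.1 - 1); have := normr_ge0 A.2.1; lra.
have n2 : `|D * v.2| <= `|D| / 2 * `|v|.
  apply: (b _ A.2.1 (- (A.1.1 - 1)) 0); first by rewrite /u /D /=; ring.
  rewrite normrN /K; have := normr_ge0 (A.2.2 - 1); have := normr_ge0 A.1.2; lra.
have : `|D| * `|v| <= `|D| * (`|v| / 2).
  have mE : `|D| / 2 * `|v| = `|D| * (`|v| / 2) by rewrite mulrAC mulrA.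
  rewrite !normrM mE in n1 n2.
  have [e|e] : `|v| = `|v.1| \/ `|v| = `|v.2| by rewrite norm_pairE; case: leP => _; [right|left].
    by rewrite -e in n1.
  by rewrite -e in n2.
rewrite ler_pM2l//; lra.
Unshelve. all: by end_near. Qed.

End Csd.

(** * Polar discs *)

Lemma star_connected (R : realType) (A : set (R * R)) (p : R * R) : A p ->
  (forall z (t : R), A z -> 0 <= t <= 1 -> A (p + t *: (z - p))) -> connected A.
Proof.
move=> Ap As.
have -> : A = \bigcup_(w in A) [set p + t *: (w - p) | t in `[0 : R, 1]%classic].
  apply/seteqP; split=> [w w1|_ [w w1 [t t01 <-]]].
    by exists w => //; exists 1; rewrite /= ?in_itv/= ?lexx ?ler01// scale1r addrC subrK.
  by apply: As => //; move: t01; rewrite /= in_itv.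
apply: bigcup_connected.
  by exists p => w w1; exists 0; rewrite /= ?in_itv/= ?lexx ?ler01// scale0r addr0.
move=> w _; apply: connected_continuous_connected; first exact: segment_connected.
apply: continuous_subspaceT => t; apply: cvgD; first exact: cvg_cst.
by apply: cvgZr_tmp; exact: cvg_id.
Qed.

Lemma conv_bound (R : realType) (a b t : R) : 0 <= t <= 1 ->
  (a <= a + t * (b - a) \/ b <= a + t * (b - a)) /\ (a + t * (b - a) <= a \/ a + t * (b - a) <= b).
Proof.
by move=> t01; have /orP[ab|ab] := le_total a b; split; [left|right|right|left]; nra.
Qed.

Section Polar.
Variables (R : realType) (S : topologicalType) (c : chart R S) (x : S).
Hypothesis cx : chart_dom c x.
Local Notation E := (plane R).

Let pol (z : R * R) : E := chart_map c x + z.1 *: turnE z.2.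

Lemma pol_cont : continuous pol.
Proof.
move=> z; apply: cvgD; first exact: cvg_cst.
apply: (@cvgZ _ _ _ _ _ (fun z : R * R => z.1) (fun z : R * R => turnE z.2)); first exact: cvg_fst.
by apply: (@continuous_comp _ _ _ snd (@turnE R)); [exact: cvg_snd|exact: turnE_continuous].
Qed.

Lemma pol_inj (r t : R) : pol (r, t) = chart_map c x -> r = 0.
Proof.
rewrite /pol /= => /eqP; rewrite -subr_eq0 addrAC subrr add0r scaler_eq0 => /orP[/eqP //|/eqP e].
by have := turnE_circle t; rewrite e /circle /=; rewrite expr0n /= addr0 => /eqP; rewrite eq_sym oner_eq0.
Qed.

Lemma pol_norm (r t : R) : 0 <= r -> `|pol (r, t) - chart_map c x| <= r.
Proof.
move=> r0; rewrite /pol /= addrAC subrr add0r normrZ ger0_norm// ler_piMr//.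
by rewrite norm_pair_le /= !ler_norml cos_geN1 cos_le1 sin_geN1 sin_le1.
Qed.

Lemma pol_surj (z : E) : exists r t : R, [/\ 0 <= r, r <= 2 * `|z - chart_map c x| & pol (r, t) = z].
Proof.
set v := z - chart_map c x.
have zE : z = chart_map c x + v by rewrite /v addrC subrK.
have [v0|v0] := eqVneq v 0.
  by exists 0, 0; rewrite lexx mulr_ge0// /pol /= scale0r zE v0.
pose r := Num.sqrt (v.1 ^+ 2 + v.2 ^+ 2).
have s0 : 0 < v.1 ^+ 2 + v.2 ^+ 2.
  rewrite lt_def addr_ge0 ?sqr_ge0// andbT paddr_eq0 ?sqr_ge0// !sqrf_eq0.
  by apply: contra v0 => /andP[/eqP h1 /eqP h2]; apply/eqP; apply: pair_ext.
have r0 : 0 < r by rewrite sqrtr_gt0.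
have r2 : r ^+ 2 = v.1 ^+ 2 + v.2 ^+ 2 by rewrite sqr_sqrtr// ltW.
have [|t [_ tE]] := @turnE_surj R (r^-1 *: v).
  by rewrite /circle /= !exprMn -mulrDr -r2 -exprMn mulVf ?expr1n// gt_eqF.
exists r, t; split; first exact: ltW.
  have n1 : `|v.1| <= `|v| by rewrite norm_pairE le_max lexx.
  have n2 : `|v.2| <= `|v| by rewrite norm_pairE le_max lexx orbT.
  have n0 := normr_ge0 v.
  rewrite -(ler_pXn2r (_ : (0 < 2)%N)) ?nnegrE ?mulr_ge0//; last exact: ltW.
  rewrite r2 -(real_normK (num_real v.1)) -(real_normK (num_real v.2)).
  have := normr_ge0 v.1; have := normr_ge0 v.2; nra.
by rewrite /pol /= tE scalerA mulfV ?gt_eqF// scale1r.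
Qed.

(* Polar discs: connected also when punctured at the centre. *)
Lemma polar_disc (O : set S) : nbhs x O -> exists N, [/\ nbhs x N, N `<=` O, connected N, connected (N `\ x) & N `\ x !=set0].
Proof.
move=> xO; have [d0 /= d00 hd0] := (nbhs_ballP _ _).1 (chart_inv_near cx xO).
pose d := d0; have d1 : 0 < d by [].
have hd (z : E) : `|z - chart_map c x| < d -> O (chart_inv c z) /\ (chart_map c @` chart_dom c) z.
  by move=> zd; apply: hd0; rewrite -ball_normE /= distrC.
(* The value [true] admits radius 0. Both sets of polar coordinates are convex, so the disc and the
   punctured disc are connected as their images. *)
pose P (a : bool) := [set z : R * R | (if a then 0 <= z.1 else 0 < z.1) /\ z.1 < d].
have Pd a z : P a z -> `|pol z - chart_map c x| < d.
  case: z a => r t [] [/= r0 rd]; apply: (le_lt_trans (pol_norm _ _)) => //; exact: ltW.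
have Pc a : connected (chart_inv c @` (pol @` P a)).
  rewrite image_comp; apply: connected_continuous_connected.
    apply: (@star_connected _ _ (d / 2, 0)).
      by split => /=; [case: a; lra|lra].
    move=> [z1 z2] t [/= h1 h2] t01; rewrite /P /= /GRing.scale /=.
    have [g1 g2] := conv_bound (d / 2) z1 t01.
    split; last by case: g2 => g2; apply: (le_lt_trans g2) => //; lra.
    by case: a h1 => h1; case: g1 => g1; lra.
  apply: continuous_in_subspaceT => z /set_mem Pz.
  apply: continuous_comp; first exact: pol_cont.
  by apply: chart_inv_cont; have [_] := hd _ (Pd a z Pz).
have PO a : chart_inv c @` (pol @` P a) `<=` O.
  by move=> _ [_ [z Pz <-] <-]; have [] := hd _ (Pd a z Pz).
have Px : (chart_inv c @` (pol @` P true)) `\ x = chart_inv c @` (pol @` P false).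
  apply/seteqP; split=> [y [[_ [[r t] [/= r0 rd] <-] <-] yx]|y [_ [[r t] [/= r0 rd] <-] <-]].
    exists (pol (r, t)) => //; exists (r, t) => //; split => //=.
    rewrite lt_def r0 andbT; apply/eqP => re; apply: yx; rewrite /= re /pol /= scale0r addr0 chart_mapK//.
  split; first by exists (pol (r, t)) => //; exists (r, t) => //; split => //=; exact: ltW.
  move=> /= e; have [_ /chart_invK[e1 _]] := hd (pol (r, t)) (Pd false (r, t) (conj r0 rd)).
  by rewrite e in e1; have := pol_inj (esym e1); lra.
exists (chart_inv c @` (pol @` P true)); rewrite Px; split => //; last first.
  exists (chart_inv c (pol (d / 2, 0))), (pol (d / 2, 0)) => //.
  by exists (d / 2, 0) => //; split => /=; lra.
have n1 : nbhs x (chart_dom c) by apply: open_nbhs_nbhs; split => //; exact: chart_dom_open.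
have n2 : nbhs x (chart_map c @^-1` [set z | `|z - chart_map c x| < d / 2]).
  apply: (chart_map_cont cx); apply/nbhs_ballP; exists (d / 2) => /=; first by lra.
  by move=> z; rewrite -ball_normE /= distrC.
apply: filterS (filterI n1 n2) => y [cy /= yd].
have [r [t [r0 rd e]]] := pol_surj (chart_map c y).
exists (pol (r, t)); first by exists (r, t) => //; split => //=; lra.
by rewrite e chart_mapK.
Qed.

End Polar.

(** * The cyclic action of a periodic diffeomorphism and its free set *)

Section Periodic.
Variables (R : realType) (S : surface R) (h : diffeo S S) (N : nat).
Hypothesis hS : hausdorff_space S.
Hypothesis Sc : connected [set: S].
Hypothesis per : iter N.+1 h =1 id.
Hypothesis permin : forall k, (0 < k < N.+1)%N -> ~ iter k h =1 id.
Local Notation G := ('I_N.+1 : finZmodType).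
Implicit Types (x y : S) (g : G).

Definition dact (g : G) (x : S) : S := iter g h x.

Lemma iter_mod k x : iter (k %% N.+1) h x = iter k h x.
Proof.
rewrite {2}(divn_eq k N.+1) addnC iterD; congr iter.
elim: (k %/ N.+1)%N => [|q IH]; first by [].
by rewrite mulSn addnC iterD per.
Qed.

Lemma dact0 x : dact 0 x = x. Proof. by []. Qed.

Lemma dactD g g' x : dact (g + g') x = dact g (dact g' x).
Proof. by rewrite /dact /= iter_mod iterD. Qed.

Lemma h_continuous : continuous h.
Proof. by move=> x; have [hc _] := @dfun_smooth _ _ _ h; exact: hc. Qed.

Lemma iter_continuous k : continuous (iter k h).
Proof.
elim: k => [|k IH] x; first exact: cvg_id.
by apply: (@continuous_comp _ _ _ (iter k h) h); [exact: IH|exact: h_continuous].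
Qed.

Lemma dact_cont g : continuous (dact g). Proof. exact: iter_continuous. Qed.

Definition free_set : set S := [set x | forall g, g != 0 -> dact g x <> x].
Local Notation S0 := free_set.

Lemma dact_free x g : S0 x -> dact g x = x -> g = 0.
Proof. by move=> Sx e; apply/eqP/negPn/negP => g0; exact: (Sx g g0 e). Qed.

Lemma dact_S0 g x : S0 x -> S0 (dact g x).
Proof.
move=> Sx g' g'0 e; apply: (Sx g' g'0).
have {}e : dact (- g) (dact g' (dact g x)) = dact (- g) (dact g x) by rewrite e.
by move: e; rewrite -!dactD addNr dact0 addrC addrA addrN add0r.
Qed.

Lemma chart_ex (T : surface R) (x : T) : exists2 c, atlas T c & chart_dom c x.
Proof. by have [cov _ _] := atlasP T. Qed.

Lemma iter_csd k x : exists c, [/\ atlas S c, chart_dom c x &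
  forall d, atlas S d -> chart_dom d (iter k h x) -> exists A, csd (iter k h) x c d A /\ 0 < ldet A].
Proof.
have [c cA cx] := chart_ex x; exists c; split => //.
elim: k => [|k IH] d dA dx.
  by have [idS idc ido] := atlasP S; exact: (@embed_csd R S S setT id x c d openT idc ido I cA dA cx dx).
have [c' cA' cx'] := chart_ex (iter k h x).
have [A [hA A0]] := IH c' cA' cx'.
have [B [hB B0]] := @embed_csd R S S setT h (iter k h x) c' d openT (@dfun_smooth _ _ _ h) (@dfun_oriented _ _ _ h) I cA' dA cx' dx.
exists (lmul B A); split; last by rewrite ldet_mul mulr_gt0.
exact: csd_comp hA hB.
Qed.

Lemma iter_iter k M x : iter M (iter k h) x = iter (M * k) h x.
Proof. by elim: M => //= M ->; rewrite mulSn iterD. Qed.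

(** The interior of the fixed set of the iterate is open and, as a fixed point is isolated or
    interior, also closed. By connectedness it is empty, since this iterate is not the identity. *)
Lemma fixed_isolated g x : g != 0 -> \forall y \near x, dact g y = y -> y = x.
Proof.
move=> g0; pose f := iter g h.
have dich y : f y = y -> (exists V, nbhs y V /\ forall z, V z -> f z = z -> z = y) \/ (exists V, nbhs y V /\ forall z, V z -> f z = z).
  move=> fy; have [c [cA cy hc]] := iter_csd g y.
  have [|A [fA A0]] := hc c cA; first by rewrite -/f fy.
  apply: (fixed_point_dichotomy fA A0 fy (ltn0Sn N)) => z.
  by rewrite iter_iter -iter_mod modnMr.
pose F : set S := [set y : S | exists V : set S, nbhs y V /\ forall z, V z -> f z = z].
have F0 : F = set0.
  apply/seteqP; split=> // y0 Fy0.
  have FT : F = setT.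
    apply: (open_clopen Sc openT) => //; first by exists y0.
    move=> y _; have [fy|fy] := pselect (f y = y); last first.
      have [[U V] /= [/set_mem Uy /set_mem Vy] [Uo Vo UV]] : exists2 AB, y \in AB.1 /\ f y \in AB.2 & [/\ open AB.1, open AB.2 & AB.1 `&` AB.2 == set0].
        by move: hS; rewrite open_hausdorff => /(_ y (f y)) H; apply: H; apply/eqP => e; exact: fy.
      exists (U `&` f @^-1` V); split.
      - apply: filterI; first exact: open_nbhs_nbhs.
        by apply: iter_continuous; exact: open_nbhs_nbhs.
      - by [].
      - move=> [z [[A [zA hA]] [Uz Vz]]]; have fz := hA z (nbhs_singleton zA).
        have : (U `&` V) z by split => //; rewrite /= fz in Vz.
        by move/eqP: UV => ->.
    have [[V [yV hV]]|[V [yV hV]]] := dich y fy; last first.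
      exists V^°; split => //; first exact: nbhs_interior.
      by move=> _ z Vz; exists V; split.
    have [c cA cy] := chart_ex y.
    have [M [yM MV _ _ _]] := polar_disc cy yV.
    exists M^°; split => //; first exact: nbhs_interior.
    move=> [z [[A [zA hA]] zM]].
    have [c' cA' cz] := chart_ex z.
    have [M' [zM' M'A _ _ [w [M'w wz]]]] := polar_disc cz (filterI zA zM).
    have zy : z = y by exact: hV (MV _ (nbhs_singleton zM)) (hA _ (nbhs_singleton zA)).
    have [Aw Mw] := M'A _ M'w.
    by case: wz; rewrite /= zy; apply: hV; [exact: MV|exact: hA].
  exfalso; apply: (@permin g).
    by rewrite lt0n ltn_ord andbT; apply: contra g0 => /eqP e; apply/eqP; exact: val_inj.
  move=> y; have : F y by rewrite FT.
  by move=> [V [yV hV]]; exact: hV (nbhs_singleton yV).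
have [fx|fx] := pselect (f x = x).
  have [[V [xV hV]]|Fx] := dich x fx; first by apply: filterS xV => y Vy; exact: hV.
  by have : F x by []; rewrite F0.
have [[U V] /= [/set_mem Ux /set_mem Vx] [Uo Vo UV]] : exists2 AB, x \in AB.1 /\ f x \in AB.2 & [/\ open AB.1, open AB.2 & AB.1 `&` AB.2 == set0].
  by move: hS; rewrite open_hausdorff => /(_ x (f x)) H; apply: H; apply/eqP => e; exact: fx.
have n1 : nbhs x U by exact: open_nbhs_nbhs.
have n2 : nbhs x (f @^-1` V) by apply: iter_continuous; exact: open_nbhs_nbhs.
apply: filterS (filterI n1 n2) => y [Uy Vy] fy; exfalso.
have Vy' : V (dact g y) by exact: Vy.
rewrite fy in Vy'; have : (U `&` V) y by [].
by move/eqP: UV => ->.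
Qed.

Lemma near_free x : \forall y \near x, y <> x -> S0 y.
Proof.
have H : \forall y \near x, forall g, g != 0 -> dact g y = y -> y = x.
  apply: filter_forall => g; have [->|g0] := eqVneq g 0; first exact: filterE.
  by apply: filterS (fixed_isolated x g0) => y.
by apply: filterS H => y hy yx g g0 /(hy g g0).
Qed.

Lemma free_open : open S0.
Proof.
rewrite openE => x Sx; apply: filterS (near_free x) => y hy.
by have [->|] := pselect (y = x).
Qed.

Lemma free_disc (O : set S) x : nbhs x O -> exists M, [/\ nbhs x M, M `<=` O, connected M, connected (M `&` S0) & M `&` S0 !=set0].
Proof.
move=> xO; have [c cA cx] := chart_ex x; have [Sx|Sx] := pselect (S0 x).
  have xS : nbhs x S0 by apply: open_nbhs_nbhs; split => //; exact: free_open.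
  have [M [xM MO Mc _ _]] := polar_disc cx (filterI xO xS).
  exists M; rewrite (_ : M `&` S0 = M); first by split => //; [by move=> y /MO[]|exists x; exact: nbhs_singleton].
  by apply/seteqP; split=> y; [case|move=> My; split => //; have [] := MO y My].
have [M [xM MO Mc Mp Mn]] := polar_disc cx (filterI xO (near_free x)).
exists M; rewrite (_ : M `&` S0 = M `\ x); first by split => // y /MO[].
apply/seteqP; split=> y [My hy]; split => //; first by move=> /= e; apply: Sx; rewrite -e.
by have [_] := MO y My; exact.
Qed.

Lemma component_open_surface (O : set S) x : open O -> open (connected_component O x).
Proof.
move=> Oo; rewrite openE => y Cy; have Oy := connected_component_sub Cy.
have [M [yM MO Mc _ _]] := free_disc (open_nbhs_nbhs (conj Oo Oy)).
apply: filterS (yM) => z Mz; apply: (connected_component_trans Cy).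
by apply: (@connected_component_max _ O M) => //; exact: nbhs_singleton.
Qed.

(** The nonfree points are isolated. An open and closed part of the free set extends over each of
    them, because a small disc remains connected after its centre is removed. *)
Lemma free_connected (Y : set S) : open Y -> connected Y -> connected (Y `&` S0).
Proof.
move=> Yo Yc B [b Bb] [C Co BE] [C' Cc BE'].
have BY : B `<=` Y `&` S0 by rewrite BE => y [].
pose A : set S := [set x : S | Y x /\ exists V : set S, nbhs x V /\ V `&` S0 `<=` B].
have clop M : connected (M `&` S0) -> M `<=` Y -> (M `&` S0) `&` B !=set0 -> M `&` S0 `<=` B.
  move=> Mc MY MB; suff <- : (M `&` S0) `&` B = M `&` S0 by move=> y [].
  apply: Mc => //.
    exists C => //; rewrite BE; apply/seteqP; split=> y; first by move=> [? [_ ?]].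
    by move=> [[My Sy] Cy]; do !split => //; exact: MY.
  exists C' => //; rewrite BE'; apply/seteqP; split=> y; first by move=> [? [_ ?]].
  by move=> [[My Sy] Cy]; do !split => //; exact: MY.
have AY : A = Y.
  apply: (open_clopen Yc Yo); first by move=> y [].
    have [Yb Sb] := BY b Bb; exists b; split => //; exists ((Y `&` S0) `&` C); split; last first.
      by move=> y [[? ?] _]; rewrite BE.
    apply: open_nbhs_nbhs; split; last by rewrite BE in Bb.
    by apply: openI => //; apply: openI => //; exact: free_open.
  move=> x Yx; have [M [xM MY _ Mc _]] := free_disc (open_nbhs_nbhs (conj Yo Yx)).
  exists M^°; split; [exact: nbhs_interior|by move=> y /nbhs_singleton/MY|].
  move=> [y [[_ [V [yV VB]]] yM]].
  have [M' [_ M'V _ _ [w [M'w Sw]]]] := free_disc (filterI yV yM).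
  have [Vw Mw] := M'V _ M'w.
  have MB : M `&` S0 `<=` B by apply: clop => //; exists w; do !split => //; exact: VB.
  move=> z zM; split; first exact: MY (nbhs_singleton zM).
  by exists M; split.
apply/seteqP; split=> // y [Yy Sy]; have : A y by rewrite AY.
by move=> [_ [V [yV VB]]]; apply: VB; split => //; exact: nbhs_singleton.
Qed.

Lemma surface_disc (O : set S) x : open O -> O `<=` S0 -> O x -> exists b : R * R -> S, disc dact O x b.
Proof.
move=> Oo OS Ox; have [c cA cx] := chart_ex x.
have sep g : exists V, nbhs x V /\ forall y y', V y -> V y' -> g != 0 -> y <> dact g y'.
  have [->|g0] := eqVneq g 0; first by exists setT; split => //; exact: filterT.
  have [[U V] /= [/set_mem Ux /set_mem Vx] [Uo Vo UV]] : exists2 AB, x \in AB.1 /\ dact g x \in AB.2 & [/\ open AB.1, open AB.2 & AB.1 `&` AB.2 == set0].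
    by move: hS; rewrite open_hausdorff => /(_ x (dact g x)) H; apply: H; apply/eqP => e; exact: (OS x Ox g g0 (esym e)).
  have n1 : nbhs x U by exact: open_nbhs_nbhs.
  have n2 : nbhs x (dact g @^-1` V) by apply: dact_cont; exact: open_nbhs_nbhs.
  exists (U `&` dact g @^-1` V); split; first exact: filterI.
  move=> y y' [Uy _] [_ Vy'] _ e; have : (U `&` V) y by split => //; rewrite e.
  by move/eqP: UV => ->.
have [V VP] := choice sep.
have nV : \forall y \near x, forall g, V g y by apply: filter_forall => g; have [] := VP g.
have nO : nbhs x O by exact: open_nbhs_nbhs.
have [r /= r0 hr] := (nbhs_ballP _ _).1 (chart_inv_near cx (filterI nO nV)).
have rp (z : R * R) (e : R) : `|z| < e -> `|chart_map c x + r *: (z : plane R) - chart_map c x| < r * e.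
  by move=> z1; rewrite addrAC subrr add0r normrZ gtr0_norm// ltr_pM2l.
have rP (z : R * R) : `|z| < 1 -> (O `&` (fun y => forall g, V g y)) (chart_inv c (chart_map c x + r *: (z : plane R))) /\
    (chart_map c @` chart_dom c) (chart_map c x + r *: (z : plane R)).
  by move=> z1; apply: hr; rewrite -ball_normE /= distrC -[r in ltRHS]mulr1; exact: rp.
exists (fun z : R * R => chart_inv c (chart_map c x + r *: (z : plane R))); split.
- by rewrite scaler0 addr0 chart_mapK.
- move=> z z1; have [[Oz _] cz] := rP z z1; split => //.
  apply: (@continuous_comp _ _ _ (fun z : R * R => chart_map c x + r *: (z : plane R)) (chart_inv c)); last exact: chart_inv_cont.
  by apply: cvgD; [exact: cvg_cst|apply: cvgZl_tmp; exact: cvg_id].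
- move=> z w g z1 w1 e; have [[_ Vz] cz] := rP z z1; have [[_ Vw] cw] := rP w w1.
  have g0 : g = 0.
    apply/eqP/negPn/negP => g0; have [_ hV] := VP g; exact: (hV _ _ (Vz g) (Vw g) g0 e).
  move: e; rewrite g0 dact0 => e; have [e1 _] := chart_invK cz; have [e2 _] := chart_invK cw.
  have : chart_map c x + r *: (z : plane R) = chart_map c x + r *: (w : plane R) by rewrite -e1 e e2.
  by move=> /addrI/(scalerI (_ : r != 0)); apply; rewrite gt_eqF.
- move=> e /andP[e0 e1].
  have -> : (fun z : R * R => chart_inv c (chart_map c x + r *: (z : plane R))) @` [set z | `|z| < e] =
     chart_dom c `&` chart_map c @^-1` [set z | `|z - chart_map c x| < r * e].
    apply/seteqP; split=> [_ [z /= ze <-]|y [cy /= ye]].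
      have [_ cz] := rP z (lt_le_trans ze e1); have [h1 h2] := chart_invK cz.
      by split => //; rewrite /= h1; exact: rp.
    have rn : r != 0 by rewrite gt_eqF.
    exists (r^-1 *: (chart_map c y - chart_map c x)).
      by rewrite /= normrZ gtr0_norm ?invr_gt0// ltr_pdivrMl.
    by rewrite scalerA mulfV// scale1r addrC subrK chart_mapK.
  rewrite openE => y [cy /= ye]; apply: filterI; first by apply: open_nbhs_nbhs; split => //; exact: chart_dom_open.
  apply: (chart_map_cont cy).
  have : \forall z \near chart_map c y, `|z - chart_map c x| < r * e; last by [].
  have cd : {for chart_map c y, continuous (fun z : plane R => `|z - chart_map c x|)}.
    apply: (@continuous_comp _ _ _ (fun z : plane R => z - chart_map c x) (fun v : plane R => `|v|)); last exact: norm_continuous.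
    by apply: cvgB; [exact: cvg_id|exact: cvg_cst].
  by apply: (cvgr_lt _ cd).
Qed.

End Periodic.

(** * Reducibility from a shifted function modulo 1 *)

Section Reducible.
Variables (R : realType) (S : surface R) (h : diffeo S S).

Lemma locally_cst_connected (T U : topologicalType) (A : set T) (f : T -> U) x y : open A -> connected A ->
  (forall z, A z -> \forall w \near z, f w = f z) -> A x -> A y -> f x = f y.
Proof.
move=> Ao Ac fl Ax Ay; pose B := [set z | A z /\ f z = f x].
suff BA : B = A by have [_] : B y by rewrite BA.
apply: (open_clopen Ac Ao); [by move=> z []|by exists x|].
move=> z Az; exists (A `&` [set w | f w = f z]); split; [|by move=> w []|].
  by apply: filterI; [exact: open_nbhs_nbhs|exact: fl].
by move=> [w [[Aw wx] [_ wz]]] w' [Aw' w'z]; split => //; rewrite w'z -wz.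
Qed.

(* A lift of m psi would be h-invariant up to a constant integer, which vanishes as h has finite order; then psi itself would be h-invariant. *)
Lemma class_not_liftable (N : nat) (psi : S -> R) (m j : nat) (S0 : set S) : iter N.+1 h =1 id -> open S0 -> connected S0 -> S0 !=set0 ->
  (forall x, S0 x -> S0 (h x)) -> (forall x, cmod_at psi x) -> (forall x, modZ (psi (h x)) (psi x + j%:R / m%:R)) ->
  (0 < m)%N -> ~~ (m %| j)%N ->
  ~ exists f : S -> R, forall x, S0 x -> {for x, continuous f} /\ modZ (m%:R * psi x) (f x).
Proof.
move=> per S0o S0c [x0 Sx0] hS0 pc ph m0 mj [f fP].
have mR : 0 < m%:R :> R by rewrite ltr0n.
have mN : m%:R != 0 :> R by rewrite gt_eqF.
have hc : continuous h by exact: h_continuous.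
have near1 (u : S -> R) z : {for z, continuous u} -> (forall w, S0 w -> exists k : int, u w = k%:~R) -> S0 z ->
    \forall w \near z, u w = u z.
  move=> uc ui Sz; have [k kz] := ui z Sz.
  have nS : nbhs z S0 by exact: open_nbhs_nbhs.
  have /cvgrPdist_lt/(_ 1 ltr01) n1 := uc.
  apply: filterS (filterI nS n1) => w [Sw]; have [l lw] := ui w Sw.
  rewrite kz lw -rmorphB /= -intr_norm -[ltRHS]/(1%:~R) ltr_int => kl.
  by congr (_%:~R); lia.
pose u x := f (h x) - f x.
have uc z : S0 z -> {for z, continuous u}.
  move=> Sz; apply: cvgB; last by have [] := fP z Sz.
  by apply: (@continuous_comp _ _ _ h f); [exact: hc|have [] := fP _ (hS0 z Sz)].
have ui w : S0 w -> exists k : int, u w = k%:~R.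
  move=> Sw; have [_ [k1 e1]] := fP w Sw; have [_ [k2 e2]] := fP _ (hS0 w Sw); have [k3 e3] := ph w.
  exists (j%:Z + m%:Z * k3 - k2 + k1); rewrite /u.
  have -> : f (h w) = m%:R * psi (h w) - k2%:~R by rewrite e2 addrK.
  have -> : f w = m%:R * psi w - k1%:~R by rewrite e1 addrK.
  rewrite e3 !(rmorphD, rmorphB, rmorphM) /= -!pmulrn; field; exact: mN.
have u_cst w : S0 w -> u w = u x0.
  move=> Sw; apply: (locally_cst_connected S0o S0c _ Sw Sx0) => z Sz.
  by apply: near1 => //; exact: uc.
have Sit k : S0 (iter k h x0) by elim: k => //= k IH; exact: hS0.
have fit k : f (iter k h x0) = f x0 + k%:R * u x0.
  elim: k => [|k IH]; first by rewrite mul0r addr0.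
  by rewrite iterS -[f (h _)](subrK (f (iter k h x0))) -/(u _) u_cst// IH -natr1; ring.
have u0 : u x0 = 0.
  have := fit N.+1; rewrite per => /eqP; rewrite -subr_eq0 opprD addrA subrr add0r oppr_eq0 mulf_eq0 pnatr_eq0 /=.
  by move/eqP.
(* [v] takes values in the multiples of [1 / m], so it is constant modulo 1 on the connected set
   [S0]. Comparing [x0] with [h x0] would make [j / m] an integer. *)
pose v x := psi x - f x / m%:R.
have vm w : S0 w -> exists k : int, m%:R * v w = k%:~R.
  by move=> Sw; have [_ [k e]] := fP w Sw; exists k; rewrite /v mulrBr e; field; exact: mN.
have vc z : S0 z -> \forall w \near z, modZ (v w) (v z).
  move=> Sz; have nS : nbhs z S0 by exact: open_nbhs_nbhs.
  have c1 : cmod_at v z.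
    apply: cmodB => //; apply: continuous_cmod.
    by apply: cvgM; [have [] := fP z Sz|exact: cvg_cst].
  have n1 := c1 (m%:R^-1) ltac:(by rewrite invr_gt0).
  apply: filterS (filterI nS n1) => w [Sw [k hk]].
  have [a aE] := vm w Sw; have [b bE] := vm z Sz.
  exists k; apply: (mulfI mN); rewrite [RHS]mulrDr aE bE.
  have : `|(a - b - m%:Z * k)%:~R : R| < 1.
    have -> : (a - b - m%:Z * k)%:~R = m%:R * (v w - v z - k%:~R) :> R.
      by rewrite !(rmorphB, rmorphM) /= -!pmulrn -aE -bE; ring.
    by rewrite normrM gtr0_norm// -ltr_pdivlMl// mulr1.
  rewrite -intr_norm -[ltRHS]/(1%:~R) ltr_int => kl.
  have -> : a = b + m%:Z * k by lia.
  by rewrite rmorphD rmorphM /= -pmulrn.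
have vconst : modZ (v (h x0)) (v x0).
  pose B := [set z | S0 z /\ modZ (v z) (v x0)].
  suff BA : B = S0 by have [_] : B (h x0) by rewrite BA; exact: hS0.
  apply: (open_clopen S0c S0o); [by move=> z []|by exists x0; split => //; exact: modZ_refl|].
  move=> z Sz; exists (S0 `&` [set w | modZ (v w) (v z)]); split; [|by move=> w []|].
    by apply: filterI; [exact: open_nbhs_nbhs|exact: vc].
  move=> [w [[Sw wx] [_ wz]]] w' [Sw' w'z]; split => //.
  exact: modZ_trans w'z (modZ_trans (modZ_sym wz) wx).
have fh : f (h x0) = f x0 by apply/eqP; rewrite -subr_eq0 -/(u x0) u0.
move: vconst => [k]; rewrite /v fh; have [l ->] := ph x0 => e.
have : j%:R / m%:R = (k - l)%:~R :> R by rewrite rmorphB /=; lra.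
move=> /(congr1 (fun r : R => m%:R * r)); rewrite mulrC divfK// => e1.
have e2 : j%:Z = m%:Z * (k - l).
  by apply/eqP; rewrite -(eqr_int R) rmorphM /= -!pmulrn e1.
have : (m%:Z %| j%:Z)%Z by apply/dvdzP; exists (k - l); rewrite e2 mulrC.
by rewrite dvdzE /= (negbTE mj).
Qed.

(** Multiplied by [m], the function becomes invariant under [h] modulo 1. This is the class on the
    quotient to which [invariant_partition] applies. *)
Lemma reducible_of_class (n : nat) (psi : S -> R) (m j : nat) : closed_surface S -> has_period h n ->
  (forall x, cmod_at psi x) -> (forall x, modZ (psi (h x)) (psi x + j%:R / m%:R)) ->
  (0 < m)%N -> ~~ (m %| j)%N -> reducible h.
Proof.
move=> [_ hS Sc Sn] [n0 per pmin] pc ph m0 mj.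
case: n n0 per pmin => // N _ per pmin.
have hS0 := @dact_S0 R S h N per.
have iterg k : exists g : 'I_N.+1, forall x, iter k h x = dact h g x.
  by exists (inZp k) => x; rewrite /dact /= iter_mod.
have powg k : exists g : 'I_N.+1, forall x, dpow h k x = dact h g x.
  have invN x : Defs.dinv h x = iter N h x.
    by rewrite -{2}(@dinvK _ _ _ h x) -iterSr per.
  case: k => k; first exact: iterg.
  have e l x : iter l (Defs.dinv h) x = iter (l * N) h x.
    by elim: l => //= l ->; rewrite invN -iterD mulSn.
  by have [g gE] := iterg (k.+1 * N)%N; exists g => x; rewrite -gE -e.
have S0n : free_set h N !=set0.
  have [x _] := Sn; have [M [_ _ _ _ [y [_ Sy]]]] := free_disc hS Sc per pmin (@filterT _ (nbhs x) _).
  by exists y.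
have S0o := free_open hS Sc per pmin.
have S0c : connected (free_set h N).
  by have := free_connected hS Sc per pmin openT Sc; rewrite setTI.
have S0h x : free_set h N x -> free_set h N (h x).
  by move=> Sx; have [g gE] := iterg 1%N; rewrite -[h x]/(iter 1 h x) gE; exact: hS0.
have kapinv g x : modZ (m%:R * psi (dact h g x)) (m%:R * psi x).
  rewrite /dact; elim: (g : nat) => [|k IH]; first exact: modZ_refl.
  apply: modZ_trans IH; have [l ->] := ph (iter k h x).
  exists (j%:Z + m%:Z * l); rewrite rmorphD rmorphM /= -!pmulrn; field.
  by rewrite pnatr_eq0 -lt0n.
have nl := class_not_liftable per S0o S0c S0n S0h pc ph m0 mj.
have [P [Pp Pi]] := @invariant_partition R S N (dact h (N := N)) (free_set h N) (fun x => m%:R * psi x) hS (@dact0 R S h N)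
  (@dactD R S h N per) (@dact_cont R S h N) (@dact_free R S h N) hS0 S0o S0c
  (@surface_disc R S h N hS) (@component_open_surface R S h N hS Sc per pmin)
  (@free_connected R S h N hS Sc per pmin) (fun x => cmodM m (pc x)) (kapinv N) nl.
exists P; split => // k; have [g gE] := powg k.
have imE C : dpow h k @` C = dact h g @` C by apply: eq_imagel => x _; exact: gE.
apply/seteqP; split=> [_ [C PC <-]|C PC]; first by rewrite imE; exact: Pi.
exists (dact h (- g) @` C); first exact: Pi.
rewrite imE image_comp; apply/seteqP; split=> [_ [x Cx <-]|x Cx].
  by rewrite /= -dactD// addrN dact0.
by exists x => //=; rewrite -dactD// addrN dact0.
Qed.

End Reducible.

(** * The angle in the plane and degrees of loops on the circle *)

Section Turn.
Variable R : realType.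
Local Notation E := (plane R).
Implicit Types (z w : E) (s t : R).

Lemma turnE_int (k : int) t : turnE (t + k%:~R) = turnE t.
Proof.
have nat_case (n : nat) s : turnE (s + n%:R) = turnE s.
  elim: n s => [|n IH] s; first by rewrite addr0.
  rewrite -natr1 addrA -[in RHS](IH s) /turnE mulrDr mulr1 mulr_natl.
  by rewrite cosD2pi sinD2pi.
case: k => n; first by rewrite -pmulrn nat_case.
by rewrite NegzE rmorphN /= -pmulrn -[in RHS](subrK n.+1%:R t) nat_case.
Qed.

Lemma turnE_modZ s t : turnE s = turnE t -> modZ s t.
Proof.
move=> e; have [k kE] := modZ_zfrac (s - t); have b := zfrac_itv (s - t).
have : turnE (zfrac (s - t) + t) = turnE t.
  by rewrite kE addrAC subrK turnE_int.
move=> /turnE_inj; rewrite addrK => /(_ ltac:(by rewrite ltr_norml; lra)) h.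
by exists (- k); rewrite rmorphN /=; lra.
Qed.

Lemma turnED s t : turnE (s + t) = ((turnE s).1 * (turnE t).1 - (turnE s).2 * (turnE t).2,
  (turnE s).2 * (turnE t).1 + (turnE s).1 * (turnE t).2).
Proof. by rewrite /turnE mulrDr cosD sinD. Qed.

Definition norm2 z : R := Num.sqrt (z.1 ^+ 2 + z.2 ^+ 2).

Lemma norm2_gt0 z : z != 0 -> 0 < norm2 z.
Proof.
move=> z0; rewrite sqrtr_gt0 lt_def addr_ge0 ?sqr_ge0// andbT paddr_eq0 ?sqr_ge0// !sqrf_eq0.
by apply: contra z0 => /andP[/eqP h1 /eqP h2]; apply/eqP; apply: pair_ext.
Qed.

Lemma norm2_sqr z : norm2 z ^+ 2 = z.1 ^+ 2 + z.2 ^+ 2.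
Proof. by rewrite sqr_sqrtr// addr_ge0 ?sqr_ge0. Qed.

Lemma norm2Z (r : R) z : 0 <= r -> norm2 (r *: z) = r * norm2 z.
Proof.
move=> r0; rewrite /norm2 /= /GRing.scale /= !exprMn -mulrDr sqrtrM ?sqr_ge0//.
by rewrite sqrtr_sqr ger0_norm.
Qed.

Lemma norm2_circle z : circle z -> norm2 z = 1.
Proof. by rewrite /circle /norm2 /= => ->; rewrite sqrtr1. Qed.

Lemma norm2_continuous : continuous norm2.
Proof.
move=> z; apply: (@continuous_comp _ _ _ (fun z : E => z.1 ^+ 2 + z.2 ^+ 2) Num.sqrt); last exact: sqrt_continuous.
have c1 : {for z, continuous (fun z : E => z.1)} by exact: cvg_fst.
have c2 : {for z, continuous (fun z : E => z.2)} by exact: cvg_snd.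
by apply: cvgD; [exact: (cvgM c1 c1)|exact: (cvgM c2 c2)].
Qed.

Lemma circle_unit z : z != 0 -> circle ((norm2 z)^-1 *: z).
Proof.
move=> z0; have n0 := norm2_gt0 z0; rewrite /circle /= /GRing.scale /= !exprMn -mulrDr -norm2_sqr -exprMn mulVf ?expr1n//.
by rewrite gt_eqF.
Qed.

Lemma tn_ex z : exists t, z != 0 -> z = norm2 z *: turnE t.
Proof.
have [->|z0] := eqVneq z 0; first by exists 0.
have [t [_ e]] := turnE_surj (circle_unit z0); exists t => _.
by rewrite e scalerA mulfV ?scale1r// gt_eqF// norm2_gt0.
Qed.

(** An argument of [z] in turns, obtained by choice and without a branch cut: only its class modulo
    1 is meaningful. *)
Definition tn z : R := projT1 (cid (tn_ex z)).

Lemma tnP z : z != 0 -> z = norm2 z *: turnE (tn z).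
Proof. by rewrite /tn; case: cid. Qed.

Lemma tn_uniq z (r : R) t : 0 < r -> z = r *: turnE t -> modZ (tn z) t.
Proof.
move=> r0 e; have tE0 : turnE t != 0.
  apply/eqP => h; have := turnE_circle t; rewrite h /circle /= expr0n /= addr0 => /eqP.
  by rewrite eq_sym oner_eq0.
have z0 : z != 0 by rewrite e scaler_eq0 negb_or tE0 gt_eqF.
have nr : norm2 z = r by rewrite e norm2Z ?ltW// norm2_circle ?mulr1//; exact: turnE_circle.
have := tnP z0; rewrite nr {1}e => /scalerI h; apply: turnE_modZ.
by symmetry; apply: h; rewrite gt_eqF.
Qed.

Lemma tn_turnE t : modZ (tn (turnE t)) t.
Proof. by apply: (@tn_uniq _ 1) => //; rewrite scale1r. Qed.

Lemma cos_near (e : R) : 0 < e -> exists2 d, 0 < d & forall u : R, 1 - d < cos (2 * pi * u) -> nearZ e u.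
Proof.
move=> e0; pose e' := Num.min e 2^-1; have p0 := pi_gt0 R.
have e'0 : 0 < e' by rewrite lt_min e0 /=; lra.
have e'2 : e' <= 2^-1 by rewrite ge_min lexx orbT.
have m1 : 0 < pi * e' by rewrite mulr_gt0.
have m2 : pi * e' <= pi * 2^-1 by rewrite ler_wpM2l// ltW.
have c01 : cos (2 * pi * e') < cos 0.
  by rewrite ltr_cos ?in_itv/=; try (apply/andP; split); lra.
rewrite cos0 in c01; exists (1 - cos (2 * pi * e')); first by rewrite subr_gt0.
move=> u h; have [k kE] := modZ_zfrac u; have b := zfrac_itv u.
exists (- k); rewrite rmorphN opprK /= -kE.
have e'e : e' <= e by rewrite ge_min lexx.
apply: lt_le_trans e'e; rewrite ltNge; apply/negP => h'.
have cE : cos (2 * pi * u) = cos (2 * pi * `|zfrac u|).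
  have : (turnE (zfrac u)).1 = (turnE u).1 by rewrite kE turnE_int.
  rewrite /turnE /= => <-; have [z0|z0] := leP 0 (zfrac u); first by rewrite ger0_norm.
  by rewrite ltr0_norm// mulrN cosN.
have b' : `|zfrac u| <= 2^-1 by rewrite ler_norml; lra.
have : cos (2 * pi * `|zfrac u|) <= cos (2 * pi * e').
  have m3 : pi * e' <= pi * `|zfrac u| by rewrite ler_wpM2l// ltW.
  have m4 : pi * `|zfrac u| <= pi * 2^-1 by rewrite ler_wpM2l// ltW.
  by rewrite leNgt ltr_cos ?in_itv/= -?leNgt; try (apply/andP; split); lra.
by rewrite -cE; lra.
Qed.

(** The normalised scalar product of [w] and [z] is the cosine of the difference of their angles,
    and a cosine near 1 means an angle near an integer number of turns. *)
Lemma tn_cmod z : z != 0 -> cmod_at tn z.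
Proof.
move=> z0 e e0; have [d d0 hd] := cos_near e0; have n0 := norm2_gt0 z0.
pose f w := (w.1 * z.1 + w.2 * z.2) / (norm2 w * norm2 z).
have fE w : w != 0 -> f w = cos (2 * pi * (tn w - tn z)).
  move=> w0; have m0 := norm2_gt0 w0.
  have e1 := tnP w0; have e2 := tnP z0.
  rewrite mulrBr cosB /f [in w.1]e1 [in w.2]e1 [in z.1]e2 [in z.2]e2 /=.
  rewrite /GRing.scale /=; field.
  by rewrite !gt_eqF.
have fz : f z = 1 by rewrite fE// subrr mulr0 cos0.
have fc : {for z, continuous f}.
  have c1 : {for z, continuous (fun w : E => w.1)} by exact: cvg_fst.
  have c2 : {for z, continuous (fun w : E => w.2)} by exact: cvg_snd.
  apply: cvgM; first by apply: cvgD; [apply: (cvgM c1)|apply: (cvgM c2)]; exact: cvg_cst.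
  apply: cvgV; first by rewrite gt_eqF// mulr_gt0.
  by apply: cvgM; [exact: norm2_continuous|exact: cvg_cst].
have n1 : \forall w \near z, w != 0.
  have /cvgrPdist_lt/(_ _ n0) := @norm2_continuous z; apply: filterS => w h.
  apply/eqP => w0; move: h; rewrite w0 /norm2 /= expr0n /= addr0 sqrtr0 subr0 ger0_norm ?ltxx//; exact: ltW.
have /cvgrPdist_lt/(_ _ d0) n2 := fc.
apply: filterS (filterI n1 n2) => w [w0 h]; apply: hd; rewrite -fE//.
by move: h; rewrite fz ltr_norml; lra.
Qed.

Lemma circle_neq0 z : circle z -> z != 0.
Proof.
by move=> cz; apply/eqP => e; move: cz; rewrite e /circle /= expr0n /= addr0 => /eqP; rewrite eq_sym oner_eq0.
Qed.

Lemma incr_loop_int (f : R -> R) (w : R) : incr f w -> modZ (f 0) (f 1) -> exists k : int, w = k%:~R.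
Proof.
move=> iw [k e]; have [l le] := incr_modZ iw; exists (- k - l); rewrite rmorphB rmorphN /=; lra.
Qed.

Lemma incr_tn_turnE : incr (fun t => tn (turnE t)) 1.
Proof.
have h : incr (fun t : R => t) 1 by have := @incr_cont R id (fun x => @cvg_id _ _); rewrite subr0.
by apply: incr_eq h => t _; apply: modZ_sym; exact: tn_turnE.
Qed.

Lemma incrZ (k : int) (f : R -> R) (w : R) : incr f w -> incr (fun t => k%:~R * f t) (k%:~R * w).
Proof.
move=> iw; case: k => n; first by rewrite -!pmulrn; exact: incrM.
have := incrN (incrM n.+1 iw); rewrite NegzE rmorphN /= -pmulrn !mulNr => h.
by apply: incr_eq h => t _; rewrite mulNr; exact: modZ_refl.
Qed.

(** The increment [w] is an integer, so [nu] minus [w] times the angle has increment 0 around the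
    circle and lifts to a real function, which contributes nothing along the loop [eta]. *)
Lemma circle_degree (nu : E -> R) (eta : R -> E) (w k : R) : continuous eta -> eta 0 = eta 1 ->
  (forall t, circle (eta t)) -> incr (nu \o @turnE R) w -> incr (tn \o eta) k -> incr (nu \o eta) (w * k).
Proof.
move=> ec e01 ecirc iw ik.
have [|l lE] := incr_loop_int iw; first by rewrite /= turnE1; exact: modZ_refl.
pose nu' z := nu z - l%:~R * tn z.
have i0 : incr (nu' \o id \o @turnE R) 0.
  have := incrD iw (incrN (incrZ l incr_tn_turnE)); rewrite mulr1.
  by have -> : w - l%:~R = 0 by rewrite lE subrr.
have pid : parametrizes (id : E -> E) (@circle R).
  split => //; last by rewrite image_id.
  by apply: continuous_subspaceT => z; exact: cvg_id.
have [f [fc fP]] := lift_of_null (@norm_hausdorff _ _) pid i0.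
have i1 : incr (nu' \o eta) 0.
  have := incr_cont (within_comp fc ec ecirc); rewrite /= e01 subrr => h.
  by apply: incr_eq h => t _; apply: modZ_sym; exact: fP.
have := incrD i1 (incrZ l ik); rewrite add0r [in w * k]lE => h.
by apply: incr_eq h => t _; rewrite /= /nu' subrK; exact: modZ_refl.
Qed.

End Turn.

(** * Distance to a closed set and a smeared floor function *)

Section Distance.
Variables (R : realType) (V : normedModType R) (C : set V).
Hypothesis C0 : C !=set0.
Hypothesis Cc : closed C.

Let D (z : V) : set R := [set `|z - e| | e in C].

Let Dinf z : has_inf (D z).
Proof.
by split; [have [e Ce] := C0; exists `|z - e|, e|exists 0 => _ [e _ <-]].
Qed.

Let dist_lip z w : inf (D z) - inf (D w) <= `|z - w|.
Proof.
rewrite lerBlDr addrC -lerBlDr; apply: lb_le_inf; first by have [] := Dinf w.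
move=> _ [e Ce <-]; rewrite lerBlDr.
have : inf (D z) <= `|z - e| by apply: ge_inf; [have [] := Dinf z|exists e].
by have := ler_normD (z - w) (w - e); rewrite addrA subrK; lra.
Qed.

Lemma dist_fun : exists w : V -> R, continuous w /\ forall z, 0 <= w z <= 1 /\ (w z = 0 <-> C z).
Proof.
exists (fun z => clamp 0 1 (inf (D z))); split.
  move=> z; apply: (@continuous_comp _ _ _ (fun z => inf (D z)) (clamp 0 1)); last exact: clamp_continuous.
  apply/cvgrPdist_lt => e e0; near=> w.
  have h : `|z - w| < e by near: w; apply: cvgr_dist_lt => //; exact: cvg_id.
  have h1 := dist_lip z w; have h2 := dist_lip w z; rewrite distrC in h2.
  by rewrite ltr_norml; apply/andP; split; lra.
move=> z; split; first by apply: clamp_itv; exact: ler01.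
have i0 : 0 <= inf (D z) by apply: lb_le_inf; [have [] := Dinf z|move=> _ [e _ <-]].
split=> [h|Cz]; last first.
  have : inf (D z) <= `|z - z| by apply: ge_inf; [have [] := Dinf z|exists z].
  by rewrite subrr normr0 => i1; rewrite (_ : inf (D z) = 0) ?clamp_id ?lexx ?ler01//; lra.
have {}h : inf (D z) = 0.
  move: h; rewrite /clamp; have [i1|i1] := leP (inf (D z)) 1; last by rewrite max_r ?ler01//; lra.
  by rewrite max_r.
apply: Cc => U /nbhs_ballP[e /= e0 eU].
have [_ [c Cc' <-] ce] := inf_adherent e0 (Dinf z); rewrite h add0r in ce.
by exists c; split => //; apply: eU; rewrite -ball_normE.
Unshelve. all: by end_near. Qed.

End Distance.

Section Floor.
Variable R : realType.
Implicit Types s w : R.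

(* A floor function with the jump smeared over an interval of length w; at w = 0 the junk value x / 0 = 0 makes it the floor. *)
Definition fl s w : R := (Num.floor s)%:~R + clamp 0 1 ((s - (Num.floor s)%:~R - 1 + w) / w).

Lemma fl_period s (k : int) w : fl (s + k%:~R) w = fl s w + k%:~R.
Proof.
rewrite /fl floorDrz ?intr_int// intrKfloor rmorphD /= addrAC; congr (_ + clamp 0 1 (_ / w) + _).
by ring.
Qed.

Lemma fl0 s : fl s 0 = (Num.floor s)%:~R.
Proof. by rewrite /fl invr0 mulr0 clamp_id ?addr0// lexx ler01. Qed.

Lemma clamp_neg s : s <= 0 -> clamp 0 1 s = 0.
Proof. by move=> h; rewrite /clamp min_l ?max_l//; lra. Qed.

Lemma clamp_big s : 1 <= s -> clamp 0 1 s = 1.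
Proof. by move=> h; rewrite /clamp min_r ?max_r//; lra. Qed.

Lemma floor_uniq s (k : int) : k%:~R <= s < k%:~R + 1 -> Num.floor s = k.
Proof. by move=> h; apply: floor_def; rewrite rmorphD. Qed.

(** Joint continuity persists at [w0 = 0] away from the integers, because the jump is confined to
    the interval of length [w] that precedes an integer. *)
Lemma fl_cont s0 w0 : 0 <= w0 <= 1 -> 0 < w0 \/ ~ (exists k : int, s0 = k%:~R) -> forall e, 0 < e -> exists2 d, 0 < d &
  forall s w, `|s - s0| < d -> `|w - w0| < d -> 0 <= w <= 1 -> `|fl s w - fl s0 w0| < e.
Proof.
move=> w01 h e e0; set k := Num.floor s0.
have /andP[k1 k2] := floor_itv s0; rewrite -/k rmorphD /= in k1 k2.
have [w0p|w0n] := ltP 0 w0.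
  (* One formula valid on both sides of [k]: a clamp for the jump at [k] and another for the jump at
     [k + 1]. *)
  pose g (x : R * R) := (k%:~R - 1) + clamp 0 1 ((x.1 - k%:~R + x.2) / x.2) + clamp 0 1 ((x.1 - k%:~R - 1 + x.2) / x.2).
  have gE s w : k%:~R - 1 < s < k%:~R + 1 -> 0 < w <= 1 -> fl s w = g (s, w).
    move=> sk /andP[wp w1]; rewrite /g /fl /=; have [ks|sk'] := leP k%:~R s.
      rewrite (@floor_uniq s k); last by rewrite ks; lra.
      by rewrite (@clamp_big ((s - k%:~R + w) / w)) ?ler_pdivlMr//; lra.
    rewrite (@floor_uniq s (k - 1)); last by rewrite rmorphB /=; lra.
    rewrite (@clamp_neg ((s - k%:~R - 1 + w) / w)) ?rmorphB /=; last by rewrite pmulr_lle0 ?invr_gt0//; lra.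
    by rewrite addr0; congr (_ + clamp 0 1 (_ / w)); ring.
  have gc : {for (s0, w0), continuous g}.
    have c1 : {for (s0, w0), continuous (fun x : R * R => x.1)} by exact: cvg_fst.
    have c2 : {for (s0, w0), continuous (fun x : R * R => x.2)} by exact: cvg_snd.
    have cv : {for (s0, w0), continuous (fun x : R * R => x.2^-1)} by apply: cvgV => //=; rewrite gt_eqF.
    have part (f : R * R -> R) : {for (s0, w0), continuous f} -> {for (s0, w0), continuous (fun x : R * R => clamp 0 1 (f x / x.2))}.
      move=> fc; apply: (@continuous_comp _ _ _ (fun x : R * R => f x / x.2) (clamp 0 1)); last exact: clamp_continuous.
      exact: cvgM fc cv.
    apply: cvgD; first (apply: cvgD; first exact: cvg_cst).
      by apply: part; apply: cvgD => //; apply: cvgB => //; exact: cvg_cst.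
    by apply: part; apply: cvgD => //; apply: cvgB; [apply: cvgB => //; exact: cvg_cst|exact: cvg_cst].
  have /cvgrPdist_lt/(_ _ e0) := gc.
  move=> /nbhs_ballP[d /= d0 hd].
  pose d' := Num.min d (Num.min w0 (Num.min (s0 - k%:~R + 1) (k%:~R + 1 - s0))).
  exists d'; first by rewrite !lt_min d0 w0p; apply/andP; split; lra.
  move=> s w; rewrite !lt_min => /and4P[s1 s2 s3 s4] /and4P[w1 w2 w3 w4] ww.
  have s3' : k%:~R - 1 < s by move: s3; rewrite ltr_norml; lra.
  have s4' : s < k%:~R + 1 by move: s4; rewrite ltr_norml; lra.
  have w2' : 0 < w by move: w2; rewrite ltr_norml; lra.
  rewrite gE ?s3' ?w2'//; last by case/andP: ww.
  rewrite gE; [|lra|lra]; rewrite distrC; apply: hd; rewrite -ball_normE /= norm_pair_lt /=.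
  by rewrite [`|s0 - s|]distrC [`|w0 - w|]distrC s1 w1.
have w00 : w0 = 0 by apply/eqP; rewrite eq_le w0n; case/andP: w01.
have sn : s0 != k%:~R.
  by case: h => [|h]; [rewrite w00 ltxx|apply/eqP => e'; apply: h; exists k].
clear h; have {}w01 := w01.
have sk : k%:~R < s0 by rewrite lt_def sn.
pose d := Num.min ((s0 - k%:~R) / 2) ((k%:~R + 1 - s0) / 2).
exists d; first by rewrite lt_min; apply/andP; split; lra.
move=> s w; rewrite w00 subr0 !lt_min => /andP[s1 s2] /andP[w1 w2] ww.
have s1' : k%:~R < s by move: s1; rewrite ltr_norml; lra.
have s2' : s < (k%:~R + 1 + s0) / 2 by move: s2; rewrite ltr_norml; lra.
have w2' : w < (k%:~R + 1 - s0) / 2 by apply: le_lt_trans w2; exact: ler_norm.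
rewrite fl0 -/k /fl (@floor_uniq s k); last by lra.
rewrite clamp_neg ?addr0 ?subrr ?normr0//.
have wi : 0 <= w^-1 by rewrite invr_ge0; case/andP: ww.
by apply: mulr_le0_ge0 => //; lra.
Qed.

End Floor.

Lemma sum_continuous (R : realType) (T : topologicalType) (V : normedModType R) k (F : 'I_k -> T -> V) :
  (forall i, continuous (F i)) -> continuous (fun x => \sum_i F i x).
Proof.
elim: k F => [|k IH] F Fc.
  by under eq_fun do rewrite big_ord0; exact: cst_continuous.
under eq_fun do rewrite big_ord_recr /=.
by move=> x; apply: cvgD; [exact: IH|exact: Fc].
Qed.

(** * Geometry of the polygon *)

Section PolygonFacts.
Variables (R : realType) (n : nat).
Hypothesis n2 : (2 < n)%N.
Local Notation E := (plane R).
Local Notation vertex := (@vertex R n).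
Local Notation rot := (@clockwise_rotation R n).

Let n0 : n%:R != 0 :> R. Proof. by rewrite pnatr_eq0; lia. Qed.
Let np : 0 < n%:R :> R. Proof. by rewrite ltr0n; lia. Qed.

(** Multiplication of complex numbers; multiplication by [turnE s] is a rotation. *)
Definition cm (c z : E) : E := (c.1 * z.1 - c.2 * z.2, c.2 * z.1 + c.1 * z.2).

Lemma cm_turnE (s t r : R) : cm (turnE s) (r *: turnE t) = r *: turnE (s + t).
Proof. by rewrite turnED; apply: pair_ext; rewrite /= /GRing.scale /=; ring. Qed.

Lemma cm_comb (c : E) (a b : R) z w : cm c (a *: z + b *: w) = a *: cm c z + b *: cm c w.
Proof. by apply: pair_ext; rewrite /= /GRing.scale /=; ring. Qed.

Lemma cm_sum (c : E) k (F : 'I_k -> R) (V : 'I_k -> E) : cm c (\sum_i F i *: V i) = \sum_i F i *: cm c (V i).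
Proof.
elim: k F V => [|k IH] F V; first by rewrite !big_ord0; apply: pair_ext; rewrite /=; ring.
by rewrite !big_ord_recr /= -IH -[X in cm c (X + _)]scale1r cm_comb scale1r.
Qed.

Lemma vertexE k : vertex k = turnE (- (k%:R / 2 / n%:R)).
Proof.
rewrite /Defs.vertex /turnE mulrN cosN sinN (_ : 2 * pi * (k%:R / 2 / n%:R) = pi * k%:R / n%:R)//.
by field; exact: n0.
Qed.

Lemma rotE z : rot z = cm (turnE (- (1 / n%:R))) z.
Proof.
rewrite /clockwise_rotation /turnE /cm mulrN cosN sinN (_ : 2 * pi * (1 / n%:R) = 2 * pi / n%:R) /=; last first.
  by field; exact: n0.
by apply: pair_ext; rewrite /=; ring.
Qed.

Lemma rot_turnE (r t : R) : rot (r *: turnE t) = r *: turnE (t - 1 / n%:R).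
Proof. by rewrite rotE cm_turnE addrC. Qed.

Lemma rot_vertex k : rot (vertex k) = vertex k.+2.
Proof.
rewrite !vertexE -[turnE _]scale1r rot_turnE scale1r; congr turnE.
by rewrite -[k.+2]addn2 natrD; field; exact: n0.
Qed.

Lemma rot_continuous : continuous rot.
Proof.
move=> z.
have c1 : {for z, continuous (fun w : E => w.1)} by exact: cvg_fst.
have c2 : {for z, continuous (fun w : E => w.2)} by exact: cvg_snd.
apply: (@continuous_pair _ R R (fun z : E => cos (2 * pi / n%:R) * z.1 + sin (2 * pi / n%:R) * z.2)
  (fun z : E => - sin (2 * pi / n%:R) * z.1 + cos (2 * pi / n%:R) * z.2)).
  by apply: cvgD; [apply: (cvgM _ c1)|apply: (cvgM _ c2)]; exact: cvg_cst.
by apply: cvgD; [apply: (cvgM _ c1)|apply: (cvgM _ c2)]; exact: cvg_cst.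
Qed.

Lemma iter_rot k (r t : R) : iter k rot (r *: turnE t) = r *: turnE (t - k%:R / n%:R).
Proof.
elim: k => [|k IH]; first by rewrite mul0r subr0.
by rewrite iterS IH rot_turnE; congr (_ *: turnE _); rewrite -natr1; field; exact: n0.
Qed.

Lemma rot_order z : iter n rot z = z.
Proof.
have [->|z0] := eqVneq z 0.
  have r0 : rot 0 = 0 by rewrite rotE; apply: pair_ext; rewrite /=; ring.
  have it k : iter k rot 0 = 0 by elim: k => //= k ->.
  exact: it.
rewrite [in LHS](tnP z0) iter_rot divff// [RHS](tnP z0); congr (_ *: _).
by rewrite -[-1]/((-1)%:~R) turnE_int.
Qed.

Lemma vertex_period k l : vertex (k + l * (2 * n)) = vertex k.
Proof.
rewrite !vertexE -[RHS](turnE_int (- l%:Z)); congr turnE.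
by rewrite rmorphN /= -pmulrn !natrD !natrM; field; exact: n0.
Qed.

Definition edge k (t : R) : E := (1 - t) *: vertex k + t *: vertex k.+1.

Lemma edge_period k l t : edge (k + l * (2 * n)) t = edge k t.
Proof. by rewrite /edge -addSn !vertex_period. Qed.

Lemma rot_edge k t : rot (edge k t) = edge k.+2 t.
Proof. by rewrite /edge rotE cm_comb -!rotE !rot_vertex. Qed.

(** The edge is rotated to start in direction 0, where the angle of a point is an arctangent below
    [pi / n]; [n > 2] puts this bound below a right angle. *)
Lemma edge_polar k t : 0 < t < 1 -> exists r u, [/\ 0 < r, 0 < u < 2^-1 & edge k t = r *: turnE (- ((k%:R / 2 + u) / n%:R))].
Proof.
move=> t01; have p0 := pi_gt0 R; have pn0 : pi != 0 :> R by rewrite gt_eqF.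
pose ph : R := pi / n%:R.
have ph0 : 0 < ph by rewrite divr_gt0.
have ph2 : ph < pi / 2.
  by rewrite /ph ltr_pM2l// ltf_pV2 ?posrE// ltr_nat.
have cp : 0 < cos ph by apply: cos_gt0_pihalf; rewrite ph2 andbT; lra.
have sp : 0 < sin ph by apply: sin_gt0_pihalf; rewrite ph0.
pose x := 1 - t + t * cos ph; pose y := t * sin ph.
have x0 : 0 < x by rewrite /x; nra.
have y0 : 0 < y by rewrite /y mulr_gt0//; case/andP: t01.
pose ps := atan (y / x).
have ps0 : 0 < ps by rewrite /ps -(@atan0 R); apply: lt_atan; rewrite divr_gt0.
have psl : ps < ph.
  rewrite -[ph](@tanK R) ?in_itv/=; last by apply/andP; split; lra.
  apply: lt_atan; rewrite /tan ltr_pdivrMr// mulrAC ltr_pdivlMr// /x /y; nra.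
have cps : 0 < cos ps by apply: cos_gt0_pihalf; apply/andP; split; lra.
pose r := x / cos ps.
have r0 : 0 < r by rewrite divr_gt0.
have rc : r * cos ps = x by rewrite divfK// gt_eqF.
have rs : r * sin ps = y.
  have : tan ps = y / x by rewrite /ps atanK.
  rewrite /tan => h; have : sin ps = y / x * cos ps by rewrite -h divfK// gt_eqF.
  by move=> ->; rewrite /r; field; rewrite !gt_eqF.
exists r, (n%:R * ps / (2 * pi)); split => //.
  apply/andP; split; first by rewrite divr_gt0 ?mulr_gt0.
  have : n%:R * ps < pi by rewrite mulrC -ltr_pdivlMr.
  by rewrite ltr_pdivrMr; lra.
have eq (q c : R) : q != 0 -> - ((k%:R / 2 + n%:R * c / (2 * q)) / n%:R) = - (k%:R / 2 / n%:R) + - (c / (2 * q)).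
  by move=> q0; field; rewrite ?n0 ?q0.
rewrite (eq pi ps pn0).
rewrite -cm_turnE -vertexE.
have -> : edge k t = cm (vertex k) ((1 - t) *: (1 *: turnE 0) + t *: (1 *: turnE (- (2^-1 / n%:R)))).
  rewrite cm_comb /edge !vertexE !cm_turnE !scale1r addr0; congr (_ + _ *: turnE _).
  by rewrite -natr1; field; exact: n0.
congr cm; rewrite !scale1r /turnE !mulrN !cosN !sinN mulr0 cos0 sin0.
rewrite (_ : 2 * pi * (ps / (2 * pi)) = ps); last by rewrite mulrC divfK// mulf_neq0// pnatr_eq0.
rewrite (_ : 2 * pi * (2^-1 / n%:R) = ph); last by rewrite /ph; field; exact: n0.
by apply: pair_ext; rewrite /= /GRing.scale /= ?mulrN ?rc ?rs /x /y; ring.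
Qed.

Lemma polygon_rot z : polygon n z -> polygon n (rot z).
Proof.
move=> [w [w0 w1 ->]].
have k2 k : (k %% (2 * n) < 2 * n)%N by rewrite ltn_pmod//; lia.
pose f (i : 'I_(2 * n)) := Ordinal (k2 (i + 2)%N).
pose g (i : 'I_(2 * n)) := Ordinal (k2 (i + (2 * n - 2))%N).
have fg : cancel f g.
  move=> i; apply: val_inj; rewrite /= modnDml -addnA subnKC; last by lia.
  by rewrite modnDr modn_small.
have gf : cancel g f.
  move=> i; apply: val_inj; rewrite /= modnDml -addnA subnK; last by lia.
  by rewrite modnDr modn_small.
exists (w \o g); split=> [i||]; first exact: w0.
  by rewrite (reindex f) /=; [rewrite -w1; apply: eq_bigr => i _; rewrite fg|exists g => i _; [exact: fg|exact: gf]].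
rewrite [RHS](reindex f) /=; last by exists g => i _; [exact: fg|exact: gf].
rewrite rotE.
rewrite cm_sum.
apply: eq_bigr => i _; rewrite fg -rotE rot_vertex; congr (_ *: _).
by rewrite -addn2 {1}(divn_eq (i + 2) (2 * n)) addnC vertex_period.
Qed.

Lemma polygon_compact : compact (@polygon R n).
Proof.
have [k kE] : exists k, (2 * n = k.+1)%N by exists (2 * n).-1; lia.
pose f (v : 'rV[R]_k.+1) : E := \sum_i v ord0 i *: vertex i.
pose C := [set v : 'rV[R]_k.+1 | (forall i, `[0, 1]%classic (v ord0 i))] `&` [set v | \sum_i v ord0 i = 1].
have cc : continuous (fun v : 'rV[R]_k.+1 => \sum_i v ord0 i).
  by apply: sum_continuous => i; exact: coord_continuous.
have cf : continuous f.
  apply: sum_continuous => i v.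
  have c1 : {for v, continuous (fun v : 'rV[R]_k.+1 => v ord0 i)} by exact: coord_continuous.
  have c2 : {for v, continuous (fun _ : 'rV[R]_k.+1 => vertex i)} by exact: cst_continuous.
  exact: (cvgZ c1 c2).
have -> : @polygon R n = f @` C.
  rewrite /polygon kE; apply/seteqP; split=> [z [w [w0 w1 ->]]|_ [v [v0 v1] <-]].
    exists (\row_i w i); last by apply: eq_bigr => i _; rewrite mxE.
    have sE : \sum_i (\row_i w i) ord0 i = 1 by rewrite -w1; apply: eq_bigr => i _; rewrite mxE.
    split => // i; rewrite /= in_itv /= mxE w0 /=.
    have -> : 1 = \sum_i w i by [].
    by rewrite (bigD1 i)//= lerDl; apply: sumr_ge0 => j _; exact: w0.
  exists (fun i => v ord0 i); split => // i.
  by have := v0 i; rewrite /= in_itv /= => /andP[].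
apply: continuous_compact; first exact: continuous_subspaceT.
have cK : compact [set v : 'rV[R]_k.+1 | forall i, `[0, 1]%classic (v ord0 i)].
  have rc := @rV_compact R k.+1 (fun=> `[0, 1]%classic).
  by apply: rc => i; exact: segment_compact.
apply: (subclosed_compact _ cK); last by move=> v [].
apply: closedI; first by apply: compact_closed; [exact: norm_hausdorff|exact: cK].
by apply: (@closed_preim _ _ (fun v : 'rV[R]_k.+1 => \sum_i v ord0 i) [set 1]) => //; exact: closed_eq.
Qed.

End PolygonFacts.

Lemma orbit_sum (T : Type) (V : nmodType) (f : T -> T) (w : T -> V) N x : iter N f x = x ->
  \sum_(k < N) w (iter k f (f x)) = \sum_(k < N) w (iter k f x).
Proof.
case: N => [|N] ro; first by rewrite !big_ord0.
rewrite big_ord_recr [RHS]big_ord_recl /= addrC; congr (_ + _).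
  by rewrite -iterSr ro.
by apply: eq_bigr => i _; rewrite -iterSr.
Qed.

(** * The pseudo-angle on the polygon and on its quotient *)

Section Theta.
Variables (R : realType) (n p m : nat) (A B : int).
Hypothesis n2 : (2 < n)%N.
Hypothesis m0 : (0 < m)%N.
Hypothesis mn : (m %| n)%N.
Hypothesis AB : A + B = 1.
Hypothesis mpB : exists k : int, p%:Z + B = m%:Z * k.
Local Notation E := (plane R).
Local Notation vertex := (@vertex R n).
Local Notation rot := (@clockwise_rotation R n).
Local Notation edge := (@edge R n).
Hypothesis Heven : forall i, polygon_equiv n p (vertex (2 * i)) (vertex (2 * i).+2).
Hypothesis Hodd : B != 0 -> forall i, polygon_equiv n p (vertex (2 * i).+1) (vertex (2 * i).+3).

Let n0 : n%:R != 0 :> R. Proof. by rewrite pnatr_eq0; lia. Qed.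
Let np : 0 < n%:R :> R. Proof. by rewrite ltr0n; lia. Qed.
Let mp : 0 < m%:R :> R. Proof. by rewrite ltr0n. Qed.
Let mN : m%:R != 0 :> R. Proof. by rewrite gt_eqF. Qed.
Let ABR : A%:~R + B%:~R = 1 :> R. Proof. by rewrite -rmorphD AB. Qed.
Let AE : A%:~R = 1 - B%:~R :> R.
Proof. by apply/eqP; rewrite eq_sym subr_eq ABR. Qed.
Let nm : exists k : nat, n%:R = m%:R * k%:R :> R.
Proof. by have /dvdnP[k ->] := mn; exists k; rewrite natrM mulrC. Qed.

Let Ed : set E := [set z | exists k t, 0 <= t <= 1 /\ z = edge k t].

Lemma Ed_closed : closed Ed.
Proof.
have -> : Ed = \bigcup_(k in [set: 'I_(2 * n)]) (edge k @` `[0, 1]%classic).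
  apply/seteqP; split=> [z [k [t [t01 ->]]]|z [k _ [t t01 <-]]].
    have k2 : (k %% (2 * n) < 2 * n)%N by rewrite ltn_pmod//; lia.
    exists (Ordinal k2) => //; exists t; first by rewrite /= in_itv.
    by rewrite {2}(divn_eq k (2 * n)) addnC edge_period.
  by exists k, t; split => //; move: t01; rewrite /= in_itv.
apply: closed_bigcup; first exact: finite_finset.
move=> k _; apply: compact_closed; first exact: norm_hausdorff.
apply: continuous_compact; last exact: segment_compact.
apply: continuous_subspaceT => t; apply: cvgD; apply: cvgZr_tmp; last exact: cvg_id.
by apply: cvgB; [exact: cvg_cst|exact: cvg_id].
Qed.

Let Ed_rot z : Ed z -> Ed (rot z).
Proof. by move=> [k [t [t01 ->]]]; exists k.+2, t; rewrite rot_edge. Qed.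

(** The truncated distance to the edges, averaged over the rotations to make it invariant. *)
Lemma width_ex : exists w : E -> R, [/\ continuous w, forall z, 0 <= w z <= 1,
  forall z, w z = 0 <-> Ed z & forall z, w (rot z) = w z].
Proof.
have E0 : Ed !=set0 by exists (edge 0%N 0), 0%N, 0; rewrite lexx ler01.
have [w [wc wP]] := dist_fun E0 Ed_closed.
have itc k : continuous (iter k rot).
  elim: k => [|k IH] z; first exact: cvg_id.
  by apply: (@continuous_comp _ _ _ (iter k rot) rot); [exact: IH|exact: rot_continuous].
pose W z := \sum_(k < n) w (iter k rot z).
have W0 z : 0 <= W z by apply: sumr_ge0 => k _; have [/andP[]] := wP (iter k rot z).
exists (fun z => W z / n%:R); split.
- move=> z; apply: cvgM; last exact: cvg_cst.
  by apply: (@sum_continuous R E R n (fun k z => w (iter k rot z))) => k y; apply: continuous_comp; [exact: itc|exact: wc].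
- move=> z; rewrite divr_ge0//= ler_pdivrMr// mul1r.
  apply: (@le_trans _ _ (\sum_(k < n) 1)); last by rewrite sumr_const card_ord.
  by apply: ler_sum => k _; have [/andP[]] := wP (iter k rot z).
- move=> z; split=> [/eqP|Ez].
    rewrite mulf_eq0 invr_eq0 (negbTE n0) orbF => /eqP Wz; apply/(wP z).2.
    have n1 : (0 < n)%N by lia.
    have := @psumr_eq0P _ _ (fun _ : 'I_n => true) (fun k => w (iter k rot z)).
    by move=> /(_ (fun k _ => proj1 (andP (wP (iter k rot z)).1)) Wz (Ordinal n1) isT).
  rewrite /W big1 ?mul0r// => k _; apply/(wP _).2.
  by elim: (k : nat) => //= l; exact: Ed_rot.
- move=> z; congr (_ / _); rewrite /W.
  by rewrite (orbit_sum _ (rot_order n2 z)).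
Qed.

Let w : E -> R := projT1 (cid width_ex).
Let wP := projT2 (cid width_ex).

(** The clockwise angle measured in rotations: modulo [n], [vertex k] sits at [k / 2] and the
    rotation adds 1. *)
Definition sigma z : R := - (n%:R * tn z).

(** Inside the open edges, where the width is 0, the value is [i / m] on [alpha_i] and [(j + B) / m]
    on [beta_j]. [mpB] makes these agree modulo 1 on identified edges, and [A + B = 1] makes the
    rotation add [1 / m]. *)
Definition Phi (s v : R) : R := (A%:~R * fl s v + B%:~R * fl (s + 2^-1) v) / m%:R.

Definition turnT z : R := Phi (sigma z) (w z).

Lemma PhiD s v (k : int) : Phi (s + k%:~R) v = Phi s v + k%:~R / m%:R.
Proof.
have e : s + k%:~R + 2^-1 = s + 2^-1 + k%:~R by ring.
rewrite /Phi e !fl_period -mulrDl; congr (_ / _).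
rewrite AE; ring.
Qed.

Lemma PhiDn s v (k : int) : modZ (Phi (s + n%:R * k%:~R) v) (Phi s v).
Proof.
have [l nE] := nm; exists (l%:Z * k).
rewrite -[n%:R]/(n%:~R) -rmorphM PhiD rmorphM /= -!pmulrn nE; congr (_ + _).
by field; exact: mN.
Qed.

Lemma sigma_polar (z : E) (r t : R) : 0 < r -> z = r *: turnE t -> exists k : int, sigma z = - (n%:R * t) + n%:R * k%:~R.
Proof. by move=> r0 /(tn_uniq r0)[k e]; exists (- k); rewrite /sigma e rmorphN /=; ring. Qed.

(** The points where [turnT] may be discontinuous: the centre, and the vertices at which a floor
    present in [Phi] jumps. By [bad_fixed] they all represent fixed points. *)
Definition bad (z : E) := z = 0 \/ (Ed z /\ ((exists k : int, sigma z = k%:~R) \/ (B != 0 /\ exists k : int, sigma z + 2^-1 = k%:~R))).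

Lemma polar_neq0 (r t : R) : 0 < r -> r *: turnE t != 0 :> E.
Proof. by move=> r0; rewrite scaler_eq0 negb_or gt_eqF// circle_neq0//; exact: turnE_circle. Qed.

Lemma intn (k : int) : n%:R * k%:~R = (n%:Z * k)%:~R :> R.
Proof. by rewrite rmorphM. Qed.

Lemma Ed_edge k t : 0 <= t <= 1 -> Ed (edge k t). Proof. by exists k, t. Qed.

Lemma w_edge k t : 0 <= t <= 1 -> w (edge k t) = 0.
Proof. by move=> t01; have [_ _ h _] := wP; apply/h; exact: Ed_edge. Qed.

Lemma int_between (k l : int) (x : R) : k%:~R < x < k%:~R + 1 -> x <> l%:~R.
Proof. 
move=> /andP[h1 h2] e; rewrite e in h1 h2.
have {}h2 : l%:~R < (k + 1)%:~R :> R by rewrite rmorphD.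
by move: h1 h2; rewrite !ltr_int; lia. Qed.

Lemma edge_open k t : 0 < t < 1 -> ~ bad (edge k t) /\
  modZ (turnT (edge k t)) (if odd k then ((k./2)%:R + B%:~R) / m%:R else (k./2)%:R / m%:R).
Proof.
move=> t01; have [r [u [r0 u0 e]]] := edge_polar n2 k t01.
have [l sl] := sigma_polar r0 e.
have {}sl : sigma (edge k t) = (k%:R / 2 + u) + n%:R * l%:~R by rewrite sl; field; exact: n0.
have w0 : w (edge k t) = 0 by apply: w_edge; lra.
have kE : k%:R = (odd k)%:R + 2 * (k./2)%:R :> R by rewrite -{1}(odd_double_half k) natrD -mul2n natrM.
have k2 : k%:R / 2 = (k./2)%:R + (odd k)%:R / 2 :> R by rewrite kE; field.
split.
  case=> [z0|[_ [[q qE]|[_ [q qE]]]]].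
  - by have := polar_neq0 (- ((k%:R / 2 + u) / n%:R)) r0; rewrite -e z0 eqxx.
  - apply: (@int_between (k./2) (q - n%:Z * l) (k%:R / 2 + u)).
      rewrite k2 -pmulrn; case: (odd k) => /=; lra.
    by rewrite rmorphB /= -intn -qE sl; ring.
  - apply: (@int_between (k./2 + odd k)%N (q - n%:Z * l) (k%:R / 2 + u + 2^-1)).
      rewrite k2 -pmulrn natrD; case: (odd k) => /=; lra.
    by rewrite rmorphB /= -intn -qE sl; ring.
rewrite /turnT w0 sl; apply: (modZ_trans (PhiDn _ _ _)).
rewrite /Phi !fl0 k2.
have f1 : Num.floor ((k./2)%:R + (odd k)%:R / 2 + u : R) = (k./2)%:Z.
  by apply: floor_uniq; rewrite -pmulrn; case: (odd k) => /=; lra.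
have f2 : Num.floor ((k./2)%:R + (odd k)%:R / 2 + u + 2^-1 : R) = (k./2 + odd k)%N.
  by apply: floor_uniq; rewrite -pmulrn natrD; case: (odd k) => /=; lra.
rewrite f1 f2 -!pmulrn natrD.
rewrite AE.
by case: (odd k) => /=; exists 0; rewrite [RHS]addr0; congr (_ / _); ring.
Qed.

Lemma sigma_vertex k : exists l : int, sigma (vertex k) = k%:R / 2 + n%:R * l%:~R.
Proof.
have e : vertex k = 1 *: turnE (- (k%:R / 2 / n%:R)) by rewrite scale1r vertexE.
have [l ->] := sigma_polar ltr01 e; exists l; congr (_ + _); field; exact: n0.
Qed.

Lemma edge_vertex k : edge k 0 = vertex k /\ edge k 1 = vertex k.+1.
Proof. by rewrite /edge subr0 subrr !scale1r !scale0r addr0 add0r. Qed.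

Lemma Ed_vertex k : Ed (vertex k).
Proof. by have [<- _] := edge_vertex k; apply: Ed_edge; rewrite lexx ler01. Qed.

Lemma bad_vertex k : ~~ odd k \/ B != 0 -> bad (vertex k).
Proof.
move=> h; right; split; first exact: Ed_vertex.
have [l sl] := sigma_vertex k.
have kE : k%:R = (odd k)%:R + 2 * (k./2)%:R :> R by rewrite -{1}(odd_double_half k) natrD -mul2n natrM.
case ok : (odd k) h kE => h kE; [right|left]; last first.
  by exists ((k./2)%:Z + n%:Z * l); rewrite sl rmorphD /= -intn -pmulrn kE ?mulr0n ?mulr1n ?mulr1z; field.
split; first by case: h.
by exists ((k./2)%:Z + 1 + n%:Z * l); rewrite sl !rmorphD /= -intn -pmulrn kE ?mulr0n ?mulr1n ?mulr1z; field.
Qed.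

Lemma odd_vertex i : B = 0 -> ~ bad (vertex (2 * i).+1) /\ modZ (turnT (vertex (2 * i).+1)) (i%:R / m%:R).
Proof.
move=> B0; have [l sl] := sigma_vertex (2 * i).+1.
have {}sl : sigma (vertex (2 * i).+1) = i%:R + 2^-1 + n%:R * l%:~R.
  by rewrite sl -addn1 natrD natrM; field.
split.
  case=> [z0|[_ [[q qE]|[]]]]; last by rewrite B0 eqxx.
    by move: z0; rewrite vertexE// => z0; exact: (elimN eqP (circle_neq0 (turnE_circle _)) z0).
  apply: (@int_between i (q - n%:Z * l) (i%:R + 2^-1)); first by rewrite -pmulrn; lra.
  by rewrite rmorphB /= -intn -qE sl; ring.
have w0 : w (vertex (2 * i).+1) = 0 by have [_ _ h _] := wP; apply/h; exact: Ed_vertex.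
rewrite /turnT w0 sl; apply: (modZ_trans (PhiDn _ _ _)).
rewrite /Phi !fl0 (@floor_uniq _ _ i); last by rewrite -pmulrn; lra.
have A1 : A = 1 by rewrite -AB B0 addr0.
by exists 0; rewrite B0 A1 mul0r mul1r !addr0.
Qed.

Let good_rel (z z' : E) := (bad z <-> bad z') /\ (~ bad z -> modZ (turnT z) (turnT z')).

Lemma edge_identified_good z z' : edge_identified n p z z' -> good_rel z z'.
Proof.
move=> [i [j [t [i_n jn ij t01 [zE wE]]]]].
have [k kE] := mpB.
have [q qE] : exists q : int, j%:Z = i%:Z + p%:Z + n%:Z * q.
  exists ((j %/ n)%N%:Z - ((i + p) %/ n)%N%:Z).
  by have := divn_eq j n; have := divn_eq (i + p) n; rewrite ij; nia.
have [l nE] := nm.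
have jmod (c : int) : c = B -> modZ (i%:R / m%:R : R) ((j%:R + c%:~R) / m%:R).
  move=> ->; exists (- (k + l%:Z * q)).
  have -> : j%:R = i%:R + p%:R + n%:R * q%:~R :> R.
    by rewrite [j%:R]pmulrn qE !rmorphD rmorphM /= -!pmulrn.
  have -> : p%:R = m%:R * k%:~R - B%:~R :> R.
    by rewrite [p%:R]pmulrn -[m%:R]/(m%:~R) -rmorphM -rmorphB -kE addrK.
  by rewrite nE rmorphN rmorphD rmorphM /= -pmulrn; field; exact: mN.
have zE' : z = edge (2 * i) t by rewrite zE.
have wE' : z' = edge (2 * j).+1 (1 - t) by rewrite wE /beta /edge subKr addrC.
(* Parameter 0 gives even vertices, which are always bad; parameter 1 gives odd vertices, which are
   bad unless [B = 0]. *)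
have [t0|tn0] := eqVneq t 0.
  have b1 : bad z by rewrite zE' t0 (edge_vertex _).1; apply: bad_vertex; left; rewrite mul2n odd_double.
  have b2 : bad z'.
    rewrite wE' t0 subr0 (edge_vertex _).2; apply: bad_vertex; left.
    by rewrite /= mul2n odd_double.
  by split => // h; case: h.
have [t1|tn1] := eqVneq t 1.
  have z1 : z = vertex (2 * i).+1 by rewrite zE' t1 (edge_vertex _).2.
  have z2 : z' = vertex (2 * j).+1 by rewrite wE' t1 subrr (edge_vertex _).1.
  have [B0|B0] := eqVneq B 0.
    have [nb1 T1] := odd_vertex i B0; have [nb2 T2] := odd_vertex j B0.
    rewrite z1 z2; split => // _; apply: (modZ_trans T1); apply: modZ_trans (modZ_sym T2).
    by have := jmod 0 (esym B0); rewrite addr0.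
  have b1 : bad z by rewrite z1; apply: bad_vertex; right.
  have b2 : bad z' by rewrite z2; apply: bad_vertex; right.
  by split => // h; case: h.
have t01' : 0 < t < 1 by rewrite !lt_neqAle eq_sym tn0 tn1 /=.
have t01'' : 0 < 1 - t < 1 by lra.
have [nb1 T1] := edge_open (2 * i) t01'; have [nb2 T2] := edge_open (2 * j).+1 t01''.
rewrite mul2n odd_double doubleK in T1; rewrite /= mul2n odd_double /= uphalf_double in T2.
rewrite zE' wE'; split => // _; rewrite !mul2n; rewrite ?mul2n in nb1 nb2.
by apply: (modZ_trans T1); apply: modZ_trans (modZ_sym T2); exact: jmod.
Qed.

Lemma polygon_equiv_good z z' : polygon_equiv n p z z' -> good_rel z z'.
Proof.
elim=> {z z'} [z z'|z|z z' _ [h1 h2]|x y z _ [h1 h2] _ [h3 h4]].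
- exact: edge_identified_good.
- by split => // _; exact: modZ_refl.
- by split => [|nb]; [symmetry|apply: modZ_sym; apply: h2; move/h1].
- split; first by rewrite h1.
  by move=> nb; apply: modZ_trans (h2 nb) (h4 _); move/h1.
Qed.

Lemma bad_fixed z : bad z -> polygon n z -> polygon_equiv n p z (rot z).
Proof.
move=> [-> _|[[k [t [t01 ->]]] hb] _].
  have r0 : rot (0, 0) = (0, 0) by rewrite /clockwise_rotation /= !mulr0 addr0.
  have -> : rot 0 = 0 := r0.
  by rewrite /polygon_equiv; apply: Relation_Operators.rst_refl.
have [t1|t1] := boolP (0 < t < 1).
  by exfalso; have [nb _] := edge_open k t1; apply: nb; right; split => //; exact: Ed_edge.
have [l [lE hl]] : exists l, edge k t = vertex l /\ (~~ odd l \/ B != 0).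
  have [l lE] : exists l, edge k t = vertex l.
    have [->|->] : t = 0 \/ t = 1 by move: t01 t1; rewrite negb_and -!leNgt => /andP[? ?] /orP[?|?]; [left|right]; lra.
      by exists k; exact: (edge_vertex _).1.
    by exists k.+1; exact: (edge_vertex _).2.
  exists l; split => //; rewrite lE in hb.
  case ol : (odd l); [right|by left].
  have [B0|//] := eqVneq B 0; exfalso.
  have lE2 : l = (2 * l./2).+1 by rewrite -{1}(odd_double_half l) ol mul2n.
  have [nb _] := odd_vertex l./2 B0; rewrite -lE2 in nb; apply: nb; right; split => //; exact: Ed_vertex.
rewrite lE rot_vertex//.
case ol : (odd l) hl => hl.
  have lE2 : l = (2 * l./2).+1 by rewrite -{1}(odd_double_half l) ol mul2n.
  by rewrite lE2; apply: Hodd; case: hl.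
have lE2 : l = (2 * l./2)%N by rewrite -{1}(odd_double_half l) ol mul2n.
by rewrite lE2; exact: Heven.
Qed.

Lemma turnT_cmod z : ~ bad z -> cmod_at turnT z.
Proof.
move=> nb; have z0 : z != 0 by apply/eqP => z0; apply: nb; left.
have [wc w01 wE wr] := wP.
have c1 : 0 < w z \/ ~ (exists k : int, sigma z = k%:~R).
  have [Ez|nE] := pselect (Ed z); first by right => h; apply: nb; right; split => //; left.
  left; rewrite lt_def; have /andP[-> _] := w01 z; rewrite andbT; apply/eqP => h; apply: nE; exact/wE.
have c2 : B = 0 \/ (0 < w z \/ ~ (exists k : int, sigma z + 2^-1 = k%:~R)).
  have [B0|B0] := eqVneq B 0; [by left|right].
  have [Ez|nE] := pselect (Ed z); first by right => h; apply: nb; right; split => //; right.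
  left; rewrite lt_def; have /andP[-> _] := w01 z; rewrite andbT; apply/eqP => h; apply: nE; exact/wE.
have Phic e : 0 < e -> exists2 d, 0 < d & forall s v, `|s - sigma z| < d -> `|v - w z| < d -> 0 <= v <= 1 ->
    `|Phi s v - Phi (sigma z) (w z)| < e.
  move=> e0; pose K : R := `|A%:~R| + `|B%:~R| + 1.
  have nA := normr_ge0 (A%:~R : R); have nB := normr_ge0 (B%:~R : R).
  have K0 : 0 < K by rewrite /K; lra.
  have e1 : 0 < e * m%:R / K by rewrite !divr_gt0// mulr_gt0.
  have [d1 d10 h1] := fl_cont (w01 z) c1 e1.
  have [d2 d20 h2] : exists2 d, 0 < d & forall s v, `|s - sigma z| < d -> `|v - w z| < d -> 0 <= v <= 1 ->
      `|B%:~R * (fl (s + 2^-1) v - fl (sigma z + 2^-1) (w z))| <= `|B%:~R| * (e * m%:R / K).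
    case: c2 => [B0|c2]; first by exists 1 => // s v _ _ _; rewrite B0 mul0r normr0 mul0r.
    have [d d0 hd] := fl_cont (w01 z) c2 e1; exists d => // s v s1 v1 v01.
    rewrite normrM ler_wpM2l// ltW// hd//.
    by rewrite opprD addrACA subrr addr0.
  exists (Num.min d1 d2); first by rewrite lt_min d10.
  move=> s v; rewrite !lt_min => /andP[s1 s2] /andP[v1 v2] v01.
  have g1 := h1 s v s1 v1 v01; have g2 := h2 s v s2 v2 v01.
  have -> : Phi s v - Phi (sigma z) (w z) = (A%:~R * (fl s v - fl (sigma z) (w z)) + B%:~R * (fl (s + 2^-1) v - fl (sigma z + 2^-1) (w z))) / m%:R.
    by rewrite /Phi; ring.
  rewrite normrM [`|m%:R^-1|]gtr0_norm ?invr_gt0// ltr_pdivrMr//.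
  apply: (le_lt_trans (ler_normD _ _)); rewrite normrM.
  have g3 := ler_wpM2l nA (ltW g1).
  apply: (le_lt_trans (lerD g3 g2)); rewrite -mulrDl mulrA ltr_pdivrMr// mulrC ltr_pM2l ?mulr_gt0//.
  by rewrite /K; lra.
move=> e e0; have [d d0 hd] := Phic e e0.
have n1 := tn_cmod z0 (divr_gt0 d0 np).
have /cvgrPdist_lt/(_ _ d0) n3 := wc z.
apply: filterS (filterI n1 n3) => y [[k hk] wy].
have [l lE] := PhiDn (- (n%:R * (tn y - k%:~R))) (w y) (- k).
exists l; have -> : turnT y = Phi (- (n%:R * (tn y - k%:~R)) + n%:R * (- k)%:~R) (w y).
  by rewrite /turnT /sigma rmorphN /=; congr Phi; ring.
rewrite lE.
have -> : Phi (- (n%:R * (tn y - k%:~R))) (w y) + l%:~R - turnT z - l%:~R = Phi (- (n%:R * (tn y - k%:~R))) (w y) - turnT z by ring.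
apply: hd => //; last by rewrite distrC.
have -> : - (n%:R * (tn y - k%:~R)) - sigma z = - (n%:R * (tn y - tn z - k%:~R)) by rewrite /sigma; ring.
by rewrite normrN normrM gtr0_norm// mulrC -ltr_pdivlMr.
Qed.

Lemma turnT_rot z : z != 0 -> modZ (turnT (rot z)) (turnT z + 1 / m%:R).
Proof.
move=> z0; have wr : w (rot z) = w z by have [_ _ _ h] := wP.
rewrite /turnT wr.
have e : rot z = norm2 z *: turnE (tn z - 1 / n%:R) by rewrite {1}(tnP z0) rot_turnE.
have [k ->] := sigma_polar (norm2_gt0 z0) e; apply: (modZ_trans (PhiDn _ _ _)).
have -> : - (n%:R * (tn z - 1 / n%:R)) = sigma z + 1%:~R by rewrite /sigma; field; exact: n0.
by rewrite PhiD; exact: modZ_refl.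
Qed.

Section Quotient.
Variables (S : surface R) (h : diffeo S S) (q : E -> S).
Hypothesis hS : hausdorff_space S.
Hypothesis qc : {within polygon n, continuous q}.
Hypothesis qs : q @` polygon n = setT.
Hypothesis qe : forall z w, polygon n z -> polygon n w -> (q z = q w <-> polygon_equiv n p z w).
Hypothesis qh : forall z, polygon n z -> h (q z) = q (rot z).

Lemma nonfixed_good z : polygon n z -> h (q z) <> q z -> ~ bad z.
Proof.
move=> pz hz bz; apply: hz; rewrite qh//; symmetry; apply/qe => //; first exact: polygon_rot.
exact: bad_fixed.
Qed.

(** The value is taken at a chosen preimage; identified good points agree modulo 1. For continuity
    at [y], the polygon points not known to have values near that of [y] form a compact set, whose
    image is closed and misses [y]. *)
Lemma theta_ex : exists th : S -> R, (forall y, h y <> y -> cmod_at th y) /\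
  (forall y, h y <> y -> modZ (th (h y)) (th y + 1 / m%:R)).
Proof.
have qsu y : exists z, polygon n z /\ q z = y.
  by have : [set: S] y by []; rewrite -qs => -[z pz <-]; exists z.
have [f fP] := choice qsu.
pose th y := turnT (f y).
have thP z : polygon n z -> h (q z) <> q z -> modZ (th (q z)) (turnT z).
  move=> pz hz; have [pf qf] := fP (q z).
  have [h1 h2] := polygon_equiv_good ((qe pf pz).1 qf).
  by apply: h2; apply: nonfixed_good => //; rewrite qf.
exists th; split; last first.
  move=> y hy; have [pz qz] := fP y; set z := f y in pz qz.
  have hz : h (q z) <> q z by rewrite qz.
  have z0 : z != 0 by apply/eqP => z0; apply: (nonfixed_good pz hz); left.
  have e : h y = q (rot z) by rewrite -qz qh.
  have hh : h (q (rot z)) <> q (rot z).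
    by rewrite -e => /(can_inj (@dfunK _ _ _ h)).
  rewrite e; apply: (modZ_trans (thP _ (polygon_rot n2 pz) hh)).
  exact: turnT_rot.
move=> y hy e e0.
pose U : set E := (\bigcup_(V in [set V : set E | open V /\ forall z, V z -> polygon n z -> nearZ e (turnT z - th y)]) V).
have Uo : open U by apply: bigcup_open => V [].
pose K := polygon n `\` U.
have Kc : compact K.
  apply: subclosed_compact (@polygon_compact R n n2) _; last by move=> z [].
  rewrite /K setDE; apply: closedI; last exact: open_closedC.
  by apply: compact_closed; [exact: norm_hausdorff|exact: polygon_compact].
have qK : closed (q @` K).
  apply: compact_closed => //; apply: continuous_compact => //.
  by apply: continuous_subspaceW qc => z [].
have nK : ~ (q @` K) y.
  move=> [z [pz nU] qz]; apply: nU.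
  have hz : h (q z) <> q z by rewrite qz.
  have : nbhs z [set u | nearZ e (turnT u - turnT z)] := turnT_cmod (nonfixed_good pz hz) e0.
  rewrite nbhsE => -[V [Vo Vz] hV].
  exists V => //; split => // z' /hV hz' _; apply: nearZ_modZ hz'.
  by apply: modZB; [exact: modZ_refl|apply: modZ_sym; rewrite -qz; exact: thP].
have : nbhs y (~` (q @` K)) by apply: open_nbhs_nbhs; split => //; exact: closed_openC.
apply: filterS => y' ny'; have [pz qz] := fP y'.
have [V [_ hV] Vz] : U (f y') by apply: contrapT => nU; apply: ny'; exists (f y').
exact: hV.
Qed.

End Quotient.
End Theta.

(** * Increments around discs with a common centre *)

Lemma compact_inv (X Y : topologicalType) (K : set X) (c : X -> Y) x V : hausdorff_space Y -> compact K ->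
  {within K, continuous c} -> (forall x y, K x -> K y -> c x = c y -> x = y) -> K x -> nbhs x V ->
  exists2 W, nbhs (c x) W & forall z, K z -> W (c z) -> V z.
Proof.
move=> hY Kc cc ci Kx; rewrite nbhsE => -[B [Bo Bx] BV].
have cl : closed (c @` (K `&` ~` B)).
  apply: compact_closed => //; apply: continuous_compact.
    by apply: continuous_subspaceW cc => z [].
  by apply: compact_closedI => //; exact: open_closedC.
exists (~` (c @` (K `&` ~` B))).
  apply: open_nbhs_nbhs; split; first exact: closed_openC.
  by move=> [z [Kz nB] e]; apply: nB; rewrite (ci _ _ Kz Kx e).
by move=> z Kz nz; apply: contrapT => nV; apply: nz; exists z => //; split => // /BV.
Qed.

(** On a compact set a continuous injection is a homeomorphism onto its image. *)
Lemma compact_lift (X Y T : topologicalType) (K : set X) (c : X -> Y) (p : T -> Y) (eta : T -> X) :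
  hausdorff_space Y -> compact K -> {within K, continuous c} ->
  (forall x y, K x -> K y -> c x = c y -> x = y) -> continuous p ->
  (forall t, K (eta t) /\ c (eta t) = p t) -> continuous eta.
Proof.
move=> hY Kc cc ci pc ep t V nV.
have [W cW hW] := compact_inv hY Kc cc ci (ep t).1 nV.
rewrite (ep t).2 in cW; have pW : nbhs t (p @^-1` W) := pc t W cW.
have h s : (p @^-1` W) s -> (eta @^-1` V) s.
  by move=> Ws; apply: hW; [exact: (ep s).1|rewrite (ep s).2].
exact: (filterS h pW).
Qed.

Section Disc.
Variable R : realType.
Local Notation E := (plane R).
Implicit Types S : surface R.

Lemma norm2_ge0 (z : E) : 0 <= norm2 z. Proof. exact: sqrtr_ge0. Qed.

Lemma closed_diskE (z : E) : closed_disk z <-> norm2 z <= 1.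
Proof.
have n0 := norm2_ge0 z; have e := norm2_sqr z.
by split; rewrite /closed_disk /= -e => h; nra.
Qed.

Lemma open_diskE (z : E) : open_disk z <-> norm2 z < 1.
Proof.
have n0 := norm2_ge0 z; have e := norm2_sqr z.
by split; rewrite /open_disk /= -e => h; nra.
Qed.

Lemma circleE (z : E) : circle z <-> norm2 z = 1.
Proof.
have n0 := norm2_ge0 z; have e := norm2_sqr z.
by split; rewrite /circle /= -e => h; nra.
Qed.

Lemma norm2_coord (z : E) : `|z.1| <= norm2 z /\ `|z.2| <= norm2 z.
Proof. by rewrite -2!sqrtr_sqr /norm2; split; apply: ler_wsqrtr; rewrite ?lerDl ?lerDr sqr_ge0. Qed.

Lemma closed_disk_compact : compact (@closed_disk R).
Proof.
apply: (subclosed_compact _ (@compact_cball R 1)).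
  have -> : @closed_disk R = (@norm2 R) @^-1` [set y | y <= 1].
    by apply/seteqP; split=> z /closed_diskE.
  by apply: closed_preim; [exact: norm2_continuous|exact: closed_le].
move=> z /closed_diskE z1; have [h1 h2] := norm2_coord z.
by rewrite /= norm_pair_le (le_trans h1)//= (le_trans h2).
Qed.

Lemma circle_closed : closed (@circle R).
Proof.
have -> : @circle R = (@norm2 R) @^-1` [set 1] by apply/seteqP; split=> z /circleE.
by apply: closed_preim; [exact: norm2_continuous|exact: closed_eq].
Qed.

Lemma circle_closed_disk : @circle R `<=` closed_disk.
Proof. by move=> z /circleE z1; apply/closed_diskE; rewrite z1. Qed.

Lemma open_closed_disk : @open_disk R `<=` closed_disk.
Proof. by move=> z /open_diskE z1; apply/closed_diskE; exact: ltW. Qed.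

Lemma circle_compact : compact (@circle R).
Proof.
apply: (subclosed_compact circle_closed closed_disk_compact); exact: circle_closed_disk.
Qed.

Lemma open_disk_open : open (@open_disk R).
Proof.
have -> : @open_disk R = (@norm2 R) @^-1` [set y | y < 1].
  by apply/seteqP; split=> z /open_diskE.
by apply: open_comp; [move=> z _; exact: norm2_continuous|exact: open_lt].
Qed.

Lemma norm20 : norm2 (0 : E) = 0.
Proof. by rewrite /norm2 /= expr0n /= addr0 sqrtr0. Qed.

Lemma norm2_nbhs (V : set E) : nbhs (0 : E) V -> exists2 r, 0 < r & forall z, norm2 z < r -> V z.
Proof.
move=> /nbhs_ballP[r /= r0 hr]; exists r => // z zr; apply: hr.
rewrite -ball_normE /= sub0r normrN norm_pair_lt.
by have [h1 h2] := norm2_coord z; rewrite (le_lt_trans h1)//= (le_lt_trans h2).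
Qed.

(** Openness comes from the nonzero Jacobian, through [sdiff_open]. *)
Lemma embed_open (S T : surface R) (U : set S) (f : S -> T) x V : oriented_embedding U f -> U x ->
  nbhs x V -> nbhs (f x) (f @` V).
Proof.
move=> [Uo fs fo _] Ux xV.
have [hc _ _] := atlasP S; have [hd _ _] := atlasP T.
have [c cA cx] := hc x; have [d dA dx] := hd (f x).
have [A [csA A0]] := embed_csd Uo fs fo Ux cA dA cx dx.
by apply: (csd_open csA _ xV); rewrite gt_eqF.
Qed.

Lemma embed_cont (S T : surface R) (U : set S) (f : S -> T) x : oriented_embedding U f -> U x ->
  {for x, continuous f}.
Proof. by move=> [_ [fc _] _ _]; exact: fc. Qed.

Lemma embed_within (S T : surface R) (U A : set S) (f : S -> T) : oriented_embedding U f -> A `<=` U ->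
  {within A, continuous f}.
Proof.
move=> fe AU; apply/withinP => x Ax V nV; exists (f @^-1` V); split => //.
exact: (embed_cont fe (AU _ Ax)).
Qed.

(** Pushing the loop radially onto the unit circle is a homotopy inside the punctured disc. *)
Lemma radial_incr (nu : E -> R) (rho : R -> R) (eta : R -> E) w :
  (forall z, closed_disk z -> z != 0 -> cmod_at nu z) -> continuous rho -> (forall t, 0 < rho t <= 1) ->
  rho 0 = rho 1 -> continuous eta -> (forall t, circle (eta t)) -> eta 0 = eta 1 ->
  incr (fun t => nu (rho t *: eta t)) w -> incr (nu \o eta) w.
Proof.
move=> nuc rc r01 r0 ec ecirc e0 iw.
have nE s t : 0 < s <= 1 -> closed_disk (s *: eta t) /\ s *: eta t != 0.
  move=> /andP[s0 s1]; have e1 := norm2_circle (ecirc t); split.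
    by apply/closed_diskE; rewrite (norm2Z _ (ltW s0)) e1 mulr1.
  by rewrite scaler_eq0 negb_or gt_eqF//= (circle_neq0 (ecirc t)).
have etac t : cmod_at (nu \o eta) t.
  apply: cmod_comp; first exact: ec.
  have := nE 1 t; rewrite scale1r => /(_ _)[|h1 h2]; first by rewrite ltr01 lexx.
  exact: nuc.
have [w' iw'] := incr_ex etac.
pose c := @clamp R 0 1.
pose H (q : R * R) := nu ((c q.1 + (1 - c q.1) * rho q.2) *: eta q.2).
have c01 s : 0 <= c s <= 1 by apply: clamp_itv.
have Hc q : cmod_at H q.
  have b : 0 < c q.1 + (1 - c q.1) * rho q.2 <= 1 by have := c01 q.1; have := r01 q.2; nra.
  have [h1 h2] := nE _ q.2 b.
  apply: (@cmod_comp _ _ _ nu (fun q : R * R => (c q.1 + (1 - c q.1) * rho q.2) *: eta q.2)); last exact: nuc.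
  have f1 : {for q, continuous (fun q : R * R => c q.1)}.
    by apply: (@continuous_comp _ _ _ fst c); [exact: cvg_fst|exact: clamp_continuous].
  have f2 : {for q, continuous (fun q : R * R => rho q.2)}.
    by apply: (@continuous_comp _ _ _ snd rho); [exact: cvg_snd|exact: rc].
  have f3 : {for q, continuous (fun q : R * R => eta q.2)}.
    by apply: (@continuous_comp _ _ _ snd eta); [exact: cvg_snd|exact: ec].
  have f0 : {for q, continuous (fun q : R * R => 1 : R)} by exact: cst_continuous.
  exact: (cvgZ (cvgD f1 (cvgM (cvgB f0 f1) f2)) f3).
have -> // : w = w'.
apply: (incr_homotopy Hc).
- by move=> s _; rewrite /H /= r0 e0; exact: modZ_refl.
- apply: incr_eq iw => t _; rewrite /H /= /c clamp_id ?lexx ?ler01// add0r subr0 mul1r; exact: modZ_refl.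
- apply: incr_eq iw' => t _; rewrite /H /= /c clamp_id ?lexx ?ler01// subrr mul0r addr0 scale1r; exact: modZ_refl.
Qed.

Definition disk_embedding S (d : plane_surface R -> S) :=
  exists U : set (plane_surface R), (closed_disk : set E) `<=` U /\ oriented_embedding U d.

Lemma disc_inj S (d : plane_surface R -> S) z w : disk_embedding d -> closed_disk z -> closed_disk w -> d z = d w -> z = w.
Proof. by move=> [U [DU [_ _ _ i]]] /DU Uz /DU Uw; exact: i. Qed.

Lemma disc_cont S (d : plane_surface R -> S) z : disk_embedding d -> closed_disk z -> {for z, continuous d}.
Proof. by move=> [U [DU e]] /DU Uz; exact: (embed_cont e Uz). Qed.

Lemma disc_within S (d : plane_surface R -> S) : disk_embedding d -> {within (closed_disk : set E), continuous d}.
Proof. by move=> [U [DU e]]; exact: (embed_within e DU). Qed.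

Lemma disk_embedding_nbhs S (d : plane_surface R -> S) z (V : set E) : disk_embedding d -> closed_disk z -> nbhs z V ->
  nbhs (d z) (d @` V).
Proof. by move=> [U [DU e]] /DU Uz; exact: (embed_open e Uz). Qed.

Lemma closed_disk0 : closed_disk (0 : E).
Proof. by apply/closed_diskE; rewrite norm20 ler01. Qed.

Lemma disc_cmod S (d : plane_surface R -> S) (th : S -> R) : disk_embedding d ->
  (forall z, closed_disk z -> z != 0 -> cmod_at th (d z)) ->
  forall z : E, closed_disk z -> z != 0 -> cmod_at (th \o d) z.
Proof. by move=> dd thc z zc z0; apply: cmod_comp; [exact: disc_cont|exact: thc]. Qed.

Lemma turnE01 : @turnE R 0 = turnE 1. Proof. by rewrite turnE1. Qed.

(* The inclusion of a small circle of the second disc into the first one. *)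
Lemma disc_incr_mul S (d1 d2 : plane_surface R -> S) (th : S -> R) w1 w2 : hausdorff_space S -> disk_embedding d1 -> disk_embedding d2 ->
  d1 0 = d2 0 ->
  (forall z, closed_disk z -> z != 0 -> cmod_at th (d1 z)) ->
  (forall z, closed_disk z -> z != 0 -> cmod_at th (d2 z)) ->
  incr (fun t => th (d1 (turnE t))) w1 -> incr (fun t => th (d2 (turnE t))) w2 -> exists k : int, w2 = w1 * k%:~R.
Proof.
move=> hS D1 D2 e12 c1 c2 i1 i2.
have nu1c := disc_cmod D1 c1; have nu2c := disc_cmod D2 c2.
have n1 : nbhs (d2 0) (d1 @` (open_disk : set E)).
  rewrite -e12; apply: (disk_embedding_nbhs D1 closed_disk0).
  by apply: open_nbhs_nbhs; split; [exact: open_disk_open|apply/open_diskE; rewrite norm20 ltr01].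
have [r0 r00 hr0] := norm2_nbhs (disc_cont D2 closed_disk0 n1).
pose r := Num.min (r0 / 2) 1.
have rr : 0 < r by rewrite /r lt_min ltr01 divr_gt0.
have r1 : r <= 1 by rewrite /r ge_min lexx orbT.
have r2 : r < r0 by rewrite /r gt_min; apply/orP; left; lra.
have nt t : norm2 (r *: turnE t) = r by rewrite norm2Z ?ltW// (norm2_circle (turnE_circle t)) mulr1.
have rt0 t : r *: turnE t != 0 :> E by rewrite scaler_eq0 negb_or gt_eqF//= (circle_neq0 (turnE_circle t)).
have rtc t : closed_disk (r *: turnE t : E) by apply/closed_diskE; rewrite nt.
have rtcont : continuous (fun t => r *: turnE t : E).
  by move=> t; apply: cvgZl_tmp; exact: turnE_continuous.
pose p t := d2 (r *: turnE t).
have pc : continuous p.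
  by move=> t; apply: (@continuous_comp _ _ _ (fun t => r *: turnE t : E) d2); [exact: rtcont|exact: disc_cont].
have ex t : exists z : E, open_disk z /\ d1 z = p t.
  by have [z zo ze] := hr0 (r *: turnE t) (eq_ind_r (fun x => x < r0) r2 (nt t)); exists z.
have [zeta zP] := choice ex.
have zcl t : closed_disk (zeta t) by apply: open_closed_disk; exact: (zP t).1.
have zc : continuous zeta.
  apply: (@compact_lift E S R closed_disk d1 p zeta hS closed_disk_compact (disc_within D1)) => //.
    by move=> x y cx cy; exact: disc_inj.
  by move=> t; split => //; exact: (zP t).2.
have z0 t : zeta t != 0.
  apply/eqP => z0; have := (zP t).2; rewrite z0 e12 => /(disc_inj D2 closed_disk0 (rtc t)) e.
  by move: (rt0 t); rewrite -e eqxx.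
have z01 : zeta 0 = zeta 1.
  by apply: (disc_inj D1) => //; rewrite !(zP _).2 /p turnE01.
pose rho t := norm2 (zeta t).
have rho0 t : 0 < rho t by exact: norm2_gt0.
have rhoc : continuous rho by apply: (continuous_compT zc); exact: norm2_continuous.
pose eta t := (rho t)^-1 *: zeta t : E.
have ec : continuous eta.
  move=> t; have h1 : {for t, continuous (fun t => (rho t)^-1)}.
    by apply: cvgV; [rewrite gt_eqF|exact: rhoc].
  exact: (cvgZ h1 (zc t)).
have ecirc t : circle (eta t) by exact: circle_unit.
have e01 : eta 0 = eta 1 by rewrite /eta /rho z01.
have rezE t : rho t *: eta t = zeta t by rewrite scalerA divff ?scale1r// gt_eqF.
have isr : incr (fun t => (th \o d2) (r *: turnE t)) w2.
  have [w iw] := @incr_ex R (fun t => (th \o d2) (r *: turnE t)) (fun t => cmod_comp (rtcont t) (nu2c _ (rtc t) (rt0 t))).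
  have rcst : continuous (fun _ : R => r) by move=> ?; exact: cst_continuous.
  have := @radial_incr (th \o d2) (fun _ => r) (@turnE R) w nu2c rcst (fun _ => introT andP (conj rr r1)) erefl (@turnE_continuous R) (@turnE_circle R) turnE01 iw.
  by move=> /incr_uniq/(_ i2) <-.
have ie : incr ((th \o d1) \o eta) w2.
  apply: (radial_incr nu1c rhoc _ _ ec ecirc e01).
  - by move=> t; rewrite rho0 /=; apply/closed_diskE.
  - by rewrite /rho z01.
  - by apply: incr_eq isr => t _; rewrite rezE /= (zP t).2; exact: modZ_refl.
have [kr ikr] := @incr_ex R (@tn R \o eta) (fun t => cmod_comp (ec t) (tn_cmod (circle_neq0 (ecirc t)))).
have [k kE] : exists k : int, kr = k%:~R.
  by apply: (incr_loop_int ikr); rewrite /= e01; exact: modZ_refl.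
by exists k; rewrite -kE; apply: incr_uniq ie _; apply: (circle_degree ec e01 ecirc _ ikr).
Qed.

Lemma pm_of_mul (w w' : R) (k k' : int) : w' = w * k%:~R -> w = w' * k'%:~R -> w' = w \/ w' = - w.
Proof.
move=> e e'; have [w0|w0] := eqVneq w 0; first by left; rewrite e w0 mul0r.
have kk : k * k' = 1.
  apply/eqP; rewrite -(@eqr_int R) rmorphM; apply/eqP/(mulfI w0).
  by rewrite mulrA -e -e' mulr1.
have ak : (absz k * absz k' = 1)%N by rewrite -abszM kk.
have {}ak : absz k = 1%N by move/eqP: ak; rewrite muln_eq1 => /andP[/eqP].
have [k1|k1] : k = 1 \/ k = -1 by lia.
  by left; rewrite e k1 mulr1.
by right; rewrite e k1 mulrN1.
Qed.

(** Each increment is an integer multiple of the other, which leaves only a sign. *)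
Lemma disc_incr S (d1 d2 : plane_surface R -> S) (th : S -> R) w1 w2 : hausdorff_space S -> disk_embedding d1 -> disk_embedding d2 ->
  d1 0 = d2 0 ->
  (forall z, closed_disk z -> z != 0 -> cmod_at th (d1 z)) ->
  (forall z, closed_disk z -> z != 0 -> cmod_at th (d2 z)) ->
  incr (fun t => th (d1 (turnE t))) w1 -> incr (fun t => th (d2 (turnE t))) w2 -> w2 = w1 \/ w2 = - w1.
Proof.
move=> hS D1 D2 e12 c1 c2 i1 i2.
have [k kE] := disc_incr_mul hS D1 D2 e12 c1 c2 i1 i2.
have [k' kE'] := disc_incr_mul hS D2 D1 (esym e12) c2 c1 i2 i1.
exact: pm_of_mul kE kE'.
Qed.

(* Two parametrizations of a curve differ by a homeomorphism of the circle, of degree [1] or [-1]. *)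
Lemma reparam_incr (T : topologicalType) (c c' : E -> T) C (nu : E -> R) w w' : hausdorff_space T ->
  parametrizes c C -> parametrizes c' C -> incr (nu \o @turnE R) w ->
  (forall eta : R -> E, (forall t, circle (eta t) /\ c (eta t) = c' (turnE t)) -> incr (nu \o eta) w') ->
  w' = w \/ w' = - w.
Proof.
move=> hT.
have key (c1 c2 : E -> T) : parametrizes c1 C -> parametrizes c2 C -> exists f : E -> E,
    (forall z, circle z -> circle (f z) /\ c1 (f z) = c2 z) /\ continuous (f \o @turnE R).
  move=> [cc1 i1 C1] [cc2 i2 C2].
  have ex z : exists z' : E, circle z -> circle z' /\ c1 z' = c2 z.
    have [cz|] := pselect (circle z); last by exists 0.
    have : C (c2 z) by rewrite -C2; exists z.
    by rewrite -C1 => -[z' cz' e]; exists z'.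
  have [f fP] := choice ex; exists f; split => //.
  apply: (@compact_lift E T R circle c1 (c2 \o @turnE R) _ hT circle_compact cc1 i1).
    apply: (within_comp cc2); [exact: turnE_continuous|exact: turnE_circle].
  by move=> t; apply: fP; exact: turnE_circle.
move=> pc pc' iw h.
have [f [fP fc]] := key c c' pc pc'; have [g [gP gc]] := key c' c pc' pc.
have fcirc t : circle ((f \o @turnE R) t) by have [] := fP _ (turnE_circle t).
have gcirc t : circle ((g \o @turnE R) t) by have [] := gP _ (turnE_circle t).
have f01 : (f \o @turnE R) 0 = (f \o @turnE R) 1 by rewrite /= turnE01.
have g01 : (g \o @turnE R) 0 = (g \o @turnE R) 1 by rewrite /= turnE01.
have [kr ikr] := @incr_ex R (@tn R \o (f \o @turnE R)) (fun t => cmod_comp (fc t) (tn_cmod (circle_neq0 (fcirc t)))).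
have [lr ilr] := @incr_ex R (@tn R \o (g \o @turnE R)) (fun t => cmod_comp (gc t) (tn_cmod (circle_neq0 (gcirc t)))).
have [k kE] : exists k : int, kr = k%:~R.
  by apply: (incr_loop_int ikr); rewrite /= turnE01; exact: modZ_refl.
have [l lE] : exists l : int, lr = l%:~R.
  by apply: (incr_loop_int ilr); rewrite /= turnE01; exact: modZ_refl.
(* The two changes of parameter are inverse to each other, so their degrees have product 1. *)
have kl : kr * lr = 1.
  have h1 : incr ((@tn R \o f) \o (g \o @turnE R)) (kr * lr).
    exact: (circle_degree gc g01 gcirc ikr ilr).
  apply: incr_uniq h1 _; apply: incr_eq (@incr_tn_turnE R) => t _ /=.
  have [cg eg] := gP _ (turnE_circle t); have [cf ef] := fP _ cg.
  suff -> : f (g (turnE t)) = turnE t by exact: modZ_refl.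
  by have [_ i _] := pc; apply: i => //; [exact: turnE_circle|rewrite ef eg].
have e1 : w' = w * kr.
  apply: incr_uniq (h (f \o @turnE R) _) _; first by move=> t; apply: fP; exact: turnE_circle.
  exact: (circle_degree fc f01 fcirc iw ikr).
by apply: (@pm_of_mul w w' k l); rewrite -?kE -?lE // e1 -mulrA kl mulr1.
Qed.

End Disc.

(** * Gluing functions modulo 1 along circles *)

(** At a maximum of [f] on the curve, [f (F x) - f x] is at most 0, and at a minimum it is at least
    0. So it vanishes somewhere and [a] is an integer; being then continuous and integer valued, the
    difference is 0 everywhere. *)
Lemma shift_cst (R : realType) (T : topologicalType) (C : set T) (p : R -> T) (F : T -> T) (f : T -> R) (a : R) :
  continuous p -> (forall t, C (p t)) -> (forall x, C x -> exists2 t, 0 <= t <= 1 & p t = x) ->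
  continuous F -> (forall x, C x -> C (F x)) -> {within C, continuous f} ->
  (forall x, C x -> modZ (f (F x)) (f x + a)) -> modZ a 0 /\ forall x, C x -> f (F x) = f x.
Proof.
move=> pc pC pS Fc FC fc fa.
pose u := f \o p; have uc : continuous u := within_comp fc pc pC.
pose v := f \o (F \o p).
have vc : continuous v.
  by apply: (within_comp fc) => [|t]; [exact: (continuous_compT pc Fc)|exact: FC].
pose g t := v t - u t.
have gc : continuous g by move=> t; apply: cvgB; [exact: vc|exact: uc].
have [c c01 cM] := @EVT_max R u 0 1 ler01 (continuous_subspaceT uc).
have [d d01 dM] := @EVT_min R u 0 1 ler01 (continuous_subspaceT uc).
have gM : g c <= 0.
  have [t t01 e] := pS _ (FC _ (pC c)).
  by rewrite /g /v /= -e subr_le0; apply: cM; rewrite in_itv.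
have gm : 0 <= g d.
  have [t t01 e] := pS _ (FC _ (pC d)).
  by rewrite /g /v /= -e subr_ge0; apply: dM; rewrite in_itv.
have ivt s t y : g s <= y <= g t -> exists r, g r = y.
  move=> /andP[h1 h2]; have [st|ts] := leP s t.
    have [|r _ e] := @IVT R g s t y st (continuous_subspaceT gc); last by exists r.
    by rewrite ge_min h1 le_max h2 orbT.
  have [|r _ e] := @IVT R g t s y (ltW ts) (continuous_subspaceT gc); last by exists r.
  by rewrite ge_min h1 le_max h2 ?orbT.
have [t0 gt0] := ivt c d 0 (introT andP (conj gM gm)).
have ga t : modZ (g t) a.
  have [k e] := fa (p t) (pC t); exists k; rewrite /g /v /u /= e; ring.
have a0 : modZ a 0 by apply: modZ_sym; rewrite -gt0; exact: ga.
split => // x Cx; have [t t01 <-] := pS x Cx.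
suff : g t = 0 by move/eqP; rewrite subr_eq0 => /eqP.
have [k kE] : exists k : int, g t = k%:~R.
  by have [k ->] := modZ_trans (ga t) a0; exists k; rewrite add0r.
have half y : y = 2^-1 \/ y = - 2^-1 -> forall r, g r <> y.
  move=> hy r e; have [l lE] := modZ_trans (ga r) a0; rewrite add0r in lE.
  have : (2 * l)%:~R = 1 :> R \/ (2 * l)%:~R = -1 :> R.
    by rewrite rmorphM /= -lE e; case: hy => ->; [left|right]; lra.
  by move=> [/(@intr_inj R (2 * l) 1)|/(@intr_inj R (2 * l) (-1))]; lia.
have [k0|k0] := eqVneq k 0; first by rewrite kE k0.
exfalso; have [kp|kn] : (1 <= k) \/ (k <= -1) by lia.
  have h : 1 <= k%:~R :> R by rewrite ler1z.
  have [|r e] := ivt t0 t 2^-1; first by rewrite gt0 kE; apply/andP; split; lra.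
  by apply: (half 2^-1 _ r e); left.
have h : k%:~R <= -1 :> R by rewrite -[-1]/((-1)%:~R) ler_int.
have [|r e] := ivt t t0 (- 2^-1); first by rewrite gt0 kE; apply/andP; split; lra.
by apply: (half (- 2^-1) _ r e); right.
Qed.

(** Continuity modulo 1 relative to [B], since on a gluing circle each piece is only a one-sided
    neighbourhood. *)
Definition cmodin (R : realType) (T : topologicalType) (B : set T) (phi : T -> R) (x : T) :=
  forall e, 0 < e -> exists2 U, nbhs x U & forall y, U y -> B y -> nearZ e (phi y - phi x).

Lemma cmodin_comp (R : realType) (X T : topologicalType) (B : set T) (phi : T -> R) (p : X -> T) :
  (forall y, B y -> cmodin B phi y) -> continuous p -> (forall t, B (p t)) -> forall t, cmod_at (phi \o p) t.
Proof.
move=> h pc pB t e e0; have [U nU hU] := h _ (pB t) e e0.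
have pU : nbhs t (p @^-1` U) := pc t U nU.
have hh s : (p @^-1` U) s -> nearZ e ((phi \o p) s - (phi \o p) t) by move=> Us; apply: hU.
exact: (filterS hh pU).
Qed.

Section Discs.
Variables (R : realType) (S1 : surface R) (r : nat) (f : S1 -> S1) (x : 'I_r -> S1) (d : 'I_r -> plane_surface R -> S1).
Hypothesis fc : continuous f.
Hypothesis fi : injective f.
Hypothesis inv : invariant_disks f x d.
Local Notation E := (plane R).

Lemma inv_disc i : disk_embedding (d i). Proof. by have [h _ _ _] := inv; exact: h. Qed.

Lemma disc_open_image i : open (d i @` (open_disk : set E)).
Proof.
rewrite openE => _ [z zo <-]; apply: (disk_embedding_nbhs (inv_disc i)); first exact: open_closed_disk.
by apply: open_nbhs_nbhs; split => //; exact: open_disk_open.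
Qed.

Lemma removed_closed : closed (disks_removed d).
Proof. by apply: open_closedC; apply: bigcup_open => i _; exact: disc_open_image. Qed.

Lemma circle_not_open (z : E) : circle z -> ~ open_disk z.
Proof. by move=> /circleE z1 /open_diskE; rewrite z1 ltxx. Qed.

Lemma discs_disjoint i j z w : closed_disk z -> closed_disk w -> d i z = d j w -> i = j.
Proof.
move=> cz cw e; apply: contrapT => ij; have [_ _ _ h] := inv.
suff : (d i @` (closed_disk : set E) `&` d j @` (closed_disk : set E)) (d i z) by rewrite h.
by split; [exists z|exists w].
Qed.

Lemma circle_removed i z : circle z -> disks_removed d (d i z).
Proof.
move=> cz [j _ [w wo e]]; have cw := open_closed_disk wo; have cz' := circle_closed_disk cz.
have ij := discs_disjoint cw cz' e; rewrite ij in e.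
by apply: (circle_not_open cz); rewrite -(disc_inj (inv_disc i) cw cz' e).
Qed.

Lemma disc_preimage i y w : closed_disk w -> f y = d i w -> exists2 z, closed_disk z & d i z = y.
Proof.
move=> cw e; have [_ _ h _] := inv.
have : (f @` (d i @` (closed_disk : set E))) (f y) by rewrite h e; exists w.
by move=> [_ [z cz <-] /fi e']; exists z.
Qed.

Lemma not_nbhs_closed_disk (z : E) : circle z -> ~ nbhs z (closed_disk : set E).
Proof.
move=> cz nz; pose l (s : R) : E := (1 + s) *: z.
have lc : continuous l.
  move=> s; have h1 : {for s, continuous (fun s : R => 1 + s)} by apply: cvgD; [exact: cvg_cst|exact: cvg_id].
  exact: (cvgZr_tmp h1).
have l0 : l 0 = z by rewrite /l addr0 scale1r.
rewrite -l0 in nz; have nl : nbhs (0 : R) (l @^-1` closed_disk) := lc 0 _ nz.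
have [q /= q0 hq] := (nbhs_ballP _ _).1 nl.
have b : ball (0 : R) q (q / 2) by rewrite -ball_normE /= sub0r normrN gtr0_norm ?divr_gt0//; lra.
have /closed_diskE := hq _ b.
have q1 : 0 <= 1 + q / 2 by lra.
rewrite /l (norm2Z _ q1) (norm2_circle cz) mulr1; lra.
Qed.

(** The invariance hypothesis concerns the closed disc as a set. If a boundary point went into the
    open disc, pulling the open disc back by [f] would make the closed disc a neighbourhood of that
    boundary point. *)
Lemma circle_inv i z : circle z -> exists2 z', circle z' & f (d i z) = d i z'.
Proof.
move=> cz; have cz' := circle_closed_disk cz; have [_ _ h _] := inv.
have : (d i @` (closed_disk : set E)) (f (d i z)) by rewrite -h; exists (d i z) => //; exists z.
move=> [w cw e]; have [w1|w1] := eqVneq (norm2 w) 1; first by exists w => //; apply/circleE.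
have wo : open_disk w by apply/open_diskE; rewrite lt_neqAle w1 /=; apply/closed_diskE.
exfalso; have nw : nbhs (f (d i z)) (d i @` (open_disk : set E)).
  by apply: open_nbhs_nbhs; split; [exact: disc_open_image|exists w].
have nz : nbhs (d i z) (f @^-1` (d i @` (open_disk : set E))) := fc nw.
have nz2 : nbhs z (d i @^-1` (f @^-1` (d i @` (open_disk : set E)))) := disc_cont (inv_disc i) cz' nz.
have [U [DU [Uo _ _ Ui]]] := inv_disc i.
have nU : nbhs z U by apply: open_nbhs_nbhs; split => //; exact: DU.
apply: (not_nbhs_closed_disk cz).
have hh (u : E) : ((d i @^-1` (f @^-1` (d i @` (open_disk : set E)))) `&` U) u -> closed_disk u.
  move=> [[v vo ve] Uu].
  have [u' cu' eu] := disc_preimage (open_closed_disk vo) (esym ve).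
  by rewrite -(Ui _ _ (DU _ cu') Uu eu).
exact: (filterS hh (filterI nz2 nU)).
Qed.

Lemma removed_inv y : disks_removed d y -> disks_removed d (f y).
Proof.
move=> Ay [i _ [w wo e]].
have [z cz ez] := disc_preimage (open_closed_disk wo) (esym e).
have z1 : circle z.
  apply/circleE; apply/eqP; apply: contrapT => /negP z1; apply: Ay; exists i => //; exists z => //.
  by apply/open_diskE; rewrite lt_neqAle z1 /=; apply/closed_diskE.
have [z' cz' e'] := circle_inv i z1; rewrite ez -e in e'.
apply: (circle_not_open cz').
by rewrite -(disc_inj (inv_disc i) (open_closed_disk wo) (circle_closed_disk cz') e').
Qed.

Lemma removed_neq y i : disks_removed d y -> y <> x i.
Proof.
move=> Ay e; have [_ h _ _] := inv; apply: Ay; exists i => //; exists 0; last by rewrite h.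
by apply/open_diskE; rewrite norm20 ltr01.
Qed.

Lemma disc_neq i j z : closed_disk z -> z != 0 -> d i z <> x j.
Proof.
move=> cz z0; have [_ <- _ _] := inv => e.
have ij := discs_disjoint cz (@closed_disk0 R) e; rewrite ij in e.
by move: z0; rewrite (disc_inj (inv_disc j) cz (@closed_disk0 R) e) eqxx.
Qed.

Section Piece.
Variables (S : surface R) (F : S -> S) (e : S1 -> S) (th : S1 -> R) (a : R).
Hypothesis cS1 : compact [set: S1].
Hypothesis hS : hausdorff_space S.
Hypothesis ge : glued_piece f d F e.
Hypothesis thc : forall y, (forall i, y <> x i) -> cmod_at th y.
Hypothesis tha : forall y, (forall i, y <> x i) -> modZ (th (f y)) (th y + a).
Local Notation A := (disks_removed d).
Local Notation B := (e @` A).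

Lemma piece_inj y z : A y -> A z -> e y = e z -> y = z.
Proof. by have [[U [AU [_ _ _ i]]] _] := ge => /AU Uy /AU Uz; exact: i. Qed.

Lemma piece_within : {within A, continuous e}.
Proof. by have [[U [AU ee]] _] := ge; exact: (embed_within ee AU). Qed.

Lemma piece_compact : compact A.
Proof. by apply: (subclosed_compact removed_closed cS1). Qed.

Lemma piece_closed : closed B.
Proof.
by apply: compact_closed => //; apply: continuous_compact; [exact: piece_within|exact: piece_compact].
Qed.

Lemma piece_ex : exists phi : S -> R, [/\ forall z, A z -> phi (e z) = th z,
  forall y, B y -> cmodin B phi y & forall y, B y -> B (F y) /\ modZ (phi (F y)) (phi y + a)].
Proof.
have ex y : exists v : R, forall z, A z -> e z = y -> v = th z.
  have [[z Az zy]|n] := pselect (exists2 z, A z & e z = y); last first.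
    by exists 0 => z Az zy; case: n; exists z.
  by exists (th z) => z' Az' z'y; congr th; apply: piece_inj => //; rewrite zy.
have [phi hphi] := choice ex.
have phiE z : A z -> phi (e z) = th z by move=> Az; exact: hphi.
exists phi; split => //.
  move=> _ [z Az <-] q q0.
  have nz : forall i, z <> x i by move=> i; exact: removed_neq.
  have [W nW hW] := compact_inv hS piece_compact piece_within piece_inj Az (thc nz q0).
  exists W => //; move=> y' Wy [z' Az' ey]; move: Wy; rewrite -ey !phiE//; exact: hW.
move=> _ [z Az <-]; have [_ ->] := ge => //; have fz := removed_inv Az.
split; first by exists (f z).
by rewrite !phiE//; apply: tha => i; exact: removed_neq.
Qed.

Lemma piece_param i : parametrizes (e \o d i) (e @` boundary_circle d i).
Proof.
split.
- apply/withinP => z cz V nV.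
  have [U [AU ee]] := ge.1.
  have ce : {for d i z, continuous e} := embed_cont ee (AU _ (circle_removed cz)).
  have cd := disc_cont (inv_disc i) (circle_closed_disk cz).
  by exists ((e \o d i) @^-1` V); split => //; exact: (continuous_comp cd ce nV).
- move=> z w cz cw /piece_inj h.
  apply: (disc_inj (inv_disc i)); [exact: circle_closed_disk|exact: circle_closed_disk|].
  by apply: h; exact: circle_removed.
- by rewrite /boundary_circle image_comp.
Qed.

Lemma piece_circle_inv i y : (e @` boundary_circle d i) y -> (e @` boundary_circle d i) (F y).
Proof.
move=> [_ [z cz <-] <-]; have [_ ->] := ge; last exact: circle_removed.
by have [z' cz' ->] := circle_inv i cz; exists (d i z') => //; exists z'.
Qed.

Lemma piece_circle_sub i : e @` boundary_circle d i `<=` B.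
Proof. by move=> _ [_ [z cz <-] <-]; exists (d i z) => //; exact: circle_removed. Qed.

Lemma piece_circle_disj i j y : (e @` boundary_circle d i) y -> (e @` boundary_circle d j) y -> i = j.
Proof.
move=> [_ [z cz <-] <-] [_ [w cw <-] e'].
apply: (@discs_disjoint i j z w); [exact: circle_closed_disk|exact: circle_closed_disk|].
by apply: piece_inj; [exact: circle_removed|exact: circle_removed|].
Qed.

End Piece.
End Discs.

Section Glue.
Variables (R : realType) (S1 S : surface R) (m r : nat) (f1 f2 : S1 -> S1) (x : 'I_r -> S1)
  (d1 d2 : 'I_r -> plane_surface R -> S1) (e1 e2 : S1 -> S) (F : S -> S) (th : S1 -> R).
Hypotheses (cS1 : compact [set: S1]) (hS1 : hausdorff_space S1) (cS : compact [set: S]) (hS : hausdorff_space S).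
Hypothesis m2 : (2 < m)%N.
Hypotheses (f1c : continuous f1) (f1i : injective f1) (f2c : continuous f2) (f2i : injective f2).
Hypotheses (inv1 : invariant_disks f1 x d1) (inv2 : invariant_disks f2 x d2).
Hypotheses (ge1 : glued_piece f1 d1 F e1) (ge2 : glued_piece f2 d2 F e2) (Fc : continuous F).
Hypothesis thc : forall y, (forall i, y <> x i) -> cmod_at th y.
Hypothesis th1 : forall y, (forall i, y <> x i) -> modZ (th (f1 y)) (th y + 1 / m%:R).
Hypothesis th2 : forall y, (forall i, y <> x i) -> modZ (th (f2 y)) (th y - 1 / m%:R).
Local Notation E := (plane R).
Local Notation A1 := (disks_removed d1).
Local Notation A2 := (disks_removed d2).
Local Notation B1 := (e1 @` A1).
Local Notation B2 := (e2 @` A2).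
Local Notation C i := (e1 @` boundary_circle d1 i).
Hypothesis C12 : forall i, C i = e2 @` boundary_circle d2 i.
Hypothesis Bcover : B1 `|` B2 = setT.
Hypothesis BI : B1 `&` B2 = \bigcup_i C i.

Section WithPhi.
Variables phi1 phi2 : S -> R.
Hypothesis p1E : forall z, A1 z -> phi1 (e1 z) = th z.
Hypothesis p1c : forall y, B1 y -> cmodin B1 phi1 y.
Hypothesis p1s : forall y, B1 y -> B1 (F y) /\ modZ (phi1 (F y)) (phi1 y + 1 / m%:R).
Hypothesis p2E : forall z, A2 z -> phi2 (e2 z) = - th z.
Hypothesis p2c : forall y, B2 y -> cmodin B2 phi2 y.
Hypothesis p2s : forall y, B2 y -> B2 (F y) /\ modZ (phi2 (F y)) (phi2 y + 1 / m%:R).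

(* If the two functions turned in opposite directions along the curve, their sum would lift to
   a real function that [F] shifts by a number congruent to [2 / m]. *)
Lemma circle_lift i : exists g : S -> R, [/\ {within C i, continuous g},
  forall y, C i y -> modZ (phi1 y - phi2 y) (g y) & forall y, C i y -> g (F y) = g y].
Proof.
have par1 := piece_param inv1 ge1 i; have par2 := piece_param inv2 ge2 i; rewrite -C12 in par2.
have D1 := inv_disc inv1 i; have D2 := inv_disc inv2 i.
have e12 : d1 i 0 = d2 i 0 by have [_ -> _ _] := inv1; have [_ -> _ _] := inv2.
have k1 (z : E) : closed_disk z -> z != 0 -> cmod_at th (d1 i z).
  by move=> cz z0; apply: thc => j; exact: (disc_neq inv1 cz z0).
have k2 (z : E) : closed_disk z -> z != 0 -> cmod_at th (d2 i z).
  by move=> cz z0; apply: thc => j; exact: (disc_neq inv2 cz z0).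
pose p := (e1 \o d1 i) \o @turnE R.
have pc : continuous p.
  by have [wc _ _] := par1; apply: (within_comp wc); [exact: turnE_continuous|exact: turnE_circle].
have pC t : C i (p t).
  by exists (d1 i (turnE t)) => //; exists (turnE t) => //; exact: turnE_circle.
have pS y : C i y -> exists2 t, 0 <= t <= 1 & p t = y.
  by move=> [_ [z cz <-] <-]; have [t [t01 <-]] := turnE_surj cz; exists t.
have CB1 : C i `<=` B1 by apply: (piece_circle_sub inv1).
have CB2 : C i `<=` B2 by rewrite C12; apply: (piece_circle_sub inv2).
have FC y : C i y -> C i (F y) by apply: (piece_circle_inv f1c f1i inv1 ge1).
have [w1 i1] := @incr_ex R (phi1 \o p) (cmodin_comp p1c pc (fun t => CB1 _ (pC t))).
have [w' i'] := @incr_ex R (phi2 \o p) (cmodin_comp p2c pc (fun t => CB2 _ (pC t))).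
have i1' : incr (fun t => th (d1 i (turnE t))) w1.
  apply: incr_eq i1 => t _; rewrite /= p1E; first exact: modZ_refl.
  by apply: (circle_removed inv1); exact: turnE_circle.
have [w2 i2] : exists w2, incr (fun t => th (d2 i (turnE t))) w2.
  apply: incr_ex => t; have c2 := disc_cmod D2 k2 (circle_closed_disk (turnE_circle t)) (circle_neq0 (turnE_circle t)).
  exact: (cmod_comp (@turnE_continuous R t) c2).
(* The two boundary circles bound discs around the same point of [S1], so the increments of [th]
   along them agree up to sign. *)
have pm := disc_incr hS1 D1 D2 e12 k1 k2 i1' i2.
have i2' : incr ((phi2 \o (e2 \o d2 i)) \o @turnE R) (- w2).
  apply: incr_eq (incrN i2) => t _; rewrite /= p2E; first exact: modZ_refl.
  by apply: (circle_removed inv2); exact: turnE_circle.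
(* The curve in [S] is parametrized from both pieces, and the change of parameter costs another
   sign. *)
have pm' : w' = - w2 \/ w' = - - w2.
  apply: (reparam_incr hS par2 par1 i2') => eta etaP.
  apply: incr_eq i' => t _; have [_ e] := etaP t; rewrite /= in e.
  by rewrite /= e; exact: modZ_refl.
have w'E : w' = w1 \/ w' = - w1.
  by case: pm => e; case: pm' => e'; rewrite e' e ?opprK; [right|left|left|right].
have lift psi a : incr (psi \o p) 0 -> (forall y, C i y -> modZ (psi (F y)) (psi y + a)) ->
    exists g : S -> R, [/\ {within C i, continuous g}, forall y, C i y -> modZ (psi y) (g y), modZ a 0 &
      forall y, C i y -> g (F y) = g y].
  move=> ipsi ps; have [g [gc gE]] := lift_of_null hS par1 ipsi.
  have gs y : C i y -> modZ (g (F y)) (g y + a).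
    move=> Cy; apply: modZ_trans (modZ_sym (gE _ (FC _ Cy))) _; apply: modZ_trans (ps y Cy) _.
    exact: modZD (gE _ Cy) (modZ_refl _).
  by have [a0 gF] := shift_cst pc pC pS Fc FC gc gs; exists g.
have s1 y : C i y -> modZ (phi1 (F y)) (phi1 y + 1 / m%:R) by move=> /CB1/p1s[].
have s2 y : C i y -> modZ (phi2 (F y)) (phi2 y + 1 / m%:R) by move=> /CB2/p2s[].
case: w'E => w'E; last first.
  exfalso; have [|y Cy|g [_ _ [k kE] _]] := lift (fun y => phi1 y + phi2 y) (2 / m%:R).
  - by have := incrD i1 i'; rewrite w'E subrr.
  - have -> : phi1 y + phi2 y + 2 / m%:R = (phi1 y + 1 / m%:R) + (phi2 y + 1 / m%:R) by ring.
    by apply: modZD; [exact: s1|exact: s2].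
  rewrite add0r in kE; have m2R : 2 < m%:R :> R by rewrite (ltr_nat _ 2 m).
  have m0 : 0 < m%:R :> R by lra.
  have h1 : 0 < 2 / m%:R :> R by rewrite divr_gt0.
  have h2 : 2 / m%:R < 1 :> R by rewrite ltr_pdivrMr// mul1r.
  by move: h1 h2; rewrite kE ltr0z ltrz1; lia.
have [|y Cy|g [gc gE _ gF]] := lift (fun y => phi1 y - phi2 y) 0; last by exists g.
- by have := incrD i1 (incrN i'); rewrite w'E subrr.
- rewrite addr0; have := modZB (s1 y Cy) (s2 y Cy).
  have -> // : phi1 y + 1 / m%:R - (phi2 y + 1 / m%:R) = phi1 y - phi2 y by ring.
Qed.

(** As the circles are disjoint, their separate lifts form one continuous function on a closed set;
    compactness bounds it, as the extension theorem requires. *)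
Lemma circles_lift : exists G : S -> R, [/\ continuous G,
  forall y, (\bigcup_i C i) y -> modZ (phi1 y - phi2 y) (G y),
  forall y, (\bigcup_i C i) y -> G (F y) = G y & forall y, (\bigcup_i C i) y -> (\bigcup_i C i) (F y)].
Proof.
have [g gP] := choice circle_lift.
pose CC := \bigcup_(i in [set: 'I_r]) C i.
have exf y : exists v : R, forall i, C i y -> v = g i y.
  have [[i Ci]|n] := pselect (exists i, C i y); last by exists 0 => i Ci; case: n; exists i.
  by exists (g i y) => j Cj; have -> : i = j := piece_circle_disj inv1 ge1 Ci Cj.
have [f fP] := choice exf.
have Ccl i : closed (C i).
  have [wc _ <-] := piece_param inv1 ge1 i; apply: compact_closed => //.
  by apply: continuous_compact => //; exact: circle_compact.
have CCcl : closed CC by apply: closed_bigcup => //; exact: finite_finset.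
have FC y : CC y -> CC (F y) by move=> [i _ Ci]; exists i => //; apply: (piece_circle_inv f1c f1i inv1 ge1).
have fc : {within CC, continuous f}.
  apply/withinP => y [i _ Ci] V nV; rewrite (fP y i Ci) in nV.
  have [gc _ _] := gP i; have /withinP/(_ y Ci V nV)[U [nU hU]] := gc.
  pose W := ~` \bigcup_(j in [set j | j <> i]) C j.
  have Wo : open W by apply: closed_openC; apply: closed_bigcup => //; exact: finite_finset.
  exists (U `&` W); split.
    apply: filterI => //; apply: open_nbhs_nbhs; split => // -[j ji Cj]; apply: ji.
    exact: (piece_circle_disj inv1 ge1 Cj Ci).
  move=> y' [Uy' Wy'] [j _ Cj].
  have ji : j = i by apply: contrapT => ji; apply: Wy'; exists j.
  by rewrite ji in Cj; rewrite (fP _ i Cj); exact: hU.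
have CCk : compact CC := subclosed_compact CCcl cS (@subsetT _ _).
have [M [Mr hM]] := compact_bounded (continuous_compact fc CCk).
pose M' := `|M| + 1.
have MM : M < M' by rewrite /M'; have := ler_norm M; lra.
have M'0 : 0 < M' by rewrite /M'; have := normr_ge0 M; lra.
have fb y : CC y -> `|f y| <= M' by move=> Cy; apply: (hM _ MM); exists y.
have [G [GE Gc _]] := @continuous_bounded_extension S R (compact_normal hS cS) CC CCcl f M' M'0 fc fb.
have GE' y : CC y -> G y = f y by move=> Cy; rewrite GE// inE.
exists G; split => // y Cy; rewrite (GE' _ Cy).
  by have [i _ Ci] := Cy; rewrite (fP _ i Ci); have [_ h _] := gP i; exact: h.
rewrite (GE' _ (FC _ Cy)); have [i _ Ci] := Cy; have [_ _ h] := gP i.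
by rewrite (fP _ i Ci) (fP _ i) ?h//; apply: (piece_circle_inv f1c f1i inv1 ge1).
Qed.

(** The extension [G0] is invariant under [F] on the circles only. Averaging over the iterates makes
    it invariant everywhere and leaves it unchanged there, so [phi2 + G] keeps the shift [1 / m] and
    agrees with [phi1] modulo 1 on the circles. *)
Lemma glue_phi N : (0 < N)%N -> iter N F =1 id -> exists phi : S -> R, (forall y, cmod_at phi y) /\
  forall y, modZ (phi (F y)) (phi y + 1 / m%:R).
Proof.
move=> N0 FN; have [G0 [G0c G0E G0F FC]] := circles_lift.
pose G y := (\sum_(k < N) G0 (iter k F y)) / N%:R.
have itc k : continuous (iter k F).
  elim: k => [|k IH] z; first exact: cvg_id.
  by apply: (@continuous_comp _ _ _ (iter k F) F); [exact: IH|exact: Fc].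
have Gc : continuous G.
  move=> y; apply: cvgM; last exact: cvg_cst.
  have sc : continuous (fun y => \sum_(k < N) G0 (iter k F y)).
    by apply: (@sum_continuous R S R N (fun k z => G0 (iter k F z))) => k z; exact: (continuous_comp (itc k z) (G0c (iter k F z))).
  exact: sc.
have GF y : G (F y) = G y by rewrite /G (orbit_sum _ (FN y)).
have GE y : (\bigcup_i C i) y -> modZ (phi1 y) (phi2 y + G y).
  move=> Cy; have itG k : (\bigcup_i C i) (iter k F y) /\ G0 (iter k F y) = G0 y.
    by elim: k => //= k [h1 h2]; split; [exact: FC|rewrite G0F].
  have -> : G y = G0 y.
    rewrite /G (eq_bigr (fun=> G0 y)); last by move=> k _; exact: (itG k).2.
    by rewrite sumr_const card_ord -[G0 y *+ N]mulr_natr mulfK// pnatr_eq0; lia.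
  by have [k kE] := G0E y Cy; exists k; rewrite -addrA -kE; ring.
pose phi y := if `[< B1 y >] then phi1 y else phi2 y + G y.
have phiB1 y : B1 y -> phi y = phi1 y by move=> By; rewrite /phi asboolT.
have phiB2 y : B2 y -> modZ (phi y) (phi2 y + G y).
  move=> B2y; have [B1y|nB1] := pselect (B1 y); last by rewrite /phi asboolF//; exact: modZ_refl.
  by rewrite phiB1//; apply: GE; rewrite -BI.
have p2c' y : B2 y -> cmodin B2 (fun y => phi2 y + G y) y.
  move=> By e e0; have eh : 0 < e / 2 by lra.
  have [U nU hU] := p2c By eh.
  have nG : nbhs y [set y' | nearZ (e / 2) (G y' - G y)] := @continuous_cmod _ _ G y (Gc y) _ eh.
  exists (U `&` [set y' | nearZ (e / 2) (G y' - G y)]); first exact: filterI.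
  move=> y' [Uy' Gy'] By'; have := nearZD (hU _ Uy' By') Gy'.
  by rewrite -splitr opprD addrACA.
have loc (B : set S) psi : closed B -> (forall y, B y -> cmodin B psi y) -> (forall y, B y -> modZ (phi y) (psi y)) ->
    forall y e, 0 < e -> exists2 U, nbhs y U & forall y', U y' -> B y' -> nearZ e (phi y' - phi y).
  move=> Bcl cB eB y e e0; have [By|nB] := pselect (B y); last first.
    exists (~` B); last by move=> y' nB' By'; case: nB'.
    by apply: open_nbhs_nbhs; split => //; exact: closed_openC.
  have [U nU hU] := cB y By e e0; exists U => // y' Uy' By'.
  by apply: nearZ_modZ (hU y' Uy' By'); apply: modZ_sym; apply: modZB; exact: eB.
have B1cl : closed B1 := piece_closed inv1 cS1 hS ge1.
have B2cl : closed B2 := piece_closed inv2 cS1 hS ge2.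
exists phi; split.
  move=> y e e0.
  have phiB1' y' : B1 y' -> modZ (phi y') (phi1 y') by move=> B1y'; rewrite phiB1//; exact: modZ_refl.
  have [U1 n1 h1] := loc B1 phi1 B1cl p1c phiB1' y e e0.
  have [U2 n2 h2] := loc B2 _ B2cl p2c' phiB2 y e e0.
  have hh y' : (U1 `&` U2) y' -> nearZ e (phi y' - phi y).
    move=> [u1 u2]; have : (B1 `|` B2) y' by rewrite Bcover.
    by move=> [b|b]; [exact: h1|exact: h2].
  exact: (filterS hh (filterI n1 n2)).
move=> y; have : (B1 `|` B2) y by rewrite Bcover.
move=> [b|b].
  by have [b' s] := p1s b; rewrite !phiB1.
have [b' s] := p2s b; apply: (modZ_trans (phiB2 _ b')); rewrite GF.
apply: modZ_trans (modZD s (modZ_refl (G y))) _; rewrite addrAC.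
exact: modZD (modZ_sym (phiB2 _ b)) (modZ_refl _).
Qed.

End WithPhi.

Lemma glue_class N : (0 < N)%N -> iter N F =1 id -> exists phi : S -> R, (forall y, cmod_at phi y) /\
  forall y, modZ (phi (F y)) (phi y + 1 / m%:R).
Proof.
have [phi1 [p1E p1c p1s]] := piece_ex f1c f1i inv1 cS1 hS ge1 thc th1.
have thc' y : (forall i, y <> x i) -> cmod_at (fun y => - th y) y by move=> /thc; exact: cmodN.
have th2' y : (forall i, y <> x i) -> modZ (- th (f2 y)) (- th y + 1 / m%:R).
  by move=> /th2/modZN; rewrite opprB addrC.
have [phi2 [p2E p2c p2s]] := piece_ex f2c f2i inv2 cS1 hS ge2 thc' th2'.
exact: (glue_phi p1E p1c p1s p2E p2c p2s).
Qed.

End Glue.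

(** * The class on the glued surface and its transfer to roots of the map *)

Lemma double_class (R : realType) (n p m r N : nat) (A B : int) (S : surface R) (F : diffeo S S) :
  (2 < n)%N -> (2 < m)%N -> (m %| n)%N -> A + B = 1 -> (exists k : int, p%:Z + B = m%:Z * k) ->
  (forall i, polygon_equiv n p (@vertex R n (2 * i)) (@vertex R n (2 * i).+2)) ->
  (B != 0 -> forall i, polygon_equiv n p (@vertex R n (2 * i).+1) (@vertex R n (2 * i).+3)) ->
  closed_surface S -> has_period F N -> is_double n p r F ->
  exists phi : S -> R, (forall y, cmod_at phi y) /\ forall y, modZ (phi (F y)) (phi y + 1 / m%:R).
Proof.
move=> n2 m2 mn AB mpB Heven Hodd [cS hS _ _] [N0 FN _].
move=> [S1 [h [x [[[cS1 hS1 _ _] [q [qc qs qe _ qh]]] xi xfix [d1 [d2 [e1 [e2 [[inv1 inv2] [ge1 ge2] Bc C12 BI]]]]]]]]].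
have m0 : (0 < m)%N by lia.
have [th [thc ths]] := @theta_ex R n p m A B n2 m0 mn AB mpB Heven Hodd S1 h q hS1 qc qs qe qh.
have nfix y : (forall i, y <> x i) -> h y <> y.
  move=> yx hy; have : [set y | h y = y] y by [].
  by rewrite xfix => -[i _ e]; apply: (yx i).
have hi : injective h := can_inj (@dfunK _ _ _ h).
have hc : continuous h by exact: h_continuous.
have ii k : injective (iter k h) by elim: k => //= k IH y z /hi/IH.
have ic k : continuous (iter k h) by exact: iter_continuous.
have hq k z : polygon n z -> polygon n (iter k (@clockwise_rotation R n) z) /\
    iter k h (q z) = q (iter k (@clockwise_rotation R n) z).
  move=> pz; elim: k => //= k [IH1 IH2]; split; first exact: polygon_rot.
  by rewrite IH2 qh.
have hn y : h (iter n.-1 h y) = y.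
  rewrite -iterS prednK; last by lia.
  have : [set: S1] y by []; rewrite -qs => -[z pz <-].
  by rewrite (hq n z pz).2 rot_order.
have th1 y : (forall i, y <> x i) -> modZ (th (h y)) (th y + 1 / m%:R) by move=> /nfix; exact: ths.
have th2 y : (forall i, y <> x i) -> modZ (th (iter n.-1 h y)) (th y - 1 / m%:R).
  move=> /nfix yx; have nz : h (iter n.-1 h y) <> iter n.-1 h y.
    by rewrite hn => e; apply: yx; rewrite {1}e hn.
  have [k kE] := ths _ nz; rewrite hn in kE.
  by exists (- k); rewrite kE rmorphN /=; ring.
have thc' y : (forall i, y <> x i) -> cmod_at th y by move=> /nfix; exact: thc.
have Fc : continuous F by exact: h_continuous.
exact: (glue_class cS1 hS1 cS hS m2 hc hi (ic n.-1) (ii n.-1) inv1 inv2 ge1 ge2 Fc thc' th1 th2 C12 Bc BI N0 FN).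
Qed.

(** Periodicity turns negative powers into iterates; adding one full period makes [k0] positive, as
    the Bezout identity below needs. *)
Lemma dpow_iter (R : realType) (S : surface R) (h : diffeo S S) N (k : int) : has_period h N ->
  exists2 k0, (0 < k0)%N & dpow h k =1 iter k0 h.
Proof.
move=> [N0 hN _].
have itN l y : iter (l * N) h y = y by elim: l y => //= l IH y; rewrite mulSn iterD IH hN.
have inv y : Defs.dinv h y = iter N.-1 h y.
  apply: (can_inj (@dfunK _ _ _ h)); rewrite -iterS prednK// hN.
  exact: (@dinvK _ _ _ h).
suff [k0 e] : exists k0, dpow h k =1 iter k0 h.
  exists (k0 + N)%N; first by rewrite addn_gt0 N0 orbT.
  by move=> y; rewrite e iterD hN.
case: k => k /=; first by exists k.
by exists (k.+1 * N.-1)%N => y; rewrite iterM; exact: (eq_iter inv k.+1 y).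
Qed.

(** [M] is the gcd of [k0] and the period, so the iterate of order [M] of [h] is an iterate of that
    of order [k0], and shifts [phi1] by some [j / m]. The sum of [phi1] over [M] successive iterates
    telescopes, so [h] shifts it by [j / m]. Conversely [k0] is a multiple of [M]; if [m] divided
    [j], the shift [1 / m] would be an integer. *)
Lemma not_power_of_irreducible (R : realType) (S : surface R) (F : diffeo S S) (phi : S -> R) m :
  closed_surface S -> (1 < m)%N -> (forall y, cmod_at phi y) ->
  (forall y, modZ (phi (F y)) (phi y + 1 / m%:R)) -> ~ conjugate_to_power_of_irreducible F.
Proof.
move=> Scl m1 phic phis [h [k [[[N hN] irr] [c cP]]]]; apply: irr.
have [k0 k00 kE] := dpow_iter k hN.
have [N0 hNid _] := hN.
have mR : m%:R != 0 :> R by rewrite pnatr_eq0; lia.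
pose phi1 := phi \o Defs.dinv c.
have phi1c y : cmod_at phi1 y.
  apply: cmod_comp; last exact: phic.
  by have [dc _] := @dinv_smooth _ _ _ c; exact: dc.
have phi1s y : modZ (phi1 (iter k0 h y)) (phi1 y + 1 / m%:R).
  have e : iter k0 h y = c (F (Defs.dinv c y)) by rewrite cP kE (@dinvK _ _ _ c y).
  by rewrite /phi1 /= e (@dfunK _ _ _ c); exact: phis.
have shift l f a : (forall y, modZ (phi1 (f y)) (phi1 y + a)) ->
    forall y, modZ (phi1 (iter l f y)) (phi1 y + l%:R * a).
  move=> fs; elim: l => [|l IH] y; first by rewrite mul0r addr0; exact: modZ_refl.
  rewrite iterS; apply: (modZ_trans (fs _)).
  have -> : phi1 y + l.+1%:R * a = phi1 y + l%:R * a + a by rewrite -addn1 natrD; ring.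
  exact: modZD (IH y) (modZ_refl _).
have itN l y : iter (l * N) h y = y by elim: l y => //= l IH y; rewrite mulSn iterD IH hNid.
pose M := gcdn k0 N.
have [j jE] : exists j, forall y, modZ (phi1 (iter M h y)) (phi1 y + j%:R / m%:R).
  have [km kn e _] := egcdnP N k00; exists km => y.
  have -> : iter M h y = iter km (iter k0 h) y by rewrite -iterM e addnC iterD itN.
  by have := shift km _ _ phi1s y; rewrite mulrA mulr1.
pose psi y := \sum_(i < M) phi1 (iter i h y).
have hc : continuous h by exact: h_continuous.
have psic y : cmod_at psi y.
  apply: (@cmod_sum _ _ M (fun i z => phi1 (iter i h z))) => i; apply: cmod_comp; last exact: phi1c.
  exact: iter_continuous.
have psis y : modZ (psi (h y)) (psi y + j%:R / m%:R).
  have e : psi (h y) + phi1 y = psi y + phi1 (iter M h y).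
    have e0 L : \sum_(i < L) phi1 (iter i h (h y)) + phi1 y = \sum_(i < L) phi1 (iter i h y) + phi1 (iter L h y).
      elim: L => [|L IH]; first by rewrite !big_ord0.
      by rewrite !big_ord_recr /= -iterSr /= addrAC IH.
    exact: e0.
  have -> : psi (h y) = psi y - phi1 y + phi1 (iter M h y) by rewrite -[LHS](addrK (phi1 y)) e; ring.
  have -> : psi y + j%:R / m%:R = psi y - phi1 y + (phi1 y + j%:R / m%:R) by ring.
  exact: modZD (modZ_refl _) (jE y).
apply: (reducible_of_class Scl hN psic psis); first by lia.
apply/negP => /dvdnP[l lE].
have [_ _ _ [y _]] := Scl.
have /dvdnP[q qE] : (M %| k0)%N := dvdn_gcdl k0 N.
have [k1 k1E] := phi1s y; rewrite qE iterM in k1E.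
have [k2 k2E] := shift q _ _ jE y; rewrite k2E in k1E.
have e : 1 / m%:R = (q%:Z * l%:Z + k2 - k1)%:~R :> R.
  rewrite rmorphB rmorphD rmorphM /= -!pmulrn.
  have jm : j%:R / m%:R = l%:R :> R by rewrite lE natrM mulfK.
  by rewrite jm in k1E; lra.
have h1 : 0 < 1 / m%:R :> R by rewrite divr_gt0// ltr0n; lia.
have h2 : 1 / m%:R < 1 :> R by rewrite ltr_pdivrMr ?mul1r ?ltr1n// ltr0n; lia.
by move: h1 h2; rewrite e ltr0z ltrz1; lia.
Qed.

(** * Identified vertices of the polygon *)

Section VertexClasses.
Variables (R : realType) (n p : nat).
Hypothesis n2 : (2 < n)%N.
Local Notation vertex := (@vertex R n).

Lemma vertex_mod i c : vertex (2 * (i %% n) + c) = vertex (2 * i + c).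
Proof.
have -> : (2 * i + c = (2 * (i %% n) + c) + (i %/ n) * (2 * n))%N.
  by rewrite {1}(divn_eq i n); nia.
by rewrite vertex_period.
Qed.

Lemma vertex_step i : polygon_equiv n p (vertex (2 * i)) (vertex (2 * (i + p) + 2)).
Proof.
rewrite -[(2 * i)%N]addn0 -vertex_mod -(vertex_mod (i + p)); apply: Relation_Operators.rst_step.
exists (i %% n)%N, ((i + p) %% n)%N, 0; split.
- by rewrite ltn_pmod//; lia.
- by rewrite ltn_pmod//; lia.
- by rewrite modn_mod modnDml.
- by rewrite lexx ler01.
- by rewrite /alpha /beta subr0 !scale1r !scale0r !addr0 addn0 addn2.
Qed.

Lemma vertex_odd_step i : polygon_equiv n p (vertex (2 * i + 1)) (vertex (2 * (i + p) + 1)).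
Proof.
rewrite -vertex_mod -(vertex_mod (i + p)); apply: Relation_Operators.rst_step.
exists (i %% n)%N, ((i + p) %% n)%N, 1; split.
- by rewrite ltn_pmod//; lia.
- by rewrite ltn_pmod//; lia.
- by rewrite modn_mod modnDml.
- by rewrite lexx ler01.
- by rewrite /alpha /beta subrr !scale1r !scale0r !add0r !addn1.
Qed.

Lemma vertex_chain k i : polygon_equiv n p (vertex (2 * i)) (vertex (2 * (i + k * p.+1))).
Proof.
elim: k => [|k IH]; first by rewrite addn0; exact: Relation_Operators.rst_refl.
apply: (Relation_Operators.rst_trans _ _ _ _ _ IH); have := vertex_step (i + k * p.+1).
by have -> : (2 * (i + k * p.+1 + p) + 2 = 2 * (i + k.+1 * p.+1))%N by rewrite mulSn; lia.
Qed.

(** Even vertices are identified in steps of [p + 1]; here [k] is an inverse of [p + 1] modulo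
    [n]. *)
Lemma vertex_even_equiv k l i : (k * p.+1 = 1 + l * n)%N -> polygon_equiv n p (vertex (2 * i)) (vertex (2 * i).+2).
Proof.
move=> e; have := vertex_chain k i; rewrite e.
have -> : (2 * (i + (1 + l * n)) = (2 * i).+2 + l * (2 * n))%N by nia.
by rewrite vertex_period.
Qed.

End VertexClasses.

Theorem proposition5p1 (R : realType) (g : nat) (hg : (1 < g)%N) :
  (forall (S : surface R) (F1 : diffeo S S),
     closed_surface_of_genus S (2 * g + 1) ->
     has_period F1 (4 * g) ->
     is_F1 g F1 ->
     ~ conjugate_to_power_of_irreducible F1) /\
  (forall (S : surface R) (F2 : diffeo S S),
     closed_surface_of_genus S (2 * g + 2) ->
     has_period F2 (2 * g + 1) ->
     is_F2 g F2 ->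
     ~ conjugate_to_power_of_irreducible F2).
Proof.
split=> S F [Scl _] FN dF.
  (* The odd vertices are not fixed here, so [B = 0] and [A = 1]; then [m] has to divide
     [p = 2 * g], and [m = 2 * g] exceeds 2 because [g > 1]. *)
  have [|||||||phi [phic phis]] := @double_class R (4 * g) (2 * g) (2 * g) 2 (4 * g) 1 0 S F _ _ _ _ _ _ _ Scl FN dF.
  - by lia.
  - by lia.
  - by apply/dvdnP; exists 2; lia.
  - by [].
  - by exists 1; rewrite addr0 mulr1.
  (* The square of [2 * g + 1] is [1 + (g + 1) * (4 * g)]. *)
  - by move=> i; apply: (@vertex_even_equiv R _ _ _ (2 * g).+1 g.+1); nia.
  - by rewrite eqxx.
  by apply: (not_power_of_irreducible Scl _ phic phis); lia.
(* With [p = 1] and [m = n], the value [B = -1] gives [p + B = 0], whence [A = 2]. Since [B] is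
   nonzero, the odd vertices must be identified with one another, and they are, in steps of
   [p = 1]. *)
have [|||||||phi [phic phis]] := @double_class R (2 * g).+1 1 (2 * g).+1 3 (2 * g + 1) 2 (-1) S F _ _ _ _ _ _ _ Scl FN dF.
- by lia.
- by lia.
- exact: dvdnn.
- by [].
- by exists 0; rewrite mulr0 subrr.
(* Here [2 * (g + 1) = 1 + (2 * g + 1)]. *)
- by move=> i; apply: (@vertex_even_equiv R _ _ _ g.+1 1); nia.
- move=> _ i; have := @vertex_odd_step R (2 * g).+1 1 _ i.
  have -> : (2 * i + 1 = (2 * i).+1)%N by lia.
  have -> : (2 * (i + 1) + 1 = (2 * i).+3)%N by lia.
  by apply; lia.
by apply: (not_power_of_irreducible Scl _ phic phis); lia.
Qed.
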